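(* Let $a>0$, $\gamma\in\mathbb{R}$, $\alpha>0$, and for $x>0$ let $f(x,a,\gamma,\alpha)=\sum_{k=0}^{\infty}(k+a)^{\gamma}e^{-(k+a)^{\alpha}x}$. Then the following asymptotic expansions hold as $x\to+0$. (i) If $-\frac{\gamma+1}{\alpha}\notin\mathbb{Z}_+$, then $$f(x,a,\gamma,\alpha)\underset{x\to+0}{\sim}\frac1\alpha\,\Gamma\left(\frac{\gamma+1}{\alpha}\right)x^{-\frac{\gamma+1}{\alpha}}+\sum_{k=0}^{\infty}\frac{(-1)^k}{k!}\,\zeta(-\alpha k-\gamma,a)\,x^k .$$ (ii) If $-\frac{\gamma+1}{\alpha}=r\in\mathbb{Z}_+$, then $$f(x,a,\gamma,\alpha)\underset{x\to+0}{\sim}\frac{(-1)^r x^r}{\Gamma(r+1)}\left(-\frac{\ln x}{\alpha}+\frac{\Gamma'(r+1)}{\Gamma(r+1)}\,\frac1\alpha-\frac{\Gamma'(a)}{\Gamma(a)}\right)+\sum_{k=0,\,k\ne r}^{\infty}\frac{(-1)^k}{k!}\,\zeta(-\alpha k-\gamma,a)\,x^k .$$ Moreover, if $0<\alpha<1$, then in both cases (i) and (ii) the relation $\sim$ is an equality (with convergent series on the right) for all $x>0$; if $\alpha=1$, then in both cases the relation $\sim$ is an equality for all $x\in(0,2\pi)$.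
   Context: $\mathbb{Z}_+=\{0,1,2,\dots\}$. $\Gamma$ is the Euler gamma function, meromorphically continued to $\mathbb{C}$ (with simple poles exactly at $0,-1,-2,\dots$). For fixed $a>0$, $\zeta(s,a)$ is the Hurwitz zeta function: $\zeta(s,a)=\sum_{k=0}^{\infty}(k+a)^{-s}$ for $\operatorname{Re}s>1$, continued analytically to $\mathbb{C}\setminus\{1\}$ (with a simple pole at $s=1$). Meaning of the asymptotic expansions: for a function $F$ on $(0,+\infty)$, a function $T$ and coefficients $c_k$, the relation $F(x)\underset{x\to+0}{\sim}T(x)+\sum_{k}c_kx^k$ (sum over $k\in\mathbb{Z}_+$, or over $k\in\mathbb{Z}_+$ with $k\neq r$) means that for every $N\in\mathbb{Z}_+$ one has $F(x)-T(x)-\sum_{k\le N}c_kx^k=o(x^N)$ as $x\to+0$ (the finite sum being over the admissible indices $k\le N$). Here $T$ is the first displayed term (the term with $x^{-(\gamma+1)/\alpha}$ in (i), the term with $\ln x$ in (ii)). *)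

(* Defs.v *)
From Stdlib Require Import Factorial Reals ClassicalEpsilon.
From Coquelicot Require Import Coquelicot.

Open Scope R_scope.

(* [t ^ s] for real [t > 0] and complex [s], i.e. [exp (s * ln t)]. *)
Definition cpower (t : R) (s : C) : C :=
  (exp (Re s * ln t) * cos (Im s * ln t),
   exp (Re s * ln t) * sin (Im s * ln t)).

Definition analytic_on (U : C -> Prop) (g : C -> C) : Prop :=
  forall z : C, U z ->
    exists (c : nat -> C) (rho : posreal),
      forall w : C, Cmod (w - z) < rho ->
        @is_pseries C_AbsRing C_NormedModule c (w - z)%C (g w).

(* Euler's integral on [Re s > 0], continued analytically to the complement of
   the nonpositive integers; the domain is connected, so this determines [G]
   there. *)
Definition is_Gamma (G : C -> C) : Prop :=
  analytic_on (fun s => forall n : nat, s <> RtoC (- INR n)) G /\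
  forall s : C, 0 < Re s ->
    @is_RInt_gen C_R_NormedModule
      (fun t : R => (cpower t (s - 1) * RtoC (exp (- t)))%C)
      (at_right 0) (Rbar_locally p_infty) (G s).

(* The values at the poles are unspecified. *)
Definition Gamma : C -> C :=
  epsilon (inhabits (fun _ : C => RtoC 0)) is_Gamma.

Definition is_hurwitz_zeta (a : R) (Z : C -> C) : Prop :=
  analytic_on (fun s => s <> RtoC 1) Z /\
  forall s : C, 1 < Re s ->
    @is_series C_AbsRing C_NormedModule
      (fun k : nat => cpower (INR k + a) (- s)%C) (Z s).

(* The value at the pole [s = 1] is unspecified. *)
Definition hurwitz_zeta (a : R) : C -> C :=
  epsilon (inhabits (fun _ : C => RtoC 0)) (is_hurwitz_zeta a).

Definition exp_power_sum (x a gamma alpha : R) : R :=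
  Series (fun k : nat =>
    Rpower (INR k + a) gamma * exp (- Rpower (INR k + a) alpha * x)).

(* The [k]-th term of a power series whose index runs over the [k] such that
   [adm k = true]. *)
Definition power_term (adm : nat -> bool) (c : nat -> C) (x : R) (k : nat) : C :=
  if adm k then (c k * RtoC (x ^ k))%C else RtoC 0.

Definition asymp_expansion (F T : R -> C) (adm : nat -> bool) (c : nat -> C)
    : Prop :=
  forall N : nat,
    @is_domin R R_AbsRing C_AbsRing R_NormedModule C_NormedModule
      (at_right 0) (fun x : R => x ^ N)
      (fun x : R =>
         (F x - T x - @sum_n C_AbelianMonoid (power_term adm c x) N)%C).

Definition convergent_expansion_at (F T : R -> C) (adm : nat -> bool)
    (c : nat -> C) (x : R) : Prop :=
  @is_series C_AbsRing C_NormedModule (power_term adm c x) (F x - T x)%C.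

Definition zeta_coeff (a gamma alpha : R) (k : nat) : C :=
  (RtoC ((-1) ^ k / INR (fact k)) *
   hurwitz_zeta a (RtoC (- alpha * INR k - gamma)))%C.

Definition T_nonresonant (gamma alpha x : R) : C :=
  (RtoC (1 / alpha) * Gamma (RtoC ((gamma + 1) / alpha)) *
   RtoC (Rpower x (- ((gamma + 1) / alpha))))%C.

Definition T_resonant (a alpha : R) (r : nat) (x : R) : C :=
  (RtoC ((-1) ^ r * x ^ r) / Gamma (RtoC (INR r + 1)) *
   (- RtoC (ln x / alpha)
    + C_derive Gamma (RtoC (INR r + 1)) / Gamma (RtoC (INR r + 1))
      * RtoC (1 / alpha)
    - C_derive Gamma (RtoC a) / Gamma (RtoC a)))%C.

(* Main.v *)
Require Import Defs.
From Stdlib Require Import Factorial Reals Lra Lia ClassicalEpsilon.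
From Coquelicot Require Import Coquelicot.
Open Scope R_scope.

(** Write [b = a + 1/2].  For [F] holomorphic on [Re u > 0], moving the contour to the rays
    [u = b + r (m +- i)] gives the midpoint Abel-Plana formula
      [sum_(k >= 1) F (a + k) = int_b^oo F + J(F)],
    where [J(F)] integrates [F] along the two rays against the kernel [- q / (1 + q)], [q] being the
    nome [e^(+- 2 pi i (u - b))], of modulus [e^(-2 pi r)].  Taking [F = u^-s] continues the Hurwitz zeta function:
      [zeta (s, a) = a^-s + b^(1-s) / (s - 1) + J(u^-s)].
    Taking [F = u^ga e^(-x u^al)], with a slope [m] making [Re (u^al) >= c |u|^al] on the rays, expresses
    the sum [f (x)], and the integral [int_b^oo F] is a Gamma value minus the series of the lower incomplete Gamma
    function.  Subtracting the first [N + 1] terms of the expansion therefore replaces [e^-w] by its Taylor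
    remainder, which is at most [|w|^(N+1) / (N+1)!] for [Re w >= 0]: this yields [O (x^(N+1))].
    For [al <= 1] vertical rays ([m = 0]) are allowed, and the remainders tend to [0] because [x |u|^al]
    grows slower than the exponent [2 pi r] of the kernel, which for [al = 1] requires [x < 2 pi].
    At a resonance [ga + al r = -1] the poles of Gamma and zeta cancel; the constant terms of their Laurent
    expansions are digamma values. *)

(** The midpoint is what makes the kernel harmless: on the rays issued from [b] the nome starts at
    [1], so [1 + q] stays away from [0] and neither residues nor principal values occur. The kernel
    is the limit of the finite sums [alt_geom], which are polynomials in the nome; such a sum and
    its conjugate, added to [1], restrict on a real unit segment to the Dirichlet kernel centred at
    the midpoint, which samples [F] there. [Gamma] and [hurwitz_zeta] are chosen by [epsilon], so
    explicit models are built and identified with them at the real points that matter, by uniqueness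
    of limits and continuation along segments. Since [/ 0 = 0], a term with vanishing denominator
    drops out, so [gamma_fn] and [zeta_value] take at a pole the value of their finite part, the
    logarithm of a resonant primitive being kept by [power_primitive]. Both cases of the theorem
    thus share one formula, and a resonance only decides whether a logarithm and digamma values come
    out of it. *)

Lemma im_le_Cmod (z : C) : Rabs (Im z) <= Cmod z.
Proof.
  eapply Rle_trans; [|apply Rmax_Cmod]. apply Rmax_r.
Qed.

Lemma Cmod_le_re_im (z : C) : Cmod z <= Rabs (Re z) + Rabs (Im z).
Proof.
  unfold Cmod, Re, Im. rewrite <- (sqrt_pow2 (Rabs (fst z) + Rabs (snd z))).
  - apply sqrt_le_1_alt.
    rewrite <- (pow2_abs (fst z)), <- (pow2_abs (snd z)).
    pose proof (Rabs_pos (fst z)); pose proof (Rabs_pos (snd z)); nra.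
  - pose proof (Rabs_pos (fst z)); pose proof (Rabs_pos (snd z)); lra.
Qed.

Lemma Cmod_minus_sym (z w : C) : Cmod (z - w) = Cmod (w - z).
Proof. rewrite <- Cmod_opp. f_equal. ring. Qed.

(** * The complex exponential *)

Definition cexp (z : C) : C := (exp (Re z) * cos (Im z), exp (Re z) * sin (Im z)).

Lemma cexp_plus (z w : C) : cexp (z + w) = (cexp z * cexp w)%C.
Proof.
  unfold cexp, Cmult, Cplus, Re, Im; simpl.
  rewrite exp_plus, cos_plus, sin_plus. f_equal; ring.
Qed.

Lemma cexp_R (x : R) : cexp (RtoC x) = RtoC (exp x).
Proof.
  unfold cexp, RtoC, Re, Im; simpl. rewrite cos_0, sin_0. f_equal; ring.
Qed.

Lemma cexp_0 : cexp 0 = RtoC 1.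
Proof. rewrite cexp_R, exp_0. reflexivity. Qed.

Lemma Cmod_cexp (z : C) : Cmod (cexp z) = exp (Re z).
Proof.
  unfold cexp, Cmod; simpl fst; simpl snd.
  rewrite <- (sqrt_pow2 (exp (Re z))) at 3 by (left; apply exp_pos).
  f_equal. pose proof (sin2_cos2 (Im z)) as H. unfold Rsqr in H. nra.
Qed.

Lemma cexp_conj (z : C) : cexp (Cconj z) = Cconj (cexp z).
Proof.
  unfold cexp, Cconj, Re, Im; simpl. rewrite cos_neg, sin_neg. f_equal; ring.
Qed.

Lemma cexp_nat (n : nat) (z : C) : cexp (INR n * z) = (cexp z ^ n)%C.
Proof.
  induction n as [|n IH].
  - simpl. rewrite <- cexp_0. f_equal. ring.
  - rewrite S_INR, RtoC_plus. replace ((INR n + 1) * z)%C with (z + INR n * z)%C by ring.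
    rewrite cexp_plus, IH. reflexivity.
Qed.

Lemma cpower_cexp (t : R) (s : C) : cpower t s = cexp (s * RtoC (ln t)).
Proof.
  unfold cpower, cexp, Cmult, RtoC, Re, Im; simpl.
  replace (fst s * ln t - snd s * 0) with (fst s * ln t) by ring.
  replace (fst s * 0 + snd s * ln t) with (snd s * ln t) by ring. reflexivity.
Qed.

(** * Calculus of complex functions of a real variable *)

(** Componentwise, so that real differentiation applies. The variable is real; complex
    differentiability is expressed separately, by [holo] and [analytic_at]. *)
Definition is_cderive (f : R -> C) (x : R) (l : C) : Prop :=
  is_derive (fun t => Re (f t)) x (Re l) /\ is_derive (fun t => Im (f t)) x (Im l).

Definition ccont (f : R -> C) (x : R) : Prop :=
  continuous (fun t => Re (f t)) x /\ continuous (fun t => Im (f t)) x.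

Definition CRInt (f : R -> C) (a b : R) : C :=
  (RInt (fun t => Re (f t)) a b, RInt (fun t => Im (f t)) a b).

Lemma is_derive_continuous (f : R -> R) (x l : R) : is_derive f x l -> continuous f x.
Proof. intro H. apply (ex_derive_continuous (V := R_NormedModule)). now exists l. Qed.

Lemma is_derive_eq (f : R -> R) (x l l' : R) : is_derive f x l -> l = l' -> is_derive f x l'.
Proof. intros H <-; exact H. Qed.

Lemma is_cderive_eq (f : R -> C) (x : R) (l l' : C) :
  is_cderive f x l -> l = l' -> is_cderive f x l'.
Proof. intros H <-; exact H. Qed.

Lemma is_cderive_ext (f g : R -> C) (x : R) (l : C) :
  (forall t, f t = g t) -> is_cderive f x l -> is_cderive g x l.
Proof.
  intros E [H1 H2]; split; [eapply is_derive_ext; [|exact H1]|eapply is_derive_ext; [|exact H2]];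
  intro t; simpl; now rewrite E.
Qed.

Lemma is_cderive_const (c : C) (x : R) : is_cderive (fun _ => c) x 0.
Proof. split; apply (is_derive_const (K := R_AbsRing) (V := R_NormedModule)). Qed.

Lemma is_cderive_RtoC (f : R -> R) (x l : R) : is_derive f x l -> is_cderive (fun t => RtoC (f t)) x (RtoC l).
Proof. intro H; split; simpl; [exact H|apply (is_derive_const (K := R_AbsRing) (V := R_NormedModule))]. Qed.

Lemma is_cderive_plus (f g : R -> C) (x : R) (l m : C) :
  is_cderive f x l -> is_cderive g x m -> is_cderive (fun t => (f t + g t)%C) x (l + m)%C.
Proof.
  intros [F1 F2] [G1 G2]; split.
  - exact (is_derive_plus (V := R_NormedModule) _ _ _ _ _ F1 G1).
  - exact (is_derive_plus (V := R_NormedModule) _ _ _ _ _ F2 G2).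
Qed.

Lemma is_cderive_minus (f g : R -> C) (x : R) (l m : C) :
  is_cderive f x l -> is_cderive g x m -> is_cderive (fun t => (f t - g t)%C) x (l - m)%C.
Proof.
  intros [F1 F2] [G1 G2]; split.
  - exact (is_derive_minus (V := R_NormedModule) _ _ _ _ _ F1 G1).
  - exact (is_derive_minus (V := R_NormedModule) _ _ _ _ _ F2 G2).
Qed.

Lemma is_cderive_mult (f g : R -> C) (x : R) (l m : C) :
  is_cderive f x l -> is_cderive g x m ->
  is_cderive (fun t => (f t * g t)%C) x (l * g x + f x * m)%C.
Proof.
  intros [F1 F2] [G1 G2]; split.
  - eapply is_derive_eq.
    + apply (is_derive_minus (V := R_NormedModule)); apply (is_derive_mult (K := R_AbsRing)); try eassumption; apply Rmult_comm.
    + unfold minus, plus, opp, mult, Re, Im; simpl; ring.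
  - eapply is_derive_eq.
    + apply (is_derive_plus (V := R_NormedModule)); apply (is_derive_mult (K := R_AbsRing)); try eassumption; apply Rmult_comm.
    + unfold plus, mult, Re, Im; simpl; ring.
Qed.

Lemma is_cderive_scal (c : C) (f : R -> C) (x : R) (l : C) :
  is_cderive f x l -> is_cderive (fun t => (c * f t)%C) x (c * l)%C.
Proof.
  intro H. eapply is_cderive_eq.
  - apply is_cderive_mult; [apply is_cderive_const|exact H].
  - cbv beta; ring.
Qed.

Lemma is_cderive_cexp (f : R -> C) (x : R) (l : C) :
  is_cderive f x l -> is_cderive (fun t => cexp (f t)) x (l * cexp (f x))%C.
Proof.
  intros [F1 F2]; unfold Re, Im in *.
  assert (E1 : is_derive (fun t => exp (fst (f t))) x (fst l * exp (fst (f x)))).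
  { apply (is_derive_comp (K := R_AbsRing) (V := R_NormedModule) exp (fun t => fst (f t))); [apply is_derive_exp|exact F1]. }
  assert (E2 : is_derive (fun t => cos (snd (f t))) x (snd l * - sin (snd (f x)))).
  { apply (is_derive_comp (K := R_AbsRing) (V := R_NormedModule) cos (fun t => snd (f t))); [apply is_derive_cos|exact F2]. }
  assert (E3 : is_derive (fun t => sin (snd (f t))) x (snd l * cos (snd (f x)))).
  { apply (is_derive_comp (K := R_AbsRing) (V := R_NormedModule) sin (fun t => snd (f t))); [apply is_derive_sin|exact F2]. }
  split; (eapply is_derive_eq; [apply (is_derive_mult (K := R_AbsRing)); try eassumption; apply Rmult_comm|]);
    unfold plus, mult, cexp, Re, Im; simpl; ring.
Qed.

Lemma is_cderive_ccont (f : R -> C) (x : R) (l : C) : is_cderive f x l -> ccont f x.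
Proof.
  intros [F1 F2]; split; eapply is_derive_continuous; eassumption.
Qed.

Lemma ccont_ext (f g : R -> C) (x : R) : (forall t, f t = g t) -> ccont f x -> ccont g x.
Proof.
  intros E [H1 H2]; split; [eapply continuous_ext; [|exact H1]|eapply continuous_ext; [|exact H2]];
  intro t; simpl; now rewrite E.
Qed.

Lemma ccont_const (c : C) (x : R) : ccont (fun _ => c) x.
Proof. split; apply continuous_const. Qed.

Lemma ccont_RtoC (f : R -> R) (x : R) : continuous f x -> ccont (fun t => RtoC (f t)) x.
Proof. intro H; split; simpl; [exact H|apply continuous_const]. Qed.

Lemma ccont_plus (f g : R -> C) (x : R) : ccont f x -> ccont g x -> ccont (fun t => (f t + g t)%C) x.
Proof.
  intros [F1 F2] [G1 G2]; split; apply (continuous_plus (V := R_NormedModule)); assumption.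
Qed.

Lemma ccont_opp (f : R -> C) (x : R) : ccont f x -> ccont (fun t => (- f t)%C) x.
Proof.
  intros [F1 F2]; split; apply (continuous_opp (V := R_NormedModule)); assumption.
Qed.

Lemma ccont_mult (f g : R -> C) (x : R) : ccont f x -> ccont g x -> ccont (fun t => (f t * g t)%C) x.
Proof.
  intros [F1 F2] [G1 G2]; split.
  - apply (continuous_minus (V := R_NormedModule)); apply (continuous_mult (K := R_AbsRing)); assumption.
  - apply (continuous_plus (V := R_NormedModule)); apply (continuous_mult (K := R_AbsRing)); assumption.
Qed.

Lemma ccont_minus (f g : R -> C) (x : R) : ccont f x -> ccont g x -> ccont (fun t => (f t - g t)%C) x.
Proof.
  intros [F1 F2] [G1 G2]; split; apply (continuous_minus (V := R_NormedModule)); assumption.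
Qed.

Lemma ccont_cexp (f : R -> C) (x : R) : ccont f x -> ccont (fun t => cexp (f t)) x.
Proof.
  intros [F1 F2]; split; apply (continuous_mult (K := R_AbsRing)).
  - apply (continuous_comp (fun t => Re (f t)) exp); [exact F1|apply continuous_exp].
  - apply (continuous_comp (fun t => Im (f t)) cos); [exact F2|apply continuous_cos].
  - apply (continuous_comp (fun t => Re (f t)) exp); [exact F1|apply continuous_exp].
  - apply (continuous_comp (fun t => Im (f t)) sin); [exact F2|apply continuous_sin].
Qed.

Lemma ccont_conj (f : R -> C) (x : R) : ccont f x -> ccont (fun t => Cconj (f t)) x.
Proof.
  intros [F1 F2]; split; [exact F1|apply (continuous_opp (V := R_NormedModule)); exact F2].
Qed.

Lemma ccont_pow (f : R -> C) (x : R) (n : nat) : ccont f x -> ccont (fun t => (f t ^ n)%C) x.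
Proof.
  intro H; induction n as [|n IH]; simpl.
  - apply ccont_const.
  - apply ccont_mult; assumption.
Qed.

Lemma ccont_inv (f : R -> C) (x : R) : ccont f x -> f x <> 0 -> ccont (fun t => (/ f t)%C) x.
Proof.
  intros [F1 F2] N.
  assert (D : continuous (fun t => / (Re (f t) ^ 2 + Im (f t) ^ 2)) x).
  { apply (continuous_comp (fun t => Re (f t) ^ 2 + Im (f t) ^ 2) Rinv).
    - apply (continuous_plus (V := R_NormedModule)); simpl;
      (apply (continuous_mult (K := R_AbsRing)); [assumption|apply (continuous_mult (K := R_AbsRing)); [assumption|apply continuous_const]]).
    - apply continuous_Rinv. intro E. apply N. apply Cmod_eq_0. unfold Cmod, Re, Im in *. rewrite E. apply sqrt_0. }
  split; unfold Cinv; simpl; apply (continuous_mult (K := R_AbsRing)); try assumption.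
  apply (continuous_opp (V := R_NormedModule)); assumption.
Qed.

(** Cauchy-Schwarz: the left side is the real part of [Cconj w * z]. *)
Lemma Cdot_le (w z : C) : Re w * Re z + Im w * Im z <= Cmod w * Cmod z.
Proof.
  rewrite <- (Cmod_conj w), <- Cmod_mult.
  eapply Rle_trans; [|apply re_le_Cmod]. eapply Rle_trans; [|apply Rle_abs].
  unfold Cconj, Cmult, Re, Im; simpl; lra.
Qed.

Lemma Cmod_sqr_dot (w : C) : Cmod w * Cmod w = Re w * Re w + Im w * Im w.
Proof. pose proof (Cmod2_alt w) as H; simpl in H. lra. Qed.

(** The increment [w = g b - g a] is projected onto its own direction: by the bound on [g'], the
    real function [Re (Cconj w * g) - |w| h] is nonincreasing, and comparing its end values gives
    [|w|^2 <= |w| (h b - h a)]. *)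
Lemma cmean_value (g g' : R -> C) (h h' : R -> R) (a b : R) : a <= b ->
  (forall t, a <= t <= b -> is_cderive g t (g' t)) ->
  (forall t, a <= t <= b -> is_derive h t (h' t)) ->
  (forall t, a <= t <= b -> Cmod (g' t) <= h' t) ->
  Cmod (g b - g a) <= h b - h a.
Proof.
  intros Hab Dg Dh Hle.
  destruct (Req_dec (Cmod (g b - g a)) 0) as [E|NE].
  - rewrite E. destruct (MVT_gen h a b h') as [c [Hc Hc']].
    + intros x Hx. apply Dh. rewrite Rmin_left, Rmax_right in Hx by lra; lra.
    + intros x Hx. rewrite Rmin_left, Rmax_right in Hx by lra.
      apply continuity_pt_filterlim. eapply is_derive_continuous; apply Dh; lra.
    + rewrite Rmin_left, Rmax_right in Hc by lra. rewrite Hc'.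
      apply Rmult_le_pos; [|lra]. eapply Rle_trans; [apply Cmod_ge_0|apply Hle; exact Hc].
  - set (w := (g b - g a)%C) in *.
    assert (Pw : 0 < Cmod w) by (pose proof (Cmod_ge_0 w); lra).
    set (k := fun t => (Re w * Re (g t) + Im w * Im (g t)) - Cmod w * h t).
    set (k' := fun t => (Re w * Re (g' t) + Im w * Im (g' t)) - Cmod w * h' t).
    assert (Dk : forall t, a <= t <= b -> is_derive k t (k' t)).
    { intros t Ht. destruct (Dg t Ht) as [D1 D2]. pose proof (Dh t Ht) as D3. unfold k, k'.
      apply (is_derive_minus (V := R_NormedModule)).
      - apply (is_derive_plus (V := R_NormedModule)); apply (is_derive_scal); assumption.
      - apply (is_derive_scal); assumption. }
    assert (Hk' : forall t, a <= t <= b -> k' t <= 0).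
    { intros t Ht. unfold k'.
      pose proof (Cdot_le w (g' t)). pose proof (Rmult_le_compat_l _ _ _ (Rlt_le _ _ Pw) (Hle t Ht)). lra. }
    destruct (MVT_gen k a b k') as [c [Hc Hc']].
    + intros x Hx. apply Dk. rewrite Rmin_left, Rmax_right in Hx by lra; lra.
    + intros x Hx. rewrite Rmin_left, Rmax_right in Hx by lra.
      apply continuity_pt_filterlim. eapply is_derive_continuous; apply Dk; lra.
    + rewrite Rmin_left, Rmax_right in Hc by lra.
      assert (Hkk : k b - k a <= 0). { rewrite Hc'. pose proof (Hk' c Hc). apply Ropp_le_cancel. rewrite Ropp_0, <- Ropp_mult_distr_l_reverse. apply Rmult_le_pos; lra. }
      assert (Hw : Cmod w * Cmod w = Re w * (Re (g b) - Re (g a)) + Im w * (Im (g b) - Im (g a))).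
      { rewrite Cmod_sqr_dot. unfold w, Re, Im; simpl; ring. }
      unfold k in Hkk. apply Rmult_le_reg_l with (Cmod w); [exact Pw|]. lra.
Qed.

Lemma RInt_plus_R (f g : R -> R) (a b : R) : ex_RInt f a b -> ex_RInt g a b ->
  RInt (fun t => f t + g t) a b = RInt f a b + RInt g a b.
Proof. exact (RInt_plus (V := R_CompleteNormedModule) f g a b). Qed.

Lemma RInt_minus_R (f g : R -> R) (a b : R) : ex_RInt f a b -> ex_RInt g a b ->
  RInt (fun t => f t - g t) a b = RInt f a b - RInt g a b.
Proof. exact (RInt_minus (V := R_CompleteNormedModule) f g a b). Qed.

Lemma RInt_scal_R (k : R) (f : R -> R) (a b : R) : ex_RInt f a b ->
  RInt (fun t => k * f t) a b = k * RInt f a b.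
Proof. exact (RInt_scal (V := R_CompleteNormedModule) f a b k). Qed.

Lemma ex_RInt_scal_R (k : R) (f : R -> R) (a b : R) : ex_RInt f a b -> ex_RInt (fun t => k * f t) a b.
Proof. exact (ex_RInt_scal (V := R_NormedModule) f a b k). Qed.

Lemma ex_RInt_plus_R (f g : R -> R) (a b : R) : ex_RInt f a b -> ex_RInt g a b ->
  ex_RInt (fun t => f t + g t) a b.
Proof. exact (ex_RInt_plus (V := R_NormedModule) f g a b). Qed.

Lemma RInt_Chasles_R (f : R -> R) (a b c : R) : ex_RInt f a b -> ex_RInt f b c ->
  RInt f a c = RInt f a b + RInt f b c.
Proof. intros H1 H2. symmetry. exact (RInt_Chasles (V := R_CompleteNormedModule) f a b c H1 H2). Qed.

Lemma RInt_ext_R (f g : R -> R) (a b : R) : (forall t, f t = g t) -> RInt f a b = RInt g a b.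
Proof. intro H. apply RInt_ext. intros t _. apply H. Qed.

Lemma cRInt_ex (f : R -> C) (a b : R) : a <= b -> (forall t, a <= t <= b -> ccont f t) ->
  ex_RInt (fun t => Re (f t)) a b /\ ex_RInt (fun t => Im (f t)) a b.
Proof.
  intros Hab H; split; apply (ex_RInt_continuous (V := R_CompleteNormedModule)); intros z Hz;
  rewrite Rmin_left, Rmax_right in Hz by lra; apply (H z Hz).
Qed.

(** As for the mean value inequality, pairing the integral with itself turns its squared modulus
    into a real integral, where Cauchy-Schwarz applies pointwise. *)
Lemma CRInt_bound (f : R -> C) (h : R -> R) (a b : R) : a <= b ->
  (forall t, a <= t <= b -> ccont f t) ->
  (forall t, a <= t <= b -> Cmod (f t) <= h t) ->
  ex_RInt h a b ->
  Cmod (CRInt f a b) <= RInt h a b.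
Proof.
  intros Hab Hc Hh Hex.
  destruct (Req_dec (Cmod (CRInt f a b)) 0) as [E|NE].
  - rewrite E. apply RInt_ge_0; try assumption. intros x Hx. eapply Rle_trans; [apply Cmod_ge_0|apply Hh; lra].
  - set (w := CRInt f a b) in *.
    assert (Pw : 0 < Cmod w) by (pose proof (Cmod_ge_0 w); lra).
    destruct (cRInt_ex f a b Hab Hc) as [E1 E2].
    apply Rmult_le_reg_l with (Cmod w); [exact Pw|].
    assert (Hw : Cmod w * Cmod w = RInt (fun t => Re w * Re (f t) + Im w * Im (f t)) a b).
    { rewrite (RInt_plus_R).
      - rewrite !(RInt_scal_R) by assumption.
        rewrite Cmod_sqr_dot. reflexivity.
      - apply ex_RInt_scal_R; assumption.
      - apply ex_RInt_scal_R; assumption. }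
    rewrite Hw. rewrite <- (RInt_scal_R) by assumption.
    apply RInt_le; try assumption.
    + apply ex_RInt_plus_R; apply ex_RInt_scal_R; assumption.
    + apply ex_RInt_scal_R; assumption.
    + intros x Hx. assert (Hx' : a <= x <= b) by lra.
      pose proof (Cdot_le w (f x)). pose proof (Rmult_le_compat_l _ _ _ (Rlt_le _ _ Pw) (Hh x Hx')). lra.
Qed.

Lemma CRInt_derive (f f' : R -> C) (a b : R) : a <= b ->
  (forall t, a <= t <= b -> is_cderive f t (f' t)) ->
  (forall t, a <= t <= b -> ccont f' t) ->
  CRInt f' a b = (f b - f a)%C.
Proof.
  intros Hab D Cn. unfold CRInt.
  assert (is_RInt (fun t => Re (f' t)) a b (Re (f b) - Re (f a))) as H1.
  { apply (is_RInt_derive (V := R_CompleteNormedModule) (fun t => Re (f t))); intros x Hx; rewrite Rmin_left, Rmax_right in Hx by lra.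
    - apply (D x Hx). - apply (Cn x Hx). }
  assert (is_RInt (fun t => Im (f' t)) a b (Im (f b) - Im (f a))) as H2.
  { apply (is_RInt_derive (V := R_CompleteNormedModule) (fun t => Im (f t))); intros x Hx; rewrite Rmin_left, Rmax_right in Hx by lra.
    - apply (D x Hx). - apply (Cn x Hx). }
  rewrite (is_RInt_unique _ _ _ _ H1), (is_RInt_unique _ _ _ _ H2). reflexivity.
Qed.

Lemma CRInt_ext (f g : R -> C) (a b : R) : a <= b ->
  (forall t, a <= t <= b -> f t = g t) -> CRInt f a b = CRInt g a b.
Proof.
  intros Hab E. unfold CRInt. f_equal; apply RInt_ext; intros x Hx;
  rewrite Rmin_left, Rmax_right in Hx by lra; now rewrite E by lra.
Qed.

Lemma CRInt_plus (f g : R -> C) (a b : R) : a <= b ->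
  (forall t, a <= t <= b -> ccont f t) -> (forall t, a <= t <= b -> ccont g t) ->
  CRInt (fun t => (f t + g t)%C) a b = (CRInt f a b + CRInt g a b)%C.
Proof.
  intros Hab Hf Hg. destruct (cRInt_ex f a b Hab Hf). destruct (cRInt_ex g a b Hab Hg).
  unfold CRInt, Cplus; simpl. f_equal; apply RInt_plus_R; assumption.
Qed.

Lemma CRInt_scal (c : C) (f : R -> C) (a b : R) : a <= b ->
  (forall t, a <= t <= b -> ccont f t) ->
  CRInt (fun t => (c * f t)%C) a b = (c * CRInt f a b)%C.
Proof.
  intros Hab Hf. destruct (cRInt_ex f a b Hab Hf) as [E1 E2].
  unfold CRInt, Cmult; simpl. f_equal.
  - rewrite (RInt_minus_R (fun t => fst c * Re (f t)) (fun t => snd c * Im (f t))).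
    + rewrite !(RInt_scal_R) by assumption. reflexivity.
    + apply ex_RInt_scal_R; assumption.
    + apply ex_RInt_scal_R; assumption.
  - rewrite (RInt_plus_R (fun t => fst c * Im (f t)) (fun t => snd c * Re (f t))).
    + rewrite !(RInt_scal_R) by assumption. reflexivity.
    + apply ex_RInt_scal_R; assumption.
    + apply ex_RInt_scal_R; assumption.
Qed.

Lemma CRInt_conj (f : R -> C) (a b : R) : a <= b -> (forall t, a <= t <= b -> ccont f t) ->
  CRInt (fun t => Cconj (f t)) a b = Cconj (CRInt f a b).
Proof.
  intros Hab Hf. destruct (cRInt_ex f a b Hab Hf) as [E1 E2].
  unfold CRInt, Cconj; simpl. f_equal. apply (RInt_opp (V := R_CompleteNormedModule)); assumption.
Qed.

(** * Finite complex sums and the Taylor remainder of the exponential *)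

Definition csum (u : nat -> C) (n : nat) : C := @sum_n C_AbelianMonoid u n.

Lemma csum_0 (u : nat -> C) : csum u 0 = u 0%nat.
Proof. apply sum_O. Qed.

Lemma csum_S (u : nat -> C) (n : nat) : csum u (S n) = (csum u n + u (S n))%C.
Proof. apply (sum_Sn (G := C_AbelianMonoid)). Qed.

Lemma csum_ext (u v : nat -> C) (n : nat) : (forall k, (k <= n)%nat -> u k = v k) -> csum u n = csum v n.
Proof. intro H; apply sum_n_ext_loc; exact H. Qed.

Lemma csum_plus (u v : nat -> C) (n : nat) : csum (fun k => (u k + v k)%C) n = (csum u n + csum v n)%C.
Proof. induction n; [rewrite !csum_0|rewrite !csum_S, IHn]; ring. Qed.

Lemma csum_scal (c : C) (u : nat -> C) (n : nat) : csum (fun k => (c * u k)%C) n = (c * csum u n)%C.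
Proof. induction n; [rewrite !csum_0|rewrite !csum_S, IHn]; ring. Qed.

Lemma sum_n_S (u : nat -> R) (n : nat) : sum_n u (S n) = sum_n u n + u (S n).
Proof. apply (sum_Sn (G := R_AbelianMonoid)). Qed.

Lemma sum_n_ge_0 (u : nat -> R) (n : nat) : (forall k, 0 <= u k) -> 0 <= sum_n u n.
Proof.
  intro H; induction n; [rewrite sum_O; apply H|rewrite sum_n_S].
  pose proof (H (S n)); lra.
Qed.

Lemma Rle_plus_r (x y : R) : 0 <= y -> x <= x + y.
Proof. lra. Qed.

Lemma csum_re (u : nat -> C) (n : nat) : Re (csum u n) = sum_n (fun k => Re (u k)) n.
Proof. induction n; [rewrite csum_0, sum_O|rewrite csum_S, sum_Sn, <- IHn]; reflexivity. Qed.

Lemma csum_im (u : nat -> C) (n : nat) : Im (csum u n) = sum_n (fun k => Im (u k)) n.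
Proof. induction n; [rewrite csum_0, sum_O|rewrite csum_S, sum_Sn, <- IHn]; reflexivity. Qed.

Lemma exp_le_mono (x y : R) : x <= y -> exp x <= exp y.
Proof. intros [H| ->]; [left; now apply exp_increasing|right; reflexivity]. Qed.

Lemma ccont_csum (u : nat -> R -> C) (n : nat) (x : R) :
  (forall k, ccont (u k) x) -> ccont (fun t => csum (fun k => u k t) n) x.
Proof.
  intro H. induction n as [|n IH].
  - apply ccont_ext with (u 0%nat); [|apply H]. intro t. now rewrite csum_0.
  - apply ccont_ext with (fun t => (csum (fun k => u k t) n + u (S n) t)%C).
    + intro t. now rewrite csum_S.
    + apply ccont_plus; auto.
Qed.

Lemma pow_fact_le_exp (y : R) (n : nat) : 0 <= y -> y ^ n / INR (fact n) <= exp y.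
Proof.
  intro Hy.
  assert (HS : is_series (fun k => y ^ k / INR (fact k)) (exp y)).
  { generalize (is_exp_Reals y); unfold is_pseries; apply is_series_ext.
    intro k. rewrite pow_n_pow. unfold scal; simpl; unfold mult; simpl. reflexivity. }
  assert (P : forall k, 0 <= y ^ k / INR (fact k)).
  { intro k. apply Rdiv_le_0_compat; [apply pow_le; exact Hy|apply INR_fact_lt_0]. }
  assert (L : y ^ n / INR (fact n) <= sum_n (fun k => y ^ k / INR (fact k)) n).
  { destruct n as [|n]; [rewrite sum_O; lra|]. rewrite sum_n_S.
    pose proof (sum_n_ge_0 _ n P). lra. }
  eapply Rle_trans; [exact L|].
  apply (is_lim_seq_incr_compare _ _ HS). intro k. rewrite sum_n_S. apply Rle_plus_r, P.
Qed.

Definition exp_term (v : C) (j : nat) : C := (v ^ j * RtoC (/ INR (fact j)))%C.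

Definition exp_rem (n : nat) (v : C) : C := (cexp v - csum (exp_term v) n)%C.

Lemma exp_term_S (v : C) (j : nat) : (RtoC (INR (S j)) * exp_term v (S j) = v * exp_term v j)%C.
Proof.
  unfold exp_term. rewrite Cpow_S. rewrite fact_simpl, mult_INR, Rinv_mult, RtoC_mult.
  assert (H : (RtoC (INR (S j)) * RtoC (/ INR (S j)))%C = 1).
  { rewrite <- RtoC_mult. f_equal. field. apply not_0_INR; lia. }
  replace (RtoC (INR (S j)) * (v * v ^ j * (RtoC (/ INR (S j)) * RtoC (/ INR (fact j)))))%C
    with ((RtoC (INR (S j)) * RtoC (/ INR (S j))) * (v * (v ^ j * RtoC (/ INR (fact j)))))%C by ring.
  rewrite H; ring.
Qed.

Lemma is_cderive_line (v : C) (t : R) : is_cderive (fun t => (RtoC t * v)%C) t v.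
Proof.
  eapply is_cderive_eq.
  - apply is_cderive_mult; [apply is_cderive_RtoC, is_derive_id|apply is_cderive_const].
  - unfold one; simpl. ring.
Qed.

Lemma is_cderive_exp_term (v : C) (j : nat) (t : R) :
  is_cderive (fun t => exp_term (RtoC t * v) (S j)) t (v * exp_term (RtoC t * v) j)%C.
Proof.
  induction j as [|j IH].
  - unfold exp_term. eapply is_cderive_ext; [|eapply is_cderive_eq; [apply (is_cderive_line v)|]].
    + intro s. simpl. rewrite Rinv_1. ring.
    + simpl. rewrite Rinv_1. ring.
  - eapply is_cderive_ext; [|eapply is_cderive_eq; [apply is_cderive_scal; apply is_cderive_mult; [apply is_cderive_line|exact IH]|]].
    + intro s. cbv beta. rewrite <- exp_term_S.
      instantiate (1 := RtoC (/ INR (S (S j)))). rewrite Cmult_assoc, <- RtoC_mult.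
      rewrite Rinv_l by (apply not_0_INR; lia). ring.
    + cbv beta. replace (RtoC t * v * (v * exp_term (RtoC t * v) j))%C with (v * (RtoC t * v * exp_term (RtoC t * v) j))%C by ring.
      rewrite <- exp_term_S. rewrite (S_INR (S j)).
      replace (RtoC (/ (INR (S j) + 1)) * (v * exp_term (RtoC t * v) (S j) + v * (RtoC (INR (S j)) * exp_term (RtoC t * v) (S j))))%C
        with ((RtoC (/ (INR (S j) + 1)) * (RtoC (INR (S j)) + 1)) * (v * exp_term (RtoC t * v) (S j)))%C by ring.
      rewrite <- RtoC_plus, <- RtoC_mult, Rinv_l by (pose proof (pos_INR (S j)); lra). ring.
Qed.

Lemma is_cderive_exp_rem (v : C) (n : nat) (t : R) :
  is_cderive (fun t => exp_rem (S n) (RtoC t * v)) t (v * exp_rem n (RtoC t * v))%C.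
Proof.
  assert (HS : forall n, is_cderive (fun t => csum (exp_term (RtoC t * v)) (S n)) t (v * csum (exp_term (RtoC t * v)) n)%C).
  { clear n. intro n. induction n as [|n IH].
    - eapply is_cderive_ext; [|eapply is_cderive_eq; [apply is_cderive_plus; [apply (is_cderive_const 1)|apply (is_cderive_exp_term v 0)]|]].
      + intro s. rewrite csum_S, csum_0. f_equal. unfold exp_term; simpl. rewrite Rinv_1; ring.
      + rewrite csum_0; ring.
    - eapply is_cderive_ext; [|eapply is_cderive_eq; [apply is_cderive_plus; [exact IH|apply (is_cderive_exp_term v (S n))]|]].
      + intro s. now rewrite (csum_S _ (S n)).
      + rewrite csum_S; ring. }
  eapply is_cderive_eq; [apply is_cderive_minus; [apply is_cderive_cexp, is_cderive_line|apply HS]|].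
  unfold exp_rem; ring.
Qed.

Lemma is_derive_pow_fact (m : nat) (s : R) :
  is_derive (fun u => u ^ S m / INR (fact (S m))) s (s ^ m / INR (fact m)).
Proof.
  apply is_derive_ext with (fun u => / INR (fact (S m)) * u ^ S m); [intro u; apply Rmult_comm|].
  eapply is_derive_eq; [apply is_derive_scal, is_derive_pow, is_derive_id|].
  rewrite (fact_simpl m), mult_INR. change (pred (S m)) with m. change one with 1.
  field. split; [apply INR_fact_neq_0|apply not_0_INR; lia].
Qed.

(** On the segment [t v] the derivative of each remainder is [v] times the previous one, so the mean
    value inequality integrates the bound once per order. The last factor bounds [|exp (t v)|] for
    [0 <= t <= 1]; it equals [1] when [Re v <= 0]. *)
Lemma exp_rem_bound (n : nat) (v : C) :
  Cmod (exp_rem n v) <= Cmod v ^ S n / INR (fact (S n)) * Rmax 1 (exp (Re v)).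
Proof.
  set (M := Rmax 1 (exp (Re v))).
  assert (HM : forall t, 0 <= t <= 1 -> Cmod (cexp (RtoC t * v)) <= M).
  { intros t Ht. rewrite Cmod_cexp. replace (Re (RtoC t * v)) with (t * Re v) by (unfold Re, Cmult, RtoC; simpl; ring).
    destruct (Rle_dec (Re v) 0) as [Hv|Hv].
    - eapply Rle_trans; [|apply Rmax_l]. rewrite <- exp_0. apply exp_le_mono. nra.
    - eapply Rle_trans; [|apply Rmax_r]. apply exp_le_mono. nra. }
  assert (K : forall n t, 0 <= t <= 1 -> Cmod (exp_rem n (RtoC t * v)) <= M * Cmod v ^ S n * (t ^ S n / INR (fact (S n)))).
  { clear n. intro n. induction n as [|n IH]; intros t Ht.
    - assert (E : forall s, exp_rem 0 (RtoC s * v) = (cexp (RtoC s * v) - 1)%C).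
      { intro s. unfold exp_rem. rewrite csum_0. unfold exp_term; simpl. rewrite Rinv_1; ring. }
      replace (exp_rem 0 (RtoC t * v)) with (exp_rem 0 (RtoC t * v) - exp_rem 0 (RtoC 0 * v))%C
        by (rewrite (E 0); rewrite Cmult_0_l, cexp_0; ring).
      replace (M * Cmod v ^ 1 * (t ^ 1 / INR (fact 1))) with (M * Cmod v * t - M * Cmod v * 0) by (simpl; field).
      apply (cmean_value (fun s => exp_rem 0 (RtoC s * v)) (fun s => v * cexp (RtoC s * v))%C (fun s => M * Cmod v * s) (fun _ => M * Cmod v)); [lra| | |].
      + intros s Hs. eapply is_cderive_ext; [intro u; symmetry; apply E|].
        eapply is_cderive_eq; [apply is_cderive_plus; [apply is_cderive_cexp, is_cderive_line|apply is_cderive_const]|]. cbv beta; ring.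
      + intros s Hs. auto_derive; trivial; ring.
      + intros s Hs. rewrite Cmod_mult. pose proof (HM s ltac:(lra)). pose proof (Cmod_ge_0 v). nra.
    - assert (E0 : exp_rem (S n) (RtoC 0 * v) = 0).
      { clear. rewrite Cmult_0_l. induction (S n) as [|k IH].
        - unfold exp_rem. rewrite csum_0, cexp_0. unfold exp_term; simpl. rewrite Rinv_1; ring.
        - unfold exp_rem in *. rewrite csum_S. unfold exp_term at 2. rewrite Cpow_S.
          replace (cexp 0 - (csum (exp_term 0) k + 0 * 0 ^ k * RtoC (/ INR (fact (S k)))))%C with (cexp 0 - csum (exp_term 0) k)%C by ring. exact IH. }
      replace (exp_rem (S n) (RtoC t * v)) with (exp_rem (S n) (RtoC t * v) - exp_rem (S n) (RtoC 0 * v))%C by (rewrite E0; ring).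
      replace (M * Cmod v ^ S (S n) * (t ^ S (S n) / INR (fact (S (S n))))) with
        (M * Cmod v ^ S (S n) * (t ^ S (S n) / INR (fact (S (S n)))) - M * Cmod v ^ S (S n) * (0 ^ S (S n) / INR (fact (S (S n)))))
        by (rewrite (pow_i (S (S n))) by lia; field; apply INR_fact_neq_0).
      apply (cmean_value (fun s => exp_rem (S n) (RtoC s * v)) (fun s => v * exp_rem n (RtoC s * v))%C
        (fun s => M * Cmod v ^ S (S n) * (s ^ S (S n) / INR (fact (S (S n))))) (fun s => M * Cmod v ^ S (S n) * (s ^ S n / INR (fact (S n))))); [lra| | |].
      + intros s Hs. apply is_cderive_exp_rem.
      + intros s Hs. apply is_derive_scal, is_derive_pow_fact.
      + intros s Hs. rewrite Cmod_mult. pose proof (IH s ltac:(lra)) as IHs. pose proof (Cmod_ge_0 v).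
        change (Cmod v ^ S (S n)) with (Cmod v * Cmod v ^ S n).
        replace (M * (Cmod v * Cmod v ^ S n) * (s ^ S n / INR (fact (S n)))) with (Cmod v * (M * Cmod v ^ S n * (s ^ S n / INR (fact (S n))))) by ring.
        apply Rmult_le_compat_l; assumption. }
  pose proof (K n 1 ltac:(lra)) as H. rewrite Cmult_1_l, pow1 in H.
  eapply Rle_trans; [exact H|]. apply Req_le. unfold Rdiv; ring.
Qed.

(** The factor [|v|^(n+1) / (n+1)!] is [2^-(n+1)] times a term of the series of [exp (2 |v|)]. The
    price [exp (3 |v|)] buys a rate of decay independent of [v], which justifies termwise
    integration of exponential series. *)
Lemma exp_rem_geom (n : nat) (v : C) : Cmod (exp_rem n v) <= (/ 2) ^ S n * exp (3 * Cmod v).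
Proof.
  eapply Rle_trans; [apply exp_rem_bound|].
  assert (P := Cmod_ge_0 v).
  pose proof (pow_fact_le_exp (2 * Cmod v) (S n) ltac:(lra)) as H.
  rewrite Rpow_mult_distr in H.
  assert (Hm : Rmax 1 (exp (Re v)) <= exp (Cmod v)).
  { apply Rmax_lub; [rewrite <- exp_0 at 1; apply exp_le_mono; exact P|].
    apply exp_le_mono. eapply Rle_trans; [apply Rle_abs|apply re_le_Cmod]. }
  replace (3 * Cmod v) with (2 * Cmod v + Cmod v) by ring. rewrite exp_plus, <- Rmult_assoc.
  apply Rmult_le_compat; [| |  |exact Hm].
  - apply Rdiv_le_0_compat; [apply pow_le; exact P|apply INR_fact_lt_0].
  - eapply Rle_trans; [|apply Rmax_l]; lra.
  - rewrite pow_inv. apply Rmult_le_reg_l with (2 ^ S n); [apply pow_lt; lra|].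
    rewrite <- (Rmult_assoc (2 ^ S n)), Rinv_r, Rmult_1_l by (apply pow_nonzero; lra).
    eapply Rle_trans; [|exact H]. apply Req_le. unfold Rdiv. ring.
Qed.

(** * Limits and integrals over a half-line *)

Definition is_cseq (u : nat -> C) (l : C) : Prop :=
  forall eps, 0 < eps -> exists N, forall n, (N <= n)%nat -> Cmod (u n - l) < eps.

Definition is_clim (f : R -> C) (l : C) : Prop :=
  forall eps, 0 < eps -> exists M, forall T, M <= T -> Cmod (f T - l) < eps.

Lemma is_cseq_le (u : nat -> C) (l : C) (e : nat -> R) :
  (forall n, Cmod (u n - l) <= e n) -> is_lim_seq e 0 -> is_cseq u l.
Proof.
  intros H L eps He. apply is_lim_seq_spec in L. destruct (L (mkposreal eps He)) as [N HN].
  exists N. intros n Hn. specialize (HN n Hn). simpl in HN. rewrite Rminus_0_r in HN.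
  eapply Rle_lt_trans; [apply H|]. eapply Rle_lt_trans; [apply Rle_abs|exact HN].
Qed.

Lemma is_cseq_unique (u : nat -> C) (l m : C) : is_cseq u l -> is_cseq u m -> l = m.
Proof.
  intros Hl Hm. destruct (Req_dec (Cmod (l - m)) 0) as [E|NE].
  - apply Cmod_eq_0 in E. replace l with (l - m + m)%C by ring. rewrite E; ring.
  - exfalso. assert (P : 0 < Cmod (l - m) / 2) by (pose proof (Cmod_ge_0 (l - m)); lra).
    destruct (Hl _ P) as [N HN], (Hm _ P) as [N' HN'].
    specialize (HN (max N N') ltac:(lia)). specialize (HN' (max N N') ltac:(lia)).
    rewrite Cmod_minus_sym in HN.
    pose proof (Cmod_triangle (l - u (max N N')) (u (max N N') - m)) as T.
    replace (l - u (max N N') + (u (max N N') - m))%C with (l - m)%C in T by ring. lra.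
Qed.

Lemma is_cseq_ext (u v : nat -> C) (l : C) : (forall n, u n = v n) -> is_cseq u l -> is_cseq v l.
Proof. intros E H eps He. destruct (H eps He) as [N HN]. exists N. intros n Hn. rewrite <- E. auto. Qed.

Lemma is_cseq_plus (u v : nat -> C) (l m : C) : is_cseq u l -> is_cseq v m ->
  is_cseq (fun n => (u n + v n)%C) (l + m)%C.
Proof.
  intros Hu Hv eps He. destruct (Hu (eps / 2) ltac:(lra)) as [N HN], (Hv (eps / 2) ltac:(lra)) as [N' HN'].
  exists (max N N'). intros n Hn. specialize (HN n ltac:(lia)). specialize (HN' n ltac:(lia)).
  replace (u n + v n - (l + m))%C with ((u n - l) + (v n - m))%C by ring.
  pose proof (Cmod_triangle (u n - l) (v n - m)). lra.
Qed.

Lemma is_cseq_scal (c : C) (u : nat -> C) (l : C) : is_cseq u l -> is_cseq (fun n => (c * u n)%C) (c * l)%C.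
Proof.
  intros Hu eps He. pose proof (Cmod_ge_0 c) as Pc.
  destruct (Hu (eps / (Cmod c + 1))) as [N HN]; [apply Rdiv_lt_0_compat; lra|].
  exists N. intros n Hn. specialize (HN n Hn).
  replace (c * u n - c * l)%C with (c * (u n - l))%C by ring. rewrite Cmod_mult.
  pose proof (Cmod_ge_0 (u n - l)).
  apply Rle_lt_trans with ((Cmod c + 1) * Cmod (u n - l)); [nra|].
  apply Rlt_le_trans with ((Cmod c + 1) * (eps / (Cmod c + 1))); [apply Rmult_lt_compat_l; lra|].
  apply Req_le; field; lra.
Qed.

Lemma is_cseq_const (c : C) : is_cseq (fun _ => c) c.
Proof. intros eps He; exists 0%nat; intros n _. replace (c - c)%C with (RtoC 0) by ring. now rewrite Cmod_0. Qed.

Lemma is_cseq_minus (u v : nat -> C) (l m : C) : is_cseq u l -> is_cseq v m ->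
  is_cseq (fun n => (u n - v n)%C) (l - m)%C.
Proof.
  intros Hu Hv. eapply is_cseq_ext; [|replace (l - m)%C with (l + (-1) * m)%C; [apply is_cseq_plus; [exact Hu|apply (is_cseq_scal (-1) _ _ Hv)]|]].
  - intro n. cbv beta. replace (RtoC (-1)) with (- (1))%C by (unfold Copp, RtoC; simpl; f_equal; ring). ring.
  - replace (RtoC (-1)) with (- (1))%C by (unfold Copp, RtoC; simpl; f_equal; ring). ring.
Qed.

Lemma is_cseq_conj (u : nat -> C) (l : C) : is_cseq u l -> is_cseq (fun n => Cconj (u n)) (Cconj l).
Proof.
  intros H eps He. destruct (H eps He) as [N HN]. exists N. intros n Hn.
  replace (Cconj (u n) - Cconj l)%C with (Cconj (u n - l)) by (unfold Cconj, Cminus, Cplus, Copp; simpl; f_equal; ring).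
  rewrite Cmod_conj. auto.
Qed.

Lemma is_cseq_RtoC (u : nat -> R) (l : R) : is_lim_seq u l -> is_cseq (fun n => RtoC (u n)) (RtoC l).
Proof.
  intro L. apply is_cseq_le with (fun n => Rabs (u n - l)).
  - intro n. rewrite <- RtoC_minus, Cmod_R. lra.
  - assert (H : is_lim_seq (fun n => u n - l) (l - l)) by (apply is_lim_seq_minus'; [exact L|apply is_lim_seq_const]).
    replace (l - l) with 0 in H by ring. apply (is_lim_seq_abs _ 0) in H. simpl in H. now rewrite Rabs_R0 in H.
Qed.

Lemma is_cseq_re (u : nat -> C) (l : C) : is_cseq u l -> is_lim_seq (fun n => Re (u n)) (Re l).
Proof.
  intro H. apply is_lim_seq_spec. intros eps. destruct (H eps (cond_pos eps)) as [N HN]. exists N. intros n Hn.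
  eapply Rle_lt_trans; [|apply (HN n Hn)]. change (Re (u n) - Re l) with (Re (u n - l)). apply re_le_Cmod.
Qed.

Lemma is_cseq_im (u : nat -> C) (l : C) : is_cseq u l -> is_lim_seq (fun n => Im (u n)) (Im l).
Proof.
  intro H. apply is_lim_seq_spec. intros eps. destruct (H eps (cond_pos eps)) as [N HN]. exists N. intros n Hn.
  eapply Rle_lt_trans; [|apply (HN n Hn)]. change (Im (u n) - Im l) with (Im (u n - l)). apply im_le_Cmod.
Qed.

Lemma is_cseq_re_im (u : nat -> C) (l : C) :
  is_lim_seq (fun n => Re (u n)) (Re l) -> is_lim_seq (fun n => Im (u n)) (Im l) -> is_cseq u l.
Proof.
  intros H1 H2 eps He. apply is_lim_seq_spec in H1. apply is_lim_seq_spec in H2.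
  assert (P : 0 < eps / 2) by lra.
  destruct (H1 (mkposreal _ P)) as [N HN], (H2 (mkposreal _ P)) as [N' HN'].
  exists (max N N'). intros n Hn. specialize (HN n ltac:(lia)). specialize (HN' n ltac:(lia)). simpl in *.
  eapply Rle_lt_trans; [apply Cmod_le_re_im|]. change (Re (u n - l)) with (Re (u n) - Re l).
  change (Im (u n - l)) with (Im (u n) - Im l). lra.
Qed.

Lemma is_cseq_is_series (u : nat -> C) (l : C) :
  is_cseq (csum u) l -> @is_series C_AbsRing C_NormedModule u l.
Proof.
  intros H. apply (filterlim_locally (U := C_UniformSpace)). intros eps.
  destruct (H eps (cond_pos eps)) as [N HN]. exists N. intros n Hn.
  apply C_NormedModule_mixin_compat1. exact (HN n Hn).
Qed.

Lemma is_series_is_cseq (u : nat -> C) (l : C) :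
  @is_series C_AbsRing C_NormedModule u l -> is_cseq (csum u) l.
Proof.
  intros H eps He.
  (* Balls of the uniform structure on [C] are coordinatewise, which costs a factor [sqrt 2] on the
     modulus; the radius [eps / 2] absorbs it. *)
  assert (P : 0 < eps / 2) by lra.
  pose proof (proj1 (filterlim_locally (U := C_UniformSpace) _ _) H (mkposreal _ P)) as [N HN].
  exists N. intros n Hn. specialize (HN n Hn).
  apply C_NormedModule_mixin_compat2 in HN. simpl in HN.
  eapply Rlt_le_trans; [exact HN|].
  assert (sqrt 2 <= 2). { rewrite <- (sqrt_pow2 2) at 2 by lra. apply sqrt_le_1_alt; lra. } nra.
Qed.

Lemma is_clim_unique (f : R -> C) (l m : C) : is_clim f l -> is_clim f m -> l = m.
Proof.
  intros Hl Hm. apply is_cseq_unique with (fun n => f (INR n)).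
  - intros eps He. destruct (Hl eps He) as [M HM]. exists (Z.to_nat (up M)). intros n Hn. apply HM.
    destruct (archimed M) as [A _]. apply Rlt_le. eapply Rlt_le_trans; [exact A|].
    rewrite INR_IZR_INZ. apply IZR_le. lia.
  - intros eps He. destruct (Hm eps He) as [M HM]. exists (Z.to_nat (up M)). intros n Hn. apply HM.
    destruct (archimed M) as [A _]. apply Rlt_le. eapply Rlt_le_trans; [exact A|].
    rewrite INR_IZR_INZ. apply IZR_le. lia.
Qed.

Lemma is_clim_plus (f g : R -> C) (l m : C) : is_clim f l -> is_clim g m ->
  is_clim (fun T => (f T + g T)%C) (l + m)%C.
Proof.
  intros Hf Hg eps He. destruct (Hf (eps / 2) ltac:(lra)) as [M HM], (Hg (eps / 2) ltac:(lra)) as [M' HM'].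
  exists (Rmax M M'). intros T HT.
  specialize (HM T (Rle_trans _ _ _ (Rmax_l _ _) HT)). specialize (HM' T (Rle_trans _ _ _ (Rmax_r _ _) HT)).
  replace (f T + g T - (l + m))%C with ((f T - l) + (g T - m))%C by ring.
  pose proof (Cmod_triangle (f T - l) (g T - m)). lra.
Qed.

Lemma is_clim_scal (c : C) (f : R -> C) (l : C) : is_clim f l -> is_clim (fun T => (c * f T)%C) (c * l)%C.
Proof.
  intros Hu eps He. pose proof (Cmod_ge_0 c) as Pc.
  destruct (Hu (eps / (Cmod c + 1))) as [M HM]; [apply Rdiv_lt_0_compat; lra|].
  exists M. intros T HT. specialize (HM T HT).
  replace (c * f T - c * l)%C with (c * (f T - l))%C by ring. rewrite Cmod_mult.
  pose proof (Cmod_ge_0 (f T - l)).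
  apply Rle_lt_trans with ((Cmod c + 1) * Cmod (f T - l)); [nra|].
  apply Rlt_le_trans with ((Cmod c + 1) * (eps / (Cmod c + 1))); [apply Rmult_lt_compat_l; lra|].
  apply Req_le; field; lra.
Qed.

Lemma is_clim_conj (f : R -> C) (l : C) : is_clim f l -> is_clim (fun T => Cconj (f T)) (Cconj l).
Proof.
  intros H eps He. destruct (H eps He) as [M HM]. exists M. intros T HT.
  replace (Cconj (f T) - Cconj l)%C with (Cconj (f T - l)) by (unfold Cconj, Cminus, Cplus, Copp; simpl; f_equal; ring).
  rewrite Cmod_conj. auto.
Qed.

Lemma is_clim_ext (f g : R -> C) (l : C) : (forall T, 0 <= T -> f T = g T) -> is_clim f l -> is_clim g l.
Proof.
  intros E H eps He. destruct (H eps He) as [M HM]. exists (Rmax M 0). intros T HT.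
  rewrite <- E by (eapply Rle_trans; [apply Rmax_r|exact HT]). apply HM. eapply Rle_trans; [apply Rmax_l|exact HT].
Qed.

Lemma is_clim_bound (f : R -> C) (l : C) (B : R) : is_clim f l -> (forall T, 0 <= T -> Cmod (f T) <= B) -> Cmod l <= B.
Proof.
  intros H HB. destruct (Rle_dec (Cmod l) B) as [Y|NY]; [exact Y|exfalso].
  destruct (H (Cmod l - B) ltac:(lra)) as [M HM].
  specialize (HM (Rmax M 0) (Rmax_l _ _)). specialize (HB (Rmax M 0) (Rmax_r _ _)).
  rewrite Cmod_minus_sym in HM.
  pose proof (Cmod_triangle (l - f (Rmax M 0)) (f (Rmax M 0))) as T.
  replace (l - f (Rmax M 0) + f (Rmax M 0))%C with l in T by ring. lra.
Qed.

(** Exponential decay, rather than mere integrability: the class is closed under sums, scalars and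
    conjugation, and its integrals carry the explicit bound [K / d]. *)
Definition tame (f : R -> C) : Prop :=
  (forall r, 0 <= r -> ccont f r) /\
  exists K d, 0 < d /\ forall r, 0 <= r -> Cmod (f r) <= K * exp (- d * r).

(** A total function: [epsilon] returns the limit as soon as one exists, in particular for [tame]
    functions. *)
Definition CI (f : R -> C) : C := epsilon (inhabits (RtoC 0)) (is_clim (fun T => CRInt f 0 T)).

Lemma RInt_exp_le (K d a b : R) : 0 < d -> 0 <= K -> a <= b ->
  ex_RInt (fun r => K * exp (- d * r)) a b /\ RInt (fun r => K * exp (- d * r)) a b <= K / d * exp (- d * a).
Proof.
  intros Hd HK Hab.
  assert (I : is_RInt (fun r => K * exp (- d * r)) a b ((- (K / d) * exp (- d * b)) - (- (K / d) * exp (- d * a)))).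
  { apply (is_RInt_derive (V := R_CompleteNormedModule) (fun r => - (K / d) * exp (- d * r))).
    - intros x _. auto_derive; trivial. field; lra.
    - intros x _. eapply is_derive_continuous. auto_derive; trivial. }
  split; [eexists; exact I|]. rewrite (is_RInt_unique _ _ _ _ I).
  assert (0 <= K / d) by (apply Rdiv_le_0_compat; lra).
  pose proof (exp_pos (- d * b)). nra.
Qed.

Lemma CRInt_Chasles (f : R -> C) (a b c : R) : a <= b <= c -> (forall t, a <= t <= c -> ccont f t) ->
  CRInt f a c = (CRInt f a b + CRInt f b c)%C.
Proof.
  intros Hb H.
  destruct (cRInt_ex f a b) as [E1 E2]; [lra|intros; apply H; lra|].
  destruct (cRInt_ex f b c) as [E3 E4]; [lra|intros; apply H; lra|].
  unfold CRInt, Cplus; simpl. f_equal; symmetry; apply (RInt_Chasles (V := R_CompleteNormedModule)); assumption.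
Qed.

Lemma tame_K_ge_0 (f : R -> C) (K d : R) : (forall r, 0 <= r -> Cmod (f r) <= K * exp (- d * r)) -> 0 <= K.
Proof.
  intro H. specialize (H 0 (Rle_refl _)). rewrite Rmult_0_r, exp_0 in H. pose proof (Cmod_ge_0 (f 0)). lra.
Qed.

(** Cauchy's criterion: the integral over [[u, v]] is at most [K / d * exp (- d u)]. Completeness is
    used separately for the real and the imaginary part. *)
Lemma tame_ex (f : R -> C) : tame f -> exists l, is_clim (fun T => CRInt f 0 T) l.
Proof.
  intros [Hc [K [d [Hd HK]]]].
  pose proof (tame_K_ge_0 f K d HK) as PK.
  assert (B : forall u v, 0 <= u <= v -> Cmod (CRInt f 0 v - CRInt f 0 u) <= K / d * exp (- d * u)).
  { intros u v Huv. rewrite (CRInt_Chasles f 0 u v) by (try (intros; apply Hc); lra).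
    replace (CRInt f 0 u + CRInt f u v - CRInt f 0 u)%C with (CRInt f u v) by ring.
    destruct (RInt_exp_le K d u v Hd PK ltac:(lra)) as [E L].
    eapply Rle_trans; [apply CRInt_bound with (h := fun r => K * exp (- d * r))|exact L]; try lra; try assumption.
    - intros; apply Hc; lra. - intros; apply HK; lra. }
  assert (S : forall eps, 0 < eps -> exists M, 0 <= M /\ forall u, M <= u -> K / d * exp (- d * u) < eps).
  { intros eps He. assert (Q : 0 <= K / d) by (apply Rdiv_le_0_compat; lra).
    (* Since [exp (d u) > d u], the tail is smaller than [eps] from this threshold on. *)
    exists ((K / d) / eps / d). split; [repeat apply Rdiv_le_0_compat; lra|].
    intros u Hu. assert (Hu' : K / d / eps <= d * u).
    { apply (Rmult_le_compat_l d) in Hu; [|lra]. replace (d * (K / d / eps / d)) with (K / d / eps) in Hu by (field; lra). exact Hu. }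
    assert (E : exp (d * u) > d * u) by (pose proof (exp_ineq1_le (d * u)); lra).
    replace (- d * u) with (- (d * u)) by ring. rewrite exp_Ropp. pose proof (exp_pos (d * u)) as P.
    apply Rmult_lt_reg_r with (exp (d * u)); [exact P|]. rewrite Rmult_assoc, Rinv_l, Rmult_1_r by lra.
    apply Rle_lt_trans with (eps * (d * u)); [|nra].
    apply (Rmult_le_compat_l eps) in Hu'; [|lra]. replace (eps * (K / d / eps)) with (K / d) in Hu' by (field; lra). exact Hu'. }
  assert (Cx : forall p : C -> R, (forall z w, Rabs (p z - p w) <= Cmod (z - w)) ->
    exists y : R, forall eps, 0 < eps -> exists M, forall T, M <= T -> Rabs (p (CRInt f 0 T) - y) < eps).
  { intros p Hp.
    destruct (proj1 (filterlim_locally_cauchy (U := R_CompleteSpace) (F := Rbar_locally p_infty) (fun T => p (CRInt f 0 T)))) as [y Hy].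
    - intros eps. destruct (S eps (cond_pos eps)) as [M [PM HM]].
      exists (fun u => M < u). split; [now exists M|].
      assert (W : forall u v, M < u -> u <= v -> Rabs (p (CRInt f 0 v) - p (CRInt f 0 u)) < eps).
      { intros u v Hu Hv. eapply Rle_lt_trans; [apply Hp|]. eapply Rle_lt_trans; [apply B; lra|apply HM; lra]. }
      intros u v Hu Hv. change (Rabs (p (CRInt f 0 v) - p (CRInt f 0 u)) < eps).
      destruct (Rle_dec u v); [now apply W|]. rewrite Rabs_minus_sym. apply W; [assumption|lra].
    - exists y. intros eps He. pose proof (proj1 (filterlim_locally _ _) Hy (mkposreal eps He)) as [M HM].
      exists (M + 1). intros T HT. apply HM. lra. }
  destruct (Cx Re) as [y1 H1]. { intros z w. change (Re z - Re w) with (Re (z - w)). apply re_le_Cmod. }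
  destruct (Cx Im) as [y2 H2]. { intros z w. change (Im z - Im w) with (Im (z - w)). apply im_le_Cmod. }
  exists (y1, y2). intros eps He. destruct (H1 (eps / 2) ltac:(lra)) as [M1 L1], (H2 (eps / 2) ltac:(lra)) as [M2 L2].
  exists (Rmax M1 M2). intros T HT.
  specialize (L1 T (Rle_trans _ _ _ (Rmax_l _ _) HT)). specialize (L2 T (Rle_trans _ _ _ (Rmax_r _ _) HT)).
  eapply Rle_lt_trans; [apply Cmod_le_re_im|].
  change (Re (CRInt f 0 T - (y1, y2))) with (Re (CRInt f 0 T) - y1).
  change (Im (CRInt f 0 T - (y1, y2))) with (Im (CRInt f 0 T) - y2). lra.
Qed.

Lemma CI_lim (f : R -> C) : tame f -> is_clim (fun T => CRInt f 0 T) (CI f).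
Proof. intro H. apply (epsilon_spec (inhabits (RtoC 0)) (is_clim (fun T => CRInt f 0 T))). now apply tame_ex. Qed.

Lemma CI_unique (f : R -> C) (l : C) : is_clim (fun T => CRInt f 0 T) l -> CI f = l.
Proof.
  intro H. apply (is_clim_unique (fun T => CRInt f 0 T)); [|exact H].
  apply (epsilon_spec (inhabits (RtoC 0)) (is_clim (fun T => CRInt f 0 T))). now exists l.
Qed.

Lemma CI_bound (f : R -> C) (K d : R) : (forall r, 0 <= r -> ccont f r) -> 0 < d ->
  (forall r, 0 <= r -> Cmod (f r) <= K * exp (- d * r)) -> Cmod (CI f) <= K / d.
Proof.
  intros Hc Hd HK. pose proof (tame_K_ge_0 f K d HK) as PK.
  eapply is_clim_bound; [apply CI_lim; split; [exact Hc|exists K, d; split; assumption]|].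
  intros T HT. destruct (RInt_exp_le K d 0 T Hd PK HT) as [E L].
  rewrite Rmult_0_r, exp_0, Rmult_1_r in L.
  eapply Rle_trans; [apply CRInt_bound with (h := fun r => K * exp (- d * r))|exact L]; try assumption.
  - intros; apply Hc; lra. - intros; apply HK; lra.
Qed.

Lemma tame_ext (f g : R -> C) : (forall r, f r = g r) -> tame f -> tame g.
Proof.
  intros E [H1 [K [d [Hd HK]]]]; split.
  - intros r Hr. eapply ccont_ext; [exact E|auto].
  - exists K, d; split; [assumption|]. intros; rewrite <- E; auto.
Qed.

Lemma tame_plus (f g : R -> C) : tame f -> tame g -> tame (fun r => (f r + g r)%C).
Proof.
  intros [F1 [K [d [Hd HK]]]] [G1 [K' [d' [Hd' HK']]]]; split.
  - intros; apply ccont_plus; auto.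
  - exists (K + K'), (Rmin d d'). split; [now apply Rmin_glb_lt|]. intros r Hr.
    eapply Rle_trans; [apply Cmod_triangle|]. rewrite Rmult_plus_distr_r.
    pose proof (tame_K_ge_0 f K d HK). pose proof (tame_K_ge_0 g K' d' HK').
    apply Rplus_le_compat.
    + eapply Rle_trans; [now apply HK|]. apply Rmult_le_compat_l; [assumption|]. apply exp_le_mono.
      pose proof (Rmin_l d d'). nra.
    + eapply Rle_trans; [now apply HK'|]. apply Rmult_le_compat_l; [assumption|]. apply exp_le_mono.
      pose proof (Rmin_r d d'). nra.
Qed.

Lemma tame_scal (c : C) (f : R -> C) : tame f -> tame (fun r => (c * f r)%C).
Proof.
  intros [F1 [K [d [Hd HK]]]]; split.
  - intros; apply ccont_mult; [apply ccont_const|auto].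
  - exists (Cmod c * K), d. split; [assumption|]. intros r Hr. rewrite Cmod_mult, Rmult_assoc.
    apply Rmult_le_compat_l; [apply Cmod_ge_0|auto].
Qed.

Lemma tame_conj (f : R -> C) : tame f -> tame (fun r => Cconj (f r)).
Proof.
  intros [F1 [K [d [Hd HK]]]]; split.
  - intros; apply ccont_conj; auto.
  - exists K, d. split; [assumption|]. intros r Hr. rewrite Cmod_conj; auto.
Qed.

Lemma CI_ext (f g : R -> C) : (forall r, 0 <= r -> f r = g r) -> tame f -> CI f = CI g.
Proof.
  intros E H. symmetry; apply CI_unique. eapply is_clim_ext; [|apply CI_lim, H].
  intros T HT. apply CRInt_ext; [assumption|]. intros; apply E; lra.
Qed.

Lemma CI_plus (f g : R -> C) : tame f -> tame g -> CI (fun r => (f r + g r)%C) = (CI f + CI g)%C.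
Proof.
  intros Hf Hg. apply CI_unique. eapply is_clim_ext; [|apply is_clim_plus; [apply CI_lim, Hf|apply CI_lim, Hg]].
  intros T HT. symmetry; apply CRInt_plus; [assumption| |]; intros; [apply Hf|apply Hg]; lra.
Qed.

Lemma CI_scal (c : C) (f : R -> C) : tame f -> CI (fun r => (c * f r)%C) = (c * CI f)%C.
Proof.
  intros Hf. apply CI_unique. eapply is_clim_ext; [|apply is_clim_scal, CI_lim, Hf].
  intros T HT. symmetry; apply CRInt_scal; [assumption|]; intros; apply Hf; lra.
Qed.

Lemma CI_conj (f : R -> C) : tame f -> CI (fun r => Cconj (f r)) = Cconj (CI f).
Proof.
  intros Hf. apply CI_unique. eapply is_clim_ext; [|apply is_clim_conj, CI_lim, Hf].
  intros T HT. symmetry; apply CRInt_conj; [assumption|]; intros; apply Hf; lra.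
Qed.

Lemma CI_csum (u : nat -> R -> C) (n : nat) : (forall k, tame (u k)) ->
  tame (fun r => csum (fun k => u k r) n) /\ CI (fun r => csum (fun k => u k r) n) = csum (fun k => CI (u k)) n.
Proof.
  intros H. induction n as [|n [IH1 IH2]].
  - split.
    + eapply tame_ext; [|apply (H 0%nat)]. intro r; now rewrite csum_0.
    + rewrite csum_0. symmetry. apply CI_ext; [|apply H]. intros r _; now rewrite csum_0.
  - assert (T : tame (fun r => (csum (fun k => u k r) n + u (S n) r)%C)) by (apply tame_plus; auto).
    split.
    + eapply tame_ext; [|exact T]. intro r; now rewrite csum_S.
    + rewrite csum_S, <- IH2, <- CI_plus by auto. symmetry. apply CI_ext; [|exact T]. intros r _; now rewrite csum_S.
Qed.

(** * Analytic functions *)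

Definition analytic_at (g : C -> C) (z : C) : Prop :=
  exists (c : nat -> C) (rho : posreal), forall w : C, Cmod (w - z) < rho ->
    @is_pseries C_AbsRing C_NormedModule c (w - z)%C (g w).

Lemma pow_n_Cpow (z : C) (n : nat) : @pow_n C_AbsRing z n = (z ^ n)%C.
Proof. induction n; [reflexivity|]. change (z * @pow_n C_AbsRing z n = z * z ^ n)%C. now rewrite IHn. Qed.

Lemma is_cseq_is_pseries (c : nat -> C) (w l : C) :
  is_cseq (csum (fun j => (w ^ j * c j)%C)) l -> @is_pseries C_AbsRing C_NormedModule c w l.
Proof.
  intro H. apply is_cseq_is_series. eapply is_cseq_ext; [|exact H].
  intro n. apply csum_ext. intros k _. apply (f_equal (fun x => x * c k)%C). symmetry. apply pow_n_Cpow.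
Qed.

Lemma is_pseries_is_cseq (c : nat -> C) (w l : C) :
  @is_pseries C_AbsRing C_NormedModule c w l -> is_cseq (csum (fun j => (w ^ j * c j)%C)) l.
Proof.
  intro H. eapply is_cseq_ext; [|apply is_series_is_cseq, H].
  intro n. apply csum_ext. intros k _. apply (f_equal (fun x => x * c k)%C). apply pow_n_Cpow.
Qed.

Lemma analytic_at_ext_loc (g h : C -> C) (z : C) (r : R) : 0 < r ->
  (forall w, Cmod (w - z) < r -> g w = h w) -> analytic_at g z -> analytic_at h z.
Proof.
  intros Hr E [c [rho H]].
  exists c, (mkposreal _ (Rmin_stable_in_posreal rho (mkposreal r Hr))). intros w Hw. simpl in Hw.
  rewrite <- E by (eapply Rlt_le_trans; [exact Hw|apply Rmin_r]).
  apply H. eapply Rlt_le_trans; [exact Hw|apply Rmin_l].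
Qed.

Lemma analytic_at_plus (g h : C -> C) (z : C) :
  analytic_at g z -> analytic_at h z -> analytic_at (fun w => (g w + h w)%C) z.
Proof.
  intros [c [rho H]] [c' [rho' H']].
  exists (fun n => (c n + c' n)%C), (mkposreal _ (Rmin_stable_in_posreal rho rho')). intros w Hw. simpl in Hw.
  apply is_cseq_is_pseries.
  eapply is_cseq_ext; [|apply is_cseq_plus; apply is_pseries_is_cseq; [apply H|apply H']].
  - intro n. cbv beta. rewrite <- csum_plus. apply csum_ext. intros; ring.
  - eapply Rlt_le_trans; [exact Hw|apply Rmin_l].
  - eapply Rlt_le_trans; [exact Hw|apply Rmin_r].
Qed.

Lemma analytic_at_scal (a : C) (g : C -> C) (z : C) : analytic_at g z -> analytic_at (fun w => (a * g w)%C) z.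
Proof.
  intros [c [rho H]]. exists (fun n => (a * c n)%C), rho. intros w Hw.
  apply is_cseq_is_pseries.
  eapply is_cseq_ext; [|apply is_cseq_scal, is_pseries_is_cseq, H, Hw].
  intro n. cbv beta. rewrite <- csum_scal. apply csum_ext. intros; ring.
Qed.

Lemma is_lim_seq_half_pow (K : R) : is_lim_seq (fun n => (/ 2) ^ S n * K) 0.
Proof.
  replace (Finite 0) with (Rbar_mult 0 K) by (simpl; f_equal; ring).
  apply (is_lim_seq_scal_r (fun n => (/ 2) ^ S n)).
  apply (is_lim_seq_incr_1 (fun n => (/ 2) ^ n)). apply is_lim_seq_geom. rewrite Rabs_pos_eq; lra.
Qed.

(* The Taylor remainder of [exp v] is at most [2^-(n+1) exp (3|v|)], so expanding
   [exp ((w - z) M)] under the integral sign needs no convergence theorem. *)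
Lemma analytic_at_CI (M k : R -> C) (z : C) (K d : R) :
  (forall r, 0 <= r -> ccont M r) -> (forall r, 0 <= r -> ccont k r) -> 0 < d ->
  (forall r, 0 <= r -> Cmod (cexp (z * M r) * k r) * exp (3 * Cmod (M r)) <= K * exp (- d * r)) ->
  analytic_at (fun s => CI (fun r => (cexp (s * M r) * k r)%C)) z.
Proof.
  intros HM Hk Hd HK.
  set (h := fun r => (cexp (z * M r) * k r)%C).
  assert (Ch : forall r, 0 <= r -> ccont h r).
  { intros r Hr. apply ccont_mult; [apply ccont_cexp, ccont_mult; [apply ccont_const|]|]; auto. }
  assert (Bh : forall n w r, 0 <= r -> Cmod w <= 1 -> Cmod (exp_term (w * M r) n * h r) <= K * exp (- d * r)).
  { intros n w r Hr Hw. eapply Rle_trans; [|apply HK, Hr]. rewrite Cmod_mult, Rmult_comm.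
    apply Rmult_le_compat_l; [apply Cmod_ge_0|]. unfold exp_term.
    assert (P := Cmod_ge_0 (M r)).
    rewrite Cmod_mult, Cmod_pow, Cmod_R, Rabs_pos_eq by (left; apply Rinv_0_lt_compat, INR_fact_lt_0).
    eapply Rle_trans; [apply pow_fact_le_exp, Cmod_ge_0|]. apply exp_le_mono.
    rewrite Cmod_mult. pose proof (Cmod_ge_0 w). nra. }
  assert (Th : forall n w, Cmod w <= 1 -> tame (fun r => (exp_term (w * M r) n * h r)%C)).
  { intros n w Hw; split.
    - intros r Hr. apply ccont_mult; [|auto]. unfold exp_term. apply ccont_mult; [|apply ccont_const].
      apply ccont_pow, ccont_mult; [apply ccont_const|auto].
    - exists K, d. split; [assumption|]. intros; now apply Bh. }
  (* The coefficients are the integrals of [M^n / n!] against [h]. Radius [1] suffices: for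
     [|w - z| <= 1] the factor [exp (3 |M r|)] of the hypothesis pays for the Taylor remainder of
     [exp ((w - z) M)]. *)
  exists (fun n => CI (fun r => (exp_term (M r) n * h r)%C)), (mkposreal 1 Rlt_0_1). simpl. intros w Hw.
  apply is_cseq_is_pseries.
  assert (Hw1 : Cmod (w - z) <= 1) by lra.
  assert (Tg : tame (fun r => (cexp (w * M r) * k r)%C)).
  { split.
    - intros r Hr. apply ccont_mult; [apply ccont_cexp, ccont_mult; [apply ccont_const|]|]; auto.
    - exists K, d. split; [assumption|]. intros r Hr. eapply Rle_trans; [|apply HK, Hr].
      replace (w * M r)%C with ((w - z) * M r + z * M r)%C by ring. rewrite cexp_plus, <- Cmult_assoc, Cmod_mult, Rmult_comm.
      apply Rmult_le_compat_l; [apply Cmod_ge_0|]. rewrite Cmod_cexp. apply exp_le_mono.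
      eapply Rle_trans; [apply Rle_abs|]. eapply Rle_trans; [apply re_le_Cmod|]. rewrite Cmod_mult.
      pose proof (Cmod_ge_0 (M r)). pose proof (Cmod_ge_0 (w - z)). nra. }
  apply is_cseq_le with (fun n => (/ 2) ^ S n * (K / d)); [|apply is_lim_seq_half_pow].
  intro n. destruct (CI_csum (fun j r => (exp_term ((w - z) * M r) j * h r)%C) n) as [T1 T2]; [intro; now apply Th|].
  assert (E : csum (fun j => ((w - z) ^ j * CI (fun r => (exp_term (M r) j * h r)%C))%C) n
    = CI (fun r => csum (fun j => (exp_term ((w - z) * M r) j * h r)%C) n)).
  { rewrite T2. apply csum_ext. intros j _. rewrite <- CI_scal.
    - apply CI_ext.
      + intros r _. unfold exp_term. rewrite Cpow_mult_l. ring.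
      + apply tame_scal. eapply tame_ext; [|apply (Th j 1); rewrite Cmod_1; lra]. intro r; cbv beta; now rewrite Cmult_1_l.
    - eapply tame_ext; [|apply (Th j 1); rewrite Cmod_1; lra]. intro r; cbv beta; now rewrite Cmult_1_l. }
  rewrite E, Cmod_minus_sym.
  assert (D : (CI (fun r => (cexp (w * M r) * k r)%C) - CI (fun r => csum (fun j => (exp_term ((w - z) * M r) j * h r)%C) n)
     = CI (fun r => (exp_rem n ((w - z) * M r) * h r)%C))%C).
  { transitivity (CI (fun r => (cexp (w * M r) * k r)%C) + (- (1)) * CI (fun r => csum (fun j => (exp_term ((w - z) * M r) j * h r)%C) n))%C; [ring|].
    rewrite <- CI_scal by exact T1. rewrite <- CI_plus; [|exact Tg|apply tame_scal, T1].
    apply CI_ext; [|apply tame_plus; [exact Tg|apply tame_scal, T1]]. intros r _. cbv beta.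
    unfold exp_rem. rewrite (csum_ext _ (fun j => (h r * exp_term ((w - z) * M r) j)%C)) by (intros; ring).
    rewrite csum_scal. unfold h.
    replace (w * M r)%C with ((w - z) * M r + z * M r)%C by ring. rewrite cexp_plus. ring. }
  rewrite D. unfold Rdiv; rewrite <- Rmult_assoc. apply CI_bound; [|assumption|].
  - intros r Hr. apply ccont_mult; [|auto]. unfold exp_rem. apply ccont_minus.
    + apply ccont_cexp, ccont_mult; [apply ccont_const|auto].
    + apply (ccont_csum (fun j r => exp_term ((w - z) * M r) j)). intro j.
      unfold exp_term. apply ccont_mult; [|apply ccont_const]. apply ccont_pow, ccont_mult; [apply ccont_const|auto].
  - intros r Hr. rewrite Cmod_mult, Rmult_assoc. eapply Rle_trans.
    + apply Rmult_le_compat_r; [apply Cmod_ge_0|apply exp_rem_geom].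
    + rewrite Rmult_assoc. apply Rmult_le_compat_l; [apply pow_le; lra|].
      eapply Rle_trans; [|apply HK, Hr]. rewrite Rmult_comm. apply Rmult_le_compat_l; [apply Cmod_ge_0|].
      apply exp_le_mono. rewrite Cmod_mult. pose proof (Cmod_ge_0 (M r)). pose proof (Cmod_ge_0 (w - z)). nra.
Qed.

(** * Series of complex terms and sums of simple poles *)

Definition CSer (u : nat -> C) : C := (Series (fun n => Re (u n)), Series (fun n => Im (u n))).

Lemma CSer_lim (u : nat -> C) (b : nat -> R) : (forall n, Cmod (u n) <= b n) -> ex_series b ->
  is_cseq (csum u) (CSer u).
Proof.
  intros H E.
  assert (E1 : ex_series (fun n => Re (u n))).
  { apply (ex_series_le (V := R_CompleteNormedModule)) with b; [|exact E].
    intro n. eapply Rle_trans; [apply (re_le_Cmod (u n))|apply H]. }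
  assert (E2 : ex_series (fun n => Im (u n))).
  { apply (ex_series_le (V := R_CompleteNormedModule)) with b; [|exact E].
    intro n. eapply Rle_trans; [apply (im_le_Cmod (u n))|apply H]. }
  apply is_cseq_re_im.
  - apply is_lim_seq_ext with (sum_n (fun n => Re (u n))); [intro; symmetry; apply csum_re|]. apply (Series_correct _ E1).
  - apply is_lim_seq_ext with (sum_n (fun n => Im (u n))); [intro; symmetry; apply csum_im|]. apply (Series_correct _ E2).
Qed.

Lemma CSer_unique (u : nat -> C) (l : C) : is_cseq (csum u) l -> CSer u = l.
Proof.
  intro H. unfold CSer. rewrite (surjective_pairing l). f_equal; apply is_series_unique.
  - change (is_lim_seq (sum_n (fun n => Re (u n))) (Re l)). apply is_cseq_re in H.
    eapply is_lim_seq_ext; [|exact H]. intro; apply csum_re.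
  - change (is_lim_seq (sum_n (fun n => Im (u n))) (Im l)). apply is_cseq_im in H.
    eapply is_lim_seq_ext; [|exact H]. intro; apply csum_im.
Qed.

Lemma Cmod_csum_le (u : nat -> C) (b : nat -> R) (n : nat) : (forall k, Cmod (u k) <= b k) -> Cmod (csum u n) <= sum_n b n.
Proof.
  intro H. induction n; [rewrite csum_0, sum_O; apply H|rewrite csum_S, sum_n_S].
  eapply Rle_trans; [apply Cmod_triangle|]. apply Rplus_le_compat; [exact IHn|apply H].
Qed.

Lemma CSer_bound (u : nat -> C) (b : nat -> R) : (forall n, Cmod (u n) <= b n) -> ex_series b ->
  Cmod (CSer u) <= Series b.
Proof.
  intros H E. pose proof (CSer_lim u b H E) as L.
  destruct (Rle_dec (Cmod (CSer u)) (Series b)) as [Y|NY]; [exact Y|exfalso].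
  destruct (L (Cmod (CSer u) - Series b) ltac:(lra)) as [N HN]. specialize (HN N (Nat.le_refl _)).
  rewrite Cmod_minus_sym in HN.
  assert (S : sum_n b N <= Series b).
  { apply (is_lim_seq_incr_compare (sum_n b) _ (Series_correct _ E)). intro k. rewrite sum_n_S.
    apply Rle_plus_r. eapply Rle_trans; [apply Cmod_ge_0|apply H]. }
  pose proof (Cmod_csum_le u b N H).
  pose proof (Cmod_triangle (CSer u - csum u N) (csum u N)) as T.
  replace (CSer u - csum u N + csum u N)%C with (CSer u) in T by ring. lra.
Qed.

Lemma CSer_plus (u v : nat -> C) (b b' : nat -> R) :
  (forall n, Cmod (u n) <= b n) -> ex_series b -> (forall n, Cmod (v n) <= b' n) -> ex_series b' ->
  CSer (fun n => (u n + v n)%C) = (CSer u + CSer v)%C.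
Proof.
  intros. apply CSer_unique. eapply is_cseq_ext; [intro; symmetry; apply csum_plus|].
  apply is_cseq_plus; eapply CSer_lim; eassumption.
Qed.

Lemma CSer_scal (c : C) (u : nat -> C) (b : nat -> R) :
  (forall n, Cmod (u n) <= b n) -> ex_series b -> CSer (fun n => (c * u n)%C) = (c * CSer u)%C.
Proof.
  intros. apply CSer_unique. eapply is_cseq_ext; [intro; symmetry; apply csum_scal|].
  apply is_cseq_scal; eapply CSer_lim; eassumption.
Qed.

Lemma CSer_ext (u v : nat -> C) : (forall n, u n = v n) -> CSer u = CSer v.
Proof. intro H. unfold CSer. f_equal; apply Series_ext; intro n; now rewrite H. Qed.

Lemma geom_rem (a t : C) (n : nat) : a <> 0 -> (a - t)%C <> 0 ->
  (/ (a - t) - csum (fun j => t ^ j * / a ^ S j) n = (t / a) ^ S n * / (a - t))%C.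
Proof.
  intros Ha Hat. induction n as [|n IH].
  - rewrite csum_0. simpl. field. split; assumption.
  - rewrite csum_S. replace (/ (a - t) - (csum (fun j : nat => t ^ j * / a ^ S j) n + t ^ S n * / a ^ S (S n)))%C
      with ((/ (a - t) - csum (fun j : nat => t ^ j * / a ^ S j) n) - t ^ S n * / a ^ S (S n))%C by ring.
    rewrite IH. unfold Cdiv. rewrite !Cpow_mult_l. rewrite !Cpow_inv by assumption.
    rewrite !Cpow_S. field. repeat split; try assumption. now apply Cpow_nz.
Qed.

(* Only the poles with nonzero residue have to stay away from [z]. *)
Lemma analytic_at_poles (d p : nat -> C) (z : C) (c : R) : 0 < c ->
  ex_series (fun n => Cmod (d n)) -> (forall n, d n = 0 \/ c <= Cmod (z - p n)) ->
  analytic_at (fun s => CSer (fun n => (d n / (s - p n))%C)) z.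
Proof.
  intros Hc Ed Hp.
  set (q := fun n => (p n - z)%C).
  assert (Q : forall n, d n = 0 \/ (q n <> 0 /\ c <= Cmod (q n))).
  { intro n. destruct (Hp n) as [H|H]; [now left|right]. rewrite Cmod_minus_sym in H. split; [|exact H].
    apply Cmod_gt_0. unfold q in *; lra. }
  (* On the disc of radius [c / 2] every ratio [t / q n] with nonzero residue has modulus at most
     [1/2], so [d / (s - p) = - d / (q - t)] expands in a geometric series uniformly in [n]. *)
  assert (Hc2 : 0 < c / 2) by lra.
  exists (fun j => CSer (fun n => (- d n * / q n ^ S j)%C)), (mkposreal _ Hc2). intros w Hw. simpl in Hw.
  set (t := (w - z)%C) in *.
  assert (Bt : forall j n, Cmod (t ^ j * (- d n * / q n ^ S j)) <= / c * Cmod (d n)).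
  { intros j n. destruct (Q n) as [H|[H1 H2]].
    - rewrite H. replace (t ^ j * (- 0 * / q n ^ S j))%C with (RtoC 0) by ring. rewrite Cmod_0; lra.
    - rewrite !Cmod_mult, Cmod_opp, Cmod_inv, !Cmod_pow by (now apply Cpow_nz).
      assert (0 < / Cmod (q n) <= / c). { split; [apply Rinv_0_lt_compat; lra|apply Rinv_le_contravar; lra]. }
      rewrite <- (pow_inv (Cmod (q n))). simpl.
      replace (Cmod t ^ j * (Cmod (d n) * (/ Cmod (q n) * (/ Cmod (q n)) ^ j))) with
        ((Cmod t * / Cmod (q n)) ^ j * (/ Cmod (q n) * Cmod (d n))) by (rewrite Rpow_mult_distr; ring).
      pose proof (Cmod_ge_0 (d n)). pose proof (Cmod_ge_0 t).
      rewrite <- (Rmult_1_l (/ c * Cmod (d n))). apply Rmult_le_compat.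
      + apply pow_le. nra. + nra.
      + rewrite <- (pow1 j). apply pow_incr. split; [nra|].
        apply Rmult_le_reg_r with (Cmod (q n)); [lra|]. rewrite Rmult_assoc, Rinv_l by lra. lra.
      + nra. }
  assert (Ec : forall k, ex_series (fun n => k * Cmod (d n))).
  { intro k. apply (ex_series_scal_l (K := R_AbsRing) k (fun n => Cmod (d n))). exact Ed. }
  assert (Bw : forall n, Cmod (d n / (w - p n)) <= 2 / c * Cmod (d n)).
  { intro n. destruct (Q n) as [H|[H1 H2]].
    - rewrite H. unfold Cdiv. rewrite Cmult_0_l, Cmod_0; lra.
    - assert (H3 : c / 2 <= Cmod (w - p n)).
      { pose proof (Cmod_triangle (w - p n) (- t)) as T. rewrite Cmod_opp in T.
        replace (w - p n + - t)%C with (- q n)%C in T by (unfold q, t; ring). rewrite Cmod_opp in T. lra. }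
      assert (H4 : (w - p n)%C <> 0) by (apply Cmod_gt_0; lra).
      rewrite Cmod_div by exact H4. unfold Rdiv. rewrite Rmult_comm. apply Rmult_le_compat_r; [apply Cmod_ge_0|].
      replace (2 * / c) with (/ (c / 2)) by (field; lra). apply Rinv_le_contravar; lra. }
  apply is_cseq_is_pseries.
  apply is_cseq_le with (fun n => (/ 2) ^ S n * (2 / c * Series (fun n => Cmod (d n)))); [|apply is_lim_seq_half_pow].
  intro m.
  (* A finite sum is exchanged with [CSer] by induction on [m]; the bound carried along provides the
     summability used at the next step. *)
  assert (Hs : csum (fun j => (t ^ j * CSer (fun n => - d n * / q n ^ S j))%C) m
     = CSer (fun n => csum (fun j => t ^ j * (- d n * / q n ^ S j))%C m) /\
     forall n, Cmod (csum (fun j => t ^ j * (- d n * / q n ^ S j))%C m) <= INR (S m) * (/ c) * Cmod (d n)).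
  { assert (Bq : forall j, exists B, forall n, Cmod (- d n * / q n ^ S j) <= B * Cmod (d n)).
    { intro j. exists (/ c ^ S j). intro n. destruct (Q n) as [H|[H1 H2]].
      - rewrite H. replace (- 0 * / q n ^ S j)%C with (RtoC 0) by ring. rewrite Cmod_0; lra.
      - rewrite Cmod_mult, Cmod_opp, Cmod_inv, Cmod_pow by (now apply Cpow_nz). rewrite Rmult_comm.
        apply Rmult_le_compat_r; [apply Cmod_ge_0|]. apply Rinv_le_contravar; [now apply pow_lt|].
        apply pow_incr; lra. }
    assert (Hj : forall j, (t ^ j * CSer (fun n => - d n * / q n ^ S j) = CSer (fun n => t ^ j * (- d n * / q n ^ S j)))%C).
    { intro j. destruct (Bq j) as [B HB]. symmetry. eapply CSer_scal; [exact HB|apply Ec]. }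
    induction m as [|m [IH1 IH2]].
    - split.
      + rewrite csum_0, Hj. apply CSer_ext. intro n. now rewrite csum_0.
      + intro n. rewrite csum_0. simpl INR. rewrite Rmult_1_l. apply Bt.
    - split.
      + rewrite csum_S, IH1, Hj. erewrite <- CSer_plus; [|exact IH2|apply Ec|apply (Bt (S m))|apply Ec].
        apply CSer_ext. intro n. now rewrite csum_S.
      + intro n. rewrite csum_S. eapply Rle_trans; [apply Cmod_triangle|].
        rewrite (S_INR (S m)). pose proof (IH2 n). pose proof (Bt (S m) n). lra. }
  destruct Hs as [Hs Hb]. rewrite Hs, Cmod_minus_sym.
  replace (CSer (fun n : nat => d n / (w - p n)) - CSer (fun n : nat => csum (fun j : nat => t ^ j * (- d n * / q n ^ S j)) m))%C
   with (CSer (fun n : nat => d n / (w - p n)) + (- (1)) * CSer (fun n : nat => csum (fun j : nat => t ^ j * (- d n * / q n ^ S j)) m))%C by ring.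
  erewrite <- CSer_scal; [|exact Hb|apply Ec].
  erewrite <- CSer_plus; [|exact Bw|apply Ec| |apply Ec].
  2: { intro n. rewrite Cmod_mult, Cmod_opp, Cmod_1, Rmult_1_l. apply Hb. }
  eapply Rle_trans; [apply CSer_bound with (b := fun n => ((/ 2) ^ S m * (2 / c)) * Cmod (d n)); [|apply Ec]|].
  - intro n. destruct (Q n) as [H|[H1 H2]].
    + replace (Cmod (d n)) with 0 by (rewrite H; now rewrite Cmod_0). rewrite Rmult_0_r.
      apply Req_le. transitivity (Cmod 0); [f_equal|apply Cmod_0]. rewrite H. rewrite (csum_ext _ (fun j => 0 * (t ^ j * / q n ^ S j))%C) by (intros; ring).
      rewrite csum_scal. unfold Cdiv; ring.
    + assert (H4 : (q n - t)%C <> 0).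
      { apply Cmod_gt_0. pose proof (Cmod_triangle (q n - t) t) as T. replace (q n - t + t)%C with (q n) in T by ring. lra. }
      assert (E1 : (d n / (w - p n) = - d n * / (q n - t))%C).
      { assert (E0 : (q n - t)%C = (- (w - p n))%C) by (unfold q, t; ring).
        rewrite E0 in *. field. intro E3. apply H4. rewrite E3; ring. }
      assert (E2 : (d n / (w - p n) + (- (1)) * csum (fun j => t ^ j * (- d n * / q n ^ S j)) m = - d n * ((t / q n) ^ S m * / (q n - t)))%C).
      { rewrite <- geom_rem by assumption. rewrite E1.
        rewrite (csum_ext _ (fun j => - d n * (t ^ j * / q n ^ S j))%C) by (intros; ring). rewrite csum_scal. ring. }
      rewrite E2. replace (- d n * ((t / q n) ^ S m * / (q n - t)))%C with ((t / q n) ^ S m * (- d n * / (q n - t)))%C by ring.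
      rewrite <- E1, Cmod_mult, Cmod_pow. rewrite Rmult_assoc. apply Rmult_le_compat.
      * apply pow_le, Cmod_ge_0. * apply Cmod_ge_0.
      * apply pow_incr. split; [apply Cmod_ge_0|]. rewrite Cmod_div by assumption. unfold Rdiv.
        apply Rmult_le_reg_r with (Cmod (q n)); [lra|]. rewrite Rmult_assoc, Rinv_l by lra. lra.
      * apply Bw.
  - rewrite Series_scal_l. right; ring.
Qed.

(** * Tails of power series and the identity theorem *)

Lemma is_cseq_terms_bounded (u : nat -> C) (l : C) : is_cseq (csum u) l -> exists B, forall n, Cmod (u n) <= B.
Proof.
  intro H. destruct (H 1 Rlt_0_1) as [N HN].
  exists (2 + sum_n (fun k => Cmod (u k)) N). intro n.
  assert (P : forall m, 0 <= sum_n (fun k => Cmod (u k)) m) by (intro; apply sum_n_ge_0; intro; apply Cmod_ge_0).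
  destruct (Nat.le_gt_cases n N) as [L|L].
  - assert (Q : forall m, (n <= m)%nat -> Cmod (u n) <= sum_n (fun k => Cmod (u k)) m).
    { intros m Hm. destruct Hm as [|m Hm].
      - destruct n; [rewrite sum_O; lra|rewrite sum_n_S]. pose proof (P n). lra.
      - rewrite sum_n_S. pose proof (Cmod_ge_0 (u (S m))). clear HN L. induction Hm as [|m Hm IH].
        + destruct n; [rewrite sum_O; lra|rewrite sum_n_S]. pose proof (P n). lra.
        + rewrite sum_n_S. pose proof (Cmod_ge_0 (u (S m))). specialize (IH ltac:(lra)). lra. }
    pose proof (Q N L). lra.
  - destruct n as [|n]; [lia|]. pose proof (HN n ltac:(lia)) as H1. pose proof (HN (S n) ltac:(lia)) as H2.
    rewrite csum_S in H2. rewrite Cmod_minus_sym in H1.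
    pose proof (Cmod_triangle (csum u n + u (S n) - l) (l - csum u n)) as T.
    replace (csum u n + u (S n) - l + (l - csum u n))%C with (u (S n)) in T by ring. pose proof (P N). lra.
Qed.

(** Convergence at the single point [R0 = rho / 2] bounds [|c n| R0^n], and for [|w| <= R0 / 2] the
    tail is geometric. This quantitative form yields isolation of zeros, differentiability, and the
    small-[x] estimate of the incomplete gamma series. *)
Lemma pseries_tail (c : nat -> C) (h : C -> C) (rho : R) : 0 < rho ->
  (forall w, Cmod w < rho -> is_cseq (csum (fun n => (w ^ n * c n)%C)) (h w)) ->
  exists B R0, 0 <= B /\ 0 < R0 < rho /\ forall m w, 2 * Cmod w <= R0 ->
    Cmod (h w - csum (fun n => (w ^ n * c n)%C) m) <= B * (Cmod w / R0) ^ S m.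
Proof.
  intros Hr H. set (R0 := rho / 2).
  assert (PR : 0 < R0) by (unfold R0; lra).
  assert (MR : Cmod (RtoC R0) = R0) by (rewrite Cmod_R, Rabs_pos_eq; lra).
  destruct (is_cseq_terms_bounded _ _ (H (RtoC R0) ltac:(rewrite MR; unfold R0; lra))) as [B HB].
  assert (HB' : forall n, R0 ^ n * Cmod (c n) <= B).
  { intro n. specialize (HB n). rewrite Cmod_mult, Cmod_pow, MR in HB. exact HB. }
  assert (PB : 0 <= B). { specialize (HB' 0%nat). pose proof (Cmod_ge_0 (c 0%nat)). simpl in HB'. lra. }
  exists (2 * B), R0. split; [lra|]. split; [unfold R0 in *; lra|]. intros m w Hw2.
  assert (Hw : Cmod w < rho) by (pose proof (Cmod_ge_0 w); unfold R0 in *; lra).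
  set (x := Cmod w / R0).
  assert (Hx : 0 <= x <= / 2).
  { unfold x. split; [apply Rdiv_le_0_compat; [apply Cmod_ge_0|lra]|]. apply Rmult_le_reg_r with R0; [lra|].
    unfold Rdiv. rewrite Rmult_assoc, Rinv_l by lra. lra. }
  assert (T : forall n, Cmod (w ^ n * c n) <= B * x ^ n).
  { intro n. rewrite Cmod_mult, Cmod_pow. replace (Cmod w) with (x * R0) by (unfold x; field; lra).
    rewrite Rpow_mult_distr, Rmult_assoc, Rmult_comm. apply Rmult_le_compat_r; [apply pow_le; lra|apply HB']. }
  set (u := fun n => (w ^ n * c n)%C) in *.
  (* The bound is written as a difference so that the induction closes:
     [B x^k <= 2 B (x^k - x^(k+1))] when [x <= 1/2]. *)
  assert (K : forall N, Cmod (csum u (m + N) - csum u m) <= 2 * B * (x ^ S m - x ^ S (m + N))).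
  { intro N. induction N as [|N IHN].
    - rewrite Nat.add_0_r. apply Req_le. rewrite Rminus_diag, Rmult_0_r.
      replace (csum u m - csum u m)%C with (RtoC 0) by ring. apply Cmod_0.
    - rewrite Nat.add_succ_r, csum_S.
      replace (csum u (m + N) + u (S (m + N)) - csum u m)%C
        with (csum u (m + N) - csum u m + u (S (m + N)))%C by ring.
      eapply Rle_trans; [apply Cmod_triangle|]. pose proof (T (S (m + N))).
      assert (0 <= x ^ S (m + N)) by (apply pow_le; lra).
      assert (E : x ^ S (S (m + N)) = x * x ^ S (m + N)) by reflexivity. rewrite E.
      assert (0 <= B * x ^ S (m + N)) by (apply Rmult_le_pos; assumption).
      assert (x * (B * x ^ S (m + N)) <= / 2 * (B * x ^ S (m + N))) by (apply Rmult_le_compat_r; lra).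
      unfold u in *. lra. }
  apply Rnot_lt_le. intro Hlt.
  destruct (H w Hw (Cmod (h w - csum u m) - 2 * B * x ^ S m) ltac:(lra)) as [N HN].
  specialize (HN (m + N)%nat ltac:(lia)). specialize (K N). fold u in HN.
  pose proof (Cmod_triangle (h w - csum u (m + N)) (csum u (m + N) - csum u m)) as T'.
  rewrite Cmod_minus_sym in HN.
  replace (h w - csum u (m + N) + (csum u (m + N) - csum u m))%C with (h w - csum u m)%C in T' by ring.
  assert (0 <= 2 * B * x ^ S (m + N)) by (apply Rmult_le_pos; [lra|apply pow_le; lra]). lra.
Qed.

(** Strong induction on the index: if all earlier coefficients vanish, the tail estimate at a zero
    [w] gives [|c m| <= Q |w|] with [Q] fixed, and the zeros come arbitrarily close to [0]. *)
Lemma pseries_isolated_zero (c : nat -> C) (h : C -> C) (rho : R) : 0 < rho ->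
  (forall w, Cmod w < rho -> is_cseq (csum (fun n => (w ^ n * c n)%C)) (h w)) ->
  (forall eps, 0 < eps -> exists w, 0 < Cmod w < eps /\ h w = 0) ->
  forall n, c n = 0.
Proof.
  intros Hr H Z. destruct (pseries_tail c h rho Hr H) as [B [R0 [PB [[PR _] K]]]].
  intro n. induction n as [m IH] using (well_founded_induction Wf_nat.lt_wf).
  assert (F : forall w, 0 < Cmod w -> 2 * Cmod w <= R0 -> h w = 0 -> Cmod (c m) <= B / R0 ^ S m * Cmod w).
  { intros w Pw Hw Hz. specialize (K m w Hw).
    assert (E : csum (fun n => (w ^ n * c n)%C) m = (w ^ m * c m)%C).
    { destruct m as [|m]; [apply csum_0|]. rewrite csum_S, (csum_ext _ (fun n => 0 * w ^ n)%C).
      - rewrite csum_scal; ring.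
      - intros k Hk. rewrite IH by lia. ring. }
    rewrite E, Hz, Cmod_minus_sym in K. replace (w ^ m * c m - 0)%C with (w ^ m * c m)%C in K by ring.
    rewrite Cmod_mult, Cmod_pow in K.
    apply Rmult_le_reg_l with (Cmod w ^ m); [now apply pow_lt|]. eapply Rle_trans; [exact K|].
    apply Req_le. unfold Rdiv. rewrite Rpow_mult_distr, pow_inv. simpl. field. split; [apply pow_nonzero|]; lra. }
  apply Cmod_eq_0. apply Rle_antisym; [|apply Cmod_ge_0].
  apply Rnot_lt_le. intro Pc.
  set (Q := B / R0 ^ S m) in *.
  assert (PQ : 0 <= Q) by (unfold Q; apply Rdiv_le_0_compat; [lra|now apply pow_lt]).
  destruct (Z (Rmin (R0 / 2) (Cmod (c m) / (Q + 1)))) as [w [[W1 W2] W3]].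
  { apply Rmin_glb_lt; [lra|]. apply Rdiv_lt_0_compat; lra. }
  pose proof (Rmin_l (R0 / 2) (Cmod (c m) / (Q + 1))). pose proof (Rmin_r (R0 / 2) (Cmod (c m) / (Q + 1))).
  pose proof (F w W1 ltac:(lra) W3) as Fw.
  assert (W4 : (Q + 1) * Cmod w < Cmod (c m)).
  { apply Rlt_le_trans with ((Q + 1) * (Cmod (c m) / (Q + 1))); [apply Rmult_lt_compat_l; lra|].
    apply Req_le; field; lra. }
  nra.
Qed.

(** The derivative is the coefficient of degree one, because the tail beyond it is quadratic in the
    increment. *)
Lemma analytic_at_cderive (g : C -> C) (x : R) : analytic_at g (RtoC x) ->
  exists l, is_cderive (fun t => g (RtoC t)) x l.
Proof.
  intros [c [rho H]].
  destruct (pseries_tail c (fun w => g (RtoC x + w)%C) rho (cond_pos rho)) as [B [R0 [PB [[PR _] K]]]].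
  { intros w Hw. replace w with (RtoC x + w - RtoC x)%C in Hw by ring.
    pose proof (is_pseries_is_cseq _ _ _ (H _ Hw)) as L.
    replace (RtoC x + w - RtoC x)%C with w in L by ring. exact L. }
  exists (c 1%nat).
  assert (E0 : g (RtoC x) = c 0%nat).
  { specialize (K 0%nat 0). rewrite Cmod_0, csum_0 in K. unfold Rdiv in K. rewrite Rmult_0_l, pow_i in K by lia.
    replace (RtoC x + 0)%C with (RtoC x) in K by ring. specialize (K ltac:(lra)).
    rewrite Rmult_0_r in K.
    assert (E : (g (RtoC x) - 0 ^ 0 * c 0%nat)%C = 0) by (apply Cmod_eq_0; apply Rle_antisym; [exact K|apply Cmod_ge_0]).
    replace (g (RtoC x)) with (g (RtoC x) - 0 ^ 0 * c 0%nat + c 0%nat)%C by ring. rewrite E; ring. }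
  assert (Q : forall h, 2 * Rabs h <= R0 -> Cmod (g (RtoC (x + h)) - g (RtoC x) - RtoC h * c 1%nat) <= B / R0 ^ 2 * h ^ 2).
  { intros h Hh. specialize (K 1%nat (RtoC h)). rewrite Cmod_R in K. specialize (K Hh).
    rewrite csum_S, csum_0 in K. rewrite E0, RtoC_plus.
    replace (g (RtoC x + RtoC h) - c 0%nat - RtoC h * c 1%nat)%C with (g (RtoC x + RtoC h) - (RtoC h ^ 0 * c 0%nat + RtoC h ^ 1 * c 1%nat))%C by ring.
    eapply Rle_trans; [exact K|]. apply Req_le. unfold Rdiv. rewrite Rpow_mult_distr, pow2_abs, pow_inv. ring. }
  (* [p] stands for [Re] or [Im]; the argument rests on real linearity and [|p z| <= |z|]. *)
  assert (D : forall p : C -> R, (forall z, Rabs (p z) <= Cmod z) -> (forall z w, p (z - w)%C = p z - p w) ->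
     (forall (h : R) z, p (RtoC h * z)%C = h * p z) -> is_derive (fun t => p (g (RtoC t))) x (p (c 1%nat))).
  { intros p P1 P2 P3. apply is_derive_Reals. intros eps He. set (A := B / R0 ^ 2) in *.
    assert (PA : 0 <= A) by (unfold A; apply Rdiv_le_0_compat; [lra|now apply pow_lt]).
    assert (Pd : 0 < Rmin (R0 / 2) (eps / (A + 1))) by (apply Rmin_glb_lt; [lra|apply Rdiv_lt_0_compat; lra]).
    exists (mkposreal _ Pd). intros h Nh Hh. simpl in Hh.
    pose proof (Rmin_l (R0 / 2) (eps / (A + 1))). pose proof (Rmin_r (R0 / 2) (eps / (A + 1))).
    specialize (Q h ltac:(lra)). eapply Rle_trans in Q; [|apply P1].
    rewrite !P2, P3 in Q.
    replace ((p (g (RtoC (x + h))) - p (g (RtoC x))) / h - p (c 1%nat)) with ((p (g (RtoC (x + h))) - p (g (RtoC x)) - h * p (c 1%nat)) / h) by (field; exact Nh).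
    assert (Ph : 0 < Rabs h) by (now apply Rabs_pos_lt).
    unfold Rdiv. rewrite Rabs_mult, Rabs_inv. apply Rmult_lt_reg_r with (Rabs h); [exact Ph|].
    rewrite Rmult_assoc, Rinv_l, Rmult_1_r by lra. eapply Rle_lt_trans; [exact Q|].
    rewrite <- pow2_abs. simpl. rewrite Rmult_1_r, <- Rmult_assoc. apply Rmult_lt_compat_r; [exact Ph|].
    apply Rlt_le_trans with ((A + 1) * (eps / (A + 1))); [|right; field; lra]. nra. }
  split.
  - apply (D Re); [apply re_le_Cmod|reflexivity|]. intros h z. unfold Re, Cmult, RtoC; simpl; ring.
  - apply (D Im); [apply im_le_Cmod|reflexivity|]. intros h z. unfold Im, Cmult, RtoC; simpl; ring.
Qed.

(** [C_lim] lets only the real part of the variable move, so at a real point [C_derive] sees the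
    restriction to the real axis alone. *)
Lemma C_derive_real (g : C -> C) (x : R) (l : C) : is_cderive (fun t => g (RtoC t)) x l -> C_derive g (RtoC x) = l.
Proof.
  intros [D1 D2]. unfold C_derive, C_lim. rewrite (surjective_pairing l).
  assert (E : forall t, t <> x -> ((g (t, snd (RtoC x)) - g (RtoC x)) / ((t, snd (RtoC x)) - RtoC x))%C
    = (RtoC (/ (t - x)) * (g (RtoC t) - g (RtoC x)))%C).
  { intros t Ht. change (t, snd (RtoC x)) with (RtoC t). rewrite <- RtoC_minus. unfold Cdiv.
    rewrite <- RtoC_inv by lra. ring. }
  assert (L : forall p : R -> R, forall m, is_derive p x m -> is_lim (fun t => / (t - x) * (p t - p x)) x m).
  { intros p m Dp. apply is_derive_Reals in Dp. apply is_lim_spec. intros eps.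
    destruct (Dp eps (cond_pos eps)) as [d Hd]. exists d. intros y Hy Ny. change R in y.
    assert (N : y - x <> 0) by (intro; apply Ny; lra). specialize (Hd (y - x) N). replace (x + (y - x)) with y in Hd by ring.
    rewrite Rmult_comm. apply Hd. exact Hy. }
  f_equal.
  - refine (f_equal real (is_lim_unique _ _ (Finite (fst l)) _)). eapply is_lim_ext_loc; [|apply (L _ _ D1)].
    exists (mkposreal 1 Rlt_0_1). intros y _ Ny. rewrite E by exact Ny. unfold Re, Cmult, RtoC; simpl.
    change (@eq R (/ (y - x) * (fst (g (y, 0)) - fst (g (x, 0)))) (/ (y - x) * (fst (g (y, 0)) + - fst (g (x, 0))) - 0 * (snd (g (y, 0)) + - snd (g (x, 0))))). ring.
  - refine (f_equal real (is_lim_unique _ _ (Finite (snd l)) _)). eapply is_lim_ext_loc; [|apply (L _ _ D2)].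
    exists (mkposreal 1 Rlt_0_1). intros y _ Ny. rewrite E by exact Ny. unfold Im, Cmult, RtoC; simpl.
    change (@eq R (/ (y - x) * (snd (g (y, 0)) - snd (g (x, 0)))) (/ (y - x) * (snd (g (y, 0)) + - snd (g (x, 0))) + 0 * (fst (g (y, 0)) + - fst (g (x, 0))))). ring.
Qed.

Lemma analytic_at_eq_near (g h : C -> C) (z : C) : analytic_at g z -> analytic_at h z ->
  (forall eps, 0 < eps -> exists w, 0 < Cmod (w - z) < eps /\ g w = h w) ->
  exists r, 0 < r /\ forall w, Cmod (w - z) < r -> g w = h w.
Proof.
  intros Ag Ah Z.
  destruct (analytic_at_plus _ _ _ Ag (analytic_at_scal (- (1)) _ _ Ah)) as [c [rho Hc]].
  exists rho. split; [apply cond_pos|].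
  assert (E : forall n, c n = 0).
  { apply (pseries_isolated_zero c (fun w => (g (w + z) + - (1) * h (w + z))%C) rho (cond_pos rho)).
    - intros w Hw. replace w with (w + z - z)%C in Hw at 1 by ring.
      pose proof (is_pseries_is_cseq _ _ _ (Hc _ Hw)) as L.
      replace (w + z - z)%C with w in L by ring. exact L.
    - intros eps He. destruct (Z eps He) as [w [Hw Ew]]. exists (w - z)%C. split; [exact Hw|].
      replace (w - z + z)%C with w by ring. rewrite Ew; ring. }
  intros w Hw. pose proof (is_pseries_is_cseq _ _ _ (Hc _ Hw)) as L.
  assert (L0 : is_cseq (csum (fun j => ((w - z) ^ j * c j)%C)) 0).
  { eapply is_cseq_ext; [|apply is_cseq_const]. intro n. cbv beta.
    rewrite (csum_ext _ (fun j => 0 * (w - z) ^ j)%C) by (intros; rewrite E; ring). rewrite csum_scal; ring. }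
  pose proof (is_cseq_unique _ _ _ L L0) as U.
  replace (g w) with ((g w + - (1) * h w) + h w)%C by ring. rewrite U; ring.
Qed.

(** At the supremum [T] of the parameters up to which [g] and [h] agree, the points of agreement
    accumulate, so the two functions agree on a whole disc around [s T]. This pushes [T] to the end
    of the segment. *)
Lemma identity_on_segment (g h : C -> C) (p q : C) (e : R) : p <> q -> 0 < e ->
  (forall t, 0 <= t <= 1 -> analytic_at g (p + t * (q - p)) /\ analytic_at h (p + t * (q - p))) ->
  (forall t, 0 <= t <= e -> g (p + t * (q - p))%C = h (p + t * (q - p))%C) ->
  exists r, 0 < r /\ forall w, Cmod (w - q) < r -> g w = h w.
Proof.
  intros Npq He An Heq.
  set (s := fun t : R => (p + t * (q - p))%C) in *.
  assert (Pd : 0 < Cmod (q - p)).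
  { apply Cmod_gt_0. intro E. apply Npq. replace q with (q - p + p)%C by ring. rewrite E; ring. }
  assert (Ds : forall t u, Cmod (s t - s u) = Rabs (t - u) * Cmod (q - p)).
  { intros t u. unfold s. replace (p + t * (q - p) - (p + u * (q - p)))%C with ((RtoC t - RtoC u) * (q - p))%C by ring.
    now rewrite Cmod_mult, <- RtoC_minus, Cmod_R. }
  set (E := fun t => 0 <= t <= 1 /\ forall u, 0 <= u <= t -> g (s u) = h (s u)).
  destruct (completeness E) as [T [UB LUB]].
  - exists 1. intros t [Ht _]. lra.
  - exists 0. split; [lra|]. intros u Hu. apply Heq. lra.
  - assert (T1 : T <= 1) by (apply LUB; intros t [Ht _]; lra).
    assert (TE : Rmin e 1 <= T).
    { apply UB. split; [split; [apply Rmin_glb; lra|apply Rmin_r]|]. intros u Hu. apply Heq.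
      pose proof (Rmin_l e 1). lra. }
    assert (T0 : 0 < T) by (eapply Rlt_le_trans; [|exact TE]; apply Rmin_glb_lt; lra).
    assert (BT : forall u, 0 <= u < T -> g (s u) = h (s u)).
    { intros u Hu. destruct (classic (exists t, E t /\ u <= t)) as [[t [[Ht1 Ht2] Hut]]|N].
      - apply Ht2; lra.
      - exfalso. assert (T <= u); [|lra]. apply LUB. intros t Et. apply Rnot_lt_le. intro. apply N. exists t. split; [exact Et|lra]. }
    destruct (An T ltac:(lra)) as [A1 A2].
    destruct (analytic_at_eq_near g h (s T) A1 A2) as [r [Pr Hr]].
    { intros eps Heps. set (d := Rmin (T / 2) (eps / (2 * Cmod (q - p)))).
      assert (Pd0 : 0 < d) by (apply Rmin_glb_lt; [lra|apply Rdiv_lt_0_compat; lra]).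
      assert (d <= T / 2) by apply Rmin_l. assert (d <= eps / (2 * Cmod (q - p))) by apply Rmin_r.
      exists (s (T - d)). rewrite Ds. replace (T - d - T) with (- d) by ring. rewrite Rabs_Ropp, Rabs_pos_eq by lra.
      split; [|apply BT; lra]. split; [apply Rmult_lt_0_compat; lra|].
      apply Rle_lt_trans with (eps / (2 * Cmod (q - p)) * Cmod (q - p)); [apply Rmult_le_compat_r; lra|].
      replace (eps / (2 * Cmod (q - p)) * Cmod (q - p)) with (eps / 2) by (field; lra). lra. }
    destruct (Req_dec T 1) as [->|NT].
    + exists r. split; [exact Pr|]. intros w Hw. apply Hr. replace (s 1) with q; [exact Hw|]. unfold s. ring.
    + exfalso. set (d := Rmin (1 - T) (r / (2 * Cmod (q - p)))).
      assert (Pd0 : 0 < d) by (apply Rmin_glb_lt; [lra|apply Rdiv_lt_0_compat; lra]).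
      assert (d <= 1 - T) by apply Rmin_l. assert (d <= r / (2 * Cmod (q - p))) by apply Rmin_r.
      assert (T + d <= T); [|lra]. apply UB. split; [lra|]. intros u Hu.
      destruct (Rlt_dec u T) as [L|L]; [apply BT; lra|]. apply Hr. rewrite Ds. rewrite Rabs_pos_eq by lra.
      apply Rle_lt_trans with (r / (2 * Cmod (q - p)) * Cmod (q - p)); [apply Rmult_le_compat_r; lra|].
      replace (r / (2 * Cmod (q - p)) * Cmod (q - p)) with (r / 2) by (field; lra). lra.
Qed.

(* The path from the half-plane [Re w > 1] to the real point [x] goes [2 + i -> x + i -> x]. *)
Lemma identity_at_real (g h : C -> C) (x : R) :
  (forall w, Im w <> 0 \/ Re w = x -> analytic_at g w /\ analytic_at h w) ->
  (forall w, 1 < Re w -> g w = h w) -> g (RtoC x) = h (RtoC x).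
Proof.
  intros An Eq.
  destruct (Rlt_dec 1 x) as [Hx|Hx]; [apply Eq; exact Hx|].
  (* For [t] up to this value [t (2 - x) <= 1/2], so the initial piece stays in [Re w >= 3/2], where
     agreement is assumed. *)
  destruct (identity_on_segment g h (2, 1) (x, 1) (/ (2 * (2 - x)))) as [r [Pr Hr]].
  - intro E. injection E. lra.
  - apply Rinv_0_lt_compat; lra.
  - intros t Ht. apply An. left. unfold Im; simpl. lra.
  - intros t Ht. apply Eq. unfold Re; simpl.
    replace (2 + (t * (x + -2) - 0 * (1 + -1))) with (2 - t * (2 - x)) by ring.
    assert (t * (2 - x) <= / 2); [|lra].
    apply Rle_trans with (/ (2 * (2 - x)) * (2 - x)); [apply Rmult_le_compat_r; lra|]. right; field; lra.
  (* The vertical segment has length [1], so its points with [t <= r / 2] lie in the disc just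
     obtained around [x + i]. *)
  - destruct (identity_on_segment g h (x, 1) (RtoC x) (r / 2)) as [r' [Pr' Hr']].
    + intro E. injection E. lra.
    + lra.
    + intros t Ht. apply An. right. unfold Re, RtoC; simpl. ring.
    + intros t Ht. apply Hr.
      assert (Ep : forall p : C, (p + t * (RtoC x - p) - p)%C = (t * (RtoC x - p))%C) by (intro; ring).
      rewrite Ep.
      rewrite Cmod_mult, Cmod_R, Rabs_pos_eq by lra.
      assert (E : Cmod (RtoC x - (x, 1)) = 1).
      { unfold Cmod, RtoC; simpl. transitivity (sqrt 1); [f_equal; ring|apply sqrt_1]. }
      rewrite E. lra.
    + apply Hr'. replace (RtoC x - RtoC x)%C with (RtoC 0) by ring. now rewrite Cmod_0.
Qed.

(** * Integrals of power-exponential functions *)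

(** This convention deletes the singular term of a sum of simple poles at one of its poles, so the
    sum takes there the value of its finite part. *)
Lemma Cinv_0 : (/ 0)%C = 0.
Proof. unfold Cinv; simpl. unfold Rdiv. rewrite Rmult_0_l, Ropp_0, Rmult_0_l. reflexivity. Qed.

Lemma exp_ln_pow (x : R) (n : nat) : 0 < x -> exp (INR n * ln x) = x ^ n.
Proof. intro Hx. rewrite <- Rpower_pow by exact Hx. reflexivity. Qed.

Lemma is_cderive_cpower (q : C) (u : R) : 0 < u ->
  is_cderive (fun u => cexp (q * RtoC (ln u))) u (q * cexp ((q - 1) * RtoC (ln u)))%C.
Proof.
  intro Hu. eapply is_cderive_eq.
  - apply is_cderive_cexp, is_cderive_scal, is_cderive_RtoC. apply is_derive_ln. exact Hu.
  - replace ((q - 1) * RtoC (ln u))%C with (q * RtoC (ln u) + - RtoC (ln u))%C by ring.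
    rewrite cexp_plus, <- RtoC_opp, cexp_R, exp_Ropp, exp_ln by exact Hu. ring.
Qed.

Lemma ccont_cpower (q : C) (u : R) : 0 < u -> ccont (fun u => cexp (q * RtoC (ln u))) u.
Proof. intro Hu. eapply is_cderive_ccont, is_cderive_cpower, Hu. Qed.

(* An antiderivative of [u ^ (p - 1)]; since [/ 0 = 0], only the logarithm survives at [p = 0]. *)
Definition power_primitive (p : C) (u : R) : C :=
  (cexp (p * RtoC (ln u)) * / p + (if excluded_middle_informative (p = 0) then RtoC (ln u) else 0))%C.

Lemma is_cderive_power_primitive (p : C) (u : R) : 0 < u ->
  is_cderive (power_primitive p) u (cexp ((p - 1) * RtoC (ln u)))%C.
Proof.
  intro Hu. unfold power_primitive. destruct (excluded_middle_informative (p = 0)) as [E|N].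
  - rewrite E, Cinv_0. eapply is_cderive_ext; [|eapply is_cderive_eq; [apply is_cderive_RtoC, is_derive_ln, Hu|]].
    + intro t. cbv beta. ring.
    + replace ((0 - 1) * RtoC (ln u))%C with (- RtoC (ln u))%C by ring.
      now rewrite <- RtoC_opp, cexp_R, exp_Ropp, exp_ln.
  - apply is_cderive_ext with (fun u => (/ p * cexp (p * RtoC (ln u)))%C).
    + intro t. ring.
    + eapply is_cderive_eq; [apply is_cderive_scal, (is_cderive_cpower p u Hu)|]. field. exact N.
Qed.

Lemma CRInt_csum (u : nat -> R -> C) (n : nat) (a b : R) : a <= b ->
  (forall k t, a <= t <= b -> ccont (u k) t) ->
  CRInt (fun t => csum (fun k => u k t) n) a b = csum (fun k => CRInt (u k) a b) n.
Proof.
  intros Hab H. induction n as [|n IH].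
  - rewrite csum_0. apply CRInt_ext; [exact Hab|]. intros; now rewrite csum_0.
  - rewrite csum_S, <- IH, <- CRInt_plus; try assumption.
    + apply CRInt_ext; [exact Hab|]. intros; now rewrite csum_S.
    + intros t Ht. apply ccont_csum. intro; now apply H.
    + intros; now apply H.
Qed.

Lemma CRInt_minus (f g : R -> C) (a b : R) : a <= b ->
  (forall t, a <= t <= b -> ccont f t) -> (forall t, a <= t <= b -> ccont g t) ->
  CRInt (fun t => (f t - g t)%C) a b = (CRInt f a b - CRInt g a b)%C.
Proof.
  intros Hab Hf Hg. transitivity (CRInt (fun t => (f t + (- (1)) * g t)%C) a b).
  - apply CRInt_ext; [exact Hab|]. intros; ring.
  - rewrite CRInt_plus; try assumption.
    + rewrite CRInt_scal by assumption. ring.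
    + intros; apply ccont_mult; [apply ccont_const|auto].
Qed.

Lemma CRInt_bound_const (f : R -> C) (M a b : R) : a <= b ->
  (forall t, a <= t <= b -> ccont f t) -> (forall t, a <= t <= b -> Cmod (f t) <= M) ->
  Cmod (CRInt f a b) <= M * (b - a).
Proof.
  intros Hab Hc HM. eapply Rle_trans; [apply CRInt_bound with (h := fun _ => M); try assumption|].
  - apply ex_RInt_const.
  - rewrite RInt_const. unfold scal; simpl; unfold mult; simpl. lra.
Qed.

(** The residue of Gamma at [- n], and at the same time the coefficient of [y^n] in [exp (- y)]. *)
Definition gamma_residue (n : nat) : R := (-1) ^ n / INR (fact n).

Lemma gamma_residue_abs (n : nat) : Rabs (gamma_residue n) = / INR (fact n).
Proof.
  unfold gamma_residue, Rdiv. rewrite Rabs_mult, pow_1_abs, Rmult_1_l, Rabs_pos_eq; [reflexivity|].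
  left; apply Rinv_0_lt_compat, INR_fact_lt_0.
Qed.

Definition powexp (q : C) (al x : R) (u : R) : C :=
  (cexp (q * RtoC (ln u)) * RtoC (exp (- (x * Rpower u al))))%C.

Lemma ccont_powexp (q : C) (al x u : R) : 0 < u -> ccont (powexp q al x) u.
Proof.
  intro Hu. apply ccont_mult; [now apply ccont_cpower|]. apply ccont_RtoC.
  eapply is_derive_continuous. unfold Rpower. auto_derive; [exact Hu|reflexivity].
Qed.

Lemma exp_term_power (al x u : R) (n : nat) : 0 < u ->
  exp_term (RtoC (- (x * Rpower u al))) n = (RtoC (gamma_residue n * x ^ n) * cexp (RtoC (al * INR n) * RtoC (ln u)))%C.
Proof.
  intro Hu. unfold exp_term. rewrite <- RtoC_pow, <- RtoC_mult, <- RtoC_mult, cexp_R, <- RtoC_mult. f_equal.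
  unfold gamma_residue. replace (- (x * Rpower u al)) with ((-1) * x * Rpower u al) by ring.
  rewrite !Rpow_mult_distr. replace (al * INR n * ln u) with (INR n * ln (Rpower u al)).
  - rewrite exp_ln_pow by (unfold Rpower; apply exp_pos). unfold Rdiv. ring.
  - unfold Rpower. rewrite ln_exp. ring.
Qed.

Definition powexp_term (q : C) (al x u : R) (n : nat) : C :=
  (RtoC (gamma_residue n * x ^ n) * power_primitive (q + 1 + RtoC (al * INR n)) u)%C.

(** The exponential is expanded under the integral sign and each power is integrated by
    [power_primitive]. The error is the integral of [u^q] times the Taylor remainder, geometrically
    small on the compact interval. *)
Lemma CRInt_powexp (q : C) (al x b B : R) : 0 < al -> 0 <= x -> 0 < b <= B ->
  is_cseq (fun N => csum (fun n => powexp_term q al x B n - powexp_term q al x b n)%C N) (CRInt (powexp q al x) b B).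
Proof.
  intros Hal Hx Hb.
  set (L := Rabs (ln b) + Rabs (ln B)).
  set (Y := x * Rpower B al).
  assert (HL : forall u, b <= u <= B -> Rabs (ln u) <= L).
  { intros u Hu. unfold L. assert (ln b <= ln u) by (apply ln_le; lra). assert (ln u <= ln B) by (apply ln_le; lra).
    pose proof (Rle_abs (ln B)). pose proof (Rle_abs (- ln b)). rewrite Rabs_Ropp in *.
    pose proof (Rabs_pos (ln b)). pose proof (Rabs_pos (ln B)). apply Rabs_le. lra. }
  set (K := exp (Rabs (Re q) * L) * exp (3 * Y)).
  assert (PK : 0 <= K) by (unfold K; apply Rmult_le_pos; left; apply exp_pos).
  apply is_cseq_le with (fun n => (/ 2) ^ S n * (K * (B - b))); [|apply is_lim_seq_half_pow].
  intro N.
  assert (E1 : csum (fun n => powexp_term q al x B n - powexp_term q al x b n)%C N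
    = CRInt (fun u => csum (fun n => cexp (q * RtoC (ln u)) * exp_term (RtoC (- (x * Rpower u al))) n)%C N) b B).
  { rewrite CRInt_csum; [|lra|].
    - apply csum_ext. intros n _. unfold powexp_term.
      transitivity (RtoC (gamma_residue n * x ^ n) * (power_primitive (q + 1 + RtoC (al * INR n)) B - power_primitive (q + 1 + RtoC (al * INR n)) b))%C; [ring|].
      rewrite <- (CRInt_derive _ (fun u => cexp ((q + 1 + RtoC (al * INR n) - 1) * RtoC (ln u)))); [|lra| |].
      + rewrite <- CRInt_scal; [|lra|].
        * apply CRInt_ext; [lra|]. intros u Hu. rewrite exp_term_power by lra.
          replace ((q + 1 + RtoC (al * INR n) - 1) * RtoC (ln u))%C with (q * RtoC (ln u) + RtoC (al * INR n) * RtoC (ln u))%C by ring.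
          rewrite cexp_plus. ring.
        * intros u Hu. apply ccont_cpower; lra.
      + intros u Hu. apply is_cderive_power_primitive; lra.
      + intros u Hu. apply ccont_cpower; lra.
    - intros n u Hu. apply ccont_mult; [apply ccont_cpower; lra|].
      unfold exp_term. apply ccont_mult; [|apply ccont_const]. apply ccont_pow, ccont_RtoC.
      eapply is_derive_continuous. unfold Rpower. auto_derive; [lra|reflexivity]. }
  rewrite E1, Cmod_minus_sym, <- CRInt_minus; [|lra| |].
  - rewrite <- Rmult_assoc. apply CRInt_bound_const; [lra| |].
    + intros u Hu. apply ccont_minus; [apply ccont_powexp; lra|].
      apply (ccont_csum (fun n u => cexp (q * RtoC (ln u)) * exp_term (RtoC (- (x * Rpower u al))) n)%C).
      intro n. apply ccont_mult; [apply ccont_cpower; lra|].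
      unfold exp_term. apply ccont_mult; [|apply ccont_const]. apply ccont_pow, ccont_RtoC.
      eapply is_derive_continuous. unfold Rpower. auto_derive; [lra|reflexivity].
    + intros u Hu. rewrite csum_scal. unfold powexp. rewrite <- cexp_R.
      replace (cexp (q * RtoC (ln u)) * cexp (RtoC (- (x * Rpower u al))) - cexp (q * RtoC (ln u)) * csum (exp_term (RtoC (- (x * Rpower u al)))) N)%C
       with (cexp (q * RtoC (ln u)) * exp_rem N (RtoC (- (x * Rpower u al))))%C by (unfold exp_rem; ring).
      rewrite Cmod_mult, Cmod_cexp. rewrite Rmult_comm. eapply Rle_trans.
      * apply Rmult_le_compat_r; [left; apply exp_pos|apply exp_rem_geom].
      * rewrite Rmult_assoc. apply Rmult_le_compat_l; [apply pow_le; lra|]. unfold K. rewrite Rmult_comm.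
        apply Rmult_le_compat; try (left; apply exp_pos); apply exp_le_mono.
        -- replace (Re (q * RtoC (ln u))) with (Re q * ln u) by (unfold Re, Cmult, RtoC; simpl; ring).
           eapply Rle_trans; [apply Rle_abs|]. rewrite Rabs_mult. apply Rmult_le_compat_l; [apply Rabs_pos|now apply HL].
        -- rewrite Cmod_R, Rabs_Ropp.
           assert (P : 0 < Rpower u al) by (unfold Rpower; apply exp_pos).
           rewrite Rabs_pos_eq by (apply Rmult_le_pos; lra).
           unfold Y. apply Rmult_le_compat_l; [lra|]. apply Rmult_le_compat_l; [lra|]. apply Rle_Rpower_l; lra.
  - intros u Hu. apply ccont_powexp; lra.
  - intros u Hu. apply (ccont_csum (fun n u => cexp (q * RtoC (ln u)) * exp_term (RtoC (- (x * Rpower u al))) n)%C).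
    intro n. apply ccont_mult; [apply ccont_cpower; lra|].
    unfold exp_term. apply ccont_mult; [|apply ccont_const]. apply ccont_pow, ccont_RtoC.
    eapply is_derive_continuous. unfold Rpower. auto_derive; [lra|reflexivity].
Qed.

(** Once [al n >= |s| + 1] the modulus is at least [1]; the finitely many remaining indices
    contribute the minimum of their nonzero values. *)
Lemma pole_gap (s : C) (al : R) : 0 < al ->
  exists c, 0 < c /\ forall n : nat, (s + RtoC (al * INR n))%C = 0 \/ c <= Cmod (s + RtoC (al * INR n)).
Proof.
  intro Hal.
  assert (F : forall N, exists c, 0 < c /\ forall n : nat, (n < N)%nat -> (s + RtoC (al * INR n))%C = 0 \/ c <= Cmod (s + RtoC (al * INR n))).
  { induction N as [|N [c [Hc IH]]].
    - exists 1. split; [lra|]. intros; lia.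
    - destruct (Req_dec (Cmod (s + RtoC (al * INR N))) 0) as [E|NE].
      + exists c. split; [exact Hc|]. intros n Hn. destruct (Nat.eq_dec n N) as [->|]; [left; now apply Cmod_eq_0|apply IH; lia].
      + exists (Rmin c (Cmod (s + RtoC (al * INR N)))). split.
        * apply Rmin_glb_lt; [exact Hc|]. pose proof (Cmod_ge_0 (s + RtoC (al * INR N))). lra.
        * intros n Hn. destruct (Nat.eq_dec n N) as [->|]; [right; apply Rmin_r|].
          destruct (IH n ltac:(lia)) as [H|H]; [now left|right]. eapply Rle_trans; [apply Rmin_l|exact H]. }
  destruct (archimed ((Cmod s + 1) / al)) as [Ha _].
  set (N := Z.to_nat (up ((Cmod s + 1) / al))).
  destruct (F N) as [c [Hc H]].
  exists (Rmin c 1). split; [apply Rmin_glb_lt; lra|]. intro n.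
  destruct (Nat.lt_ge_cases n N) as [L|L].
  - destruct (H n L) as [E|E]; [now left|right]. eapply Rle_trans; [apply Rmin_l|exact E].
  - right. eapply Rle_trans; [apply Rmin_r|].
    assert (Hn : (Cmod s + 1) / al <= INR n).
    { apply Rlt_le. eapply Rlt_le_trans; [exact Ha|]. rewrite INR_IZR_INZ. apply IZR_le. unfold N in L. lia. }
    assert (Hn' : Cmod s + 1 <= al * INR n).
    { apply (Rmult_le_compat_l al) in Hn; [|lra]. replace (al * ((Cmod s + 1) / al)) with (Cmod s + 1) in Hn by (field; lra). exact Hn. }
    pose proof (Cmod_triangle (s + RtoC (al * INR n)) (- s)) as T.
    replace (s + RtoC (al * INR n) + - s)%C with (RtoC (al * INR n)) in T by ring.
    rewrite Cmod_opp, Cmod_R in T. pose proof (Rle_abs (al * INR n)). lra.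
Qed.

Lemma ex_series_scal_R (k : R) (a : nat -> R) : ex_series a -> ex_series (fun n => k * a n).
Proof. exact (ex_series_scal_l (K := R_AbsRing) k a). Qed.

Lemma ex_series_exp (y : R) : ex_series (fun n => y ^ n / INR (fact n)).
Proof.
  exists (exp y). generalize (is_exp_Reals y); unfold is_pseries; apply is_series_ext.
  intro k. rewrite pow_n_pow. reflexivity.
Qed.

Lemma Series_exp (y : R) : Series (fun n => y ^ n / INR (fact n)) = exp y.
Proof.
  apply is_series_unique. generalize (is_exp_Reals y); unfold is_pseries; apply is_series_ext.
  intro k. rewrite pow_n_pow. reflexivity.
Qed.

(** [pole_gap] bounds all nonzero denominators [q + 1 + al n] from below at once; at a vanishing one
    only the logarithm contributes, whence [|ln u|]. The majorant is a term of an exponential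
    series. *)
Lemma powexp_term_bound (q : C) (al : R) : 0 < al -> exists c, 0 < c /\ forall x u n, 0 <= x -> 0 < u ->
  Cmod (powexp_term q al x u n) <= (c + Rabs (ln u)) * Rpower u (Re q + 1) * ((x * Rpower u al) ^ n / INR (fact n)).
Proof.
  intro Hal. destruct (pole_gap (q + 1) al Hal) as [c [Hc G]].
  exists (/ c). split; [now apply Rinv_0_lt_compat|]. intros x u n Hx Hu. unfold powexp_term.
  set (p := (q + 1 + RtoC (al * INR n))%C) in *.
  assert (P1 : Cmod (cexp (p * RtoC (ln u))) = Rpower u (Re q + 1) * Rpower u al ^ n).
  { rewrite Cmod_cexp. replace (Re (p * RtoC (ln u))) with ((Re q + 1) * ln u + INR n * (al * ln u)) by (unfold p, Re, Cmult, Cplus, RtoC; simpl; ring).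
    rewrite exp_plus. unfold Rpower. f_equal. rewrite <- exp_ln_pow by apply exp_pos. now rewrite ln_exp. }
  assert (P2 : Cmod (power_primitive p u) <= (/ c + Rabs (ln u)) * Cmod (cexp (p * RtoC (ln u)))).
  { unfold power_primitive. eapply Rle_trans; [apply Cmod_triangle|]. rewrite Rmult_plus_distr_r.
    apply Rplus_le_compat.
    - rewrite Cmod_mult, Rmult_comm. apply Rmult_le_compat_r; [apply Cmod_ge_0|].
      destruct (G n) as [E|E]; fold p in E.
      + rewrite E, Cinv_0, Cmod_0. left; now apply Rinv_0_lt_compat.
      + rewrite Cmod_inv by (apply Cmod_gt_0; lra). apply Rinv_le_contravar; lra.
    - destruct (excluded_middle_informative (p = 0)) as [E|E].
      + rewrite E, Cmult_0_l, cexp_0, Cmod_1, Cmod_R. lra.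
      + rewrite Cmod_0. apply Rmult_le_pos; [apply Rabs_pos|apply Cmod_ge_0]. }
  rewrite P1 in P2. rewrite Cmod_mult, Cmod_R, Rabs_mult, gamma_residue_abs, (Rabs_pos_eq (x ^ n)) by (now apply pow_le).
  eapply Rle_trans; [apply Rmult_le_compat_l; [|exact P2]|].
  - apply Rmult_le_pos; [left; apply Rinv_0_lt_compat, INR_fact_lt_0|now apply pow_le].
  - rewrite Rpow_mult_distr. unfold Rdiv. right; ring.
Qed.

(** A termwise antiderivative of [powexp]. For [q = s - 1] and [al = x = 1], off the poles, it is
    the lower incomplete gamma function at [u]. *)
Definition powexp_series (q : C) (al x u : R) : C := CSer (powexp_term q al x u).

Lemma powexp_series_lim (q : C) (al x u : R) : 0 < al -> 0 <= x -> 0 < u ->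
  is_cseq (csum (powexp_term q al x u)) (powexp_series q al x u).
Proof.
  intros Hal Hx Hu. destruct (powexp_term_bound q al Hal) as [c [Hc H]].
  eapply CSer_lim; [intro n; apply H; assumption|].
  apply ex_series_scal_R, ex_series_exp.
Qed.

Lemma CRInt_powexp_series (q : C) (al x b B : R) : 0 < al -> 0 <= x -> 0 < b <= B ->
  CRInt (powexp q al x) b B = (powexp_series q al x B - powexp_series q al x b)%C.
Proof.
  intros Hal Hx Hb. eapply is_cseq_unique; [apply CRInt_powexp; assumption|].
  eapply is_cseq_ext; [|apply is_cseq_minus; apply powexp_series_lim; try assumption; lra].
  intro N. cbv beta. induction N; [rewrite !csum_0|rewrite !csum_S, <- IHN]; ring.
Qed.

(** * The Gamma function *)

(** The graph of the logarithm lies below its tangent at [l]. *)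
Lemma ln_le_div (y l : R) : 0 < y -> 0 < l -> ln y <= y / l + ln l - 1.
Proof.
  intros Hy Hl. assert (P : 0 < y / l) by (apply Rdiv_lt_0_compat; lra).
  pose proof (exp_ineq1_le (ln (y / l))) as H. rewrite exp_ln in H by exact P.
  unfold Rdiv in H at 1. rewrite ln_mult, ln_Rinv in H by (try apply Rinv_0_lt_compat; lra). lra.
Qed.

(** The tangent of slope [d], taken at [y = P / d]. By this estimate power factors are absorbed into
    small exponentials. *)
Lemma ln_linear_bound (P d : R) : 0 <= P -> 0 < d -> exists K, forall y, 0 < y -> P * ln y <= d * y + K.
Proof.
  intros HP Hd. destruct (Req_dec P 0) as [->|N].
  - exists 0. intros y Hy. nra.
  - exists (P * (ln (P / d) - 1)). intros y Hy.
    assert (H := ln_le_div y (P / d) Hy ltac:(apply Rdiv_lt_0_compat; lra)).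
    apply (Rmult_le_compat_l P) in H; [|lra].
    replace (P * (y / (P / d) + ln (P / d) - 1)) with (d * y + P * (ln (P / d) - 1)) in H by (field; lra). exact H.
Qed.

(** With [t = 1 + r], the integrand [t^(s-1) exp (- t)] on [[1, oo)] is split into [exp (s ln t)]
    and a weight free of [s], the shape that [analytic_at_CI] expects. *)
Definition gamma_log (r : R) : C := RtoC (ln (1 + r)).
Definition gamma_weight (r : R) : C := RtoC (exp (- ln (1 + r) - (1 + r))).
Definition upper_gamma (s : C) : C := CI (fun r => (cexp (s * gamma_log r) * gamma_weight r)%C).
(** Prym's decomposition of Gamma: the integral over [[0, 1]] becomes a sum over the poles, and the
    one over [[1, oo)] is entire. At [s = - n] the singular term is [0] by convention, and the value
    is the finite part of Gamma there. *)
Definition gamma_fn (s : C) : C := (CSer (fun n => RtoC (gamma_residue n) / (s - (- RtoC (INR n))))%C + upper_gamma s)%C.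

Lemma ccont_gamma_log (r : R) : 0 <= r -> ccont gamma_log r.
Proof.
  intro Hr. apply ccont_RtoC. eapply is_derive_continuous. auto_derive; [lra|reflexivity].
Qed.

Lemma ccont_gamma_weight (r : R) : 0 <= r -> ccont gamma_weight r.
Proof.
  intro Hr. apply ccont_RtoC. eapply is_derive_continuous. auto_derive; [lra|reflexivity].
Qed.

Lemma upper_gamma_bound (z : C) : exists K, forall r, 0 <= r ->
  Cmod (cexp (z * gamma_log r) * gamma_weight r) * exp (3 * Cmod (gamma_log r)) <= K * exp (- / 2 * r).
Proof.
  destruct (ln_linear_bound (Rabs (Re z) + 3) (/ 2)) as [K HK]; [pose proof (Rabs_pos (Re z)); lra|lra|].
  exists (exp K). intros r Hr.
  assert (PL : 0 <= ln (1 + r)) by (rewrite <- ln_1; apply ln_le; lra).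
  unfold gamma_log, gamma_weight. rewrite Cmod_mult, Cmod_cexp, !Cmod_R.
  rewrite (Rabs_pos_eq (ln (1 + r))) by exact PL. rewrite (Rabs_pos_eq (exp _)) by (left; apply exp_pos).
  rewrite <- !exp_plus. apply exp_le_mono.
  replace (Re (z * RtoC (ln (1 + r)))) with (Re z * ln (1 + r)) by (unfold Re, Cmult, RtoC; simpl; ring).
  pose proof (HK (1 + r) ltac:(lra)). pose proof (Rle_abs (Re z)). nra.
Qed.

Lemma analytic_at_upper_gamma (z : C) : analytic_at upper_gamma z.
Proof.
  destruct (upper_gamma_bound z) as [K HK].
  apply (analytic_at_CI gamma_log gamma_weight z K (/ 2)); try lra; try assumption.
  - apply ccont_gamma_log. - apply ccont_gamma_weight.
Qed.

Lemma tame_upper_gamma (s : C) : tame (fun r => (cexp (s * gamma_log r) * gamma_weight r)%C).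
Proof.
  split.
  - intros r Hr. apply ccont_mult; [apply ccont_cexp, ccont_mult; [apply ccont_const|now apply ccont_gamma_log]|now apply ccont_gamma_weight].
  - destruct (upper_gamma_bound s) as [K HK]. exists K, (/ 2). split; [lra|]. intros r Hr.
    eapply Rle_trans; [|apply HK, Hr]. rewrite <- (Rmult_1_r (Cmod _)) at 1.
    apply Rmult_le_compat_l; [apply Cmod_ge_0|]. rewrite <- exp_0. apply exp_le_mono.
    pose proof (Cmod_ge_0 (gamma_log r)). lra.
Qed.

Lemma ex_series_gamma_residue : ex_series (fun n => Cmod (RtoC (gamma_residue n))).
Proof.
  eapply ex_series_ext; [|apply (ex_series_exp 1)]. intro n. cbv beta.
  rewrite Cmod_R, gamma_residue_abs, pow1. apply Rmult_1_l.
Qed.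

Lemma analytic_at_gamma_fn (s : C) : (forall n : nat, s <> RtoC (- INR n)) -> analytic_at gamma_fn s.
Proof.
  intro H. apply analytic_at_plus; [|apply analytic_at_upper_gamma].
  destruct (pole_gap s 1 Rlt_0_1) as [c [Hc G]].
  apply (analytic_at_poles (fun n => RtoC (gamma_residue n)) (fun n => (- RtoC (INR n))%C) s c Hc ex_series_gamma_residue).
  intro n. right. replace (s - - RtoC (INR n))%C with (s + RtoC (1 * INR n))%C by (rewrite Rmult_1_l; ring).
  destruct (G n) as [E|E]; [|exact E]. exfalso. apply (H n). rewrite Rmult_1_l in E. rewrite RtoC_opp.
  replace s with (s + RtoC (INR n) + - RtoC (INR n))%C by ring. rewrite E; ring.
Qed.

Lemma powexp_series_1 (s : C) : powexp_series (s - 1) 1 1 1 = CSer (fun n => RtoC (gamma_residue n) / (s - (- RtoC (INR n))))%C.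
Proof.
  apply CSer_ext. intro n. unfold powexp_term, power_primitive. rewrite pow1, Rmult_1_r, Rmult_1_l, ln_1.
  replace (s - 1 + 1 + RtoC (INR n))%C with (s - - RtoC (INR n))%C by ring.
  rewrite Cmult_0_r, cexp_0. destruct (excluded_middle_informative _); unfold Cdiv; ring.
Qed.

Lemma CRInt_shift (f : R -> C) (a T : R) : 0 <= T -> (forall t, a <= t <= a + T -> ccont f t) ->
  CRInt (fun r => f (a + r)) 0 T = CRInt f a (a + T).
Proof.
  intros HT Hc. destruct (cRInt_ex f a (a + T)) as [E1 E2]; [lra|exact Hc|].
  unfold CRInt. f_equal; apply is_RInt_unique.
  - apply (RInt_correct (V := R_CompleteNormedModule)) in E1. replace a with (1 * 0 + a) in E1 at 1 by ring. replace (a + T) with (1 * T + a) in E1 at 1 by ring.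
    apply (is_RInt_comp_lin (V := R_NormedModule)) in E1. eapply is_RInt_ext; [|exact E1]. intros x _. unfold scal; simpl; unfold mult; simpl.
    rewrite Rmult_1_l. do 2 f_equal. ring.
  - apply (RInt_correct (V := R_CompleteNormedModule)) in E2. replace a with (1 * 0 + a) in E2 at 1 by ring. replace (a + T) with (1 * T + a) in E2 at 1 by ring.
    apply (is_RInt_comp_lin (V := R_NormedModule)) in E2. eapply is_RInt_ext; [|exact E2]. intros x _. unfold scal; simpl; unfold mult; simpl.
    rewrite Rmult_1_l. do 2 f_equal. ring.
Qed.

(** Valid for every [s], poles included: at [u = 1] all powers are [1] and the logarithm vanishes,
    so the series is the sum over the poles, and integrating from [1] onwards adds the upper
    part. *)
Lemma powexp_series_gamma_fn (s : C) : is_clim (powexp_series (s - 1) 1 1) (gamma_fn s).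
Proof.
  assert (H : is_clim (fun T => powexp_series (s - 1) 1 1 (1 + T)) (gamma_fn s)).
  { unfold gamma_fn. rewrite <- powexp_series_1.
    apply is_clim_ext with (fun T => (powexp_series (s - 1) 1 1 1 + CRInt (fun r => cexp (s * gamma_log r) * gamma_weight r) 0 T)%C).
    - intros T HT. assert (E : CRInt (fun r => (cexp (s * gamma_log r) * gamma_weight r)%C) 0 T = CRInt (powexp (s - 1) 1 1) 1 (1 + T)).
      { rewrite <- CRInt_shift; [|exact HT|].
        - apply CRInt_ext; [exact HT|]. intros t Ht. unfold powexp, gamma_log, gamma_weight.
          rewrite Rpower_1 by lra. rewrite <- !cexp_R, <- !cexp_plus. f_equal.
          rewrite RtoC_minus, !RtoC_opp, RtoC_mult. ring.
        - intros t Ht. apply ccont_powexp; lra. }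
      rewrite E, CRInt_powexp_series by lra. ring.
    - apply is_clim_plus; [|apply CI_lim, tame_upper_gamma].
      intros eps He. exists 0. intros _ _. replace (powexp_series (s - 1) 1 1 1 - powexp_series (s - 1) 1 1 1)%C with (RtoC 0) by ring. now rewrite Cmod_0. }
  intros eps He. destruct (H eps He) as [M HM]. exists (1 + M). intros T HT.
  replace T with (1 + (T - 1)) by ring. apply HM. lra.
Qed.

Lemma powexp_series_at_0 (s : C) : 0 < Re s -> forall eps, 0 < eps ->
  exists d, 0 < d /\ forall y, 0 < y < d -> Cmod (powexp_series (s - 1) 1 1 y) < eps.
Proof.
  intros Hs eps He. set (sg := Re s) in *.
  destruct (powexp_term_bound (s - 1) 1 Rlt_0_1) as [c [Hc H]].
  (* half of the exponent absorbs the logarithm *)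
  destruct (ln_linear_bound 1 (sg / 2)) as [K HK]; try lra.
  set (Q := (c + 2 / sg) * exp 1).
  assert (P2 : 0 < 2 / sg) by (apply Rdiv_lt_0_compat; lra).
  assert (PQ : 0 < Q) by (unfold Q; apply Rmult_lt_0_compat; [lra|apply exp_pos]).
  (* The second value solves [y^(sg/2) = eps / Q]; [Q] collects what is left of the logarithm, of
     the constant and of [exp y <= e]. *)
  exists (Rmin 1 (exp (2 / sg * ln (eps / Q)))). split; [apply Rmin_glb_lt; [lra|apply exp_pos]|].
  intros y [Hy0 Hy]. assert (Hy1 : y < 1) by (eapply Rlt_le_trans; [exact Hy|apply Rmin_l]).
  assert (Hy2 : y < exp (2 / sg * ln (eps / Q))) by (eapply Rlt_le_trans; [exact Hy|apply Rmin_r]).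
  assert (PE : 0 < eps / Q) by (apply Rdiv_lt_0_compat; lra).
  assert (Ly : sg / 2 * ln y < ln (eps / Q)).
  { apply ln_increasing in Hy2; [|exact Hy0]. rewrite ln_exp in Hy2.
    apply (Rmult_lt_compat_l (sg / 2)) in Hy2; [|lra].
    replace (sg / 2 * (2 / sg * ln (eps / Q))) with (ln (eps / Q)) in Hy2 by (field; lra). exact Hy2. }
  assert (Lneg : ln y < 0) by (rewrite <- ln_1; apply ln_increasing; lra).
  assert (B : Cmod (powexp_series (s - 1) 1 1 y) <= (c + Rabs (ln y)) * Rpower y (Re (s - 1) + 1) * exp (1 * Rpower y 1)).
  { eapply Rle_trans; [apply CSer_bound; [intro n; apply H; lra|apply ex_series_scal_R, ex_series_exp]|].
    rewrite Series_scal_l, Series_exp. lra. }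
  eapply Rle_lt_trans; [exact B|].
  replace (Re (s - 1) + 1) with (sg / 2 + sg / 2) by (unfold sg, Re; simpl; lra).
  rewrite Rpower_1, Rmult_1_l by exact Hy0.
  rewrite Rabs_left by exact Lneg. rewrite Rpower_plus.
  assert (Z1 : 0 < Rpower y (sg / 2)) by apply exp_pos.
  assert (Z2 : Rpower y (sg / 2) <= 1) by (unfold Rpower; rewrite <- exp_0; apply exp_le_mono; nra).
  assert (Z3 : - ln y * Rpower y (sg / 2) <= 2 / sg).
  { unfold Rpower. replace (sg / 2 * ln y) with (- (sg / 2 * - ln y)) by ring. rewrite exp_Ropp.
    pose proof (exp_ineq1_le (sg / 2 * - ln y)). assert (0 < sg / 2 * - ln y) by (apply Rmult_lt_0_compat; lra).
    apply Rmult_le_reg_r with (exp (sg / 2 * - ln y)); [apply exp_pos|]. rewrite Rmult_assoc, Rinv_l, Rmult_1_r by (pose proof (exp_pos (sg / 2 * - ln y)); lra).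
    apply Rle_trans with (2 / sg * (sg / 2 * - ln y)); [right; field; lra|]. apply Rmult_le_compat_l; lra. }
  assert (Z4 : exp y <= exp 1) by (apply exp_le_mono; lra).
  assert (Z5 : Rpower y (sg / 2) < eps / Q) by (unfold Rpower; rewrite <- (exp_ln (eps / Q)) by exact PE; now apply exp_increasing).
  apply Rle_lt_trans with (Q * Rpower y (sg / 2)).
  - unfold Q. replace ((c + - ln y) * (Rpower y (sg / 2) * Rpower y (sg / 2)) * exp y) with
      (((c * Rpower y (sg / 2) + - ln y * Rpower y (sg / 2)) * exp y) * Rpower y (sg / 2)) by ring.
    apply Rmult_le_compat_r; [lra|]. pose proof (exp_pos y). 
    apply Rmult_le_compat; try lra; [|nra].
    assert (0 <= - ln y * Rpower y (sg / 2)) by (apply Rmult_le_pos; lra). nra.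
  - apply (Rmult_lt_compat_l Q) in Z5; [|exact PQ]. replace (Q * (eps / Q)) with eps in Z5 by (field; lra). exact Z5.
Qed.

Lemma is_RInt_CRInt (f : R -> C) (a b : R) : a <= b -> (forall t, a <= t <= b -> ccont f t) ->
  @is_RInt C_R_NormedModule f a b (CRInt f a b).
Proof.
  intros Hab Hc. destruct (cRInt_ex f a b Hab Hc) as [E1 E2].
  apply (is_RInt_fct_extend_pair (U := R_NormedModule) (V := R_NormedModule)).
  - apply (RInt_correct (V := R_CompleteNormedModule) (fun t => Re (f t)) a b E1).
  - apply (RInt_correct (V := R_CompleteNormedModule) (fun t => Im (f t)) a b E2).
Qed.

(** Euler's integral over [[x, y]] is a difference of two values of [powexp_series]; the one at [x]
    tends to [0] because [Re s > 0], the one at [y] to [gamma_fn s]. *)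
Lemma is_Gamma_gamma_fn : is_Gamma gamma_fn.
Proof.
  split; [intros z Hz; now apply analytic_at_gamma_fn|].
  intros s Hs.
  assert (Ef : forall t, 0 < t -> powexp (s - 1) 1 1 t = (cpower t (s - 1) * RtoC (exp (- t)))%C).
  { intros t Ht. unfold powexp. rewrite cpower_cexp, Rpower_1, Rmult_1_l by exact Ht. reflexivity. }
  intros P [eps HP].
  assert (Pe : 0 < eps / 2) by (pose proof (cond_pos eps); lra).
  destruct (powexp_series_at_0 s Hs (eps / 2) Pe) as [d [Hd H0]].
  destruct (powexp_series_gamma_fn s (eps / 2) Pe) as [M HM].
  apply (Filter_prod _ _ _ (fun x => 0 < x < Rmin d 1) (fun y => Rmax M 1 < y)).
  - exists (mkposreal _ (Rmin_pos d 1 Hd Rlt_0_1)). intros y Hy Hy0. split; [exact Hy0|].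
    unfold ball in Hy; simpl in Hy; unfold AbsRing_ball, abs, minus, plus, opp in Hy; simpl in Hy.
    apply Rabs_def2 in Hy. lra.
  - now exists (Rmax M 1).
  - intros x y Hx Hy. simpl fst; simpl snd.
    pose proof (Rmin_l d 1). pose proof (Rmin_r d 1). pose proof (Rmax_l M 1). pose proof (Rmax_r M 1).
    exists (CRInt (powexp (s - 1) 1 1) x y). split.
    + apply (is_RInt_ext (V := C_R_NormedModule) (powexp (s - 1) 1 1)).
      * intros t Ht. apply Ef. rewrite Rmin_left in Ht by lra. lra.
      * apply is_RInt_CRInt; [lra|]. intros; apply ccont_powexp; lra.
    + apply HP. apply C_NormedModule_mixin_compat1.
      rewrite CRInt_powexp_series by lra.
      change (Cmod (powexp_series (s - 1) 1 1 y - powexp_series (s - 1) 1 1 x - gamma_fn s) < eps).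
      pose proof (H0 x ltac:(lra)). pose proof (HM y ltac:(lra)).
      replace (powexp_series (s - 1) 1 1 y - powexp_series (s - 1) 1 1 x - gamma_fn s)%C with
       ((powexp_series (s - 1) 1 1 y - gamma_fn s) + - powexp_series (s - 1) 1 1 x)%C by ring.
      eapply Rle_lt_trans; [apply Cmod_triangle|]. rewrite Cmod_opp. lra.
Qed.

Lemma Gamma_spec : is_Gamma Gamma.
Proof. apply (epsilon_spec (inhabits (fun _ : C => RtoC 0)) is_Gamma). exists gamma_fn. apply is_Gamma_gamma_fn. Qed.

(** Both values are limits of the same improper integral, and limits along a proper filter are
    unique. *)
Lemma Gamma_eq_right (s : C) : 0 < Re s -> Gamma s = gamma_fn s.
Proof.
  intro Hs. destruct Gamma_spec as [_ H1]. destruct is_Gamma_gamma_fn as [_ H2].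
  specialize (H1 s Hs). specialize (H2 s Hs). unfold is_RInt_gen in H1, H2.
  set (f := fun t : R => (cpower t (s - 1) * RtoC (exp (- t)))%C) in *.
  refine (filterlimi_locally_unique (T := R * R) (K := R_AbsRing) (V := C_R_NormedModule)
    (F := filter_prod (at_right 0) (Rbar_locally p_infty)) (fun ab => @is_RInt C_R_NormedModule f (fst ab) (snd ab)) (Gamma s) (gamma_fn s) _ H1 H2).
  apply (Filter_prod _ _ _ (fun x => True) (fun y => True)); try apply filter_true.
  intros x y _ _ y1 y2 I1 I2. 
  destruct y1 as [u1 v1], y2 as [u2 v2].
  pose proof (is_RInt_fct_extend_fst (U := R_NormedModule) (V := R_NormedModule) f x y _ I1) as A1. pose proof (is_RInt_fct_extend_fst (U := R_NormedModule) (V := R_NormedModule) f x y _ I2) as A2.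
  pose proof (is_RInt_fct_extend_snd (U := R_NormedModule) (V := R_NormedModule) f x y _ I1) as B1. pose proof (is_RInt_fct_extend_snd (U := R_NormedModule) (V := R_NormedModule) f x y _ I2) as B2.
  simpl in *. f_equal.
  - rewrite <- (is_RInt_unique _ _ _ _ A1). apply is_RInt_unique. exact A2.
  - rewrite <- (is_RInt_unique _ _ _ _ B1). apply is_RInt_unique. exact B2.
Qed.

Lemma Gamma_eq_real (x : R) : (forall n : nat, x <> - INR n) -> Gamma (RtoC x) = gamma_fn (RtoC x).
Proof.
  intro Hx. apply (identity_at_real Gamma gamma_fn x).
  - intros w Hw. assert (N : forall n : nat, w <> RtoC (- INR n)).
    { intros n ->. destruct Hw as [H|H]; [now apply H|]. simpl in H. apply (Hx n). now symmetry. }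
    split; [apply (proj1 Gamma_spec), N|now apply analytic_at_gamma_fn].
  - intros w Hw. apply Gamma_eq_right. lra.
Qed.

(** * The functional equation and the digamma function *)

Lemma csum_shift (u : nat -> C) (n : nat) : csum u (S n) = (u 0%nat + csum (fun k => u (S k)) n)%C.
Proof. induction n as [|n IH]; [rewrite csum_S, !csum_0; ring|rewrite csum_S, IH, csum_S; ring]. Qed.

Lemma CSer_shift (u : nat -> C) (b : nat -> R) : (forall n, Cmod (u n) <= b n) -> ex_series b ->
  CSer (fun n => u (S n)) = (CSer u - u 0%nat)%C.
Proof.
  intros H E. apply CSer_unique. pose proof (CSer_lim u b H E) as L.
  apply is_cseq_ext with (fun n => (csum u (S n) - u 0%nat)%C).
  - intro n. rewrite csum_shift. ring.
  - apply is_cseq_minus; [|apply is_cseq_const]. intros eps He. destruct (L eps He) as [N HN].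
    exists N. intros n Hn. apply HN. lia.
Qed.

Lemma CSer_single (u : nat -> C) (r : nat) : (forall n, n <> r -> u n = 0) -> CSer u = u r.
Proof.
  intro H. apply CSer_unique. intros eps He. exists r. intros n Hn.
  assert (E : csum u n = u r).
  { assert (Z : forall m, (m < r)%nat -> csum u m = 0).
    { induction m as [|m IH]; intro Hm; [rewrite csum_0; apply H; lia|].
      rewrite csum_S, IH, H by lia. ring. }
    induction Hn as [|n Hn IH].
    - destruct r as [|r]; [apply csum_0|]. rewrite csum_S, Z by lia. ring.
    - rewrite csum_S, IH, (H (S n)) by lia. ring. }
  rewrite E. replace (u r - u r)%C with (RtoC 0) by ring. now rewrite Cmod_0.
Qed.

(** Restores the residue that the convention [/ 0 = 0] removes; it is nonzero only at the index [n]
    with [s = - n], if there is one. *)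
Definition resonant_residue (s : C) (n : nat) : C :=
  if excluded_middle_informative ((s + RtoC (INR n))%C = 0) then RtoC (gamma_residue n) else 0.

Lemma gamma_residue_S (n : nat) : gamma_residue n = - INR (S n) * gamma_residue (S n).
Proof.
  unfold gamma_residue. rewrite fact_simpl, mult_INR. simpl pow. field.
  split; [apply INR_fact_neq_0|apply not_0_INR; lia].
Qed.

Lemma Cmod_resonant_residue (s : C) (n : nat) : Cmod (resonant_residue s n) <= 1 ^ n / INR (fact n).
Proof.
  unfold resonant_residue. rewrite pow1. destruct (excluded_middle_informative _).
  - rewrite Cmod_R, gamma_residue_abs. unfold Rdiv; lra.
  - rewrite Cmod_0. apply Rdiv_le_0_compat; [lra|apply INR_fact_lt_0].
Qed.

Lemma exp_neg_series (y : R) : is_cseq (csum (fun n => RtoC (gamma_residue n * y ^ n))) (RtoC (exp (- y))).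
Proof.
  apply is_cseq_le with (fun N => (/ 2) ^ S N * exp (3 * Cmod (RtoC (- y)))); [|apply is_lim_seq_half_pow].
  intro N. rewrite Cmod_minus_sym, <- cexp_R.
  replace (csum (fun n => RtoC (gamma_residue n * y ^ n)) N) with (csum (exp_term (RtoC (- y))) N); [apply exp_rem_geom|].
  apply csum_ext. intros n _. unfold exp_term, gamma_residue. rewrite <- RtoC_pow, <- RtoC_mult. f_equal.
  replace (- y) with ((-1) * y) by ring. rewrite Rpow_mult_distr. unfold Rdiv; ring.
Qed.

(* Termwise, [- m x^(s+m)/(s+m) = s x^(s+m)/(s+m) - x^(s+m)] off the resonance [s = - m]. *)
Lemma powexp_series_succ (s : C) (y : R) : 0 < y ->
  powexp_series s 1 1 y = (s * powexp_series (s - 1) 1 1 y - cexp (s * RtoC (ln y)) * RtoC (exp (- y)) + CSer (resonant_residue s))%C.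
Proof.
  intro Hy. set (u := powexp_term (s - 1) 1 1 y).
  set (v := fun m => (s * u m - cexp (s * RtoC (ln y)) * RtoC (gamma_residue m * y ^ m) + resonant_residue s m)%C).
  assert (Ey : forall m, cexp ((s + RtoC (INR m)) * RtoC (ln y)) = (cexp (s * RtoC (ln y)) * RtoC (y ^ m))%C).
  { intro m. rewrite Cmult_plus_distr_r, cexp_plus, <- RtoC_mult, cexp_R, exp_ln_pow by exact Hy. reflexivity. }
  assert (Ev : forall m, v m = (- RtoC (INR m) * u m)%C).
  { intro m. unfold v, u, powexp_term, power_primitive, resonant_residue. rewrite pow1, Rmult_1_r, Rmult_1_l.
    replace (s - 1 + 1 + RtoC (INR m))%C with (s + RtoC (INR m))%C by ring. rewrite Ey.
    destruct (excluded_middle_informative _) as [E|N].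
    - assert (Es : s = (- RtoC (INR m))%C) by (replace s with (s + RtoC (INR m) - RtoC (INR m))%C by ring; rewrite E; ring).
      rewrite E, Cinv_0. rewrite Es at 1.
      assert (E1 : (cexp (s * RtoC (ln y)) * RtoC (y ^ m))%C = 1) by (rewrite <- Ey, E, Cmult_0_l; apply cexp_0).
      rewrite (RtoC_mult (gamma_residue m) (y ^ m)).
      replace (cexp (s * RtoC (ln y)) * (RtoC (gamma_residue m) * RtoC (y ^ m)))%C with (RtoC (gamma_residue m) * (cexp (s * RtoC (ln y)) * RtoC (y ^ m)))%C by ring.
      rewrite E1. ring.
    - rewrite RtoC_mult. field. exact N. }
  destruct (powexp_term_bound (s - 1) 1 Rlt_0_1) as [c [Hc Hb]].
  assert (Lu : is_cseq (csum u) (powexp_series (s - 1) 1 1 y)) by (apply powexp_series_lim; lra).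
  assert (Lr : is_cseq (csum (resonant_residue s)) (CSer (resonant_residue s))) by (eapply CSer_lim; [apply Cmod_resonant_residue|apply ex_series_exp]).
  assert (Lv : is_cseq (csum v) (s * powexp_series (s - 1) 1 1 y - cexp (s * RtoC (ln y)) * RtoC (exp (- y)) + CSer (resonant_residue s))%C).
  { eapply is_cseq_ext; [|apply is_cseq_plus; [apply is_cseq_minus; [apply (is_cseq_scal s), Lu|apply (is_cseq_scal (cexp (s * RtoC (ln y)))), exp_neg_series]|exact Lr]].
    intro N. cbv beta. rewrite <- !csum_scal. induction N; [rewrite !csum_0|rewrite !csum_S, <- IHN]; unfold v; ring. }
  assert (L1 : is_cseq (csum (fun n => v (S n))) (s * powexp_series (s - 1) 1 1 y - cexp (s * RtoC (ln y)) * RtoC (exp (- y)) + CSer (resonant_residue s))%C).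
  (* The term of index [0] carries the factor [- INR 0], so shifting the index by one loses
     nothing. *)
  { intros eps He. destruct (Lv eps He) as [N HN]. exists N. intros n Hn. specialize (HN (S n) ltac:(lia)).
    rewrite csum_shift in HN. rewrite (Ev 0%nat) in HN. simpl INR in HN.
    replace (- RtoC 0 * u 0%nat + csum (fun k => v (S k)) n)%C with (csum (fun k => v (S k)) n) in HN by ring. exact HN. }
  eapply is_cseq_unique; [apply powexp_series_lim; lra|]. eapply is_cseq_ext; [|exact L1].
  intro N. apply csum_ext. intros n _. rewrite Ev. unfold u, powexp_term.
  rewrite !pow1, !Rmult_1_r, !Rmult_1_l. rewrite (gamma_residue_S n), RtoC_mult, RtoC_opp.
  replace (s - 1 + 1 + RtoC (INR (S n)))%C with (s + 1 + RtoC (INR n))%C by (rewrite S_INR, RtoC_plus; ring). ring.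
Qed.

(** Limit at infinity of the recursion for the incomplete series, whose boundary term
    [y^s exp (- y)] dies out. At [s = - n] it relates finite parts: multiplying the pole by
    [s = - n + (s + n)] releases one residue. *)
Lemma gamma_fn_succ (s : C) : gamma_fn (s + 1) = (s * gamma_fn s + CSer (resonant_residue s))%C.
Proof.
  eapply is_clim_unique; [apply powexp_series_gamma_fn|].
  replace (s * gamma_fn s + CSer (resonant_residue s))%C with (s * gamma_fn s + (CSer (resonant_residue s) + - (1) * 0))%C by ring.
  assert (K : is_clim (fun y => (s * powexp_series (s - 1) 1 1 y + (CSer (resonant_residue s) + - (1) * (cexp (s * RtoC (ln y)) * RtoC (exp (- y)))))%C)
     (s * gamma_fn s + (CSer (resonant_residue s) + - (1) * 0))%C).
  { apply is_clim_plus; [apply is_clim_scal, powexp_series_gamma_fn|]. apply is_clim_plus.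
    - intros eps He. exists 0. intros _ _. replace (CSer (resonant_residue s) - CSer (resonant_residue s))%C with (RtoC 0) by ring. now rewrite Cmod_0.
    - apply is_clim_scal. intros eps He.
      destruct (ln_linear_bound (Rabs (Re s)) (/ 2)) as [K HK]; [apply Rabs_pos|lra|].
      (* The exponent satisfies [Re s * ln y - y <= K - y / 2], which is below [ln eps] once
         [y > 2 (K - ln eps)]. *)
      exists (Rmax 1 (2 * (K - ln eps) + 1)). intros y Hy.
      pose proof (Rmax_l 1 (2 * (K - ln eps) + 1)). pose proof (Rmax_r 1 (2 * (K - ln eps) + 1)).
      replace (cexp (s * RtoC (ln y)) * RtoC (exp (- y)) - 0)%C with (cexp (s * RtoC (ln y)) * RtoC (exp (- y)))%C by ring.
      rewrite Cmod_mult, Cmod_cexp, Cmod_R, Rabs_pos_eq by (left; apply exp_pos). rewrite <- exp_plus.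
      rewrite <- (exp_ln eps) by exact He. apply exp_increasing.
      replace (Re (s * RtoC (ln y))) with (Re s * ln y) by (unfold Re, Cmult, RtoC; simpl; ring).
      assert (0 <= ln y) by (rewrite <- ln_1; apply ln_le; lra).
      specialize (HK y ltac:(lra)). pose proof (Rle_abs (Re s)). nra. }
  intros eps He. destruct (K eps He) as [M HM]. exists (Rmax 1 M). intros y Hy.
  pose proof (Rmax_l 1 M). pose proof (Rmax_r 1 M).
  replace (s + 1 - 1)%C with s by ring. rewrite powexp_series_succ by lra.
  specialize (HM y ltac:(lra)).
  match goal with H : Cmod ?x < eps |- Cmod ?y < eps => replace y with x by ring; exact H end.
Qed.

Lemma CSer_resonant_none (s : C) : (forall n : nat, (s + RtoC (INR n))%C <> 0) -> CSer (resonant_residue s) = 0.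
Proof.
  intro H. assert (E : forall n, resonant_residue s n = 0).
  { intro n. unfold resonant_residue. destruct (excluded_middle_informative _) as [E|_]; [destruct (H n E)|reflexivity]. }
  rewrite (CSer_single _ 0%nat); auto.
Qed.

Lemma CSer_resonant_neg (r : nat) : CSer (resonant_residue (RtoC (- INR r))) = RtoC (gamma_residue r).
Proof.
  rewrite (CSer_single _ r); unfold resonant_residue.
  - destruct (excluded_middle_informative _) as [_|N]; [reflexivity|]. destruct N. rewrite RtoC_opp. ring.
  - intros n Hn. destruct (excluded_middle_informative _) as [E|_]; [|reflexivity].
    rewrite <- RtoC_plus in E. apply RtoC_inj in E. destruct Hn. apply INR_eq. lra.
Qed.

Lemma gamma_fn_succ_pos (x : R) : 0 < x -> gamma_fn (RtoC (x + 1)) = (RtoC x * gamma_fn (RtoC x))%C.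
Proof.
  intro Hx. rewrite RtoC_plus, gamma_fn_succ, CSer_resonant_none; [ring|].
  intros n E. rewrite <- RtoC_plus in E. apply RtoC_inj in E. pose proof (pos_INR n). lra.
Qed.

(** * Gamma on the positive axis, its logarithmic convexity and digamma *)

Definition gamma_re (x : R) : R := Re (gamma_fn (RtoC x)).

(** Proper integrals exhausting the half-line; inequalities between integrands are integrated here
    and then passed to the limit. *)
Definition gamma_trunc (x : R) (n : nat) : R := RInt (fun t => Rpower t (x - 1) * exp (- t)) (/ INR (S n)) (INR (S n)).

Lemma inv_INR_S_le (n : nat) : 0 < / INR (S n) <= INR (S n).
Proof.
  assert (1 <= INR (S n)) by (rewrite S_INR; pose proof (pos_INR n); lra).
  split; [apply Rinv_0_lt_compat; lra|]. apply Rle_trans with 1; [|assumption].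
  rewrite <- Rinv_1. apply Rinv_le_contravar; lra.
Qed.

Lemma ex_RInt_gamma (x a b : R) : 0 < a <= b -> ex_RInt (fun t => Rpower t (x - 1) * exp (- t)) a b.
Proof.
  intros H. apply (ex_RInt_continuous (V := R_CompleteNormedModule)). intros t Ht. rewrite Rmin_left in Ht by lra.
  eapply is_derive_continuous. unfold Rpower. auto_derive; [lra|reflexivity].
Qed.

Lemma gamma_trunc_lim (x : R) : 0 < x ->
  is_lim_seq (gamma_trunc x) (gamma_re x) /\ gamma_fn (RtoC x) = RtoC (gamma_re x).
Proof.
  intro Hx.
  set (u := fun n => CRInt (powexp (RtoC x - 1) 1 1) (/ INR (S n)) (INR (S n))).
  assert (L : is_cseq u (gamma_fn (RtoC x))).
  { intros eps He.
    destruct (powexp_series_at_0 (RtoC x) Hx (eps / 2) ltac:(lra)) as [d [Hd H0]].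
    destruct (powexp_series_gamma_fn (RtoC x) (eps / 2) ltac:(lra)) as [M HM].
    destruct (archimed (Rmax M (/ d))) as [Ha _]. exists (Z.to_nat (up (Rmax M (/ d)))). intros n Hn.
    assert (Hn' : Rmax M (/ d) < INR (S n)).
    { eapply Rlt_le_trans; [exact Ha|]. rewrite INR_IZR_INZ. apply IZR_le. lia. }
    pose proof (Rmax_l M (/ d)). pose proof (Rmax_r M (/ d)). pose proof (inv_INR_S_le n).
    assert (Hd' : / INR (S n) < d).
    { rewrite <- (Rinv_inv d). apply Rinv_lt_contravar; [|lra]. apply Rmult_lt_0_compat; [now apply Rinv_0_lt_compat|].
      pose proof (Rinv_0_lt_compat d Hd). lra. }
    unfold u. rewrite CRInt_powexp_series by lra.
    pose proof (H0 (/ INR (S n)) ltac:(lra)). pose proof (HM (INR (S n)) ltac:(lra)).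
    set (p1 := powexp_series (RtoC x - 1) 1 1 (INR (S n))) in *. set (p2 := powexp_series (RtoC x - 1) 1 1 (/ INR (S n))) in *.
    replace (p1 - p2 - gamma_fn (RtoC x))%C with ((p1 - gamma_fn (RtoC x)) + - p2)%C by ring.
    eapply Rle_lt_trans; [apply Cmod_triangle|]. rewrite Cmod_opp. lra. }
  assert (Eu : forall n, u n = RtoC (gamma_trunc x n)).
  { intro n. pose proof (inv_INR_S_le n) as Hn. unfold u, gamma_trunc.
    rewrite (CRInt_ext _ (fun t => RtoC (Rpower t (x - 1) * exp (- t)))); [|lra|].
    - unfold CRInt, RtoC. f_equal. unfold Im; simpl. rewrite RInt_const. unfold scal; simpl; unfold mult; simpl. ring.
    - intros t Ht. unfold powexp. rewrite Rpower_1, Rmult_1_l by lra.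
      rewrite <- RtoC_minus, <- RtoC_mult, cexp_R, <- RtoC_mult. reflexivity. }
  split.
  - apply is_lim_seq_ext with (fun n => Re (u n)); [intro n; now rewrite Eu|]. apply is_cseq_re, L.
  - apply is_cseq_im in L. unfold gamma_re. 
    assert (Z : Im (gamma_fn (RtoC x)) = 0).
    { apply is_lim_seq_unique in L. rewrite (Lim_seq_ext _ (fun _ => 0)) in L by (intro n; now rewrite Eu).
      rewrite Lim_seq_const in L. injection L. auto. }
    rewrite (surjective_pairing (gamma_fn (RtoC x))). unfold RtoC, Re, Im in *. f_equal. exact Z.
Qed.

Lemma gamma_re_succ (x : R) : 0 < x -> gamma_re (x + 1) = x * gamma_re x.
Proof.
  intro Hx. unfold gamma_re at 1. rewrite gamma_fn_succ_pos by exact Hx.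
  unfold gamma_re, Re, Cmult, RtoC; simpl. ring.
Qed.

Lemma gamma_re_pos (x : R) : 0 < x -> 0 < gamma_re x.
Proof.
  intro Hx. destruct (gamma_trunc_lim x Hx) as [L _].
  assert (P : 0 < RInt (fun t => Rpower t (x - 1) * exp (- t)) 1 2).
  { apply RInt_gt_0; [lra| |].
    - intros t Ht. apply Rmult_lt_0_compat; apply exp_pos.
    - intros t Ht. eapply is_derive_continuous. unfold Rpower. auto_derive; [lra|reflexivity]. }
  eapply Rlt_le_trans; [exact P|].
  assert (M : Rbar_le (RInt (fun t => Rpower t (x - 1) * exp (- t)) 1 2) (gamma_re x)); [|exact M].
  eapply is_lim_seq_le_loc; [|apply is_lim_seq_const|exact L]. exists 1%nat. intros n Hn.
  assert (2 <= INR (S n)) by (change 2 with (INR 2); apply le_INR; lia).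
  assert (0 < / INR (S n) <= 1). { split; [apply Rinv_0_lt_compat; lra|]. rewrite <- Rinv_1. apply Rinv_le_contravar; lra. }
  unfold gamma_trunc. rewrite (RInt_Chasles_R _ (/ INR (S n)) 1 (INR (S n))) by (apply ex_RInt_gamma; lra).
  rewrite (RInt_Chasles_R _ 1 2 (INR (S n))) by (apply ex_RInt_gamma; lra).
  assert (G : forall a b, 0 < a <= b -> 0 <= RInt (fun t => Rpower t (x - 1) * exp (- t)) a b).
  { intros a b Hab. apply RInt_ge_0; [lra|now apply ex_RInt_gamma|]. intros t Ht. apply Rmult_le_pos; left; apply exp_pos. }
  pose proof (G (/ INR (S n)) 1 ltac:(lra)). pose proof (G 2 (INR (S n)) ltac:(lra)).
  lra.
Qed.

(** With [A = exp (h L)], the tangent inequalities read [A (1 - h L) <= 1] and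
    [A (1 + (1 - h) L) <= exp L]; adding them with weights [1 - h] and [h] cancels [L]. *)
Lemma exp_young (L h : R) : 0 <= h <= 1 -> exp (h * L) <= 1 - h + h * exp L.
Proof.
  intro Hh. pose proof (exp_ineq1_le ((1 - h) * L)) as H1. pose proof (exp_ineq1_le (- h * L)) as H2.
  assert (E1 : exp L = exp (h * L) * exp ((1 - h) * L)) by (rewrite <- exp_plus; f_equal; ring).
  assert (E2 : 1 = exp (h * L) * exp (- h * L)) by (rewrite <- exp_plus, <- exp_0; f_equal; ring).
  pose proof (exp_pos (h * L)) as P. set (A := exp (h * L)) in *.
  rewrite E1. 
  assert (K1 : A * (1 + (1 - h) * L) <= A * exp ((1 - h) * L)) by (apply Rmult_le_compat_l; lra).
  assert (K2 : A * (1 + - h * L) <= 1) by (rewrite E2; apply Rmult_le_compat_l; lra).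
  nra.
Qed.

(* Young's inequality [(t/x)^h <= 1 - h + h t/x] integrated against [t^(x-1) e^-t]. *)
Lemma gamma_re_log_convex (x h : R) : 0 < x -> 0 <= h <= 1 -> gamma_re (x + h) <= Rpower x h * gamma_re x.
Proof.
  intros Hx Hh.
  destruct (gamma_trunc_lim x Hx) as [L0 _]. destruct (gamma_trunc_lim (x + 1)) as [L1 _]; [lra|].
  destruct (gamma_trunc_lim (x + h)) as [Lh _]; [lra|]. rewrite gamma_re_succ in L1 by exact Hx.
  assert (E : Rpower x h * gamma_re x = Rpower x h * ((1 - h) * gamma_re x + h / x * (x * gamma_re x))) by (field; lra).
  rewrite E.
  assert (M : Rbar_le (gamma_re (x + h)) (Rpower x h * ((1 - h) * gamma_re x + h / x * (x * gamma_re x)))); [|exact M].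
  assert (L2 : is_lim_seq (fun n => Rpower x h * ((1 - h) * gamma_trunc x n + h / x * gamma_trunc (x + 1) n))
     (Rpower x h * ((1 - h) * gamma_re x + h / x * (x * gamma_re x)))).
  { apply (is_lim_seq_scal_l (fun n => (1 - h) * gamma_trunc x n + h / x * gamma_trunc (x + 1) n) (Rpower x h) (Finite ((1 - h) * gamma_re x + h / x * (x * gamma_re x)))).
    apply is_lim_seq_plus'.
    - apply (is_lim_seq_scal_l (gamma_trunc x) (1 - h) (Finite (gamma_re x))), L0.
    - apply (is_lim_seq_scal_l (gamma_trunc (x + 1)) (h / x) (Finite (x * gamma_re x))), L1. }
  eapply is_lim_seq_le; [|exact Lh|exact L2].
  intro n. cbv beta. pose proof (inv_INR_S_le n) as Hn. unfold gamma_trunc.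
  rewrite <- !RInt_scal_R by (apply ex_RInt_gamma; lra).
  rewrite <- RInt_plus_R by (apply ex_RInt_scal_R, ex_RInt_gamma; lra).
  rewrite <- RInt_scal_R by (apply ex_RInt_plus_R; apply ex_RInt_scal_R, ex_RInt_gamma; lra).
  apply RInt_le; [lra|apply ex_RInt_gamma; lra| |].
  - apply ex_RInt_scal_R, ex_RInt_plus_R; apply ex_RInt_scal_R, ex_RInt_gamma; lra.
  - intros t Ht. assert (Pt : 0 < t) by lra.
    replace (x + h - 1) with (h + (x - 1)) by ring. replace (x + 1 - 1) with (1 + (x - 1)) by ring.
    rewrite !(Rpower_plus _ (x - 1)), Rpower_1 by exact Pt.
    pose proof (exp_young (ln t - ln x) h Hh) as Y.
    assert (E1 : exp (h * (ln t - ln x)) * Rpower x h = Rpower t h).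
    { unfold Rpower. rewrite <- exp_plus. f_equal. ring. }
    assert (E2 : exp (ln t - ln x) = t / x). { unfold Rminus. rewrite exp_plus, exp_Ropp, !exp_ln by lra. reflexivity. }
    rewrite E2 in Y. rewrite <- E1.
    assert (P0 : 0 < Rpower x h) by apply exp_pos.
    assert (P1 : 0 < Rpower t (x - 1) * exp (- t)) by (apply Rmult_lt_0_compat; apply exp_pos).
    replace (Rpower x h * ((1 - h) * (Rpower t (x - 1) * exp (- t)) + h / x * (t * Rpower t (x - 1) * exp (- t)))) with
      ((1 - h + h * (t / x)) * (Rpower x h * (Rpower t (x - 1) * exp (- t)))) by (field; lra).
    replace (exp (h * (ln t - ln x)) * Rpower x h * Rpower t (x - 1) * exp (- t)) with
      (exp (h * (ln t - ln x)) * (Rpower x h * (Rpower t (x - 1) * exp (- t)))) by ring.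
    apply Rmult_le_compat_r; [|exact Y]. apply Rmult_le_pos; lra.
Qed.

Lemma gamma_re_derive (x : R) : 0 < x -> exists l : R, is_derive gamma_re x l /\
  C_derive gamma_fn (RtoC x) = RtoC l /\ C_derive Gamma (RtoC x) = RtoC l.
Proof.
  intro Hx.
  assert (A : analytic_at gamma_fn (RtoC x)).
  { apply analytic_at_gamma_fn. intros n E. apply RtoC_inj in E. pose proof (pos_INR n). lra. }
  destruct (analytic_at_cderive _ _ A) as [[l m] [D1 D2]]. simpl in D1, D2.
  assert (Loc : locally x (fun t => 0 < t)).
  { exists (mkposreal x Hx). intros t Ht. unfold ball in Ht; simpl in Ht; unfold AbsRing_ball, abs, minus, plus, opp in Ht; simpl in Ht.
    apply Rabs_def2 in Ht. lra. }
  assert (Em : m = 0).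
  { rewrite <- (is_derive_unique _ _ _ D2). transitivity (Derive (fun _ => 0) x); [|apply Derive_const].
    apply Derive_ext_loc. eapply filter_imp; [|exact Loc]. intros t Ht. destruct (gamma_trunc_lim t Ht) as [_ E]. change (Im (gamma_fn (RtoC t)) = 0). rewrite E. reflexivity. }
  subst m. exists l. split; [exact D1|].
  split; [apply C_derive_real; split; assumption|]. apply C_derive_real. split.
  - eapply is_derive_ext_loc; [|exact D1]. eapply filter_imp; [|exact Loc]. intros t Ht. cbv beta. rewrite (Gamma_eq_right (RtoC t)) by exact Ht. reflexivity.
  - eapply is_derive_ext_loc; [|exact D2]. eapply filter_imp; [|exact Loc]. intros t Ht. cbv beta. rewrite (Gamma_eq_right (RtoC t)) by exact Ht. reflexivity.
Qed.

Definition digamma (x : R) : R := Derive gamma_re x / gamma_re x.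

Lemma is_derive_gamma_re (x : R) : 0 < x -> is_derive gamma_re x (gamma_re x * digamma x).
Proof.
  intro Hx. destruct (gamma_re_derive x Hx) as [l [D _]]. unfold digamma. rewrite (is_derive_unique _ _ _ D).
  eapply is_derive_eq; [exact D|]. pose proof (gamma_re_pos x Hx). field. lra.
Qed.

Lemma Gamma_logderiv (x : R) : 0 < x -> (C_derive Gamma (RtoC x) / Gamma (RtoC x))%C = RtoC (digamma x).
Proof.
  intro Hx. destruct (gamma_re_derive x Hx) as [l [D [_ E]]]. rewrite E.
  rewrite Gamma_eq_right by exact Hx. destruct (gamma_trunc_lim x Hx) as [_ ->].
  unfold digamma. rewrite (is_derive_unique _ _ _ D). symmetry. apply RtoC_div.
  pose proof (gamma_re_pos x Hx). lra.
Qed.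

Lemma digamma_succ (x : R) : 0 < x -> digamma (x + 1) = digamma x + / x.
Proof.
  intro Hx. pose proof (gamma_re_pos x Hx) as P.
  assert (D1 : is_derive (fun t => gamma_re (t + 1)) x (gamma_re (x + 1) * digamma (x + 1))).
  { eapply is_derive_eq; [apply (is_derive_comp (K := R_AbsRing) (V := R_NormedModule) gamma_re (fun t => t + 1)); [apply is_derive_gamma_re; lra|auto_derive; trivial]|].
    unfold scal; simpl; unfold mult; simpl. ring. }
  assert (D2 : is_derive (fun t => gamma_re (t + 1)) x (gamma_re x + x * (gamma_re x * digamma x))).
  { apply is_derive_ext_loc with (fun t => t * gamma_re t).
    - exists (mkposreal x Hx). intros t Ht. unfold ball in Ht; simpl in Ht; unfold AbsRing_ball, abs, minus, plus, opp in Ht; simpl in Ht.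
      apply Rabs_def2 in Ht. symmetry. apply gamma_re_succ. lra.
    - eapply is_derive_eq; [apply (is_derive_mult (K := R_AbsRing)); [apply is_derive_id|now apply is_derive_gamma_re|apply Rmult_comm]|].
      unfold plus, mult, one; simpl. ring. }
  pose proof (is_derive_unique _ _ _ D1) as E1. rewrite (is_derive_unique _ _ _ D2), gamma_re_succ in E1 by exact Hx.
  apply Rmult_eq_reg_l with (x * gamma_re x); [|apply Rgt_not_eq, Rmult_lt_0_compat; assumption].
  rewrite <- E1. field. lra.
Qed.

Lemma derive_ge_0_right (f : R -> R) (x l d : R) : 0 < d -> is_derive f x l -> f x = 0 ->
  (forall h, 0 < h < d -> 0 <= f (x + h)) -> 0 <= l.
Proof.
  intros Hd D E H. apply is_derive_Reals in D. apply Rnot_lt_le. intro Hl.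
  destruct (D (- l) ltac:(lra)) as [e He].
  set (h := Rmin d e / 2).
  assert (Pm : 0 < Rmin d e) by (apply Rmin_glb_lt; [exact Hd|apply cond_pos]).
  pose proof (Rmin_l d e). pose proof (Rmin_r d e).
  specialize (He h ltac:(unfold h; lra) ltac:(rewrite Rabs_pos_eq; unfold h; lra)).
  specialize (H h ltac:(unfold h; lra)). rewrite E in He. apply Rabs_def2 in He.
  assert (0 <= (f (x + h) - 0) / h) by (apply Rdiv_le_0_compat; [lra|unfold h; lra]). lra.
Qed.

(** [gamma_re (x + h) <= x^h gamma_re x] is an equality at [h = 0], so the inequality passes to the
    right derivatives there. *)
Lemma digamma_le_ln (x : R) : 0 < x -> digamma x <= ln x.
Proof.
  intro Hx. pose proof (gamma_re_pos x Hx) as P.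
  assert (0 <= gamma_re x * ln x - gamma_re x * digamma x).
  { apply (derive_ge_0_right (fun t => gamma_re x * exp ((t - x) * ln x) - gamma_re t) x _ 1); [lra| | |].
    - apply (is_derive_minus (V := R_NormedModule)); [|now apply is_derive_gamma_re].
      auto_derive; trivial. replace ((x + - x) * ln x) with 0 by ring. rewrite exp_0. ring.
    - rewrite Rminus_diag, Rmult_0_l, exp_0. ring.
    - intros h Hh. pose proof (gamma_re_log_convex x h Hx ltac:(lra)) as G. unfold Rpower in G.
      replace (x + h - x) with h by ring. lra. }
  apply Rmult_le_reg_l with (gamma_re x); lra.
Qed.

(** The same argument based at [x + h]: log-convexity gives [x gamma_re x = gamma_re (x + 1) <= (x +
    h)^(1-h) gamma_re (x + h)], again with equality at [h = 0]. *)
Lemma digamma_ge_ln (x : R) : 0 < x -> ln x - / x <= digamma x.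
Proof.
  intro Hx. pose proof (gamma_re_pos x Hx) as P.
  assert (0 <= x * (/ x - ln x) * gamma_re x + x * (gamma_re x * digamma x)).
  { apply (derive_ge_0_right (fun t => exp ((1 - (t - x)) * ln t) * gamma_re t - x * gamma_re x) x _ 1); [lra| | |].
    - eapply is_derive_eq; [apply (is_derive_minus (V := R_NormedModule)); [apply (is_derive_mult (K := R_AbsRing) (fun t => exp ((1 - (t - x)) * ln t)) gamma_re x);
        [|now apply is_derive_gamma_re|apply Rmult_comm]|apply (is_derive_const (V := R_NormedModule))]|].
      + auto_derive; [exact Hx|reflexivity].
      + unfold minus, plus, opp, mult, zero; simpl. replace ((1 + - (x + - x)) * ln x) with (ln x) by ring. replace ((1 - (x - x)) * ln x) with (ln x) by ring.
        rewrite exp_ln by exact Hx. field. lra.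
    - replace ((1 - (x - x)) * ln x) with (ln x) by ring. rewrite exp_ln by exact Hx. ring.
    - intros h Hh. pose proof (gamma_re_log_convex (x + h) (1 - h) ltac:(lra) ltac:(lra)) as G. unfold Rpower in G.
      replace (x + h + (1 - h)) with (x + 1) in G by ring. rewrite gamma_re_succ in G by exact Hx.
      replace (1 - (x + h - x)) with (1 - h) by ring. lra. }
  apply Rmult_le_reg_l with (x * gamma_re x); [now apply Rmult_lt_0_compat|].
  replace (x * gamma_re x * (ln x - / x)) with (- (x * (/ x - ln x) * gamma_re x)) by ring.
  lra.
Qed.

Lemma digamma_sum (a : R) (K : nat) : 0 < a -> digamma (a + INR (S K)) = digamma a + sum_n (fun k => / (INR k + a)) K.
Proof.
  intro Ha. induction K as [|K IH].
  - rewrite sum_O. simpl INR. rewrite digamma_succ, Rplus_0_l by exact Ha. reflexivity.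
  - rewrite sum_n_S, (S_INR (S K)), <- Rplus_assoc, digamma_succ, IH by (pose proof (pos_INR (S K)); lra).
    rewrite (Rplus_comm (INR (S K)) a). ring.
Qed.

(** At [x = a + K + 1] the two bounds pin [digamma x] to [ln x] within [1 / x], and the recursion
    leads back to [a]. The same limit reappears as the constant term of the Hurwitz zeta function at
    [1], up to sign. *)
Lemma digamma_lim (a : R) : 0 < a ->
  is_lim_seq (fun K => ln (a + INR (S K)) - sum_n (fun k => / (INR k + a)) K) (digamma a).
Proof.
  intro Ha.
  assert (B : forall K, 0 < a + INR (S K)) by (intro K; pose proof (pos_INR (S K)); lra).
  assert (L0 : is_lim_seq (fun K => / (a + INR (S K))) 0).
  { apply (is_lim_seq_inv _ p_infty); [|discriminate]. 
    apply is_lim_seq_plus with a p_infty; [apply is_lim_seq_const|apply (is_lim_seq_incr_1 INR), is_lim_seq_INR|reflexivity]. }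
  assert (L1 : is_lim_seq (fun K => digamma a + / (a + INR (S K))) (digamma a)).
  { pose proof (is_lim_seq_plus' _ _ _ _ (is_lim_seq_const (digamma a)) L0) as H.
    rewrite Rplus_0_r in H. exact H. }
  apply is_lim_seq_le_le with (fun _ => digamma a) (fun K => digamma a + / (a + INR (S K))).
  - intro K. pose proof (digamma_sum a K Ha) as E. pose proof (digamma_le_ln _ (B K)). pose proof (digamma_ge_ln _ (B K)).
    set (S1 := sum_n (fun k => / (INR k + a)) K) in *. lra.
  - apply is_lim_seq_const.
  - exact L1.
Qed.

(** At [s = 0] the product in the functional equation vanishes and the residue of Gamma at [0]
    remains. *)
Lemma gamma_fn_1 : gamma_fn 1 = 1.
Proof.
  replace (gamma_fn 1) with (gamma_fn (0 + 1)) by (f_equal; ring).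
  pose proof (CSer_resonant_neg 0) as E. simpl INR in E. rewrite Ropp_0 in E.
  rewrite gamma_fn_succ, E. unfold gamma_residue. simpl. replace (1 / 1) with 1 by field. ring.
Qed.

Lemma gamma_re_fact (r : nat) : gamma_re (INR r + 1) = INR (fact r).
Proof.
  induction r as [|r IH].
  - simpl INR. rewrite Rplus_0_l. unfold gamma_re. rewrite gamma_fn_1. reflexivity.
  - rewrite S_INR at 1. rewrite gamma_re_succ, IH by (pose proof (pos_INR r); lra).
    rewrite fact_simpl, mult_INR, S_INR. reflexivity.
Qed.

(* [Gamma(x) = (x - 1) Gamma(x - 1)] turns the difference quotient of Gamma at [1] into the regular part of Gamma near [0]. *)
Lemma gamma_fn_0 : gamma_fn 0 = RtoC (digamma 1).
Proof.
  (* [d0] removes the pole at the origin, so [reg] is Gamma minus [1 / s], analytic near [0]. *)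
  set (d0 := fun n => if Nat.eqb n 0 then RtoC 0 else RtoC (gamma_residue n)).
  set (reg := fun s => (CSer (fun n => d0 n / (s - (- RtoC (INR n))))%C + upper_gamma s)%C).
  assert (Hd0 : forall n, Cmod (d0 n) <= Cmod (RtoC (gamma_residue n))).
  { intro n. unfold d0. destruct (Nat.eqb n 0); [rewrite Cmod_0; apply Cmod_ge_0|lra]. }
  assert (A : analytic_at reg 0).
  { apply analytic_at_plus; [|apply analytic_at_upper_gamma].
    apply (analytic_at_poles d0 (fun n => (- RtoC (INR n))%C) 0 1 Rlt_0_1).
    - apply (ex_series_le (V := R_CompleteNormedModule)) with (fun n => Cmod (RtoC (gamma_residue n))); [|apply ex_series_gamma_residue].
      intro n. unfold norm; simpl. unfold abs; simpl. rewrite Rabs_pos_eq by apply Cmod_ge_0. apply Hd0.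
    - intros [|n]; [now left|right]. replace (0 - - RtoC (INR (S n)))%C with (RtoC (INR (S n))) by ring.
      rewrite Cmod_R, S_INR. pose proof (pos_INR n). rewrite Rabs_pos_eq; lra. }
  assert (R0 : reg 0 = gamma_fn 0).
  { unfold reg, gamma_fn. f_equal. apply CSer_ext. intros [|n]; [|reflexivity]. unfold d0, Cdiv. simpl.
    replace (0 - - RtoC 0)%C with (RtoC 0) by ring. rewrite Cinv_0. ring. }
  assert (R1 : forall h, -1 < h < 1 -> h <> 0 -> gamma_fn (RtoC h) = (reg (RtoC h) + / RtoC h)%C).
  { intros h Hh Nh. unfold reg, gamma_fn.
    assert (E : CSer (fun n => RtoC (gamma_residue n) / (RtoC h - (- RtoC (INR n))))%C =
      (CSer (fun n => d0 n / (RtoC h - (- RtoC (INR n)))) + / RtoC h)%C); [|rewrite E; ring].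
    destruct (pole_gap (RtoC h) 1 Rlt_0_1) as [c [Hc Gp]].
    assert (Bd : forall d : nat -> C, (forall n, Cmod (d n) <= Cmod (RtoC (gamma_residue n))) ->
       forall n, Cmod (d n / (RtoC h - (- RtoC (INR n)))) <= / c * Cmod (RtoC (gamma_residue n))).
    { intros d Hd n. unfold Cdiv. rewrite Cmod_mult, Rmult_comm. apply Rmult_le_compat; try apply Cmod_ge_0; [|apply Hd].
      destruct (Gp n) as [E|E]; rewrite Rmult_1_l in E; replace (RtoC h + RtoC (INR n))%C with (RtoC h - - RtoC (INR n))%C in E by ring.
      - rewrite E, Cinv_0, Cmod_0. left; now apply Rinv_0_lt_compat.
      - rewrite Cmod_inv by (apply Cmod_gt_0; lra). apply Rinv_le_contravar; lra. }
    assert (Eb : ex_series (fun n => / c * Cmod (RtoC (gamma_residue n)))) by apply ex_series_scal_R, ex_series_gamma_residue.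
    assert (Hg : forall n, Cmod (RtoC (gamma_residue n)) <= Cmod (RtoC (gamma_residue n))) by (intro; lra).
    (* The two series differ only in the term of index [0]; both are shifted past it and
       compared. *)
    assert (E1 := CSer_shift _ _ (Bd _ Hg) Eb). assert (E2 := CSer_shift _ _ (Bd _ Hd0) Eb). cbv beta in E1, E2.
    rewrite (CSer_ext (fun n => d0 (S n) / (RtoC h - - RtoC (INR (S n))))%C (fun n => RtoC (gamma_residue (S n)) / (RtoC h - - RtoC (INR (S n))))%C) in E2 by reflexivity.
    rewrite E2 in E1. unfold d0 at 2 in E1. simpl Nat.eqb in E1. simpl INR in E1.
    assert (G0 : gamma_residue 0 = 1) by (unfold gamma_residue; simpl; field). rewrite G0 in E1.
    replace (RtoC h - - RtoC 0)%C with (RtoC h) in E1 by ring. unfold Cdiv at 2 4 in E1.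
    set (X := CSer (fun n : nat => d0 n / (RtoC h - - RtoC (INR n)))%C) in *.
    set (Y := CSer (fun n : nat => RtoC (gamma_residue n) / (RtoC h - - RtoC (INR n)))%C) in *.
    replace Y with ((Y - 1 * / RtoC h) + / RtoC h)%C by ring. rewrite <- E1. ring. }
  destruct (analytic_at_cderive reg 0 A) as [m Dm].
  assert (Lreg : is_lim (fun t => Re (reg (RtoC t))) 0 (Re (reg 0))).
  { apply is_lim_continuity. apply continuity_pt_filterlim. apply (is_cderive_ccont _ _ _ Dm). }
  assert (Dg : is_derive gamma_re 1 (gamma_re 1 * digamma 1)) by (apply is_derive_gamma_re; lra).
  assert (G1 : gamma_re 1 = 1) by (unfold gamma_re; rewrite gamma_fn_1; reflexivity).
  rewrite G1, Rmult_1_l in Dg.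
  (* The functional equation at [h] is [Gamma (1 + h) = h Gamma (h)], and the pole part [1 / h] of
     [Gamma (h)] cancels against [Gamma (1) = 1]. *)
  assert (Q : forall h, -1 < h < 1 -> h <> 0 -> (gamma_re (1 + h) - gamma_re 1) / h = Re (reg (RtoC h))).
  { intros h Hh Nh. unfold gamma_re at 1. replace (RtoC (1 + h)) with (RtoC h + 1)%C by (rewrite RtoC_plus; ring).
    rewrite gamma_fn_succ, CSer_resonant_none.
    - rewrite R1 by assumption. rewrite G1.
      replace (RtoC h * (reg (RtoC h) + / RtoC h) + 0)%C with (RtoC h * reg (RtoC h) + 1)%C by (field; intro E; apply Nh; now apply RtoC_inj).
      unfold Re, Cplus, Cmult, RtoC; simpl. field. exact Nh.
    - intros n E. rewrite <- RtoC_plus in E. apply RtoC_inj in E.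
      destruct n as [|n]; [simpl in E; lra|]. rewrite S_INR in E. pose proof (pos_INR n). lra. }
  assert (Ere : Re (reg 0) = digamma 1).
  { assert (L : is_lim (fun t => Re (reg (RtoC t))) 0 (digamma 1)).
    { apply is_derive_Reals in Dg. apply is_lim_spec. intros eps. destruct (Dg eps (cond_pos eps)) as [d Hd].
      assert (P : 0 < Rmin d 1) by (apply Rmin_glb_lt; [apply cond_pos|lra]).
      exists (mkposreal _ P). intros h Hh Nh. change R in h.
      assert (Hb : Rabs h < Rmin d 1) by (unfold ball in Hh; simpl in Hh; unfold AbsRing_ball, abs, minus, plus, opp in Hh; simpl in Hh;
        rewrite Ropp_0, Rplus_0_r in Hh; exact Hh).
      pose proof (Rmin_l d 1). pose proof (Rmin_r d 1).
      rewrite <- Q; [apply Hd; [exact Nh|lra]| |exact Nh]. apply Rabs_def2 in Hb. lra. }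
    apply is_lim_unique in L. apply is_lim_unique in Lreg. rewrite L in Lreg. injection Lreg. auto. }
  (* Along [h = 1 / (n + 2)] both [gamma_fn] and [1 / h] are real, hence so is the limit [reg 0]. *)
  assert (Eim : Im (reg 0) = 0).
  { assert (Li : is_lim (fun t => Im (reg (RtoC t))) 0 (Im (reg 0))).
    { apply is_lim_continuity. apply continuity_pt_filterlim. apply (is_cderive_ccont _ _ _ Dm). }
    assert (L2 : is_lim_seq (fun n => Im (reg (RtoC (/ INR (S (S n)))))) (Im (reg 0))).
    { apply (is_lim_comp_seq (fun t => Im (reg (RtoC t))) (fun n => / INR (S (S n))) 0 (Im (reg 0)) Li).
      - exists 0%nat. intros n _ E. injection E. change (/ INR (S (S n)) = 0 -> False). apply Rgt_not_eq, Rinv_0_lt_compat, lt_0_INR. lia.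
      - apply (is_lim_seq_inv _ p_infty); [|discriminate]. apply (is_lim_seq_incr_1 (fun n => INR (S n))), (is_lim_seq_incr_1 INR), is_lim_seq_INR. }
    apply is_lim_seq_unique in L2. rewrite (Lim_seq_ext _ (fun _ => 0)) in L2.
    - rewrite Lim_seq_const in L2. injection L2. auto.
    - intro n. assert (P : 0 < / INR (S (S n)) < 1).
      { assert (1 < INR (S (S n))) by (rewrite !S_INR; pose proof (pos_INR n); lra).
        split; [apply Rinv_0_lt_compat; lra|]. rewrite <- Rinv_1. apply Rinv_lt_contravar; lra. }
      set (h := / INR (S (S n))) in *.
      destruct (gamma_trunc_lim h ltac:(lra)) as [_ E]. rewrite R1 in E by lra.
      replace (reg (RtoC h)) with (RtoC (gamma_re h) - / RtoC h)%C by (rewrite <- E; ring).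
      rewrite <- RtoC_inv, <- RtoC_minus by lra. reflexivity. }
  rewrite <- R0, (surjective_pairing (reg 0)). unfold RtoC, Re, Im in *. f_equal; assumption.
Qed.

(** The finite part of Gamma at [- r], found by stepping down from [0]: solving the functional
    equation for the value at [- (r + 1)] changes the residue and adds the [1 / (r + 1)] by which
    digamma grows. *)
Lemma gamma_fn_neg (r : nat) : gamma_fn (RtoC (- INR r)) = RtoC (gamma_residue r * digamma (INR r + 1)).
Proof.
  induction r as [|r IH].
  - simpl INR. rewrite Ropp_0, Rplus_0_l, gamma_fn_0. unfold gamma_residue; simpl. f_equal. field.
  - pose proof (gamma_fn_succ (RtoC (- INR (S r)))) as E. rewrite CSer_resonant_neg in E.
    replace (RtoC (- INR (S r)) + 1)%C with (RtoC (- INR r)) in E by (rewrite S_INR, <- RtoC_plus; f_equal; ring).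
    rewrite IH in E. rewrite (gamma_residue_S r) in E.
    assert (N : INR (S r) <> 0) by (apply not_0_INR; lia).
    assert (Nc : RtoC (INR (S r)) <> 0) by (intro H; apply N; now apply RtoC_inj).
    rewrite digamma_succ by (pose proof (pos_INR r); rewrite S_INR; lra).
    rewrite S_INR in *. rewrite <- (S_INR r) in *.
    apply (f_equal (fun z => / RtoC (INR (S r)) * (RtoC (gamma_residue (S r)) - z))%C) in E.
    rewrite RtoC_opp in E.
    replace (/ RtoC (INR (S r)) * (RtoC (gamma_residue (S r)) - (- RtoC (INR (S r)) * gamma_fn (- RtoC (INR (S r))) + RtoC (gamma_residue (S r)))))%C
      with (gamma_fn (- RtoC (INR (S r)))) in E by (field; exact Nc).
    rewrite RtoC_opp, <- E. rewrite <- RtoC_minus, <- RtoC_inv, <- RtoC_mult by exact N. f_equal. field. exact N.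
Qed.

(** * The Dirichlet kernel *)

Fixpoint dirichlet (N : nat) (s : R) : R :=
  match N with O => 1 | S n => dirichlet n s + 2 * cos (2 * PI * INR (S n) * s) end.

(** Normalized to vanish at [0]; since all the sines vanish at [1/2], the kernel has integral [1/2]
    over [[0, 1/2]] for every [N]. *)
Fixpoint dirichlet_primitive (N : nat) (s : R) : R :=
  match N with O => s | S n => dirichlet_primitive n s + sin (2 * PI * INR (S n) * s) / (PI * INR (S n)) end.

Lemma is_derive_dirichlet_primitive (N : nat) (s : R) : is_derive (dirichlet_primitive N) s (dirichlet N s).
Proof.
  induction N as [|N IH].
  - apply (is_derive_id (K := R_AbsRing)).
  - apply (is_derive_plus (V := R_NormedModule) (dirichlet_primitive N)); [exact IH|].
    assert (0 < INR (S N)) by (apply lt_0_INR; lia). pose proof PI_RGT_0.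
    auto_derive; trivial. change (match N with 0%nat => 1 | S _ => INR N + 1 end) with (INR (S N)). field. split; lra.
Qed.

Lemma dirichlet_sin (N : nat) (s : R) : sin (PI * s) * dirichlet N s = sin ((2 * INR N + 1) * (PI * s)).
Proof.
  induction N as [|N IH].
  - simpl. rewrite Rmult_1_r. f_equal. ring.
  - simpl dirichlet. rewrite Rmult_plus_distr_l, IH. change (match N with 0%nat => 1 | S _ => INR N + 1 end) with (INR (S N)).
    rewrite S_INR. replace (2 * PI * (INR N + 1) * s) with ((2 * INR N + 2) * (PI * s)) by ring.
    replace ((2 * (INR N + 1) + 1) * (PI * s)) with ((2 * INR N + 2) * (PI * s) + PI * s) by ring.
    replace ((2 * INR N + 1) * (PI * s)) with ((2 * INR N + 2) * (PI * s) - PI * s) by ring.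
    rewrite sin_plus, sin_minus. ring.
Qed.

Lemma dirichlet_even (N : nat) (s : R) : dirichlet N (- s) = dirichlet N s.
Proof.
  induction N as [|N IH]; [reflexivity|]. simpl dirichlet. rewrite IH.
  rewrite Ropp_mult_distr_r_reverse, cos_neg. reflexivity.
Qed.

Lemma dirichlet_bound (N : nat) (s : R) : Rabs (dirichlet N s) <= 2 * INR N + 1.
Proof.
  induction N as [|N IH].
  - simpl. rewrite Rabs_pos_eq; lra.
  - rewrite S_INR. simpl dirichlet. eapply Rle_trans; [apply Rabs_triang|].
    assert (Rabs (2 * cos (2 * PI * INR (S N) * s)) <= 2).
    { rewrite Rabs_mult, (Rabs_pos_eq 2) by lra. pose proof (COS_bound (2 * PI * INR (S N) * s)) as B.
      assert (Rabs (cos (2 * PI * INR (S N) * s)) <= 1) by (apply Rabs_le; lra). lra. }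
    simpl INR in *. lra.
Qed.

Lemma dirichlet_primitive_0 (N : nat) : dirichlet_primitive N 0 = 0.
Proof.
  induction N as [|N IH]; [reflexivity|]. simpl dirichlet_primitive. rewrite IH, Rmult_0_r, sin_0. unfold Rdiv; ring.
Qed.

Lemma sin_nat_PI (n : nat) : sin (INR n * PI) = 0.
Proof.
  induction n as [|n IH]; [simpl; rewrite Rmult_0_l; apply sin_0|].
  rewrite S_INR, Rmult_plus_distr_r, Rmult_1_l, neg_sin, IH. ring.
Qed.

Lemma dirichlet_primitive_half (N : nat) : dirichlet_primitive N (/ 2) = / 2.
Proof.
  induction N as [|N IH]; [reflexivity|]. simpl dirichlet_primitive. rewrite IH.
  change (match N with 0%nat => 1 | S _ => INR N + 1 end) with (INR (S N)).
  replace (2 * PI * INR (S N) * / 2) with (INR (S N) * PI) by field. rewrite sin_nat_PI. unfold Rdiv; ring.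
Qed.

Lemma cos_odd_half_PI (N : nat) : cos ((2 * INR N + 1) * (PI / 2)) = 0.
Proof.
  replace ((2 * INR N + 1) * (PI / 2)) with (PI / 2 + INR N * PI) by field.
  rewrite cos_plus, cos_PI2, sin_PI2, sin_nat_PI. ring.
Qed.

(** With [x = PI s / 2], [sin (2 x) = 2 sin x cos x], and both [sin x >= cos (PI/4) x] and
    [cos x >= cos (PI/4)] hold for [0 <= x <= PI/4]; the product gives [sin (PI s) >= x >= s]. *)
Lemma sin_PI_lower (s : R) : 0 <= s <= / 2 -> s <= sin (PI * s).
Proof.
  intro Hs. pose proof PI_RGT_0 as PP. pose proof PI2_3_2.
  set (x := PI * s / 2).
  assert (Hx : 0 <= x <= PI / 4) by (unfold x; split; nra).
  assert (C4 : cos (PI / 4) * cos (PI / 4) = / 2).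
  { pose proof (sin2_cos2 (PI / 4)) as E. unfold Rsqr in E.
    replace (sin (PI / 4)) with (cos (PI / 4)) in E by (rewrite cos_PI4, sin_PI4; reflexivity). lra. }
  assert (Pc : 0 < cos (PI / 4)) by (apply cos_gt_0; lra).
  assert (Cx : cos (PI / 4) <= cos x) by (apply cos_decr_1; lra).
  assert (Sx : cos (PI / 4) * x <= sin x).
  { destruct (Req_dec x 0) as [->|N]; [rewrite sin_0; lra|].
    destruct (MVT_cor2 sin cos 0 x) as [c [Ec Hc]]; [lra|intros; apply derivable_pt_lim_sin|].
    rewrite sin_0, !Rminus_0_r in Ec. rewrite Ec. apply Rmult_le_compat_r; [lra|]. apply cos_decr_1; lra. }
  replace (PI * s) with (2 * x) by (unfold x; field). rewrite sin_2a.
  assert (cos (PI / 4) * x * cos (PI / 4) <= sin x * cos x) by (apply Rmult_le_compat; nra).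
  assert (2 * (cos (PI / 4) * x * cos (PI / 4)) = x) by (replace (cos (PI / 4) * x * cos (PI / 4)) with (cos (PI / 4) * cos (PI / 4) * x) by ring; rewrite C4; field).
  unfold x in *. nra.
Qed.

(** Integration by parts on [[s, 1/2]] of [sin (m PI u) / sin (PI u)]: the boundary term at [1/2]
    vanishes because [m] is odd, the one at [s] is [O (1 / (m s))], and the remaining integrand is
    dominated by the derivative of the monotone function [W]. *)
Lemma dirichlet_tail_decay (N : nat) (s : R) : 0 < s <= / 2 ->
  Rabs (/ 2 - dirichlet_primitive N s) <= / ((2 * INR N + 1) * s).
Proof.
  intro Hs. set (m := 2 * INR N + 1). pose proof (pos_INR N) as PN. assert (Pm : 0 < m) by (unfold m; lra).
  pose proof PI_RGT_0 as PP. pose proof PI2_3_2 as P3.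
  assert (Pmp : 0 < m * PI) by (apply Rmult_lt_0_compat; assumption).
  assert (Sp : forall u, s <= u <= / 2 -> 0 < sin (PI * u)).
  { intros u Hu. apply Rlt_le_trans with u; [lra|]. apply sin_PI_lower; lra. }
  assert (Cp : forall u, s <= u <= / 2 -> 0 <= cos (PI * u)).
  { intros u Hu. apply cos_ge_0; nra. }
  set (V := fun u => / 2 - dirichlet_primitive N u - cos (m * (PI * u)) / (m * PI * sin (PI * u))).
  set (V' := fun u => cos (m * (PI * u)) * cos (PI * u) / (m * (sin (PI * u) * sin (PI * u)))).
  set (W := fun u => - / (m * PI * sin (PI * u))).
  set (W' := fun u => cos (PI * u) / (m * (sin (PI * u) * sin (PI * u)))).
  assert (DV : forall u, s <= u <= / 2 -> is_derive V u (V' u)).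
  { intros u Hu. pose proof (Sp u Hu). unfold V.
    eapply is_derive_eq.
    - apply (is_derive_minus (V := R_NormedModule)).
      + apply (is_derive_minus (V := R_NormedModule)); [apply (is_derive_const (V := R_NormedModule))|apply is_derive_dirichlet_primitive].
      + auto_derive; [|reflexivity]. apply Rgt_not_eq, Rmult_lt_0_compat; assumption.
    - unfold minus, plus, opp, zero; simpl. unfold V'.
      replace (dirichlet N u) with (sin (m * (PI * u)) / sin (PI * u)) by (unfold m; rewrite <- dirichlet_sin; field; lra).
      field. repeat split; lra. }
  assert (DW : forall u, s <= u <= / 2 -> is_derive W u (W' u)).
  { intros u Hu. pose proof (Sp u Hu). unfold W, W'. auto_derive; [apply Rgt_not_eq, Rmult_lt_0_compat; assumption|].
    field. repeat split; lra. }
  assert (K := cmean_value (fun u => RtoC (V u)) (fun u => RtoC (V' u)) W W' s (/ 2) ltac:(lra)).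
  cbv beta in K. rewrite <- RtoC_minus, Cmod_R in K.
  assert (K' : Rabs (V (/ 2) - V s) <= W (/ 2) - W s).
  { apply K.
    - intros u Hu. apply is_cderive_RtoC. now apply DV.
    - exact DW.
    - intros u Hu. rewrite Cmod_R. unfold V', W', Rdiv. pose proof (Sp u Hu) as S1. pose proof (Cp u Hu) as C1.
      assert (P : 0 < / (m * (sin (PI * u) * sin (PI * u)))) by (apply Rinv_0_lt_compat; repeat apply Rmult_lt_0_compat; lra).
      rewrite Rabs_mult, (Rabs_pos_eq (/ _)) by lra. apply Rmult_le_compat_r; [lra|].
      rewrite Rabs_mult, (Rabs_pos_eq (cos (PI * u))) by exact C1.
      pose proof (COS_bound (m * (PI * u))). assert (Rabs (cos (m * (PI * u))) <= 1) by (apply Rabs_le; lra). nra. }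
  assert (V2 : V (/ 2) = 0).
  { unfold V. rewrite dirichlet_primitive_half. replace (m * (PI * / 2)) with ((2 * INR N + 1) * (PI / 2)) by (unfold m; field).
    rewrite cos_odd_half_PI. unfold Rdiv; ring. }
  assert (Ss := sin_PI_lower s ltac:(lra)).
  assert (S2 : sin (PI * / 2) = 1) by (replace (PI * / 2) with (PI / 2) by reflexivity; apply sin_PI2).
  unfold W in K'. rewrite V2, S2 in K'. 
  set (J := / (m * PI * sin (PI * s))) in *.
  assert (PJ : 0 < J <= / (3 * (m * s))).
  { unfold J. split; [apply Rinv_0_lt_compat, Rmult_lt_0_compat; lra|].
    apply Rinv_le_contravar; [repeat apply Rmult_lt_0_compat; lra|].
    replace (3 * (m * s)) with (m * (3 * s)) by ring. rewrite Rmult_assoc. apply Rmult_le_compat_l; [lra|]. apply Rmult_le_compat; lra. }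
  assert (P2 : 0 < / (m * PI * 1)) by (apply Rinv_0_lt_compat; rewrite Rmult_1_r; exact Pmp).
  assert (Es : / 2 - dirichlet_primitive N s = V s + cos (m * (PI * s)) * J) by (unfold V, J, Rdiv; ring).
  rewrite Es. eapply Rle_trans; [apply Rabs_triang|].
  assert (B1 : Rabs (V s) <= J) by (replace (V s) with (- (0 - V s)) by ring; rewrite Rabs_Ropp; lra).
  assert (B2 : Rabs (cos (m * (PI * s)) * J) <= J).
  { rewrite Rabs_mult, (Rabs_pos_eq J) by lra. pose proof (COS_bound (m * (PI * s))).
    assert (Rabs (cos (m * (PI * s))) <= 1) by (apply Rabs_le; lra). nra. }
  assert (E3 : / (3 * (m * s)) = / 3 * / (m * s)) by (field; split; lra).
  assert (0 < / (m * s)) by (apply Rinv_0_lt_compat, Rmult_lt_0_compat; lra). lra.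
Qed.

(** Uniform in [N]: beyond [s = 1 / m] the decay estimate gives at most [1], and before it the
    kernel is at most [m], so the primitive is at most [1]. *)
Lemma dirichlet_tail_bound (N : nat) (s : R) : 0 <= s <= / 2 -> Rabs (/ 2 - dirichlet_primitive N s) <= 2.
Proof.
  intro Hs. set (m := 2 * INR N + 1). pose proof (pos_INR N) as PN. assert (Pm : 0 < m) by (unfold m; lra).
  destruct (Rle_dec (/ m) s) as [L|L].
  - assert (0 < / m) by (now apply Rinv_0_lt_compat).
    eapply Rle_trans; [apply dirichlet_tail_decay; lra|]. fold m. apply Rle_trans with 1; [|lra].
    rewrite <- Rinv_1. apply Rinv_le_contravar; [lra|]. apply (Rmult_le_compat_l m) in L; [|lra]. rewrite Rinv_r in L by lra. lra.
  - assert (K := cmean_value (fun u => RtoC (dirichlet_primitive N u)) (fun u => RtoC (dirichlet N u)) (fun u => m * u) (fun _ => m) 0 s ltac:(lra)).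
    cbv beta in K. rewrite <- RtoC_minus, Cmod_R, dirichlet_primitive_0, Rminus_0_r in K.
    assert (K' : Rabs (dirichlet_primitive N s) <= m * s - m * 0).
    { apply K.
      - intros u _. apply is_cderive_RtoC, is_derive_dirichlet_primitive.
      - intros u _. auto_derive; trivial; ring.
      - intros u _. rewrite Cmod_R. apply dirichlet_bound. }
    assert (m * s <= 1). { apply Rnot_le_lt in L. apply (Rmult_lt_compat_l m) in L; [|lra]. rewrite Rinv_r in L by lra. lra. }
    replace (/ 2 - dirichlet_primitive N s) with (/ 2 + - dirichlet_primitive N s) by ring.
    eapply Rle_trans; [apply Rabs_triang|]. rewrite Rabs_Ropp, (Rabs_pos_eq (/ 2)) by lra. lra.
Qed.

Lemma continuous_dirichlet_primitive (N : nat) (s : R) : continuous (dirichlet_primitive N) s.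
Proof. eapply is_derive_continuous, is_derive_dirichlet_primitive. Qed.

Lemma continuous_dirichlet (N : nat) (s : R) : continuous (dirichlet N) s.
Proof.
  induction N as [|N IH]; [apply continuous_const|]. apply (continuous_plus (V := R_NormedModule) (dirichlet N)); [exact IH|].
  eapply is_derive_continuous. auto_derive; trivial.
Qed.

Lemma continuous_mult_R (f g : R -> R) (x : R) : continuous f x -> continuous g x -> continuous (fun t => f t * g t) x.
Proof. exact (continuous_mult (K := R_AbsRing) f g x). Qed.

Lemma continuous_minus_R (f g : R -> R) (x : R) : continuous f x -> continuous g x -> continuous (fun t => f t - g t) x.
Proof. exact (continuous_minus (V := R_NormedModule) f g x). Qed.

Lemma continuous_plus_R (f g : R -> R) (x : R) : continuous f x -> continuous g x -> continuous (fun t => f t + g t) x.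
Proof. exact (continuous_plus (V := R_NormedModule) f g x). Qed.

Lemma ex_RInt_cont (f : R -> R) (a b : R) : a <= b -> (forall t, a <= t <= b -> continuous f t) -> ex_RInt f a b.
Proof.
  intros Hab H. apply (ex_RInt_continuous (V := R_CompleteNormedModule)). intros t Ht.
  rewrite Rmin_left, Rmax_right in Ht by lra. now apply H.
Qed.

Lemma Rplus_minus_l (x y : R) : x + y - x = y.
Proof. ring. Qed.

(** Integrating by parts against [dirichlet_primitive N - 1/2], which vanishes at [1/2], produces
    [F 0 / 2] exactly. The remaining integral of [F'] against the tail is small by the uniform bound
    near [0] and by the decay elsewhere; continuity of [F'] replaces the Riemann-Lebesgue lemma. *)
Lemma dirichlet_half_limit (F F' : R -> R) :
  (forall s, 0 <= s <= / 2 -> is_derive F s (F' s)) -> (forall s, 0 <= s <= / 2 -> continuous F' s) ->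
  is_lim_seq (fun N => RInt (fun s => F s * dirichlet N s) 0 (/ 2)) (F 0 / 2).
Proof.
  intros D Cn.
  assert (H2 : 0 <= / 2) by lra.
  assert (exists M, 0 < M /\ forall s, 0 <= s <= / 2 -> Rabs (F' s) <= M) as [M [PM HM]].
  { destruct (continuity_ab_maj (fun s => Rabs (F' s)) 0 (/ 2) H2) as [x [Hx _]].
    - intros s Hs. apply continuity_pt_filterlim. apply (continuous_comp F' Rabs); [now apply Cn|apply continuous_Rabs].
    - exists (Rabs (F' x) + 1). split; [pose proof (Rabs_pos (F' x)); lra|]. intros s Hs. specialize (Hx s Hs). lra. }
  assert (E : forall N, RInt (fun s => F s * dirichlet N s) 0 (/ 2) = F 0 / 2 + RInt (fun s => F' s * (/ 2 - dirichlet_primitive N s)) 0 (/ 2)).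
  { intro N.
    assert (Dq : forall s, is_derive (fun s => dirichlet_primitive N s - / 2) s (dirichlet N s)).
    { intro s. eapply is_derive_eq; [apply (is_derive_minus (V := R_NormedModule)); [apply is_derive_dirichlet_primitive|apply (is_derive_const (V := R_NormedModule))]|].
      unfold minus, plus, opp, zero; simpl; ring. }
    assert (I : is_RInt (fun s => F' s * (dirichlet_primitive N s - / 2) + F s * dirichlet N s) 0 (/ 2)
       (F (/ 2) * (dirichlet_primitive N (/ 2) - / 2) - F 0 * (dirichlet_primitive N 0 - / 2))).
    { apply (is_RInt_derive (V := R_CompleteNormedModule) (fun s => F s * (dirichlet_primitive N s - / 2))); intros s Hs; rewrite Rmin_left, Rmax_right in Hs by lra.
      - exact (is_derive_mult (K := R_AbsRing) F (fun s => dirichlet_primitive N s - / 2) s (F' s) (dirichlet N s) (D s Hs) (Dq s) Rmult_comm).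
      - apply continuous_plus_R; apply continuous_mult_R.
        + now apply Cn. + apply (continuous_minus_R (dirichlet_primitive N) (fun _ => / 2)); [apply continuous_dirichlet_primitive|apply continuous_const].
        + eapply is_derive_continuous, D, Hs. + apply continuous_dirichlet. }
    apply (is_RInt_unique (V := R_CompleteNormedModule)) in I. rewrite RInt_plus_R in I.
    - rewrite dirichlet_primitive_half, dirichlet_primitive_0 in I.
      assert (En : RInt (fun s => F' s * (dirichlet_primitive N s - / 2)) 0 (/ 2) = (-1) * RInt (fun s => F' s * (/ 2 - dirichlet_primitive N s)) 0 (/ 2)).
      { rewrite <- RInt_scal_R.
        - apply RInt_ext_R. intro s. ring.
        - apply ex_RInt_cont; [lra|]. intros s Hs. apply continuous_mult_R; [now apply Cn|]. apply (continuous_minus_R (fun _ => / 2) (dirichlet_primitive N)); [apply continuous_const|apply continuous_dirichlet_primitive]. }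
      rewrite En in I. lra.
    - apply ex_RInt_cont; [lra|]. intros s Hs. apply continuous_mult_R; [now apply Cn|]. apply (continuous_minus_R (dirichlet_primitive N) (fun _ => / 2)); [apply continuous_dirichlet_primitive|apply continuous_const].
    - apply ex_RInt_cont; [lra|]. intros s Hs. apply continuous_mult_R; [eapply is_derive_continuous, D, Hs|apply continuous_dirichlet]. }
  apply is_lim_seq_spec. intros eps. pose proof (cond_pos eps) as Pe.
  (* With this [d] the part over [[0, d]] is at most [2 M d <= eps / 4]; the lower bound on [N]
     below makes the part over [[d, 1/2]] equally small. *)
  set (d := Rmin (/ 4) (eps / (8 * M))).
  assert (Pd : 0 < d) by (apply Rmin_glb_lt; [lra|apply Rdiv_lt_0_compat; lra]).
  assert (d <= / 4) by apply Rmin_l. assert (Hd : d <= eps / (8 * M)) by apply Rmin_r.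
  destruct (archimed (4 * M / (d * eps))) as [Ha _].
  exists (Z.to_nat (up (4 * M / (d * eps)))). intros N HN.
  assert (PA : 0 < 4 * M / (d * eps)) by (apply Rdiv_lt_0_compat; [lra|now apply Rmult_lt_0_compat]).
  assert (HN' : 4 * M / (d * eps) < INR N).
  { eapply Rlt_le_trans; [exact Ha|]. rewrite INR_IZR_INZ. apply IZR_le. lia. }
  rewrite E, Rplus_minus_l.
  assert (Cq : forall s, 0 <= s <= / 2 -> continuous (fun s => F' s * (/ 2 - dirichlet_primitive N s)) s).
  { intros s Hs. apply continuous_mult_R; [now apply Cn|]. apply (continuous_minus_R (fun _ => / 2) (dirichlet_primitive N)); [apply continuous_const|apply continuous_dirichlet_primitive]. }
  rewrite (RInt_Chasles_R _ 0 d (/ 2)) by (apply ex_RInt_cont; [lra|intros; apply Cq; lra]).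
  eapply Rle_lt_trans; [apply Rabs_triang|].
  assert (B1 : Rabs (RInt (fun s => F' s * (/ 2 - dirichlet_primitive N s)) 0 d) <= (d - 0) * (M * 2)).
  { apply abs_RInt_le_const; [lra|apply ex_RInt_cont; [lra|intros; apply Cq; lra]|].
    intros s Hs. rewrite Rabs_mult. apply Rmult_le_compat; try apply Rabs_pos; [apply HM; lra|apply dirichlet_tail_bound; lra]. }
  assert (B2 : Rabs (RInt (fun s => F' s * (/ 2 - dirichlet_primitive N s)) d (/ 2)) <= (/ 2 - d) * (M * / (2 * INR N * d))).
  { apply abs_RInt_le_const; [lra|apply ex_RInt_cont; [lra|intros; apply Cq; lra]|].
    intros s Hs. rewrite Rabs_mult. apply Rmult_le_compat; try apply Rabs_pos; [apply HM; lra|].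
    eapply Rle_trans; [apply dirichlet_tail_decay; lra|]. apply Rinv_le_contravar; [apply Rmult_lt_0_compat; lra|]. nra. }
  assert (T1 : d * (M * 2) <= eps / 4).
  { apply (Rmult_le_compat_r (M * 2)) in Hd; [|lra]. replace (eps / (8 * M) * (M * 2)) with (eps / 4) in Hd by (field; lra). exact Hd. }
  assert (T2 : M * / (2 * INR N * d) <= eps / 4).
  { assert (Q : 2 * M <= eps / 4 * (2 * INR N * d) ).
    { apply (Rmult_lt_compat_r (d * eps)) in HN'; [|now apply Rmult_lt_0_compat].
      replace (4 * M / (d * eps) * (d * eps)) with (4 * M) in HN' by (field; split; lra).
      replace (eps / 4 * (2 * INR N * d)) with (INR N * (d * eps) / 2) by field. lra. }
    assert (P : 0 < 2 * INR N * d) by (apply Rmult_lt_0_compat; lra).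
    apply Rmult_le_reg_r with (2 * INR N * d); [exact P|]. rewrite Rmult_assoc, Rinv_l by lra. lra. }
  assert (0 < M * / (2 * INR N * d)) by (apply Rmult_lt_0_compat; [lra|apply Rinv_0_lt_compat, Rmult_lt_0_compat; lra]).
  nra.
Qed.

(** The kernel is even around [c], so the two halves fold into an integral of
    [f (c + s) + f (c - s)] over [[0, 1/2]]. *)
Lemma dirichlet_limit (f f' : R -> R) (c : R) :
  (forall s, c - / 2 <= s <= c + / 2 -> is_derive f s (f' s)) -> (forall s, c - / 2 <= s <= c + / 2 -> continuous f' s) ->
  is_lim_seq (fun N => RInt (fun s => f s * dirichlet N (s - c)) (c - / 2) (c + / 2)) (f c).
Proof.
  intros D Cn.
  set (F := fun s => f (c + s) + f (c - s)). set (F' := fun s => f' (c + s) - f' (c - s)).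
  assert (L : is_lim_seq (fun N => RInt (fun s => F s * dirichlet N s) 0 (/ 2)) (F 0 / 2)).
  { apply (dirichlet_half_limit F F').
    - intros s Hs. unfold F. eapply is_derive_eq.
      + apply (is_derive_plus (V := R_NormedModule)).
        * apply (is_derive_comp (K := R_AbsRing) (V := R_NormedModule) f (fun s => c + s)); [apply D; lra|auto_derive; trivial].
        * apply (is_derive_comp (K := R_AbsRing) (V := R_NormedModule) f (fun s => c - s)); [apply D; lra|auto_derive; trivial].
      + unfold plus, scal, F'; simpl; unfold mult; simpl. ring.
    - intros s Hs. apply continuous_minus_R.
      + apply (continuous_comp (fun s => c + s) f'); [eapply is_derive_continuous; auto_derive; trivial|apply Cn; lra].
      + apply (continuous_comp (fun s => c - s) f'); [eapply is_derive_continuous; auto_derive; trivial|apply Cn; lra]. }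
  replace (f c) with (F 0 / 2) by (unfold F; rewrite Rplus_0_r, Rminus_0_r; field).
  eapply is_lim_seq_ext; [|exact L]. intro N. cbv beta.
  set (g := fun s => f s * dirichlet N (s - c)).
  assert (Cg : forall s, c - / 2 <= s <= c + / 2 -> continuous g s).
  { intros s Hs. apply continuous_mult_R; [eapply is_derive_continuous, D, Hs|].
    apply (continuous_comp (fun s => s - c) (dirichlet N)); [eapply is_derive_continuous; auto_derive; trivial|apply continuous_dirichlet]. }
  rewrite (RInt_Chasles_R g (c - / 2) c (c + / 2)) by (apply ex_RInt_cont; [lra|intros; apply Cg; lra]).
  assert (E1 : is_RInt g c (c + / 2) (RInt (fun s => f (c + s) * dirichlet N s) 0 (/ 2))).
  { assert (I := RInt_correct (V := R_CompleteNormedModule) g c (c + / 2) ltac:(apply ex_RInt_cont; [lra|intros; apply Cg; lra])).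
    replace (RInt (fun s => f (c + s) * dirichlet N s) 0 (/ 2)) with (RInt g c (c + / 2)); [exact I|]. symmetry. apply is_RInt_unique.
    replace c with (1 * 0 + c) in I at 1 by ring. replace (c + / 2) with (1 * / 2 + c) in I at 1 by ring.
    apply (is_RInt_comp_lin (V := R_NormedModule)) in I. eapply is_RInt_ext; [|exact I]. intros s _. unfold scal, g; simpl; unfold mult; simpl.
    rewrite Rmult_1_l, Rmult_1_l. f_equal; f_equal; ring. }
  assert (E2 : is_RInt g (c - / 2) c (RInt (fun s => f (c - s) * dirichlet N s) 0 (/ 2))).
  { assert (I := RInt_correct (V := R_CompleteNormedModule) g (c - / 2) c ltac:(apply ex_RInt_cont; [lra|intros; apply Cg; lra])).
    replace (RInt (fun s => f (c - s) * dirichlet N s) 0 (/ 2)) with (RInt g (c - / 2) c); [exact I|]. symmetry. apply is_RInt_unique.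
    apply (is_RInt_swap (V := R_NormedModule)) in I.
    replace c with ((-1) * 0 + c) in I at 1 by ring. replace (c - / 2) with ((-1) * / 2 + c) in I at 1 by field.
    apply (is_RInt_comp_lin (V := R_NormedModule)) in I. apply (is_RInt_opp (V := R_NormedModule)) in I.
    rewrite opp_opp in I. eapply is_RInt_ext; [|exact I]. intros s _. unfold scal, opp, g; simpl; unfold mult; simpl.
    rewrite <- (dirichlet_even N s). replace (-1 * s + c - c) with (- s) by ring. replace (-1 * s + c) with (c - s) by ring. ring. }
  rewrite (is_RInt_unique _ _ _ _ E1), (is_RInt_unique _ _ _ _ E2), Rplus_comm, <- RInt_plus_R.
  - apply RInt_ext_R. intro s. unfold F. ring.
  - apply ex_RInt_cont; [lra|]. intros s Hs. apply continuous_mult_R; [|apply continuous_dirichlet].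
    apply (continuous_comp (fun s => c + s) f); [eapply is_derive_continuous; auto_derive; trivial|]. eapply is_derive_continuous, D; lra.
  - apply ex_RInt_cont; [lra|]. intros s Hs. apply continuous_mult_R; [|apply continuous_dirichlet].
    apply (continuous_comp (fun s => c - s) f); [eapply is_derive_continuous; auto_derive; trivial|]. eapply is_derive_continuous, D; lra.
Qed.

(** * Holomorphic functions on slanted strips *)

(** Joint continuity in both coordinates, as differentiation under the integral sign requires. *)
Definition c2cont (W : R -> R -> C) (t r : R) : Prop :=
  continuity_2d_pt (fun t r => Re (W t r)) t r /\ continuity_2d_pt (fun t r => Im (W t r)) t r.

Lemma c2cont_plus (V W : R -> R -> C) (t r : R) : c2cont V t r -> c2cont W t r -> c2cont (fun t r => (V t r + W t r)%C) t r.
Proof. intros [V1 V2] [W1 W2]; split; apply continuity_2d_pt_plus; assumption. Qed.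

Lemma c2cont_mult (V W : R -> R -> C) (t r : R) : c2cont V t r -> c2cont W t r -> c2cont (fun t r => (V t r * W t r)%C) t r.
Proof.
  intros [V1 V2] [W1 W2]; split.
  - apply continuity_2d_pt_minus; apply continuity_2d_pt_mult; assumption.
  - apply continuity_2d_pt_plus; apply continuity_2d_pt_mult; assumption.
Qed.

Lemma c2cont_const (c : C) (t r : R) : c2cont (fun _ _ => c) t r.
Proof. split; apply continuity_2d_pt_const. Qed.

Lemma continuity_1d_2d (f : R -> R) (g : R -> R -> R) (t r : R) :
  continuity_pt f (g t r) -> continuity_2d_pt g t r -> continuity_2d_pt (fun t r => f (g t r)) t r.
Proof.
  intros Hf Hg. apply continuity_1d_2d_pt_comp; assumption.
Qed.

Lemma c2cont_cexp (V : R -> R -> C) (t r : R) : c2cont V t r -> c2cont (fun t r => cexp (V t r)) t r.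
Proof.
  intros [V1 V2].
  assert (E : continuity_2d_pt (fun t r => exp (Re (V t r))) t r) by (apply continuity_1d_2d; [apply derivable_continuous_pt, derivable_pt_exp|exact V1]).
  split; apply continuity_2d_pt_mult; try exact E; apply continuity_1d_2d; try exact V2.
  - apply continuity_cos. - apply continuity_sin.
Qed.

(* The coordinates are [u = t + r (m + i)]; [W] is holomorphic in [u] with derivative [D] on [Re u > 0]. *)
Definition holo (m : R) (W D : R -> R -> C) : Prop := forall t r, 0 < t + r * m ->
  is_cderive (fun t => W t r) t (D t r) /\ is_cderive (fun r => W t r) r ((m, 1) * D t r)%C /\
  c2cont W t r /\ c2cont D t r.

Lemma holo_const (m : R) (c : C) : holo m (fun _ _ => c) (fun _ _ => 0).
Proof.
  intros t r H. split; [apply is_cderive_const|]. split; [|split; apply c2cont_const].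
  eapply is_cderive_eq; [apply is_cderive_const|]. ring.
Qed.

Lemma holo_plus (m : R) (V DV W DW : R -> R -> C) : holo m V DV -> holo m W DW ->
  holo m (fun t r => (V t r + W t r)%C) (fun t r => (DV t r + DW t r)%C).
Proof.
  intros HV HW t r H. destruct (HV t r H) as [V1 [V2 [V3 V4]]]. destruct (HW t r H) as [W1 [W2 [W3 W4]]].
  split; [now apply (is_cderive_plus (fun t => V t r) (fun t => W t r))|]. split; [|split; now apply c2cont_plus].
  eapply is_cderive_eq; [apply (is_cderive_plus (V t) (W t)); eassumption|]. ring.
Qed.

Lemma holo_mult (m : R) (V DV W DW : R -> R -> C) : holo m V DV -> holo m W DW ->
  holo m (fun t r => (V t r * W t r)%C) (fun t r => (DV t r * W t r + V t r * DW t r)%C).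
Proof.
  intros HV HW t r H. destruct (HV t r H) as [V1 [V2 [V3 V4]]]. destruct (HW t r H) as [W1 [W2 [W3 W4]]].
  split; [now apply (is_cderive_mult (fun t => V t r) (fun t => W t r))|]. split; [|split; [now apply c2cont_mult|apply c2cont_plus; now apply c2cont_mult]].
  eapply is_cderive_eq; [apply (is_cderive_mult (V t) (W t)); eassumption|]. cbv beta. ring.
Qed.

Lemma holo_scal (m : R) (c : C) (W DW : R -> R -> C) : holo m W DW -> holo m (fun t r => (c * W t r)%C) (fun t r => (c * DW t r)%C).
Proof.
  intros HW t r H. destruct (HW t r H) as [W1 [W2 [W3 W4]]].
  split; [now apply (is_cderive_scal c (fun t => W t r))|]. split; [|split; (apply c2cont_mult; [apply c2cont_const|assumption])].
  eapply is_cderive_eq; [apply (is_cderive_scal c (W t)); eassumption|]. ring.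
Qed.

Lemma holo_cexp (m : R) (W DW : R -> R -> C) : holo m W DW ->
  holo m (fun t r => cexp (W t r)) (fun t r => (DW t r * cexp (W t r))%C).
Proof.
  intros HW t r H. destruct (HW t r H) as [W1 [W2 [W3 W4]]].
  split; [now apply (is_cderive_cexp (fun t => W t r))|]. split; [|split; [now apply c2cont_cexp|apply c2cont_mult; [assumption|now apply c2cont_cexp]]].
  eapply is_cderive_eq; [apply (is_cderive_cexp (fun r => W t r)); eassumption|]. cbv beta. ring.
Qed.

Definition ray (m t r : R) : C := (t + r * m, r).

Lemma holo_ray (m : R) : holo m (ray m) (fun _ _ => 1).
Proof.
  intros t r _. unfold ray. split; [|split; [|split; [|apply c2cont_const]]].
  - split; simpl; auto_derive; trivial.
  - split; simpl; auto_derive; trivial; ring.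
  - split; simpl.
    + apply continuity_2d_pt_plus; [apply continuity_2d_pt_id1|]. apply continuity_2d_pt_mult; [apply continuity_2d_pt_id2|apply continuity_2d_pt_const].
    + apply continuity_2d_pt_id2.
Qed.

(* The principal logarithm on [Re u > 0]. *)
Definition clog (u : C) : C := (ln (Re u ^ 2 + Im u ^ 2) / 2, atan (Im u / Re u)).

Lemma holo_clog (m : R) : holo m (fun t r => clog (ray m t r)) (fun t r => (/ ray m t r)%C).
Proof.
  intros t r H. unfold clog, ray; simpl.
  assert (P : 0 < (t + r * m) * ((t + r * m) * 1) + r * (r * 1)) by nra.
  assert (CX : continuity_2d_pt (fun t r => t + r * m) t r).
  { apply continuity_2d_pt_plus; [apply continuity_2d_pt_id1|]. apply continuity_2d_pt_mult; [apply continuity_2d_pt_id2|apply continuity_2d_pt_const]. }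
  assert (CN : continuity_2d_pt (fun t r => (t + r * m) * ((t + r * m) * 1) + r * (r * 1)) t r).
  { apply continuity_2d_pt_plus; (apply continuity_2d_pt_mult; [|apply continuity_2d_pt_mult; [|apply continuity_2d_pt_const]]); try assumption; apply continuity_2d_pt_id2. }
  assert (CI : continuity_2d_pt (fun t r => / ((t + r * m) * ((t + r * m) * 1) + r * (r * 1))) t r).
  { apply continuity_2d_pt_inv; [exact CN|lra]. }
  split; [|split; [|split]].
  - split; simpl.
    + auto_derive; [lra|]. field. lra.
    + auto_derive; [lra|]. field. split; lra.
  - split; simpl.
    + auto_derive; [lra|]. field. lra.
    + auto_derive; [lra|]. field. split; lra.
  - split; simpl.
    + apply continuity_2d_pt_mult; [|apply continuity_2d_pt_const]. apply (continuity_1d_2d ln); [|exact CN].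
      apply derivable_continuous_pt. exists (/ ((t + r * m) * ((t + r * m) * 1) + r * (r * 1))). now apply derivable_pt_lim_ln.
    + apply (continuity_1d_2d atan); [apply derivable_continuous_pt, derivable_pt_atan|].
      apply continuity_2d_pt_mult; [apply continuity_2d_pt_id2|]. apply continuity_2d_pt_inv; [exact CX|lra].
  - split; simpl; apply continuity_2d_pt_mult; try exact CI; [exact CX|].
    apply continuity_2d_pt_opp, continuity_2d_pt_id2.
Qed.

Lemma holo_ext (m : R) (V W DV DW : R -> R -> C) : (forall t r, V t r = W t r) -> (forall t r, DV t r = DW t r) ->
  holo m V DV -> holo m W DW.
Proof.
  intros E1 E2 H t r P. destruct (H t r P) as [H1 [H2 [[H3 H4] [H5 H6]]]]. rewrite <- E2.
  split; [eapply is_cderive_ext; [|exact H1]; intro; apply E1|].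
  split; [eapply is_cderive_ext; [|exact H2]; intro; apply E1|].
  split; split.
  - eapply continuity_2d_pt_ext; [|exact H3]. intros; cbv beta; now rewrite E1.
  - eapply continuity_2d_pt_ext; [|exact H4]. intros; cbv beta; now rewrite E1.
  - eapply continuity_2d_pt_ext; [|exact H5]. intros; cbv beta; now rewrite E2.
  - eapply continuity_2d_pt_ext; [|exact H6]. intros; cbv beta; now rewrite E2.
Qed.

Lemma holo_ccont_r (m : R) (W D : R -> R -> C) (t r : R) : holo m W D -> 0 < t + r * m -> ccont (W t) r.
Proof. intros H P. eapply is_cderive_ccont. apply (H t r P). Qed.

Lemma holo_ccont_t (m : R) (W D : R -> R -> C) (t r : R) : holo m W D -> 0 < t + r * m -> ccont (fun t => W t r) t.
Proof. intros H P. eapply is_cderive_ccont. apply (H t r P). Qed.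

Lemma continuity_2d_pt_continuous_r (f : R -> R -> R) (t r : R) : continuity_2d_pt f t r -> continuous (f t) r.
Proof.
  intro H. apply filterlim_locally. intros eps. destruct (H eps) as [d Hd].
  exists d. intros y Hy. apply Hd; [rewrite Rminus_diag, Rabs_R0; apply cond_pos|exact Hy].
Qed.

(* Cauchy's theorem on the parallelogram with vertices [b, b + 1, b + 1 + T (m + i), b + T (m + i)]. *)
Lemma cauchy_parallelogram (m b T : R) (W D : R -> R -> C) : 0 <= m -> 0 < b -> 0 <= T -> holo m W D ->
  (CRInt (fun r => ((m, 1) * W (b + 1)%R r)%C) 0 T - CRInt (fun r => ((m, 1) * W b r)%C) 0 T)%C
   = (CRInt (fun t => W t T) b (b + 1) - CRInt (fun t => W t 0) b (b + 1))%C.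
Proof.
  intros Hm Hb HT H.
  assert (Pos : forall t r, 0 < t -> 0 <= r -> 0 < t + r * m) by (intros; nra).
  assert (HE : holo m (fun t r => ((m, 1) * W t r)%C) (fun t r => ((m, 1) * D t r)%C)) by now apply holo_scal.
  (* [A t] integrates [W] along the slanted side through [t]. Its derivative is the integral of
     [(m + i) D], which is also the derivative of [W] along that side, hence equals [W t T - W t 0];
     integrating over [[b, b + 1]] closes the contour. *)
  set (A := fun t => CRInt (fun r => ((m, 1) * W t r)%C) 0 T).
  assert (DA : forall t, 0 < t -> is_cderive A t (CRInt (fun r => ((m, 1) * D t r)%C) 0 T)).
  { intros t Ht.
    assert (Loc : locally t (fun y => 0 < y)).
    { exists (mkposreal t Ht). intros y Hy. unfold ball in Hy; simpl in Hy; unfold AbsRing_ball, abs, minus, plus, opp in Hy; simpl in Hy.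
      apply Rabs_def2 in Hy. lra. }
    assert (K : forall (p : C -> R),
       (forall t r, 0 < t + r * m -> is_derive (fun t => p ((m, 1) * W t r)%C) t (p ((m, 1) * D t r)%C)) ->
       (forall t r, 0 < t + r * m -> continuity_2d_pt (fun t r => p ((m, 1) * D t r)%C) t r) ->
       (forall t r, 0 < t + r * m -> continuous (fun r => p ((m, 1) * W t r)%C) r) ->
       is_derive (fun t => RInt (fun r => p ((m, 1) * W t r)%C) 0 T) t (RInt (fun r => p ((m, 1) * D t r)%C) 0 T)).
    { intros p P1 P2 P3.
      eapply is_derive_eq; [apply (is_derive_RInt_param (fun t r => p ((m, 1) * W t r)%C) 0 T t)|].
      - eapply filter_imp; [|exact Loc]. intros y Hy r Hr. rewrite Rmin_left in Hr by lra. eexists. apply P1, Pos; [exact Hy|lra].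
      - intros r Hr. rewrite Rmin_left in Hr by lra.
        assert (Q : 0 < t + r * m) by (apply Pos; lra).
        (* The parametric rule asks for continuity of [Derive] itself, known to agree with [D] only
           where [t + r m > 0]; hence the neighbourhood built here. *)
        apply continuity_2d_pt_ext_loc with (fun t r => p ((m, 1) * D t r)%C); [|now apply P2].
        assert (CX : continuity_2d_pt (fun t r => t + r * m) t r).
        { apply continuity_2d_pt_plus; [apply continuity_2d_pt_id1|]. apply continuity_2d_pt_mult; [apply continuity_2d_pt_id2|apply continuity_2d_pt_const]. }
        destruct (CX (mkposreal _ Q)) as [d Hd]. exists d. intros u v Hu Hv. symmetry. apply is_derive_unique, P1.
        specialize (Hd u v Hu Hv). simpl in Hd. apply Rabs_def2 in Hd. lra.
      - eapply filter_imp; [|exact Loc]. intros y Hy. apply ex_RInt_cont; [exact HT|]. intros r Hr. apply P3, Pos; [exact Hy|lra].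
      - apply RInt_ext. intros r Hr. rewrite Rmin_left in Hr by lra. apply is_derive_unique. apply P1, Pos; lra. }
    split; apply K; intros u r Hu; destruct (HE u r Hu) as [E1 [E2 [E3 E4]]].
    - apply E1. - apply E4. - apply (is_cderive_ccont _ _ _ E2).
    - apply E1. - apply E4. - apply (is_cderive_ccont _ _ _ E2). }
  assert (Eq : forall t, 0 < t -> CRInt (fun r => ((m, 1) * D t r)%C) 0 T = (W t T - W t 0)%C).
  { intros t Ht. apply (CRInt_derive (W t)); [exact HT| |]; intros r Hr.
    - apply H, Pos; lra.
    - destruct (HE t r) as [_ [_ [_ [C1 C2]]]]; [apply Pos; lra|].
      split; [apply (continuity_2d_pt_continuous_r _ t r C1)|apply (continuity_2d_pt_continuous_r _ t r C2)]. }
  change (A (b + 1)%R - A b = CRInt (fun t => W t T) b (b + 1) - CRInt (fun t => W t 0) b (b + 1))%C.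
  assert (CW : forall r, 0 <= r -> forall t, b <= t <= b + 1 -> ccont (fun t => W t r) t).
  { intros r Hr t Ht. eapply holo_ccont_t; [exact H|]. apply Pos; lra. }
  rewrite <- CRInt_minus; [|lra|now apply CW|apply CW; lra].
  symmetry. apply (CRInt_derive A); [lra| |].
  - intros t Ht. rewrite <- Eq by lra. apply DA. lra.
  - intros t Ht. apply ccont_minus; apply CW; lra.
Qed.

(** * A midpoint Abel-Plana formula on slanted rays *)

Definition nome (m r : R) : C := cexp (- (2 * PI * r), 2 * PI * r * m).

(** Partial sums, from [n = 1], of the geometric series of [- q], whose sum is [plana_kernel q]. As
    polynomials in [q] they have no poles, so Cauchy's theorem applies to them directly. *)
Fixpoint alt_geom (N : nat) (q : C) : C :=
  match N with O => 0 | S n => (alt_geom n q + (- q) ^ S n)%C end.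

Definition plana_kernel (q : C) : C := (- q / (1 + q))%C.

Lemma Cmod_nome (m r : R) : Cmod (nome m r) = exp (- (2 * PI * r)).
Proof. unfold nome. rewrite Cmod_cexp. reflexivity. Qed.

Lemma alt_geom_closed (N : nat) (q : C) : (1 + q)%C <> 0 -> alt_geom N q = (plana_kernel q * (1 - (- q) ^ N))%C.
Proof.
  intro H. induction N as [|N IH].
  - unfold plana_kernel; simpl. field. exact H.
  - simpl alt_geom. rewrite IH. unfold plana_kernel. rewrite Cpow_S. field. exact H.
Qed.

(** Up to [r0] the angle [2 PI r m] is at most [PI/2], so [Re (1 + q) >= 1]; beyond it
    [|q| <= exp (- 2 PI r0) < 1]. Starting at the midpoint matters: there [q = 1], whereas at a
    summation point [q] would be [-1]. *)
Lemma nome_gap (m : R) : 0 <= m -> exists c, 0 < c /\ forall r, 0 <= r -> c <= Cmod (1 + nome m r).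
Proof.
  intro Hm. pose proof PI_RGT_0 as PP.
  set (r0 := / (4 * (m + 1))).
  assert (P0 : 0 < r0) by (apply Rinv_0_lt_compat; lra).
  assert (E0 : exp (- (2 * PI * r0)) < 1).
  { rewrite <- exp_0. apply exp_increasing. assert (0 < PI * r0) by (now apply Rmult_lt_0_compat). lra. }
  exists (1 - exp (- (2 * PI * r0))). split; [lra|]. intros r Hr.
  destruct (Rle_dec r r0) as [L|L].
  - apply Rle_trans with 1; [pose proof (exp_pos (- (2 * PI * r0))); lra|].
    eapply Rle_trans; [|apply re_le_Cmod]. eapply Rle_trans; [|apply Rle_abs].
    unfold nome, cexp, Cplus, RtoC, Re, Im; simpl.
    assert (0 <= cos (2 * PI * r * m)); [|pose proof (exp_pos (- (2 * PI * r))); nra].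
    assert (Hrm : 4 * (r * m) <= 1).
    { apply (Rmult_le_compat_r (4 * (m + 1))) in L; [|lra]. unfold r0 in L. rewrite Rinv_l in L by lra. nra. }
    assert (0 <= r * m) by (now apply Rmult_le_pos). apply cos_ge_0; nra.
  - pose proof (Cmod_triangle (1 + nome m r) (- nome m r)) as T.
    rewrite Cmod_opp, Cmod_nome in T.
    replace (1 + nome m r + - nome m r)%C with (RtoC 1) in T by ring. rewrite Cmod_1 in T.
    assert (exp (- (2 * PI * r)) <= exp (- (2 * PI * r0))); [|lra]. apply exp_le_mono.
    assert (PI * r0 <= PI * r) by (apply Rmult_le_compat_l; lra). lra.
Qed.

Lemma ccont_nome (m r : R) : ccont (nome m) r.
Proof.
  apply ccont_cexp. split; simpl; eapply is_derive_continuous; auto_derive; trivial.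
Qed.

Lemma ccont_alt_geom (m r : R) (N : nat) : ccont (fun r => alt_geom N (nome m r)) r.
Proof.
  induction N as [|N IH]; [apply ccont_const|]. simpl alt_geom. apply ccont_plus; [exact IH|].
  apply (ccont_pow (fun r => - nome m r)%C r (S N)). apply ccont_opp, ccont_nome.
Qed.

Lemma ccont_plana_kernel (m r : R) : 0 <= m -> 0 <= r -> ccont (fun r => plana_kernel (nome m r)) r.
Proof.
  intros Hm Hr. destruct (nome_gap m Hm) as [c [Hc H]].
  apply ccont_mult; [apply ccont_opp, ccont_nome|]. apply (ccont_inv (fun r => 1 + nome m r)%C).
  - apply ccont_plus; [apply ccont_const|apply ccont_nome].
  - apply Cmod_gt_0. specialize (H r Hr). lra.
Qed.

Lemma plana_kernel_bound (m : R) : 0 <= m -> exists c, 0 < c /\ forall r, 0 <= r ->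
  Cmod (plana_kernel (nome m r)) <= c * exp (- (2 * PI * r)).
Proof.
  intros Hm. destruct (nome_gap m Hm) as [c [Hc H]]. exists (/ c). split; [now apply Rinv_0_lt_compat|].
  intros r Hr. specialize (H r Hr). unfold plana_kernel.
  rewrite Cmod_div by (apply Cmod_gt_0; lra). rewrite Cmod_opp, Cmod_nome. unfold Rdiv. rewrite Rmult_comm.
  apply Rmult_le_compat_r; [left; apply exp_pos|]. apply Rinv_le_contravar; lra.
Qed.

(** The factor [(m, 1)] is the derivative of [ray] in its parameter [r]. *)
Definition ray_integral (m : R) (F : R -> C) : C := CI (fun r => ((m, 1) * F r * plana_kernel (nome m r))%C).

Lemma two_PI_gt_6 : 6 < 2 * PI.
Proof. pose proof PI2_3_2. lra. Qed.

Lemma tame_ray (m K : R) (F : R -> C) : 0 <= m -> (forall r, 0 <= r -> ccont F r) ->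
  (forall r, 0 <= r -> Cmod (F r) <= K * exp r) ->
  tame (fun r => ((m, 1) * F r * plana_kernel (nome m r))%C).
Proof.
  intros Hm HF HK. destruct (plana_kernel_bound m Hm) as [c [Hc H]]. pose proof two_PI_gt_6 as P6.
  split.
  - intros r Hr. apply ccont_mult; [|now apply ccont_plana_kernel]. apply ccont_mult; [apply ccont_const|auto].
  - exists (Cmod (m, 1) * K * c), 1. split; [lra|]. intros r Hr. rewrite !Cmod_mult.
    specialize (HK r Hr). specialize (H r Hr).
    apply Rle_trans with (Cmod (m, 1) * (K * exp r) * (c * exp (- (2 * PI * r)))).
    + apply Rmult_le_compat; try apply Cmod_ge_0; [apply Rmult_le_pos; apply Cmod_ge_0| |exact H].
      apply Rmult_le_compat_l; [apply Cmod_ge_0|exact HK].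
    + assert (PK : 0 <= K). { pose proof (exp_pos r). pose proof (Cmod_ge_0 (F r)). apply Rmult_le_reg_r with (exp r); lra. }
      replace (Cmod (m, 1) * (K * exp r) * (c * exp (- (2 * PI * r)))) with (Cmod (m, 1) * K * c * (exp r * exp (- (2 * PI * r)))) by ring.
      rewrite <- exp_plus. apply Rmult_le_compat_l; [repeat apply Rmult_le_pos; try apply Cmod_ge_0; lra|].
      apply exp_le_mono. nra.
Qed.

(* [e^(2 pi i (u - b))] at [u = t + r (m + i)]; it equals the nome on both sides [t = b] and [t = b + 1]. *)
Definition nome_at (m b t r : R) : C := cexp ((0, (2 * PI)%R) * (ray m t r - RtoC b))%C.

Lemma nome_at_b (m b r : R) : nome_at m b b r = nome m r.
Proof.
  unfold nome_at, nome, ray. f_equal. unfold Cmult, Cminus, Cplus, Copp, RtoC; simpl. f_equal; ring.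
Qed.

Lemma nome_at_Sb (m b r : R) : nome_at m b (b + 1) r = nome m r.
Proof.
  rewrite <- (nome_at_b m b r). unfold nome_at, ray, cexp, Cmult, Cminus, Cplus, Copp, RtoC, Re, Im; simpl.
  replace (0 * (b + 1 + r * m + - b) - 2 * PI * (r + - 0)) with (0 * (b + r * m + - b) - 2 * PI * (r + - 0)) by ring.
  replace (0 * (r + - 0) + 2 * PI * (b + 1 + r * m + - b)) with (0 * (r + - 0) + 2 * PI * (b + r * m + - b) + 2 * INR 1 * PI) by (simpl; ring).
  rewrite cos_period, sin_period. reflexivity.
Qed.

Lemma Cmod_nome_at (m b t r : R) : Cmod (nome_at m b t r) = exp (- (2 * PI * r)).
Proof.
  unfold nome_at, ray. rewrite Cmod_cexp. f_equal. unfold Re, Cmult, Cminus, Cplus, Copp, RtoC; simpl. ring.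
Qed.

Lemma holo_alt_geom (m b : R) (N : nat) : exists D, holo m (fun t r => alt_geom N (nome_at m b t r)) D.
Proof.
  assert (Hq : holo m (nome_at m b) (fun t r => ((0, (2 * PI)%R) * (1 + 0) * nome_at m b t r)%C)).
  { apply holo_cexp. apply holo_scal. apply holo_plus; [apply holo_ray|].
    apply (holo_const m (- RtoC b)%C). }
  assert (Hp : forall n, exists D, holo m (fun t r => ((- nome_at m b t r) ^ n)%C) D).
  { induction n as [|n [D IH]].
    - eexists. apply (holo_const m 1).
    - eexists. eapply holo_ext; [| |apply holo_mult; [apply (holo_scal m (- (1))%C); exact Hq|exact IH]].
      + intros t r. cbv beta. rewrite Cpow_S. ring.
      + intros t r. reflexivity. }
  induction N as [|N [D IH]].
  - eexists. apply (holo_const m 0).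
  - destruct (Hp (S N)) as [D' H']. eexists. apply (holo_plus m _ _ _ _ IH H').
Qed.

Lemma Cmod_alt_geom (N : nat) (q : C) : Cmod q <= 1 -> Cmod (alt_geom N q) <= INR N * Cmod q.
Proof.
  intro Hq. induction N as [|N IH].
  - simpl. rewrite Cmod_0. lra.
  - rewrite S_INR. simpl alt_geom. eapply Rle_trans; [apply Cmod_triangle|].
    assert (Cmod ((- q) * (- q) ^ N) <= Cmod q).
    { rewrite Cmod_mult, Cmod_pow, Cmod_opp. rewrite <- (Rmult_1_r (Cmod q)) at 3.
      apply Rmult_le_compat_l; [apply Cmod_ge_0|]. rewrite <- (pow1 N). apply pow_incr. split; [apply Cmod_ge_0|exact Hq]. }
    lra.
Qed.

Lemma is_lim_seq_inv_S (K : R) : is_lim_seq (fun n => K / INR (S n)) 0.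
Proof.
  replace (Finite 0) with (Rbar_mult K 0) by (simpl; f_equal; ring).
  apply is_lim_seq_scal_l. apply (is_lim_seq_inv _ p_infty); [|discriminate].
  apply (is_lim_seq_incr_1 INR), is_lim_seq_INR.
Qed.

(** [alt_geom N] of the nome is holomorphic with period [1], so Cauchy's theorem on the
    parallelogram turns the real segment into the difference of the two slanted sides. The top side
    vanishes as [T] grows, and letting [N] grow turns [alt_geom] into the kernel. *)
Lemma ray_integral_half_step (m b K : R) (F D : R -> R -> C) : 0 <= m -> 0 < b -> holo m F D ->
  (forall t r, b <= t <= b + 1 -> 0 <= r -> Cmod (F t r) <= K * exp r) ->
  is_cseq (fun N => CRInt (fun t => (F t 0%R * alt_geom N (nome_at m b t 0%R))%C) b (b + 1))
    (ray_integral m (F b) - ray_integral m (F (b + 1)%R))%C.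
Proof.
  intros Hm Hb HF HK. pose proof two_PI_gt_6 as P6.
  assert (Pos : forall t r, b <= t -> 0 <= r -> 0 < t + r * m) by (intros; nra).
  assert (PK : 0 <= K).
  { specialize (HK b 0 ltac:(lra) ltac:(lra)). rewrite exp_0 in HK. pose proof (Cmod_ge_0 (F b 0)). lra. }
  assert (Ec : forall r, 0 <= r -> exp (- (2 * PI * r)) <= 1) by (intros; rewrite <- exp_0; apply exp_le_mono; nra).
  set (HN := fun N t => CI (fun r => ((m, 1) * (F t r * alt_geom N (nome m r)))%C)).
  assert (Tm : forall N t, b <= t <= b + 1 -> tame (fun r => ((m, 1) * (F t r * alt_geom N (nome m r)))%C)).
  { intros N t Ht. apply tame_scal. split.
    - intros r Hr. apply ccont_mult; [|apply ccont_alt_geom]. eapply holo_ccont_r; [exact HF|]. apply Pos; lra.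
    - exists (K * INR N), 1. split; [lra|]. intros r Hr. rewrite Cmod_mult.
      apply Rle_trans with (K * exp r * (INR N * exp (- (2 * PI * r)))).
      + apply Rmult_le_compat; try apply Cmod_ge_0; [now apply HK|].
        rewrite <- (Cmod_nome m). apply Cmod_alt_geom. rewrite Cmod_nome. now apply Ec.
      + replace (K * exp r * (INR N * exp (- (2 * PI * r)))) with (K * INR N * (exp r * exp (- (2 * PI * r)))) by ring.
        rewrite <- exp_plus. apply Rmult_le_compat_l; [apply Rmult_le_pos; [exact PK|apply pos_INR]|]. apply exp_le_mono. nra. }
  assert (Step : forall N, CRInt (fun t => (F t 0%R * alt_geom N (nome_at m b t 0%R))%C) b (b + 1) = (HN N b - HN N (b + 1)%R)%C).
  { intro N. destruct (holo_alt_geom m b N) as [DA HA].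
    set (W := fun t r => (F t r * alt_geom N (nome_at m b t r))%C).
    assert (HW : holo m W (fun t r => (D t r * alt_geom N (nome_at m b t r) + F t r * DA t r)%C)) by (now apply holo_mult).
    assert (L : is_clim (fun T => (CRInt (fun t => W t T) b (b + 1)))%C (HN N (b + 1)%R + (- (1)) * HN N b + CRInt (fun t => W t 0) b (b + 1))%C).
    { apply is_clim_ext with (fun T => (CRInt (fun r => ((m, 1) * (F (b + 1)%R r * alt_geom N (nome m r)))%C) 0 T
         + (- (1)) * CRInt (fun r => ((m, 1) * (F b r * alt_geom N (nome m r)))%C) 0 T + CRInt (fun t => W t 0) b (b + 1))%C).
      - intros T HT. pose proof (cauchy_parallelogram m b T W _ Hm Hb HT HW) as Cp.
        assert (E1 : CRInt (fun r => ((m, 1) * W (b + 1)%R r)%C) 0 T = CRInt (fun r => ((m, 1) * (F (b + 1)%R r * alt_geom N (nome m r)))%C) 0 T).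
        { apply CRInt_ext; [exact HT|]. intros r _. unfold W. now rewrite nome_at_Sb. }
        assert (E2 : CRInt (fun r => ((m, 1) * W b r)%C) 0 T = CRInt (fun r => ((m, 1) * (F b r * alt_geom N (nome m r)))%C) 0 T).
        { apply CRInt_ext; [exact HT|]. intros r _. unfold W. now rewrite nome_at_b. }
        rewrite E1, E2 in Cp.
        replace (CRInt (fun t => W t T) b (b + 1)) with ((CRInt (fun t => W t T) b (b + 1) - CRInt (fun t => W t 0) b (b + 1)) + CRInt (fun t => W t 0) b (b + 1))%C by ring.
        rewrite <- Cp. ring.
      - apply is_clim_plus; [apply is_clim_plus; [apply CI_lim, Tm; lra|apply is_clim_scal, CI_lim, Tm; lra]|].
        intros eps He. exists 0. intros _ _. set (z := CRInt _ _ _). replace (z - z)%C with (RtoC 0) by ring. now rewrite Cmod_0. }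
    (* On the top side the nome contributes [exp (- 2 PI T)] against the growth [exp T] of [F]; as
       [2 PI > 6], a factor [exp (- T)] is left over. *)
    assert (L0 : is_clim (fun T => (CRInt (fun t => W t T) b (b + 1)))%C 0).
    { intros eps He.
      exists (Rmax 0 (K * INR N / eps + 1)). intros T HT.
      assert (T0 : 0 <= T) by (eapply Rle_trans; [apply Rmax_l|exact HT]).
      assert (T1 : K * INR N / eps + 1 <= T) by (eapply Rle_trans; [apply Rmax_r|exact HT]).
      set (z := CRInt _ _ _). replace (z - 0)%C with z by ring. unfold z.
      apply Rle_lt_trans with (K * INR N * exp (- T)).
      - rewrite <- (Rmult_1_r (K * INR N * exp (- T))). replace 1 with (b + 1 - b) at 2 by ring.
        apply CRInt_bound_const; [lra| |].
        + intros t Ht. eapply holo_ccont_t; [exact HW|]. apply Pos; lra.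
        + intros t Ht. unfold W. rewrite Cmod_mult. apply Rle_trans with (K * exp T * (INR N * exp (- (2 * PI * T)))).
          * apply Rmult_le_compat; try apply Cmod_ge_0; [apply HK; lra|]. rewrite <- (Cmod_nome_at m b t T).
            apply Cmod_alt_geom. rewrite Cmod_nome_at. now apply Ec.
          * replace (K * exp T * (INR N * exp (- (2 * PI * T)))) with (K * INR N * (exp T * exp (- (2 * PI * T)))) by ring.
            rewrite <- exp_plus. apply Rmult_le_compat_l; [apply Rmult_le_pos; [exact PK|apply pos_INR]|]. apply exp_le_mono. nra.
      - assert (PKN : 0 <= K * INR N) by (apply Rmult_le_pos; [exact PK|apply pos_INR]).
        rewrite exp_Ropp. pose proof (exp_ineq1_le T) as X. pose proof (exp_pos T).
        apply Rmult_lt_reg_r with (exp T); [assumption|]. rewrite Rmult_assoc, Rinv_l, Rmult_1_r by lra.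
        apply Rlt_le_trans with (eps * (K * INR N / eps + 1)); [|nra].
        replace (eps * (K * INR N / eps + 1)) with (K * INR N + eps) by (field; lra). lra. }
    pose proof (is_clim_unique _ _ _ L L0) as E. unfold W in E.
    set (z := CRInt _ _ _) in *. replace z with ((HN N (b + 1)%R + - (1) * HN N b + z) + (HN N b - HN N (b + 1)%R))%C by ring.
    rewrite E. ring. }
  assert (LH : forall t, b <= t <= b + 1 -> is_cseq (fun N => HN N t) (ray_integral m (F t))).
  { intros t Ht. destruct (plana_kernel_bound m Hm) as [c [Hc Hk]]. destruct (nome_gap m Hm) as [c0 [Hc0 Hg]].
    assert (CF : forall r, 0 <= r -> ccont (F t) r) by (intros r Hr; eapply holo_ccont_r; [exact HF|apply Pos; lra]).
    (* The difference from the kernel carries the factor [(- q)^N], and integrating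
       [exp (- (N + 1) r)] yields [1 / (N + 1)]. *)
    apply is_cseq_le with (fun N => (Cmod (m, 1) * K * c) / INR (S N)); [|apply is_lim_seq_inv_S].
    intro N. unfold HN, ray_integral.
    assert (T2 : tame (fun r => ((m, 1) * F t r * plana_kernel (nome m r))%C)) by (apply (tame_ray m K); auto).
    replace (CI (fun r => ((m, 1) * (F t r * alt_geom N (nome m r)))%C) - CI (fun r => ((m, 1) * F t r * plana_kernel (nome m r))%C))%C
      with (CI (fun r => ((m, 1) * (F t r * alt_geom N (nome m r)) + - (1) * ((m, 1) * F t r * plana_kernel (nome m r)))%C)).
    2: { rewrite CI_plus, (CI_scal (- (1))); [ring|exact T2|now apply Tm|now apply tame_scal]. }
    assert (PN : 0 < INR (S N)) by (apply lt_0_INR; lia).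
    apply CI_bound; [|exact PN|].
    - intros r Hr. apply ccont_plus; [apply (Tm N t Ht); exact Hr|]. apply ccont_mult; [apply ccont_const|apply T2, Hr].
    - intros r Hr. assert (N1 : (1 + nome m r)%C <> 0) by (apply Cmod_gt_0; specialize (Hg r Hr); lra).
      rewrite alt_geom_closed by exact N1.
      replace ((m, 1) * (F t r * (plana_kernel (nome m r) * (1 - (- nome m r) ^ N))) + - (1) * ((m, 1) * F t r * plana_kernel (nome m r)))%C
        with (- ((m, 1) * F t r * plana_kernel (nome m r) * (- nome m r) ^ N))%C by ring.
      rewrite Cmod_opp, !Cmod_mult, Cmod_pow, Cmod_opp, Cmod_nome.
      replace (exp (- (2 * PI * r)) ^ N) with (exp (- (2 * PI * r * INR N))).
      2: { rewrite <- (exp_ln_pow (exp _)) by apply exp_pos. rewrite ln_exp. f_equal. ring. }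
      specialize (HK t r Ht Hr). specialize (Hk r Hr).
      apply Rle_trans with (Cmod (m, 1) * (K * exp r) * (c * exp (- (2 * PI * r))) * exp (- (2 * PI * r * INR N))).
      + apply Rmult_le_compat_r; [left; apply exp_pos|]. apply Rmult_le_compat; try apply Cmod_ge_0; [apply Rmult_le_pos; apply Cmod_ge_0| |exact Hk].
        apply Rmult_le_compat_l; [apply Cmod_ge_0|exact HK].
      + replace (Cmod (m, 1) * (K * exp r) * (c * exp (- (2 * PI * r))) * exp (- (2 * PI * r * INR N)))
          with (Cmod (m, 1) * K * c * (exp r * exp (- (2 * PI * r)) * exp (- (2 * PI * r * INR N)))) by ring.
        rewrite <- !exp_plus. apply Rmult_le_compat_l; [repeat apply Rmult_le_pos; try apply Cmod_ge_0; lra|].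
        apply exp_le_mono. rewrite S_INR. pose proof (pos_INR N). assert (0 <= r * INR N) by (apply Rmult_le_pos; lra). nra. }
  eapply is_cseq_ext; [intro N; symmetry; apply Step|]. apply is_cseq_minus; apply LH; lra.
Qed.

(** On the real segment [- q = exp (2 PI i (t - b - 1/2))]: the sign is a shift by half a period,
    which centres the kernel at the midpoint of [[b, b + 1]]. *)
Lemma alt_geom_dirichlet (m b t : R) (N : nat) :
  (1 + alt_geom N (nome_at m b t 0) + Cconj (alt_geom N (nome_at m b t 0)))%C = RtoC (dirichlet N (t - (b + / 2))).
Proof.
  set (s := t - (b + / 2)).
  assert (E : (- nome_at m b t 0)%C = cexp (0, 2 * PI * s)).
  { unfold nome_at, ray, cexp, s, Copp, Cmult, Cminus, Cplus, Copp, RtoC, Re, Im; simpl.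
    replace (0 * (t + 0 * m + - b) - 2 * PI * (0 + - 0)) with 0 by ring.
    replace (0 * (0 + - 0) + 2 * PI * (t + 0 * m + - b)) with (2 * PI * (t - (b + / 2)) + PI) by field.
    rewrite neg_cos, neg_sin. f_equal; ring. }
  assert (P : forall n, ((- nome_at m b t 0) ^ n)%C = cexp (0, 2 * PI * INR n * s)).
  { intro n. rewrite E, <- cexp_nat. f_equal. unfold Cmult, RtoC; simpl. f_equal; ring. }
  induction N as [|N IH].
  - simpl. unfold Cconj, Cplus, RtoC; simpl. f_equal; ring.
  - change (alt_geom (S N) (nome_at m b t 0)) with (alt_geom N (nome_at m b t 0) + (- nome_at m b t 0) ^ S N)%C.
    rewrite P. simpl dirichlet. rewrite RtoC_plus, <- IH.
    unfold cexp, Cconj, Cplus, RtoC, Re, Im; simpl. rewrite exp_0. f_equal; ring.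
Qed.

(** The Dirichlet kernel samples [F] at the midpoint and splits as [1 + g + Cconj g]: the constant
    gives the integral, [g] the upper rays, [Cconj g] the lower ones. [G] is the reflection
    [Cconj (F (Cconj u))], specified by its values on the real axis, so the lower rays become
    conjugates of upper ray integrals of [G]. *)
Lemma plana_step (m b K : R) (F D G E : R -> R -> C) : 0 <= m -> 0 < b -> holo m F D -> holo m G E ->
  (forall t r, b <= t <= b + 1 -> 0 <= r -> Cmod (F t r) <= K * exp r) ->
  (forall t r, b <= t <= b + 1 -> 0 <= r -> Cmod (G t r) <= K * exp r) ->
  (forall t, b <= t <= b + 1 -> G t 0 = Cconj (F t 0)) ->
  F (b + / 2) 0 = (CRInt (fun t => F t 0%R) b (b + 1) +
    ((ray_integral m (F b) + Cconj (ray_integral m (G b))) - (ray_integral m (F (b + 1)%R) + Cconj (ray_integral m (G (b + 1)%R)))))%C.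
Proof.
  intros Hm Hb HF HG KF KG FG.
  pose proof (ray_integral_half_step m b K F D Hm Hb HF KF) as L1.
  pose proof (is_cseq_conj _ _ (ray_integral_half_step m b K G E Hm Hb HG KG)) as L2.
  assert (Pos : forall t, b <= t -> 0 < t + 0 * m) by (intros; lra).
  assert (CA : forall N t, b <= t <= b + 1 -> ccont (fun t => alt_geom N (nome_at m b t 0)) t).
  { intros N t Ht. destruct (holo_alt_geom m b N) as [DA HA]. eapply (holo_ccont_t m _ _ t 0 HA). apply Pos; lra. }
  assert (CF : forall t, b <= t <= b + 1 -> ccont (fun t => F t 0) t) by (intros t Ht; eapply holo_ccont_t; [exact HF|apply Pos; lra]).
  assert (CG : forall t, b <= t <= b + 1 -> ccont (fun t => G t 0) t) by (intros t Ht; eapply holo_ccont_t; [exact HG|apply Pos; lra]).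
  assert (L : is_cseq (fun N => CRInt (fun t => (RtoC (dirichlet N (t - (b + / 2))) * F t 0%R)%C) b (b + 1)) (F (b + / 2) 0)).
  { assert (Sp : forall (p : C -> R),
      (forall z, Rabs (p z) <= Cmod z) -> (forall x z, p (RtoC x * z)%C = x * p z) ->
      (forall t r, 0 < t + r * m -> is_derive (fun t => p (F t r)) t (p (D t r))) ->
      (forall t r, 0 < t + r * m -> continuity_2d_pt (fun t r => p (D t r)) t r) ->
      is_lim_seq (fun N => RInt (fun t => p (RtoC (dirichlet N (t - (b + / 2))) * F t 0%R)%C) b (b + 1)) (p (F (b + / 2) 0))).
    { intros p P0 P1 P2 P3.
      pose proof (dirichlet_limit (fun t => p (F t 0)) (fun t => p (D t 0)) (b + / 2)) as DL.
      replace (b + / 2 - / 2) with b in DL by ring. replace (b + / 2 + / 2) with (b + 1) in DL by field.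
      eapply is_lim_seq_ext; [|apply DL].
      - intro N. cbv beta. apply RInt_ext_R. intro t. rewrite P1. apply Rmult_comm.
      - intros s Hs. apply P2, Pos; lra.
      - intros s Hs. apply filterlim_locally. intros eps. destruct (P3 s 0 ltac:(apply Pos; lra) eps) as [d Hd].
        exists d. intros y Hy. apply Hd; [exact Hy|rewrite Rminus_diag, Rabs_R0; apply cond_pos]. }
    apply is_cseq_re_im.
    - apply (Sp Re).
      + apply re_le_Cmod. + intros x z; unfold Re, Cmult, RtoC; simpl; ring.
      + intros t r H. apply (HF t r H). + intros t r H. apply (HF t r H).
    - apply (Sp Im).
      + apply im_le_Cmod. + intros x z; unfold Im, Cmult, RtoC; simpl; ring.
      + intros t r H. apply (HF t r H). + intros t r H. apply (HF t r H). }
  eapply is_cseq_unique; [exact L|].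
  eapply is_cseq_ext; [|replace (CRInt (fun t => F t 0%R) b (b + 1) +
    ((ray_integral m (F b) + Cconj (ray_integral m (G b))) - (ray_integral m (F (b + 1)%R) + Cconj (ray_integral m (G (b + 1)%R)))))%C
    with (CRInt (fun t => F t 0%R) b (b + 1) + ((ray_integral m (F b) - ray_integral m (F (b + 1)%R)) + Cconj (ray_integral m (G b) - ray_integral m (G (b + 1)%R))))%C;
    [apply is_cseq_plus; [apply is_cseq_const|apply is_cseq_plus; [exact L1|exact L2]]|]].
  - intro N. cbv beta. rewrite <- CRInt_conj; [|lra|].
    + rewrite <- !CRInt_plus; try lra; try assumption.
      * apply CRInt_ext; [lra|]. intros t Ht. rewrite <- (alt_geom_dirichlet m). rewrite FG by exact Ht.
        set (z := alt_geom N (nome_at m b t 0)). rewrite Cmult_conj. 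
        replace (Cconj (Cconj (F t 0))) with (F t 0) by (unfold Cconj; destruct (F t 0); simpl; f_equal; ring). ring.
      * intros t Ht. apply ccont_plus; [apply ccont_mult; auto|]. apply ccont_conj, ccont_mult; auto.
      * intros t Ht. apply ccont_mult; auto.
      * intros t Ht. apply ccont_conj, ccont_mult; auto.
    + intros t Ht. apply ccont_mult; auto.
  - assert (Ec : forall z w : C, Cconj (z - w) = (Cconj z - Cconj w)%C) by (intros; unfold Cconj, Cminus, Cplus, Copp; simpl; f_equal; ring).
    rewrite Ec. ring.
Qed.

(* [J t] collects the contribution of the two rays issued from [t]. *)
Lemma plana_sum (m b : R) (F D G E : R -> R -> C) (n : nat) : 0 <= m -> 0 < b -> holo m F D -> holo m G E ->
  (forall B, exists K, forall t r, b <= t <= B -> 0 <= r -> Cmod (F t r) <= K * exp r /\ Cmod (G t r) <= K * exp r) ->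
  (forall t, b <= t -> G t 0 = Cconj (F t 0)) ->
  let J := fun t => (ray_integral m (F t) + Cconj (ray_integral m (G t)))%C in
  csum (fun k => F (b + / 2 + INR k)%R 0%R) n = (CRInt (fun t => F t 0%R) b (b + INR (S n)) + (J b - J (b + INR (S n))%R))%C.
Proof.
  intros Hm Hb HF HG HK FG J.
  assert (St : forall k : nat, F (b + / 2 + INR k)%R 0%R = (CRInt (fun t => F t 0%R) (b + INR k) (b + INR (S k)) + (J (b + INR k)%R - J (b + INR (S k))%R))%C).
  { intro k. pose proof (pos_INR k) as Pk. destruct (HK (b + INR k + 1)) as [K HKk].
    replace (b + / 2 + INR k) with (b + INR k + / 2) by ring. rewrite S_INR, <- Rplus_assoc.
    apply (plana_step m (b + INR k) K F D G E); try assumption; try lra.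
    - intros t r Ht Hr. apply HKk; lra. - intros t r Ht Hr. apply HKk; lra. - intros t Ht. apply FG; lra. }
  induction n as [|n IH].
  - rewrite csum_0, St. simpl INR. rewrite Rplus_0_r. reflexivity.
  - rewrite csum_S, IH, St. pose proof (pos_INR n) as Pn.
    rewrite (CRInt_Chasles (fun t => F t 0) b (b + INR (S n)) (b + INR (S (S n)))).
    + ring.
    + rewrite !S_INR. lra.
    + intros t Ht. eapply holo_ccont_t; [exact HF|]. lra.
Qed.

(** * The summand on slanted strips *)

Lemma clog_real (t : R) : 0 < t -> clog (RtoC t) = RtoC (ln t).
Proof.
  intro Ht. unfold clog, RtoC, Re, Im; simpl. replace (0 / t) with 0 by (unfold Rdiv; ring). rewrite atan_0. f_equal.
  replace (t * (t * 1) + 0 * (0 * 1)) with (t * t) by ring. rewrite ln_mult by exact Ht. field.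
Qed.

Lemma ray_0 (m t : R) : ray m t 0 = RtoC t.
Proof. unfold ray, RtoC. f_equal. ring. Qed.

Definition strip_powexp (m : R) (p : C) (al x t r : R) : C :=
  (cexp (p * clog (ray m t r)) * cexp (- (RtoC x * cexp (RtoC al * clog (ray m t r)))))%C.

Lemma holo_strip_powexp (m : R) (p : C) (al x : R) : exists D, holo m (strip_powexp m p al x) D.
Proof.
  eexists. apply holo_mult.
  - apply holo_cexp, holo_scal, holo_clog.
  - apply holo_cexp. eapply holo_ext; [| |apply (holo_scal m (- RtoC x)%C), holo_cexp, (holo_scal m (RtoC al)), holo_clog].
    + intros t r. cbv beta. ring.
    + intros t r. reflexivity.
Qed.

Lemma strip_powexp_real (m : R) (p : C) (al x t : R) : 0 < t -> strip_powexp m p al x t 0 = powexp p al x t.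
Proof.
  intro Ht. unfold strip_powexp, powexp. rewrite ray_0, clog_real by exact Ht. f_equal.
  rewrite <- cexp_R. f_equal. rewrite <- (RtoC_mult al), cexp_R, <- RtoC_mult, <- RtoC_opp. reflexivity.
Qed.

(** On the real axis, conjugating the exponent conjugates the function; this supplies the reflected
    function of the Abel-Plana formula. *)
Lemma powexp_conj (p : C) (al x t : R) : powexp (Cconj p) al x t = Cconj (powexp p al x t).
Proof.
  unfold powexp. rewrite Cmult_conj, <- cexp_conj, Cmult_conj.
  replace (Cconj (RtoC (ln t))) with (RtoC (ln t)) by (unfold Cconj, RtoC; simpl; f_equal; ring).
  replace (Cconj (RtoC (exp (- (x * Rpower t al))))) with (RtoC (exp (- (x * Rpower t al)))) by (unfold Cconj, RtoC; simpl; f_equal; ring).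
  reflexivity.
Qed.

Lemma powexp_x0 (p : C) (al t : R) : powexp p al 0 t = cexp (p * RtoC (ln t)).
Proof. unfold powexp. rewrite Rmult_0_l, Ropp_0, exp_0. ring. Qed.

Lemma strip_powexp_x0 (m : R) (p : C) (al t r : R) : strip_powexp m p al 0 t r = cexp (p * clog (ray m t r)).
Proof. unfold strip_powexp. rewrite Cmult_0_l. replace (- 0)%C with (RtoC 0) by ring. rewrite cexp_0. ring. Qed.

(** [y] dominates [|u|] and grows linearly in [r], while [|u| >= b] and the argument is at most [2];
    so [|log u|] is at most [ln y] plus a constant, and [ln_linear_bound] applies. *)
Lemma clog_linear (m b : R) : 0 <= m -> 0 < b -> forall P d B, 0 <= P -> 0 < d -> exists K, forall t r,
  b <= t <= B -> 0 <= r -> P * Cmod (clog (ray m t r)) <= d * r + K.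
Proof.
  intros Hm Hb P d B HP Hd.
  destruct (ln_linear_bound P (d / (m + 1)) HP) as [K HK]; [apply Rdiv_lt_0_compat; lra|].
  exists (P * (Rabs (ln b) + 2) + d / (m + 1) * (Rabs B + 1) + K). intros t r Ht Hr.
  set (y := Rabs B + 1 + (m + 1) * r). pose proof (Rle_abs B).
  assert (Hy : 1 <= y) by (unfold y; pose proof (Rabs_pos B); nra).
  set (N2 := (t + r * m) ^ 2 + r ^ 2).
  assert (X0 : b <= t + r * m) by nra.
  assert (N1 : b * b <= N2) by (unfold N2; nra).
  assert (N3 : N2 <= y * y).
  { assert (S1 : t + r * m + r <= y) by (unfold y; lra). assert (S2 : 0 <= (t + r * m) * r) by (apply Rmult_le_pos; lra).
    assert (S3 : (t + r * m + r) * (t + r * m + r) <= y * y) by (apply Rmult_le_compat; lra).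
    unfold N2. lra. }
  assert (L1 : ln b <= ln N2 / 2).
  { assert (Lb : ln (b * b) <= ln N2) by (apply ln_le; [now apply Rmult_lt_0_compat|exact N1]). rewrite ln_mult in Lb by lra. lra. }
  assert (L2 : ln N2 / 2 <= ln y).
  { assert (Ly : ln N2 <= ln (y * y)) by (apply ln_le; [apply Rlt_le_trans with (b * b); [now apply Rmult_lt_0_compat|exact N1]|exact N3]). rewrite ln_mult in Ly by lra. lra. }
  assert (L3 : 0 <= ln y) by (rewrite <- ln_1; apply ln_le; lra).
  assert (C1 : Cmod (clog (ray m t r)) <= Rabs (ln b) + ln y + 2).
  { eapply Rle_trans; [apply Cmod_le_re_im|]. unfold clog, ray, Re, Im; cbn [fst snd]. fold N2.
    apply Rplus_le_compat.
    - apply Rabs_le. pose proof (Rle_abs (- ln b)) as Q. rewrite Rabs_Ropp in Q. pose proof (Rabs_pos (ln b)). lra.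
    - pose proof (atan_bound (r / (t + r * m))). pose proof PI_4. apply Rabs_le. lra. }
  apply (Rmult_le_compat_l P) in C1; [|exact HP]. specialize (HK y ltac:(lra)).
  assert (E : d / (m + 1) * y = d / (m + 1) * (Rabs B + 1) + d * r) by (unfold y; field; lra).
  lra.
Qed.

Lemma strip_power_bound (m b : R) : 0 <= m -> 0 < b -> forall (p : C) d B, 0 < d -> exists K, forall t r,
  b <= t <= B -> 0 <= r -> Cmod (cexp (p * clog (ray m t r))) <= K * exp (d * r).
Proof.
  intros Hm Hb p d B Hd. destruct (clog_linear m b Hm Hb (Cmod p) d B (Cmod_ge_0 p) Hd) as [K HK].
  exists (exp K). intros t r Ht Hr. rewrite Cmod_cexp, <- exp_plus. apply exp_le_mono.
  eapply Rle_trans; [apply Rle_abs|]. eapply Rle_trans; [apply re_le_Cmod|]. rewrite Cmod_mult.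
  specialize (HK t r Ht Hr). lra.
Qed.

(** Stated with [Re u] in place of [|u|]: for [al = 1] on vertical rays no positive multiple of
    [|u|] bounds [Re u] from below, whereas [c = 1] works here. *)
Definition cone_bound (m al c : R) : Prop := forall t r, 0 < t -> 0 <= r ->
  c * Rpower (t + r * m) al <= Re (cexp (RtoC al * clog (ray m t r))).

Lemma Re_cexp_clog (m al t r : R) :
  Re (cexp (RtoC al * clog (ray m t r))) = exp (al * (ln ((t + r * m) ^ 2 + r ^ 2) / 2)) * cos (al * atan (r / (t + r * m))).
Proof.
  unfold cexp, clog, ray, Cmult, RtoC, Re, Im; cbn [fst snd].
  f_equal; f_equal; ring.
Qed.

Lemma exp_ln_half (al X Y : R) : 0 <= al -> 0 < X -> Rpower X al <= exp (al * (ln (X ^ 2 + Y ^ 2) / 2)).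
Proof.
  intros Hal HX. unfold Rpower. apply exp_le_mono. apply Rmult_le_compat_l; [exact Hal|].
  assert (H : ln (X * X) <= ln (X ^ 2 + Y ^ 2)) by (apply ln_le; nra). rewrite ln_mult in H by exact HX. lra.
Qed.

(* For [al = 1] the rays must be vertical and [cos] may vanish at infinity, but [Re u] itself is the bound. *)
Lemma slope_exists (al : R) : 0 < al -> exists m c, 0 <= m /\ 0 < c /\ (al <= 1 -> m = 0) /\ cone_bound m al c.
Proof.
  intro Hal. pose proof PI_RGT_0 as PP.
  (* [th] bounds [al] times the argument of [u], so that [Re (u^al) >= |u|^al cos th]. *)
  assert (Gen : forall m th, 0 <= m -> 0 < th < PI / 2 ->
     (forall t r, 0 < t -> 0 <= r -> al * atan (r / (t + r * m)) <= th) -> 0 < cos th /\ cone_bound m al (cos th)).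
  { intros m th Hm Hth H. assert (Pc : 0 < cos th) by (apply cos_gt_0; lra). split; [exact Pc|].
    intros t r Ht Hr. rewrite Re_cexp_clog. rewrite Rmult_comm.
    assert (X0 : 0 < t + r * m) by nra.
    apply Rmult_le_compat; [left; apply exp_pos|lra|apply exp_ln_half; lra|].
    assert (0 <= atan (r / (t + r * m))).
    { rewrite <- atan_0. destruct (Req_dec r 0) as [->|N]; [unfold Rdiv; rewrite Rmult_0_l; lra|].
      left. apply atan_increasing. apply Rdiv_lt_0_compat; lra. }
    specialize (H t r Ht Hr). apply cos_decr_1; try lra. now apply Rmult_le_pos; [left|]. }
  destruct (Rtotal_order al 1) as [L|[->|G]].
  - destruct (Gen 0 (al * (PI / 2)) (Rle_refl 0)) as [P1 P2].
    + split; [apply Rmult_lt_0_compat; lra|]. rewrite <- (Rmult_1_l (PI / 2)) at 2. apply Rmult_lt_compat_r; lra.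
    + intros t r Ht Hr. apply Rmult_le_compat_l; [lra|]. left. apply atan_bound.
    + exists 0, (cos (al * (PI / 2))). repeat split; try assumption; lra.
  - exists 0, 1. split; [lra|]. split; [lra|]. split; [reflexivity|]. intros t r Ht Hr.
    rewrite Re_cexp_clog, Rmult_1_l, !Rmult_1_l. rewrite Rmult_0_r, Rplus_0_r, Rpower_1 by exact Ht.
    rewrite cos_atan. set (y := r / t).
    assert (E1 : exp (ln (t ^ 2 + r ^ 2) / 2) = sqrt (t ^ 2 + r ^ 2)).
    { rewrite <- Rpower_sqrt by nra. unfold Rpower. f_equal. field. }
    rewrite E1. assert (E2 : sqrt (t ^ 2 + r ^ 2) = t * sqrt (1 + y²)).
    { rewrite <- (sqrt_pow2 t) at 2 by lra. rewrite <- sqrt_mult_alt by nra. f_equal. unfold y, Rsqr. field. lra. }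
    rewrite E2. assert (0 < sqrt (1 + y²)) by (apply sqrt_lt_R0; pose proof (Rle_0_sqr y); lra).
    apply Req_le. field. lra.
  (* The slope [/ tan th] keeps the argument of [u] at most [th], hence that of [u^al] at most
     [PI / 4]. *)
  - set (th := PI / (4 * al)).
    assert (Hth : 0 < th < PI / 4).
    { unfold th. split; [apply Rdiv_lt_0_compat; lra|]. apply Rmult_lt_compat_l; [exact PP|]. apply Rinv_lt_contravar; lra. }
    assert (Pt : 0 < tan th) by (apply tan_gt_0; lra).
    destruct (Gen (/ tan th) (PI / 4)) as [P1 P2].
    + left; now apply Rinv_0_lt_compat.
    + lra.
    + intros t r Ht Hr. replace (PI / 4) with (al * th) by (unfold th; field; lra). apply Rmult_le_compat_l; [lra|].
      assert (Pm : 0 < / tan th) by (now apply Rinv_0_lt_compat).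
      assert (X0 : 0 < t + r * / tan th) by nra.
      assert (Q : r / (t + r * / tan th) <= tan th).
      { apply Rmult_le_reg_r with (t + r * / tan th); [exact X0|]. unfold Rdiv. rewrite Rmult_assoc, Rinv_l, Rmult_1_r by lra.
        rewrite Rmult_plus_distr_l. replace (tan th * (r * / tan th)) with r by (field; lra). nra. }
      apply Rle_trans with (atan (tan th)); [|rewrite atan_tan; lra].
      destruct Q as [Q|Q]; [left; now apply atan_increasing|rewrite Q; apply Rle_refl].
    + exists (/ tan th), (cos (PI / 4)). split; [left; now apply Rinv_0_lt_compat|]. split; [exact P1|]. split; [lra|exact P2].
Qed.

Lemma cone_bound_nonneg (m al c t r : R) : 0 <= c -> cone_bound m al c -> 0 < t -> 0 <= r ->
  0 <= Re (cexp (RtoC al * clog (ray m t r))).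
Proof.
  intros Hc H Ht Hr. eapply Rle_trans; [|apply H; assumption].
  apply Rmult_le_pos; [exact Hc|left; apply exp_pos].
Qed.

Lemma strip_powexp_bound (m b c al x : R) : 0 <= m -> 0 < b -> 0 <= c -> 0 <= x -> cone_bound m al c ->
  forall (p : C) d B, 0 < d -> exists K, forall t r, b <= t <= B -> 0 <= r -> Cmod (strip_powexp m p al x t r) <= K * exp (d * r).
Proof.
  intros Hm Hb Hc Hx HC p d B Hd. destruct (strip_power_bound m b Hm Hb p d B Hd) as [K HK].
  exists K. intros t r Ht Hr. eapply Rle_trans; [|apply HK; eassumption].
  unfold strip_powexp. rewrite Cmod_mult. rewrite <- (Rmult_1_r (Cmod (cexp (p * clog (ray m t r))))) at 2.
  apply Rmult_le_compat_l; [apply Cmod_ge_0|]. rewrite Cmod_cexp, <- exp_0. apply exp_le_mono.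
  assert (P := cone_bound_nonneg m al c t r Hc HC ltac:(lra) Hr).
  replace (Re (- (RtoC x * cexp (RtoC al * clog (ray m t r))))) with (- (x * Re (cexp (RtoC al * clog (ray m t r))))).
  - assert (0 <= x * Re (cexp (RtoC al * clog (ray m t r)))) by (now apply Rmult_le_pos). lra.
  - unfold Re, Copp, Cmult, RtoC; simpl. ring.
Qed.

(** The constant depends on [m] and [d] only, so any smallness of the bound [K] on [F], in [x], in
    [N] or in the base point of the ray, passes to the integral. *)
Lemma ray_integral_bound (m d : R) : 0 <= m -> 0 <= d < 2 * PI -> exists c, 0 < c /\ forall (F : R -> C) K,
  (forall r, 0 <= r -> ccont F r) -> (forall r, 0 <= r -> Cmod (F r) <= K * exp (d * r)) ->
  tame (fun r => ((m, 1) * F r * plana_kernel (nome m r))%C) /\ Cmod (ray_integral m F) <= c * K.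
Proof.
  intros Hm Hd. destruct (plana_kernel_bound m Hm) as [c [Hc H]].
  exists (Cmod (m, 1) * c / (2 * PI - d) + 1). split.
  { assert (0 <= Cmod (m, 1) * c / (2 * PI - d)) by (apply Rdiv_le_0_compat; [apply Rmult_le_pos; [apply Cmod_ge_0|lra]|lra]). lra. }
  intros F K HF HK.
  assert (PK : 0 <= K). { specialize (HK 0 (Rle_refl 0)). rewrite Rmult_0_r, exp_0 in HK. pose proof (Cmod_ge_0 (F 0)). lra. }
  assert (B : forall r, 0 <= r -> Cmod ((m, 1) * F r * plana_kernel (nome m r)) <= (Cmod (m, 1) * c * K) * exp (- (2 * PI - d) * r)).
  { intros r Hr. rewrite !Cmod_mult. specialize (HK r Hr). specialize (H r Hr).
    apply Rle_trans with (Cmod (m, 1) * (K * exp (d * r)) * (c * exp (- (2 * PI * r)))).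
    - apply Rmult_le_compat; try apply Cmod_ge_0; [apply Rmult_le_pos; apply Cmod_ge_0| |exact H].
      apply Rmult_le_compat_l; [apply Cmod_ge_0|exact HK].
    - replace (- (2 * PI - d) * r) with (d * r + - (2 * PI * r)) by ring. rewrite exp_plus. right; ring. }
  assert (Cc : forall r, 0 <= r -> ccont (fun r => ((m, 1) * F r * plana_kernel (nome m r))%C) r).
  { intros r Hr. apply ccont_mult; [|now apply ccont_plana_kernel]. apply ccont_mult; [apply ccont_const|auto]. }
  split; [split; [exact Cc|exists (Cmod (m, 1) * c * K), (2 * PI - d); split; [lra|exact B]]|].
  eapply Rle_trans; [apply (CI_bound _ (Cmod (m, 1) * c * K) (2 * PI - d)); [exact Cc|lra|exact B]|].
  replace (Cmod (m, 1) * c * K / (2 * PI - d)) with (Cmod (m, 1) * c / (2 * PI - d) * K) by (field; lra). nra.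
Qed.

(** The second summand is the lower ray, of direction [m - i], expressed by reflection through the
    conjugate exponent. *)
Definition ray_pair (m : R) (p : C) (al x t : R) : C :=
  (ray_integral m (strip_powexp m p al x t) + Cconj (ray_integral m (strip_powexp m (Cconj p) al x t)))%C.

(** One instance serves both sums: [x = 0] gives partial sums of the zeta series, [x > 0] those of
    [f]. *)
Lemma plana_powexp (m b c al x : R) (p : C) (n : nat) : 0 <= m -> 0 < b -> 0 <= c -> 0 <= x -> cone_bound m al c ->
  csum (fun k => powexp p al x (b + / 2 + INR k)) n =
  (CRInt (powexp p al x) b (b + INR (S n)) + (ray_pair m p al x b - ray_pair m p al x (b + INR (S n))%R))%C.
Proof.
  intros Hm Hb Hc Hx HC.
  destruct (holo_strip_powexp m p al x) as [D HD]. destruct (holo_strip_powexp m (Cconj p) al x) as [E HE].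
  rewrite (csum_ext _ (fun k => strip_powexp m p al x (b + / 2 + INR k) 0)).
  2: { intros k _. symmetry. apply strip_powexp_real. pose proof (pos_INR k). lra. }
  rewrite (plana_sum m b _ D _ E n Hm Hb HD HE).
  - f_equal. apply CRInt_ext; [pose proof (pos_INR (S n)); lra|]. intros t Ht. apply strip_powexp_real. lra.
  - intro B. destruct (strip_powexp_bound m b c al x Hm Hb Hc Hx HC p 1 B Rlt_0_1) as [K1 H1].
    destruct (strip_powexp_bound m b c al x Hm Hb Hc Hx HC (Cconj p) 1 B Rlt_0_1) as [K2 H2].
    exists (Rmax K1 K2). intros t r Ht Hr. specialize (H1 t r Ht Hr). specialize (H2 t r Ht Hr). rewrite Rmult_1_l in H1, H2.
    pose proof (exp_pos r). split; (eapply Rle_trans; [eassumption|apply Rmult_le_compat_r; [lra|]]); [apply Rmax_l|apply Rmax_r].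
  - intros t Ht. rewrite !strip_powexp_real by lra. apply powexp_conj.
Qed.

Lemma ccont_strip_powexp (m : R) (p : C) (al x t r : R) : 0 <= m -> 0 < t -> 0 <= r -> ccont (strip_powexp m p al x t) r.
Proof.
  intros Hm Ht Hr. destruct (holo_strip_powexp m p al x) as [D HD]. eapply holo_ccont_r; [exact HD|]. nra.
Qed.

Lemma ray_pair_vanishes (m b al x : R) (p : C) (e : nat -> R) : 0 <= m -> 0 < b ->
  (forall n r, 0 <= r -> Cmod (strip_powexp m p al x (b + INR (S n)) r) <= e n * exp r /\
     Cmod (strip_powexp m (Cconj p) al x (b + INR (S n)) r) <= e n * exp r) ->
  is_lim_seq e 0 -> is_cseq (fun n => ray_pair m p al x (b + INR (S n))) 0.
Proof.
  intros Hm Hb He Le. pose proof two_PI_gt_6. destruct (ray_integral_bound m 1 Hm ltac:(lra)) as [c [Hc H1]].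
  apply is_cseq_le with (fun n => 2 * c * e n).
  - intro n. unfold ray_pair. set (t := b + INR (S n)).
    assert (Pt : 0 < t) by (unfold t; pose proof (pos_INR (S n)); lra).
    destruct (H1 (strip_powexp m p al x t) (e n)) as [_ B1].
    { intros; now apply ccont_strip_powexp. } { intros r Hr. rewrite Rmult_1_l. now apply He. }
    destruct (H1 (strip_powexp m (Cconj p) al x t) (e n)) as [_ B2].
    { intros; now apply ccont_strip_powexp. } { intros r Hr. rewrite Rmult_1_l. now apply He. }
    set (z1 := ray_integral m (strip_powexp m p al x t)) in *. set (z2 := ray_integral m (strip_powexp m (Cconj p) al x t)) in *.
    replace (z1 + Cconj z2 - 0)%C with (z1 + Cconj z2)%C by ring. eapply Rle_trans; [apply Cmod_triangle|]. rewrite Cmod_conj. lra.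
  - replace (Finite 0) with (Rbar_mult (2 * c) 0) by (simpl; f_equal; ring). now apply is_lim_seq_scal_l.
Qed.

(** * The Hurwitz zeta function *)

Lemma is_clim_const (c : C) : is_clim (fun _ => c) c.
Proof. intros eps He. exists 0. intros _ _. replace (c - c)%C with (RtoC 0) by ring. now rewrite Cmod_0. Qed.

Lemma Cmod_cexp_minus_1 (v : C) : Cmod (cexp v - 1) <= Cmod v * exp (Cmod v).
Proof.
  pose proof (exp_rem_bound 0 v) as H. unfold exp_rem in H. rewrite csum_0 in H. unfold exp_term in H. simpl in H.
  rewrite Rinv_1 in H. replace (1 * 1)%C with (RtoC 1) in H by ring.
  eapply Rle_trans; [exact H|]. replace (Cmod v * 1 / 1) with (Cmod v) by field.
  apply Rmult_le_compat_l; [apply Cmod_ge_0|]. apply Rmax_lub.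
  - rewrite <- exp_0. apply exp_le_mono, Cmod_ge_0.
  - apply exp_le_mono. eapply Rle_trans; [apply Rle_abs|apply re_le_Cmod].
Qed.

Lemma exp_neg_lim (K eps : R) : 0 <= K -> 0 < eps -> exists M, 0 <= M /\ forall T, M <= T -> K * exp (- T) < eps.
Proof.
  intros HK He. exists (K / eps). split; [apply Rdiv_le_0_compat; lra|]. intros T HT.
  rewrite exp_Ropp. pose proof (exp_ineq1_le T) as X. pose proof (exp_pos T).
  apply Rmult_lt_reg_r with (exp T); [assumption|]. rewrite Rmult_assoc, Rinv_l, Rmult_1_r by lra.
  apply (Rmult_le_compat_l eps) in HT; [|lra]. replace (eps * (K / eps)) with K in HT by (field; lra). nra.
Qed.

Lemma is_derive_exp_neg (r : R) : is_derive (fun r => - exp (- r)) r (exp (- r)).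
Proof. auto_derive; trivial; ring. Qed.

Lemma CI_exp_neg : CI (fun r => RtoC (exp (- r))) = 1.
Proof.
  apply CI_unique. apply is_clim_ext with (fun T => (1 + - (1) * RtoC (exp (- T)))%C).
  - intros T HT. rewrite (CRInt_derive (fun r => RtoC (- exp (- r)))); [|exact HT| |].
    + rewrite Ropp_0, exp_0, !RtoC_opp. ring.
    + intros t _. apply is_cderive_RtoC, is_derive_exp_neg.
    + intros t _. apply ccont_RtoC. eapply is_derive_continuous. auto_derive; trivial.
  - match goal with |- is_clim ?f _ => assert (K : is_clim f (1 + - (1) * 0)%C) end;
      [|replace (1 + - (1) * 0)%C with (RtoC 1) in K by ring; exact K].
    apply is_clim_plus; [apply is_clim_const|]. apply is_clim_scal.
    intros eps He. destruct (exp_neg_lim 1 eps ltac:(lra) He) as [M [_ HM]]. exists M. intros T HT.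
    replace (RtoC (exp (- T)) - 0)%C with (RtoC (exp (- T))) by ring. rewrite Cmod_R, Rabs_pos_eq by (left; apply exp_pos).
    specialize (HM T HT). lra.
Qed.

(** Multiplying by the integral of [exp (- r)], which is [1], presents the exponential as an
    integral to which [analytic_at_CI] applies. *)
Lemma analytic_at_cexp (l z : C) : analytic_at (fun s => cexp (s * l)) z.
Proof.
  assert (A : analytic_at (fun s => CI (fun r => (cexp (s * l) * RtoC (exp (- r)))%C)) z).
  { apply (analytic_at_CI (fun _ => l) (fun r => RtoC (exp (- r))) z (Cmod (cexp (z * l)) * exp (3 * Cmod l)) 1); try lra.
    - intros; apply ccont_const.
    - intros; apply ccont_RtoC. eapply is_derive_continuous. auto_derive; trivial.
    - intros r Hr. rewrite Cmod_mult, Cmod_R, Rabs_pos_eq by (left; apply exp_pos).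
      replace (- (1) * r) with (- r) by ring. right; ring. }
  eapply analytic_at_ext_loc; [apply Rlt_0_1| |exact A]. intros w _. cbv beta.
  rewrite CI_scal, CI_exp_neg; [ring|]. split.
  - intros; apply ccont_RtoC. eapply is_derive_continuous. auto_derive; trivial.
  - exists 1, 1. split; [lra|]. intros r Hr. rewrite Cmod_R, Rabs_pos_eq by (left; apply exp_pos). right. rewrite Rmult_1_l. f_equal. ring.
Qed.

(* [(e^((1-s)L) - 1)/(s - 1) = - L int_0^1 e^((1-s)Lv) dv], with [v = 1 - e^-r], is entire in [s]. *)
Lemma analytic_at_power_over (L : R) (z : C) : z <> 1 -> analytic_at (fun s => (cexp ((1 - s) * RtoC L) / (s - 1))%C) z.
Proof.
  intro Hz.
  set (M := fun r => RtoC (- L * (1 - exp (- r)))).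
  set (k := fun r => RtoC (exp (L * (1 - exp (- r))) * exp (- r))).
  assert (CM : forall r, ccont M r) by (intro; apply ccont_RtoC; eapply is_derive_continuous; auto_derive; trivial).
  assert (Ck : forall r, ccont k r) by (intro; apply ccont_RtoC; eapply is_derive_continuous; auto_derive; trivial).
  assert (Bd : forall w r, 0 <= r -> Cmod (cexp (w * M r) * k r) * exp (3 * Cmod (M r)) <= exp (Cmod w * Rabs L + Rabs L + 3 * Rabs L) * exp (- (1) * r)).
  { intros w r Hr. assert (P : 0 < exp (- r) <= 1) by (split; [apply exp_pos|rewrite <- exp_0; apply exp_le_mono; lra]).
    assert (BM : Cmod (M r) <= Rabs L).
    { unfold M. rewrite Cmod_R, Rabs_mult, Rabs_Ropp, (Rabs_pos_eq (1 - _)) by lra. pose proof (Rabs_pos L). nra. }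
    rewrite Cmod_mult, Cmod_cexp. unfold k. rewrite Cmod_R, Rabs_pos_eq by (apply Rmult_le_pos; left; apply exp_pos).
    rewrite <- !exp_plus. apply exp_le_mono.
    assert (Re (w * M r) <= Cmod w * Rabs L).
    { eapply Rle_trans; [apply Rle_abs|]. eapply Rle_trans; [apply re_le_Cmod|]. rewrite Cmod_mult. apply Rmult_le_compat_l; [apply Cmod_ge_0|exact BM]. }
    assert (L * (1 - exp (- r)) <= Rabs L). { pose proof (Rle_abs L). pose proof (Rabs_pos L). nra. }
    lra. }
  assert (A : analytic_at (fun s => CI (fun r => (cexp (s * M r) * k r)%C)) z).
  { eapply (analytic_at_CI M k z _ 1); try lra; auto. }
  assert (Tm : forall s, tame (fun r => (cexp (s * M r) * k r)%C)).
  { intro s. split; [intros; apply ccont_mult; [apply ccont_cexp, ccont_mult; [apply ccont_const|auto]|auto]|].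
    eexists; exists 1; split; [lra|]. intros r Hr. eapply Rle_trans; [|apply Bd, Hr].
    rewrite <- (Rmult_1_r (Cmod _)) at 1. apply Rmult_le_compat_l; [apply Cmod_ge_0|]. rewrite <- exp_0. apply exp_le_mono.
    pose proof (Cmod_ge_0 (M r)). lra. }
  (* The integrand times [(1 - s) L] is the derivative in [r] of [exp ((1 - s) L v)], and
     [v = 1 - exp (- r)] runs from [0] to [1]. *)
  assert (Val : forall s, ((1 - s) * RtoC L * CI (fun r => cexp (s * M r) * k r) = cexp ((1 - s) * RtoC L) - 1)%C).
  { intro s. rewrite <- CI_scal by apply Tm. apply CI_unique.
    apply is_clim_ext with (fun T => (cexp ((1 - s) * RtoC L) * cexp (- ((1 - s) * RtoC L * RtoC (exp (- T)))) - 1)%C).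
    - intros T HT. rewrite (CRInt_derive (fun r => cexp ((1 - s) * RtoC L * RtoC (1 - exp (- r))))); [|exact HT| |].
      + rewrite Ropp_0, exp_0, Rminus_diag, Cmult_0_r, cexp_0. rewrite <- cexp_plus. f_equal. f_equal. rewrite RtoC_minus. ring.
      + intros r _. eapply is_cderive_eq; [apply is_cderive_cexp, is_cderive_scal, is_cderive_RtoC|].
        * instantiate (1 := exp (- r)). auto_derive; trivial; ring.
        * unfold k, M; cbv beta. rewrite (RtoC_mult (exp (L * (1 - exp (- r))))), <- (cexp_R (L * _)).
          replace (cexp ((1 - s) * RtoC L * RtoC (1 - exp (- r)))) with (cexp (s * RtoC (- L * (1 - exp (- r)))) * cexp (RtoC (L * (1 - exp (- r)))))%C; [ring|].
          rewrite <- cexp_plus. f_equal. rewrite !RtoC_mult, RtoC_opp. ring.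
      + intros r _. apply ccont_mult; [apply ccont_const|]. apply ccont_mult; [apply ccont_cexp, ccont_mult; [apply ccont_const|auto]|auto].
    - set (v := ((1 - s) * RtoC L)%C).
      intros eps He. set (A0 := Cmod (cexp v) * Cmod v * exp (Cmod v)).
      assert (PA : 0 <= A0) by (unfold A0; repeat apply Rmult_le_pos; try apply Cmod_ge_0; left; apply exp_pos).
      destruct (exp_neg_lim A0 eps PA He) as [M0 [P0 HM]]. exists M0. intros T HT. specialize (HM T HT).
      assert (PT : 0 < exp (- T) <= 1) by (split; [apply exp_pos|rewrite <- exp_0; apply exp_le_mono; lra]).
      set (w := (- (v * RtoC (exp (- T))))%C).
      replace (cexp v * cexp w - 1 - (cexp v - 1))%C with (cexp v * (cexp w - 1))%C by ring.
      rewrite Cmod_mult. eapply Rle_lt_trans; [|exact HM].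
      assert (Ew : Cmod w = Cmod v * exp (- T)) by (unfold w; rewrite Cmod_opp, Cmod_mult, Cmod_R, Rabs_pos_eq by lra; reflexivity).
      pose proof (Cmod_cexp_minus_1 w) as K. rewrite Ew in K. pose proof (Cmod_ge_0 v).
      assert (exp (Cmod v * exp (- T)) <= exp (Cmod v)) by (apply exp_le_mono; nra).
      unfold A0. rewrite !Rmult_assoc. apply Rmult_le_compat_l; [apply Cmod_ge_0|]. eapply Rle_trans; [exact K|].
      rewrite Rmult_assoc. apply Rmult_le_compat_l; [assumption|]. rewrite Rmult_comm. apply Rmult_le_compat_r; [lra|assumption]. }
  (* The factor [1 / (s - 1)] is analytic off [1] as a sum of simple poles with a single nonzero
     residue. *)
  assert (A1 : analytic_at (fun s => CSer (fun n => (if Nat.eqb n 0 then RtoC 1 else RtoC 0) / (s - 1))%C) z).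
  { apply (analytic_at_poles (fun n => if Nat.eqb n 0 then RtoC 1 else RtoC 0) (fun _ => RtoC 1) z (Cmod (z - 1))).
    - apply Cmod_gt_0. intro E. apply Hz. replace z with (z - 1 + 1)%C by ring. rewrite E; ring.
    - exists 1. change (is_lim_seq (sum_n (fun n => Cmod (if Nat.eqb n 0 then RtoC 1 else RtoC 0))) 1).
      apply (is_lim_seq_ext (fun _ => 1)); [|apply is_lim_seq_const].
      intro n. induction n as [|n IH]; [rewrite sum_O; simpl; now rewrite Cmod_1|]. rewrite sum_n_S, <- IH. simpl. rewrite Cmod_0. ring.
    - intro n. right. apply Rle_refl. }
  assert (N1 : (z - 1)%C <> 0) by (intro E; apply Hz; replace z with (z - 1 + 1)%C by ring; rewrite E; ring).
  assert (Pz : 0 < Cmod (z - 1)) by (now apply Cmod_gt_0).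
  eapply (analytic_at_ext_loc _ _ z _ Pz); [|apply (analytic_at_plus _ _ _ A1 (analytic_at_scal (- RtoC L)%C _ _ A))].
  intros w Hw. cbv beta.
  assert (Nw : (w - 1)%C <> 0).
  { apply Cmod_gt_0. pose proof (Cmod_triangle (w - 1) (- (w - z))) as T. rewrite Cmod_opp in T.
    replace (w - 1 + - (w - z))%C with (z - 1)%C in T by ring. lra. }
  rewrite (CSer_single _ 0%nat).
  - simpl Nat.eqb. cbv iota. pose proof (Val w) as V.
    set (X := CI _) in *. replace (cexp ((1 - w) * RtoC L)) with ((1 - w) * RtoC L * X + 1)%C by (rewrite V; ring).
    field. exact Nw.
  - intros [|n] Hn; [now destruct Hn|]. simpl. unfold Cdiv; ring.
Qed.

(** Both rays have integrands of the shape [exp (s M) k]. The lower one appears as the conjugate of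
    a function of [Cconj s]; moving the conjugation inside replaces [M] and [k] by their conjugates
    and leaves a function of [s]. *)
Lemma analytic_at_ray_pair (m al b : R) (z : C) : 0 <= m -> 0 < b -> analytic_at (fun s => ray_pair m (- s)%C al 0 b) z.
Proof.
  intros Hm Hb. pose proof two_PI_gt_6 as P6.
  set (M := fun r => (- clog (ray m b r))%C). set (k := fun r => ((m, 1) * plana_kernel (nome m r))%C).
  assert (CM : forall r, 0 <= r -> ccont M r).
  { intros r Hr. apply ccont_opp. eapply (holo_ccont_r m _ _ b r (holo_clog m)). nra. }
  assert (Ck : forall r, 0 <= r -> ccont k r) by (intros r Hr; apply ccont_mult; [apply ccont_const|now apply ccont_plana_kernel]).
  destruct (plana_kernel_bound m Hm) as [c [Hc Hk]].
  assert (Bd : forall w, exists K, forall r, 0 <= r -> Cmod (cexp (w * M r) * k r) * exp (3 * Cmod (M r)) <= K * exp (- (1) * r)).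
  { intro w. destruct (clog_linear m b Hm Hb (Cmod w + 3) 1 b) as [K HK]; [pose proof (Cmod_ge_0 w); lra|lra|].
    exists (Cmod (m, 1) * c * exp K). intros r Hr. rewrite Cmod_mult. unfold k. rewrite Cmod_mult.
    specialize (Hk r Hr). specialize (HK b r ltac:(lra) Hr).
    replace (Cmod (cexp (w * M r)) * (Cmod (m, 1) * Cmod (plana_kernel (nome m r))) * exp (3 * Cmod (M r)))
      with (Cmod (m, 1) * ((Cmod (cexp (w * M r)) * exp (3 * Cmod (M r))) * Cmod (plana_kernel (nome m r)))) by ring.
    rewrite !Rmult_assoc. apply Rmult_le_compat_l; [apply Cmod_ge_0|].
    apply Rle_trans with (exp (K + r) * (c * exp (- (2 * PI * r)))).
    - rewrite <- Rmult_assoc. apply Rmult_le_compat; try apply Cmod_ge_0; [apply Rmult_le_pos; [apply Cmod_ge_0|left; apply exp_pos]| |exact Hk].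
      rewrite Cmod_cexp, <- exp_plus. apply exp_le_mono. unfold M at 2. rewrite Cmod_opp.
      assert (Re (w * M r) <= Cmod w * Cmod (clog (ray m b r))).
      { eapply Rle_trans; [apply Rle_abs|]. eapply Rle_trans; [apply re_le_Cmod|]. rewrite Cmod_mult. unfold M. rewrite Cmod_opp. lra. }
      lra.
    - replace (exp (K + r) * (c * exp (- (2 * PI * r)))) with (c * (exp (K + r) * exp (- (2 * PI * r)))) by ring.
      rewrite <- !exp_plus. apply Rmult_le_compat_l; [lra|]. apply exp_le_mono. nra. }
  assert (E1 : forall s r, (cexp (s * M r) * k r)%C = ((m, 1) * strip_powexp m (- s) al 0 b r * plana_kernel (nome m r))%C).
  { intros s r. rewrite strip_powexp_x0. unfold M, k. replace (s * - clog (ray m b r))%C with (- s * clog (ray m b r))%C by ring. ring. }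
  assert (Tm : forall s, tame (fun r => (cexp (s * M r) * k r)%C)).
  { intro s. split; [intros; apply ccont_mult; [apply ccont_cexp, ccont_mult; [apply ccont_const|auto]|auto]|].
    destruct (Bd s) as [K HK]. exists K, 1. split; [lra|]. intros r Hr. eapply Rle_trans; [|apply HK, Hr].
    rewrite <- (Rmult_1_r (Cmod _)) at 1. apply Rmult_le_compat_l; [apply Cmod_ge_0|]. rewrite <- exp_0. apply exp_le_mono.
    pose proof (Cmod_ge_0 (M r)). lra. }
  destruct (Bd z) as [K1 HK1]. destruct (Bd (Cconj z)) as [K2 HK2].
  assert (A1 : analytic_at (fun s => CI (fun r => (cexp (s * M r) * k r)%C)) z) by (apply (analytic_at_CI M k z K1 1); auto; lra).
  assert (A2 : analytic_at (fun s => CI (fun r => (cexp (s * Cconj (M r)) * Cconj (k r))%C)) z).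
  { apply (analytic_at_CI (fun r => Cconj (M r)) (fun r => Cconj (k r)) z K2 1); [intros; apply ccont_conj; auto|intros; apply ccont_conj; auto|lra|].
    intros r Hr. eapply Rle_trans; [|apply HK2, Hr]. rewrite Cmod_conj. apply Req_le. f_equal.
    rewrite !Cmod_mult, Cmod_conj. f_equal. rewrite <- (Cmod_conj (cexp (Cconj z * M r))), <- cexp_conj, Cmult_conj.
    replace (Cconj (Cconj z)) with z by (unfold Cconj; destruct z; simpl; f_equal; ring). reflexivity. }
  eapply (analytic_at_ext_loc _ _ z 1 Rlt_0_1); [|exact (analytic_at_plus _ _ _ A1 A2)].
  intros w _. cbv beta. unfold ray_pair, ray_integral. f_equal.
  - apply CI_ext; [|apply Tm]. intros r _. apply E1.
  - rewrite <- CI_conj.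
    + symmetry. apply CI_ext.
      * intros r _. replace (Cconj (- w)) with (- Cconj w)%C by (unfold Cconj, Copp; simpl; f_equal; ring).
        rewrite <- E1, Cmult_conj, <- cexp_conj, Cmult_conj.
        replace (Cconj (Cconj w)) with w by (unfold Cconj; destruct w; simpl; f_equal; ring). reflexivity.
      * apply tame_conj. eapply tame_ext; [|apply (Tm (Cconj w))]. intro r. cbv beta. rewrite E1.
        replace (Cconj (- w)) with (- Cconj w)%C by (unfold Cconj, Copp; simpl; f_equal; ring). reflexivity.
    + eapply tame_ext; [|apply (Tm (Cconj w))]. intro r. cbv beta. rewrite E1.
      replace (Cconj (- w)) with (- Cconj w)%C by (unfold Cconj, Copp; simpl; f_equal; ring). reflexivity.
Qed.

(** The slope is a parameter so that zeta is represented on the very rays used for [f], which makes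
    the two formulas comparable term by term. *)
Definition zeta_fn (m al a : R) (s : C) : C :=
  (cexp (- s * RtoC (ln a)) + cexp ((1 - s) * RtoC (ln (a + / 2))) / (s - 1) + ray_pair m (- s) al 0 (a + / 2))%C.

Lemma analytic_at_zeta_fn (m al a : R) (z : C) : 0 <= m -> 0 < a -> z <> 1 -> analytic_at (zeta_fn m al a) z.
Proof.
  intros Hm Ha Hz. unfold zeta_fn. apply analytic_at_plus; [apply analytic_at_plus|].
  - eapply analytic_at_ext_loc; [apply Rlt_0_1| |apply (analytic_at_cexp (- RtoC (ln a))%C z)].
    intros w _. cbv beta. f_equal. ring.
  - now apply analytic_at_power_over.
  - apply analytic_at_ray_pair; [exact Hm|lra].
Qed.

Lemma is_lim_seq_power_vanishes (q b : R) : q < 0 -> 0 < b -> is_lim_seq (fun n => exp (q * ln (b + INR (S n)))) 0.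
Proof.
  intros Hq Hb. apply is_lim_seq_spec. intros eps. pose proof (cond_pos eps).
  destruct (archimed (exp (ln eps / q))) as [Ha _]. exists (Z.to_nat (up (exp (ln eps / q)))). intros n Hn.
  assert (HN : exp (ln eps / q) < b + INR (S n)).
  { assert (exp (ln eps / q) < INR n); [|rewrite S_INR; lra]. eapply Rlt_le_trans; [exact Ha|]. rewrite INR_IZR_INZ. apply IZR_le. lia. }
  rewrite Rminus_0_r, Rabs_pos_eq by (left; apply exp_pos).
  rewrite <- (exp_ln eps) by assumption. apply exp_increasing.
  apply ln_increasing in HN; [|apply exp_pos]. rewrite ln_exp in HN.
  apply (Rmult_lt_gt_compat_neg_l q) in HN; [|exact Hq]. replace (q * (ln eps / q)) with (ln eps) in HN by (field; lra). lra.
Qed.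

Lemma strip_power_neg_bound (m : R) (p : C) (al t r : R) : 0 <= m -> 0 < t -> 0 <= r -> Re p <= 0 ->
  Cmod (strip_powexp m p al 0 t r) <= exp (2 * Cmod p) * exp (Re p * ln t).
Proof.
  intros Hm Ht Hr Hp. rewrite strip_powexp_x0, Cmod_cexp, <- exp_plus. apply exp_le_mono.
  set (u := ray m t r).
  replace (Re (p * clog u)) with (Re p * Re (clog u) - Im p * Im (clog u)) by (unfold Re, Im, Cmult; simpl; ring).
  assert (L : ln t <= Re (clog u)).
  { unfold u, clog, ray, Re, Im; cbn [fst snd].
    assert (H : ln (t * t) <= ln ((t + r * m) ^ 2 + r ^ 2)).
    { apply ln_le; [now apply Rmult_lt_0_compat|]. assert (0 <= r * m) by (now apply Rmult_le_pos). nra. }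
    rewrite ln_mult in H by exact Ht. lra. }
  assert (A : Rabs (Im (clog u)) <= 2).
  { unfold u, clog, ray, Re, Im; cbn [fst snd]. pose proof (atan_bound (r / (t + r * m))). pose proof PI_4. apply Rabs_le. lra. }
  assert (B : - (Im p * Im (clog u)) <= Cmod p * 2).
  { eapply Rle_trans; [apply Rle_abs|]. rewrite Rabs_Ropp, Rabs_mult. apply Rmult_le_compat; try apply Rabs_pos; [apply im_le_Cmod|exact A]. }
  assert (D : Re p * Re (clog u) <= Re p * ln t) by nra. lra.
Qed.

Lemma ray_pair_power_vanishes (m b al : R) (p : C) : 0 <= m -> 0 < b -> Re p < 0 ->
  is_cseq (fun n => ray_pair m p al 0 (b + INR (S n))) 0.
Proof.
  intros Hm Hb Hp.
  apply (ray_pair_vanishes m b al 0 p (fun n => exp (2 * Cmod p) * exp (Re p * ln (b + INR (S n)))) Hm Hb).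
  - intros n r Hr. assert (Pt : 0 < b + INR (S n)) by (pose proof (pos_INR (S n)); lra).
    assert (E1 : 1 <= exp r) by (rewrite <- exp_0; apply exp_le_mono; lra).
    assert (P : 0 <= exp (2 * Cmod p) * exp (Re p * ln (b + INR (S n)))) by (apply Rmult_le_pos; left; apply exp_pos).
    assert (W : forall X, X <= exp (2 * Cmod p) * exp (Re p * ln (b + INR (S n))) -> X <= exp (2 * Cmod p) * exp (Re p * ln (b + INR (S n))) * exp r).
    { intros X HX. eapply Rle_trans; [exact HX|]. rewrite <- (Rmult_1_r (_ * _)) at 1. apply Rmult_le_compat_l; assumption. }
    split; apply W.
    + apply strip_power_neg_bound; try assumption. lra.
    + rewrite <- (Cmod_conj p). apply (strip_power_neg_bound m (Cconj p)); try assumption. unfold Cconj, Re in *; simpl; lra.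
  - replace (Finite 0) with (Rbar_mult (exp (2 * Cmod p)) 0) by (simpl; f_equal; ring).
    apply is_lim_seq_scal_l. now apply is_lim_seq_power_vanishes.
Qed.

Lemma CRInt_power (p : C) (al b B : R) : 0 < b <= B ->
  CRInt (powexp p al 0) b B = (power_primitive (p + 1) B - power_primitive (p + 1) b)%C.
Proof.
  intro Hb. rewrite <- (CRInt_derive _ (fun u => cexp ((p + 1 - 1) * RtoC (ln u)))%C); [|lra| |].
  - apply CRInt_ext; [lra|]. intros t Ht. rewrite powexp_x0. f_equal. ring.
  - intros t Ht. apply is_cderive_power_primitive. lra.
  - intros t Ht. apply ccont_cpower. lra.
Qed.

(** For [Re s > 1] the far end [B^(1-s) / (1 - s)] of the integral and the rays issued from [B] both
    tend to [0], leaving the terms of [zeta_fn]. *)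
Lemma zeta_fn_series (m al c a : R) (s : C) : 0 <= m -> 0 <= c -> cone_bound m al c -> 0 < a -> 1 < Re s ->
  @is_series C_AbsRing C_NormedModule (fun k => cpower (INR k + a) (- s)%C) (zeta_fn m al a s).
Proof.
  intros Hm Hc HC Ha Hs. apply is_cseq_is_series. set (b := a + / 2). assert (Hb : 0 < b) by (unfold b; lra).
  assert (Ns : (- s + 1)%C <> 0) by (intro E; apply (f_equal Re) in E; unfold Re, Cplus, Copp, RtoC in E; simpl in E; unfold Re in Hs; lra).
  assert (L : is_cseq (fun n => (cexp (- s * RtoC (ln a)) + csum (fun k => powexp (- s) al 0 (b + / 2 + INR k)) n)%C) (zeta_fn m al a s)).
  { apply is_cseq_ext with (fun n => (cexp (- s * RtoC (ln a)) + (cexp ((- s + 1) * RtoC (ln (b + INR (S n)))) * / (- s + 1)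
        + (- (cexp ((- s + 1) * RtoC (ln b)) * / (- s + 1)) + (ray_pair m (- s) al 0 b - ray_pair m (- s) al 0 (b + INR (S n))))))%C).
    - intro n. rewrite (plana_powexp m b c al 0 (- s)%C n Hm Hb Hc (Rle_refl 0) HC).
      rewrite CRInt_power by (pose proof (pos_INR (S n)); lra). unfold power_primitive.
      destruct (excluded_middle_informative _) as [E|_]; [destruct (Ns E)|]. ring.
    - unfold zeta_fn. fold b.
      replace (cexp (- s * RtoC (ln a)) + cexp ((1 - s) * RtoC (ln b)) / (s - 1) + ray_pair m (- s) al 0 b)%C with
        (cexp (- s * RtoC (ln a)) + (0 * / (- s + 1) + (- (cexp ((- s + 1) * RtoC (ln b)) * / (- s + 1)) + (ray_pair m (- s) al 0 b - 0))))%C.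
      + apply is_cseq_plus; [apply is_cseq_const|]. apply is_cseq_plus.
        * apply is_cseq_ext with (fun n => (/ (- s + 1) * cexp ((- s + 1) * RtoC (ln (b + INR (S n)))))%C); [intro; ring|].
          rewrite (Cmult_comm 0). apply is_cseq_scal.
          apply is_cseq_le with (fun n => exp ((1 - Re s) * ln (b + INR (S n)))); [|apply is_lim_seq_power_vanishes; lra].
          intro n. set (X := RtoC (ln (b + INR (S n)))). replace (cexp ((- s + 1) * X) - 0)%C with (cexp ((- s + 1) * X)) by ring.
          rewrite Cmod_cexp. apply exp_le_mono. unfold X, Re, Cmult, Cplus, Copp, RtoC; simpl. lra.
        * apply is_cseq_plus; [apply is_cseq_const|]. apply is_cseq_minus; [apply is_cseq_const|].
          apply ray_pair_power_vanishes; try assumption. unfold Re, Copp in *; simpl; lra.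
      + replace ((1 - s) * RtoC (ln b))%C with ((- s + 1) * RtoC (ln b))%C by ring.
        assert (N2 : (s - 1)%C <> 0) by (intro E; apply Ns; replace (- s + 1)%C with (- (s - 1))%C by ring; rewrite E; ring).
        field. repeat split; assumption. }
  (* The term [k = 0] stands outside the Abel-Plana sum, whose points [b + 1/2 + k] are
     [a + (k + 1)]; hence the shift of the index by one. *)
  intros eps He. destruct (L eps He) as [N HN]. exists (S N). intros [|n] Hn; [lia|]. specialize (HN n ltac:(lia)).
  rewrite csum_shift. change (INR 0) with 0. rewrite Rplus_0_l, cpower_cexp.
  rewrite (csum_ext _ (fun k => powexp (- s) al 0 (b + / 2 + INR k))); [exact HN|].
  intros k _. rewrite cpower_cexp, powexp_x0, S_INR. do 4 f_equal. unfold b. field.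
Qed.

Lemma is_hurwitz_zeta_fn (m al c a : R) : 0 <= m -> 0 <= c -> cone_bound m al c -> 0 < a -> is_hurwitz_zeta a (zeta_fn m al a).
Proof.
  intros Hm Hc HC Ha. split.
  - intros z Hz. now apply analytic_at_zeta_fn.
  - intros s Hs. now apply (zeta_fn_series m al c).
Qed.

Lemma hurwitz_zeta_eq (m al c a x : R) : 0 <= m -> 0 <= c -> cone_bound m al c -> 0 < a -> x <> 1 ->
  hurwitz_zeta a (RtoC x) = zeta_fn m al a (RtoC x).
Proof.
  intros Hm Hc HC Ha Hx.
  pose proof (is_hurwitz_zeta_fn m al c a Hm Hc HC Ha) as H2.
  assert (H1 : is_hurwitz_zeta a (hurwitz_zeta a)).
  { apply (epsilon_spec (inhabits (fun _ : C => RtoC 0)) (is_hurwitz_zeta a)). now exists (zeta_fn m al a). }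
  apply identity_at_real.
  - intros w Hw. assert (N : w <> RtoC 1).
    { intros ->. destruct Hw as [E|E]; [now apply E|]. apply Hx. symmetry. exact E. }
    split; [apply (proj1 H1), N|apply (proj1 H2), N].
  - intros w Hw. eapply is_cseq_unique; apply is_series_is_cseq; [apply (proj2 H1), Hw|apply (proj2 H2), Hw].
Qed.

(* The constant term of the Laurent expansion of the Hurwitz zeta function at [s = 1]. *)
Lemma zeta_regular_part_1 (m al c a : R) : 0 <= m -> 0 <= c -> cone_bound m al c -> 0 < a ->
  (cexp (- (1) * RtoC (ln a)) - power_primitive 0 (a + / 2) + ray_pair m (- (1)) al 0 (a + / 2))%C = RtoC (- digamma a).
Proof.
  intros Hm Hc HC Ha. set (b := a + / 2). assert (Hb : 0 < b) by (unfold b; lra).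
  assert (P0 : forall u, power_primitive 0 u = RtoC (ln u)).
  { intro u. unfold power_primitive. destruct (excluded_middle_informative _) as [_|N]; [|now destruct N]. rewrite Cinv_0. ring. }
  assert (Sn : forall n, (cexp (- (1) * RtoC (ln a)) + csum (fun k => powexp (- (1)) al 0 (b + / 2 + INR k)) n)%C = RtoC (sum_n (fun k => / (INR k + a)) (S n))).
  { assert (Pw : forall u, 0 < u -> cexp (- (1) * RtoC (ln u)) = RtoC (/ u)).
    { intros u Hu. replace (- (1) * RtoC (ln u))%C with (- RtoC (ln u))%C by ring. rewrite <- RtoC_opp, cexp_R, exp_Ropp, exp_ln by exact Hu. reflexivity. }
    assert (T : forall n, csum (fun k => RtoC (/ (INR k + a))) n = RtoC (sum_n (fun k => / (INR k + a)) n)).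
    { induction n as [|n IH]; [now rewrite csum_0, sum_O|]. now rewrite csum_S, sum_n_S, IH, RtoC_plus. }
    intro n. rewrite <- T, csum_shift. f_equal.
    - rewrite Pw by exact Ha. simpl INR. now rewrite Rplus_0_l.
    - apply csum_ext. intros k _. pose proof (pos_INR k). rewrite powexp_x0, Pw by lra. rewrite S_INR. do 2 f_equal. unfold b. field. }
  assert (L1 : is_cseq (fun n => RtoC (sum_n (fun k => / (INR k + a)) (S n) - ln (b + INR (S n))))
     (cexp (- (1) * RtoC (ln a)) - power_primitive 0 b + ray_pair m (- (1)) al 0 b)%C).
  { apply is_cseq_ext with (fun n => (cexp (- (1) * RtoC (ln a)) - power_primitive 0 b + ray_pair m (- (1)) al 0 b - ray_pair m (- (1)) al 0 (b + INR (S n)))%C).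
    - intro n. rewrite RtoC_minus, <- Sn, (plana_powexp m b c al 0 (- (1))%C n Hm Hb Hc (Rle_refl 0) HC).
      rewrite CRInt_power by (pose proof (pos_INR (S n)); lra). replace (- (1) + 1)%C with (RtoC 0) by ring. rewrite !P0. ring.
    - set (X := (cexp (- (1) * RtoC (ln a)) - power_primitive 0 b + ray_pair m (- (1)) al 0 b)%C).
      match goal with |- is_cseq ?f _ => assert (K : is_cseq f (X - 0)%C) end; [|replace (X - 0)%C with X in K by ring; exact K].
      apply is_cseq_minus; [apply is_cseq_const|].
      apply ray_pair_power_vanishes; try assumption. unfold Re, Copp, RtoC; simpl; lra. }
  eapply is_cseq_unique; [exact L1|]. apply is_cseq_RtoC.
  pose proof (digamma_lim a Ha) as L2. apply is_lim_seq_incr_1 in L2.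
  (* The digamma limit involves [ln (a + n + 2)] while the Abel-Plana integral ends at
     [a + n + 3/2]; these logarithms differ by at most [1 / (2 (n + 1))]. *)
  assert (L3 : is_lim_seq (fun n => ln (a + INR (S (S n))) - ln (b + INR (S n))) 0).
  { apply is_lim_seq_le_le with (fun _ => 0) (fun n => / 2 / (INR (S n))); [|apply is_lim_seq_const|apply is_lim_seq_inv_S].
    intro n. assert (PS : 0 < INR (S n)) by (apply lt_0_INR; lia). rewrite (S_INR (S n)).
    set (y := b + INR (S n)). replace (a + (INR (S n) + 1)) with (y + / 2) by (unfold y, b; field).
    assert (Py : INR (S n) <= y) by (unfold y; lra). split.
    - assert (ln y <= ln (y + / 2)) by (apply ln_le; lra). lra.
    - replace (y + / 2) with (y * (1 + / 2 / y)) by (field; lra).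
      assert (P2 : 0 < / 2 / y) by (apply Rdiv_lt_0_compat; lra).
      rewrite ln_mult by lra. pose proof (ln_le_div (1 + / 2 / y) 1 ltac:(lra) Rlt_0_1) as Q. rewrite ln_1 in Q.
      assert (/ 2 / y <= / 2 / INR (S n)) by (apply Rmult_le_compat_l; [lra|apply Rinv_le_contravar; lra]). lra. }
  pose proof (is_lim_seq_minus' _ _ _ _ L3 L2) as L4. rewrite Rminus_0_l in L4.
  eapply is_lim_seq_ext; [|exact L4]. intro n. cbv beta. 
  set (S1 := sum_n (fun k => / (INR k + a)) (S n)). lra.
Qed.

(** * The expansion *)

(** The decay in [t] must come from [exp (- x c (Re u)^al)] since [ga] is arbitrary. With
    [y = ln t], [t^al >= (al y)^2 / 2], and this quadratic in [y] beats the linear growth [|ga| y],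
    leaving a factor [1 / t]. *)
Lemma ray_pair_powexp_vanishes (m b c al x ga : R) : 0 <= m -> 0 < b -> 0 < c -> 0 < al -> 0 < x -> cone_bound m al c ->
  is_cseq (fun n => ray_pair m (RtoC ga) al x (b + INR (S n))) 0.
Proof.
  intros Hm Hb Hc Hal Hx HC.
  destruct (ln_linear_bound (Rabs ga) (/ (m + 1))) as [K HK]; [apply Rabs_pos|apply Rinv_0_lt_compat; lra|].
  set (A := x * c * al ^ 2 / 2). assert (PA : 0 < A).
  { unfold A. assert (0 < x * c) by (now apply Rmult_lt_0_compat). assert (0 < al ^ 2) by (now apply pow_lt).
    assert (0 < x * c * al ^ 2) by (now apply Rmult_lt_0_compat). lra. }
  (* The maximum over [y] of [(|ga| + 1) y - A y^2]; the extra [1] produces the factor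
     [exp (- y) = 1 / t]. *)
  set (K2 := (Rabs ga + 1) ^ 2 / (4 * A)).
  apply (ray_pair_vanishes m b al x (RtoC ga) (fun n => exp (K + / (m + 1) + K2) * exp (-1 * ln (b + INR (S n)))) Hm Hb).
  - assert (Ec : Cconj (RtoC ga) = RtoC ga) by (unfold Cconj, RtoC; simpl; f_equal; ring).
    rewrite Ec. intros n r Hr.
    set (t := b + INR (S n)). assert (Ht : 1 <= t) by (unfold t; rewrite S_INR; pose proof (pos_INR n); lra).
    assert (W : Cmod (strip_powexp m (RtoC ga) al x t r) <= exp (K + / (m + 1) + K2) * exp (-1 * ln t) * exp r); [|split; exact W].
    unfold strip_powexp. rewrite Cmod_mult, !Cmod_cexp, <- !exp_plus. apply exp_le_mono.
    set (u := ray m t r). set (y := ln t).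
    assert (Py : 0 <= y) by (unfold y; rewrite <- ln_1; apply ln_le; lra).
    assert (Hrm : 0 <= r * m) by (now apply Rmult_le_pos).
    assert (L1 : y <= Re (clog u)).
    { unfold u, y, clog, ray, Re, Im; cbn [fst snd].
      assert (H : ln (t * t) <= ln ((t + r * m) ^ 2 + r ^ 2)) by (apply ln_le; nra).
      rewrite ln_mult in H by lra. lra. }
    assert (L2 : Re (clog u) <= y + ln (1 + (m + 1) * r)).
    { unfold u, y, clog, ray, Re, Im; cbn [fst snd]. set (w := 1 + (m + 1) * r). assert (Hw : 1 <= w) by (unfold w; nra).
      assert (S1 : t + r * m + r <= t * w) by (unfold w; nra).
      assert (S2 : (t + r * m + r) * (t + r * m + r) <= (t * w) * (t * w)) by (apply Rmult_le_compat; lra).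
      assert (H : ln ((t + r * m) ^ 2 + r ^ 2) <= ln ((t * w) * (t * w))).
      { apply ln_le; [nra|]. assert (0 <= (t + r * m) * r) by (apply Rmult_le_pos; lra). lra. }
      rewrite !ln_mult in H by nra. lra. }
    specialize (HK (1 + (m + 1) * r) ltac:(nra)).
    replace (/ (m + 1) * (1 + (m + 1) * r)) with (/ (m + 1) + r) in HK by (field; lra).
    assert (G : Re (RtoC ga * clog u) <= Rabs ga * y + (r + / (m + 1) + K)).
    { replace (Re (RtoC ga * clog u)) with (ga * Re (clog u)) by (unfold Re, Cmult, RtoC; simpl; ring).
      apply Rle_trans with (Rabs ga * Re (clog u)); [apply Rmult_le_compat_r; [lra|apply Rle_abs]|].
      apply Rle_trans with (Rabs ga * (y + ln (1 + (m + 1) * r))); [apply Rmult_le_compat_l; [apply Rabs_pos|exact L2]|]. lra. }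
    assert (D : A * y ^ 2 <= x * Re (cexp (RtoC al * clog u))).
    { assert (Q := HC t r ltac:(lra) Hr). fold u in Q.
      assert (Q1 : (al * y) ^ 2 / 2 <= Rpower (t + r * m) al).
      { pose proof (pow_fact_le_exp (al * y) 2) as E. simpl fact in E. simpl (INR _) in E. replace (1 + 1) with 2 in E by ring.
        eapply Rle_trans; [apply E; now apply Rmult_le_pos; [left|]|]. unfold Rpower, y. apply exp_le_mono.
        apply Rmult_le_compat_l; [lra|]. apply ln_le; lra. }
      apply Rle_trans with (x * (c * Rpower (t + r * m) al)); [|apply Rmult_le_compat_l; lra].
      apply Rle_trans with (x * (c * ((al * y) ^ 2 / 2))); [unfold A; right; field|].
      apply Rmult_le_compat_l; [lra|]. apply Rmult_le_compat_l; lra. }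
    replace (Re (- (RtoC x * cexp (RtoC al * clog u)))) with (- (x * Re (cexp (RtoC al * clog u)))) by (unfold Re, Copp, Cmult, RtoC; simpl; ring).
    assert (S : Rabs ga * y - A * y ^ 2 <= K2 - y).
    { assert (E : K2 - (Rabs ga + 1) * y + A * y ^ 2 = A * (y - (Rabs ga + 1) / (2 * A)) ^ 2) by (unfold K2; field; lra).
      assert (0 <= A * (y - (Rabs ga + 1) / (2 * A)) ^ 2) by (apply Rmult_le_pos; [lra|apply pow2_ge_0]). lra. }
    lra.
  - replace (Finite 0) with (Rbar_mult (exp (K + / (m + 1) + K2)) 0) by (simpl; f_equal; ring).
    apply is_lim_seq_scal_l. apply is_lim_seq_power_vanishes; lra.
Qed.

(* The logarithmic term, present only when [- (ga + 1) / al] is a natural number. *)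
Definition log_term (ga al x : R) : C :=
  (CSer (fun n => resonant_residue (RtoC ((ga + 1) / al)) n * RtoC (x ^ n)) * RtoC (ln x / al))%C.

(** The limit of [powexp_series] at infinity. Off resonance it is the leading Gamma term; at a
    resonance [gamma_fn] supplies the finite part of Gamma, corrected by the logarithm. *)
Definition singular_part (ga al x : R) : C :=
  (RtoC (/ al * Rpower x (- ((ga + 1) / al))) * gamma_fn (RtoC ((ga + 1) / al)) - log_term ga al x)%C.

(** The substitution [v = x u^al] in the primitive. Powers scale homogeneously, but at a resonance
    [ln v = ln x + al ln u] leaves an extra [ln x / al], the origin of the logarithm in the
    theorem. *)
Lemma power_primitive_scale (al x u : R) (sg : C) (n : nat) : 0 < al -> 0 < x -> 0 < u ->
  (RtoC (x ^ n) * power_primitive (RtoC al * (sg + RtoC (INR n))) u)%C =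
  (RtoC (/ al) * cexp (- sg * RtoC (ln x)) * power_primitive (sg + RtoC (INR n)) (x * Rpower u al)
    - (if excluded_middle_informative ((sg + RtoC (INR n))%C = 0) then 1 else 0) * RtoC (x ^ n) * RtoC (ln x / al))%C.
Proof.
  intros Hal Hx Hu.
  assert (Na : RtoC al <> 0) by (intro E; apply RtoC_inj in E; lra).
  assert (Ln : ln (x * Rpower u al) = ln x + al * ln u).
  { rewrite ln_mult; [|exact Hx|apply exp_pos]. unfold Rpower. now rewrite ln_exp. }
  assert (Ex : cexp (RtoC (INR n) * RtoC (ln x)) = RtoC (x ^ n)) by (rewrite <- RtoC_mult, cexp_R, exp_ln_pow by exact Hx; reflexivity).
  unfold power_primitive. rewrite Ln.
  destruct (excluded_middle_informative ((sg + RtoC (INR n))%C = 0)) as [E|N].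
  - destruct (excluded_middle_informative _) as [_|N]; [|destruct N; rewrite E; ring].
    rewrite E, Cmult_0_r, Cinv_0.
    assert (Es : (- sg)%C = RtoC (INR n)) by (replace (RtoC (INR n)) with (sg + RtoC (INR n) - sg)%C by ring; rewrite E; ring).
    rewrite Es, Ex. rewrite RtoC_plus, RtoC_mult, RtoC_inv by lra. unfold Rdiv. rewrite RtoC_mult, RtoC_inv by lra. field. exact Na.
  - destruct (excluded_middle_informative _) as [E|_].
    + destruct N. replace (sg + RtoC (INR n))%C with (/ RtoC al * (RtoC al * (sg + RtoC (INR n))))%C by (field; exact Na). rewrite E. ring.
    + rewrite RtoC_plus, RtoC_mult. rewrite <- Ex.
      replace ((sg + RtoC (INR n)) * (RtoC (ln x) + RtoC al * RtoC (ln u)))%C with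
        (sg * RtoC (ln x) + (RtoC (INR n) * RtoC (ln x) + RtoC al * (sg + RtoC (INR n)) * RtoC (ln u)))%C by ring.
      rewrite (cexp_plus (sg * _)), (cexp_plus (RtoC (INR n) * _)).
      assert (I : (cexp (- sg * RtoC (ln x)) * cexp (sg * RtoC (ln x)))%C = 1).
      { rewrite <- cexp_plus. replace (- sg * RtoC (ln x) + sg * RtoC (ln x))%C with (RtoC 0) by ring. apply cexp_0. }
      set (X := cexp (- sg * RtoC (ln x))) in *. set (Y := cexp (sg * RtoC (ln x))) in *.
      set (V := cexp (RtoC (INR n) * RtoC (ln x))). set (U := cexp (RtoC al * (sg + RtoC (INR n)) * RtoC (ln u))).
      rewrite RtoC_inv by lra.
      transitivity (X * Y * (V * (U * / (RtoC al * (sg + RtoC (INR n))))))%C; [rewrite I; ring|]. field. split; assumption.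
Qed.

Lemma Rpower_cexp (x s : R) : RtoC (Rpower x (- s)) = cexp (- RtoC s * RtoC (ln x)).
Proof. rewrite <- RtoC_opp, <- RtoC_mult, cexp_R. reflexivity. Qed.

Lemma resonant_series_ok (sg : C) (x : R) : 0 <= x ->
  is_cseq (csum (fun n => resonant_residue sg n * RtoC (x ^ n))%C) (CSer (fun n => resonant_residue sg n * RtoC (x ^ n))%C).
Proof.
  intro Hx. eapply CSer_lim; [|apply (ex_series_exp x)]. intro n. cbv beta.
  rewrite Cmod_mult, Cmod_R, (Rabs_pos_eq (x ^ n)) by (now apply pow_le).
  pose proof (Cmod_resonant_residue sg n) as H. rewrite pow1 in H.
  apply (Rmult_le_compat_r (x ^ n)) in H; [|now apply pow_le]. eapply Rle_trans; [exact H|]. right. unfold Rdiv. ring.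
Qed.

Lemma powexp_series_scale (ga al x u : R) : 0 < al -> 0 < x -> 0 < u ->
  powexp_series (RtoC ga) al x u =
  (RtoC (/ al * Rpower x (- ((ga + 1) / al))) * powexp_series (RtoC ((ga + 1) / al) - 1) 1 1 (x * Rpower u al) - log_term ga al x)%C.
Proof.
  intros Hal Hx Hu. set (sg := (ga + 1) / al).
  assert (Py : 0 < x * Rpower u al) by (apply Rmult_lt_0_compat; [exact Hx|apply exp_pos]).
  eapply is_cseq_unique; [apply powexp_series_lim; lra|].
  eapply is_cseq_ext; [|apply is_cseq_minus; [apply is_cseq_scal, powexp_series_lim; lra|]].
  2: { unfold log_term. fold sg. rewrite (Cmult_comm (CSer _)). apply is_cseq_scal. apply resonant_series_ok. lra. }
  intro N. cbv beta. rewrite <- !csum_scal.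
  assert (E : forall n, powexp_term (RtoC ga) al x u n =
    (RtoC (/ al * Rpower x (- sg)) * powexp_term (RtoC sg - 1) 1 1 (x * Rpower u al) n - RtoC (ln x / al) * (resonant_residue (RtoC sg) n * RtoC (x ^ n)))%C).
  { intro n. unfold powexp_term.
    assert (E1 : (RtoC ga + 1 + RtoC (al * INR n))%C = (RtoC al * (RtoC sg + RtoC (INR n)))%C).
    { rewrite <- !RtoC_plus, <- RtoC_mult. f_equal. unfold sg. field. lra. }
    rewrite E1, RtoC_mult, <- Cmult_assoc, (power_primitive_scale al x u (RtoC sg) n Hal Hx Hu).
    rewrite pow1, Rmult_1_r, Rmult_1_l. replace (RtoC sg - 1 + 1 + RtoC (INR n))%C with (RtoC sg + RtoC (INR n))%C by ring.
    rewrite RtoC_mult, Rpower_cexp. unfold resonant_residue.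
    destruct (excluded_middle_informative ((RtoC sg + RtoC (INR n))%C = 0)); ring. }
  induction N as [|N IH]; [rewrite !csum_0, E; reflexivity|rewrite !csum_S, <- IH, E; cbv beta; ring].
Qed.

Lemma powexp_series_at_infinity (ga al x b : R) : 0 < al -> 0 < x -> 0 < b ->
  is_cseq (fun n => powexp_series (RtoC ga) al x (b + INR (S n))) (singular_part ga al x).
Proof.
  intros Hal Hx Hb.
  assert (Pn : forall n, 0 < b + INR (S n)) by (intro n; pose proof (pos_INR (S n)); lra).
  eapply is_cseq_ext; [intro n; symmetry; now apply powexp_series_scale|].
  unfold singular_part. apply is_cseq_minus; [|apply is_cseq_const]. apply is_cseq_scal.
  intros eps He. destruct (powexp_series_gamma_fn (RtoC ((ga + 1) / al)) eps He) as [M HM].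
  set (M1 := Rmax M 1). assert (P1 : 0 < M1 / x) by (apply Rdiv_lt_0_compat; [unfold M1; pose proof (Rmax_r M 1); lra|exact Hx]).
  destruct (archimed (exp (ln (M1 / x) / al))) as [Ha _]. exists (Z.to_nat (up (exp (ln (M1 / x) / al)))). intros n Hn.
  apply HM. apply Rle_trans with M1; [apply Rmax_l|].
  assert (HN : exp (ln (M1 / x) / al) < b + INR (S n)).
  { assert (exp (ln (M1 / x) / al) < INR n); [|rewrite S_INR; lra]. eapply Rlt_le_trans; [exact Ha|]. rewrite INR_IZR_INZ. apply IZR_le. lia. }
  apply ln_increasing in HN; [|apply exp_pos]. rewrite ln_exp in HN.
  apply (Rmult_lt_compat_l al) in HN; [|exact Hal]. replace (al * (ln (M1 / x) / al)) with (ln (M1 / x)) in HN by (field; lra).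
  apply exp_increasing in HN. rewrite exp_ln in HN by exact P1. fold (Rpower (b + INR (S n)) al) in HN.
  apply (Rmult_lt_compat_l x) in HN; [|exact Hx]. replace (x * (M1 / x)) with M1 in HN by (field; lra). lra.
Qed.

Lemma powexp_real (ga al x u : R) : powexp (RtoC ga) al x u = RtoC (Rpower u ga * exp (- Rpower u al * x)).
Proof.
  unfold powexp. rewrite <- RtoC_mult, cexp_R, <- RtoC_mult. unfold Rpower at 2. do 3 f_equal. ring.
Qed.

(** In the Abel-Plana formula for the partial sums the far ray pair tends to [0] and the far value
    of the primitive to [singular_part]. Convergence of the partial sums is thus established along
    the way, so [Series] is a genuine sum. *)
Lemma exp_power_sum_formula (m c a ga al x : R) : 0 <= m -> 0 < c -> cone_bound m al c -> 0 < a -> 0 < al -> 0 < x ->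
  RtoC (exp_power_sum x a ga al) =
  (powexp (RtoC ga) al x a + (singular_part ga al x - powexp_series (RtoC ga) al x (a + / 2)) + ray_pair m (RtoC ga) al x (a + / 2))%C.
Proof.
  intros Hm Hc HC Ha Hal Hx. set (b := a + / 2). assert (Hb : 0 < b) by (unfold b; lra).
  set (Lm := (powexp (RtoC ga) al x a + (singular_part ga al x - powexp_series (RtoC ga) al x b) + ray_pair m (RtoC ga) al x b)%C).
  set (f := fun k : nat => Rpower (INR k + a) ga * exp (- Rpower (INR k + a) al * x)).
  assert (Cs : forall n, csum (fun k => RtoC (f k)) n = RtoC (sum_n f n)).
  { induction n as [|n IH]; [now rewrite csum_0, sum_O|]. now rewrite csum_S, sum_n_S, IH, RtoC_plus. }
  assert (L1 : is_cseq (fun n => csum (fun k => RtoC (f k)) (S n)) Lm).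
  { apply is_cseq_ext with (fun n => (powexp (RtoC ga) al x a + (powexp_series (RtoC ga) al x (b + INR (S n)) - powexp_series (RtoC ga) al x b)
        + (ray_pair m (RtoC ga) al x b - ray_pair m (RtoC ga) al x (b + INR (S n))))%C).
    - intro n. rewrite csum_shift. unfold f at 1. change (INR 0) with 0. rewrite Rplus_0_l, <- powexp_real.
      rewrite (csum_ext (fun k => RtoC (f (S k))) (fun k => powexp (RtoC ga) al x (b + / 2 + INR k))).
      + rewrite (plana_powexp m b c al x) by (assumption || lra). rewrite CRInt_powexp_series by (try lra; pose proof (pos_INR (S n)); lra). ring.
      + intros k _. unfold f. rewrite <- powexp_real, S_INR. f_equal. unfold b. field.
    - unfold Lm. apply is_cseq_plus; [apply is_cseq_plus; [apply is_cseq_const|apply is_cseq_minus; [now apply powexp_series_at_infinity|apply is_cseq_const]]|].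
      match goal with |- is_cseq ?g ?z => assert (K : is_cseq g (z - 0)%C) end.
      { apply is_cseq_minus; [apply is_cseq_const|]. now apply (ray_pair_powexp_vanishes m b c). }
      set (z := ray_pair m (RtoC ga) al x b) in *. replace (z - 0)%C with z in K by ring. exact K. }
  assert (L2 : is_cseq (fun n => RtoC (sum_n f n)) Lm).
  { intros eps He. destruct (L1 eps He) as [N HN]. exists (S N). intros [|n] Hn; [lia|]. rewrite <- Cs. apply HN. lia. }
  pose proof (is_cseq_re _ _ L2) as L3. cbn [Re fst RtoC] in L3.
  unfold exp_power_sum. fold f.
  assert (E : Series f = Re Lm) by (apply is_series_unique; exact L3).
  rewrite E. eapply is_cseq_unique; [apply is_cseq_RtoC; exact L3|exact L2].
Qed.

(* The value [zeta(-q, a)], or its constant term at the pole when [q = -1]. *)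
Definition zeta_value (m al a q : R) : C :=
  (cexp (RtoC q * RtoC (ln a)) - power_primitive (RtoC q + 1) (a + / 2) + ray_pair m (RtoC q) al 0 (a + / 2))%C.

Lemma zeta_value_eq (m c al a q : R) : 0 <= m -> 0 <= c -> cone_bound m al c -> 0 < a -> q <> -1 ->
  zeta_value m al a q = hurwitz_zeta a (RtoC (- q)).
Proof.
  intros Hm Hc HC Ha Hq. rewrite (hurwitz_zeta_eq m al c) by (assumption || lra).
  assert (N : (RtoC q + 1)%C <> 0) by (rewrite <- RtoC_plus; intro E; apply RtoC_inj in E; lra).
  unfold zeta_value, zeta_fn, power_primitive. destruct (excluded_middle_informative _) as [E|_]; [destruct (N E)|].
  rewrite RtoC_opp. replace (- - RtoC q)%C with (RtoC q) by ring. f_equal.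
  replace ((1 - - RtoC q) * RtoC (ln (a + / 2)))%C with ((RtoC q + 1) * RtoC (ln (a + / 2)))%C by ring.
  replace (- RtoC q - 1)%C with (- (RtoC q + 1))%C by ring. field. exact N.
Qed.

Lemma zeta_value_pole (m c al a : R) : 0 <= m -> 0 <= c -> cone_bound m al c -> 0 < a -> zeta_value m al a (-1) = RtoC (- digamma a).
Proof.
  intros Hm Hc HC Ha. rewrite <- (zeta_regular_part_1 m al c a Hm Hc HC Ha). unfold zeta_value.
  replace (RtoC (-1)) with (- (1))%C by (rewrite <- RtoC_opp; reflexivity).
  replace (- (1) + 1)%C with (RtoC 0) by ring. reflexivity.
Qed.

(** * The error of a truncated expansion *)

Definition expansion_term (m al a ga x : R) (n : nat) : C :=
  (RtoC (gamma_residue n * x ^ n) * zeta_value m al a (ga + al * INR n))%C.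

Definition expansion_error (m al a ga x : R) (N : nat) : C :=
  (RtoC (exp_power_sum x a ga al) - singular_part ga al x - csum (expansion_term m al a ga x) N)%C.

Definition ray_remainder (m al ga x b : R) (N : nat) (r : R) : C :=
  (cexp (RtoC ga * clog (ray m b r)) * exp_rem N (- (RtoC x * cexp (RtoC al * clog (ray m b r)))))%C.

Lemma strip_exp_term (m al ga x b r : R) (n : nat) :
  (cexp (RtoC ga * clog (ray m b r)) * exp_term (- (RtoC x * cexp (RtoC al * clog (ray m b r)))) n)%C
   = (RtoC (gamma_residue n * x ^ n) * strip_powexp m (RtoC (ga + al * INR n)) al 0 b r)%C.
Proof.
  rewrite strip_powexp_x0. set (L := clog (ray m b r)). unfold exp_term.
  assert (E1 : RtoC (-1) = (- (1))%C) by (rewrite <- RtoC_opp; reflexivity).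
  replace (- (RtoC x * cexp (RtoC al * L)))%C with (RtoC (-1) * (RtoC x * cexp (RtoC al * L)))%C by (rewrite E1; ring).
  rewrite !Cpow_mult_l, <- cexp_nat. rewrite <- !RtoC_pow.
  rewrite RtoC_plus, (Cmult_plus_distr_r (RtoC ga)), cexp_plus.
  unfold gamma_residue, Rdiv. rewrite !RtoC_mult.
  replace (RtoC al * RtoC (INR n) * L)%C with (RtoC (INR n) * (RtoC al * L))%C by ring. ring.
Qed.

(** The formula for the sum and the one for each coefficient have the same three pieces: the value
    at [a], the primitive at [b] and the rays. [singular_part] cancels, and subtracting piece by
    piece leaves remainders. As [ga] is real, the lower ray is the plain conjugate of the upper
    one. *)
Lemma expansion_error_split (m c a ga al x : R) (N : nat) : 0 <= m -> 0 < c -> cone_bound m al c -> 0 < a -> 0 < al -> 0 < x ->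
  expansion_error m al a ga x N =
  (cexp (RtoC ga * RtoC (ln a)) * exp_rem N (RtoC (- (x * Rpower a al)))
   - (powexp_series (RtoC ga) al x (a + / 2) - csum (powexp_term (RtoC ga) al x (a + / 2)) N)
   + (ray_integral m (ray_remainder m al ga x (a + / 2) N) + Cconj (ray_integral m (ray_remainder m al ga x (a + / 2) N))))%C.
Proof.
  intros Hm Hc HC Ha Hal Hx. unfold expansion_error. rewrite (exp_power_sum_formula m c) by assumption.
  set (b := a + / 2). assert (Hb : 0 < b) by (unfold b; lra).
  assert (Ec : forall q, Cconj (RtoC q) = RtoC q) by (intro; unfold Cconj, RtoC; simpl; f_equal; ring).
  pose proof two_PI_gt_6 as P6.
  destruct (ray_integral_bound m 1 Hm ltac:(lra)) as [cr [_ Hr]].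
  assert (Ts : forall y q, 0 <= y -> tame (fun r => ((m, 1) * strip_powexp m (RtoC q) al y b r * plana_kernel (nome m r))%C)).
  { intros y q Hy. destruct (strip_powexp_bound m b c al y Hm Hb ltac:(lra) Hy HC (RtoC q) 1 b Rlt_0_1) as [K HK].
    apply (Hr _ K); [intros; now apply ccont_strip_powexp|]. intros r Hr0. apply HK; lra. }
  assert (Er : ray_integral m (ray_remainder m al ga x b N) = (ray_integral m (strip_powexp m (RtoC ga) al x b)
     - csum (fun n => RtoC (gamma_residue n * x ^ n) * ray_integral m (strip_powexp m (RtoC (ga + al * INR n)) al 0 b))%C N)%C).
  { unfold ray_integral.
    set (g := fun n r => (RtoC (gamma_residue n * x ^ n) * ((m, 1) * strip_powexp m (RtoC (ga + al * INR n)) al 0 b r * plana_kernel (nome m r)))%C).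
    destruct (CI_csum g N) as [T1 T2]; [intro n; apply tame_scal, Ts; lra|].
    transitivity (CI (fun r => ((m, 1) * strip_powexp m (RtoC ga) al x b r * plana_kernel (nome m r) + (- (1)) * csum (fun n => g n r) N)%C)).
    - symmetry. apply CI_ext; [|apply tame_plus; [apply Ts; lra|apply tame_scal, T1]]. intros r _.
      unfold g, ray_remainder, exp_rem.
      rewrite (csum_ext (fun n => RtoC (gamma_residue n * x ^ n) * ((m, 1) * strip_powexp m (RtoC (ga + al * INR n)) al 0 b r * plana_kernel (nome m r)))%C
        (fun n => ((m, 1) * plana_kernel (nome m r) * cexp (RtoC ga * clog (ray m b r))) * exp_term (- (RtoC x * cexp (RtoC al * clog (ray m b r)))) n)%C).
      + rewrite csum_scal. unfold strip_powexp. ring.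
      + intros n _. pose proof (strip_exp_term m al ga x b r n) as Q.
        rewrite <- (Cmult_assoc ((m, 1) * plana_kernel (nome m r))), Q. ring.
    - rewrite CI_plus, (CI_scal (- (1))), T2; [|exact T1|apply Ts; lra|apply tame_scal, T1].
      unfold Cminus. f_equal. replace (- (1) * csum (fun k => CI (g k)) N)%C with (- csum (fun k => CI (g k)) N)%C by ring. f_equal.
      apply csum_ext. intros n _. unfold g. apply CI_scal, Ts. lra. }
  rewrite Er. unfold ray_pair at 1. rewrite Ec.
  set (Z0 := ray_integral m (strip_powexp m (RtoC ga) al x b)).
  assert (Es : csum (expansion_term m al a ga x) N = (cexp (RtoC ga * RtoC (ln a)) * csum (exp_term (RtoC (- (x * Rpower a al)))) N
     - csum (powexp_term (RtoC ga) al x b) N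
     + (csum (fun n => RtoC (gamma_residue n * x ^ n) * ray_integral m (strip_powexp m (RtoC (ga + al * INR n)) al 0 b))%C N
      + Cconj (csum (fun n => RtoC (gamma_residue n * x ^ n) * ray_integral m (strip_powexp m (RtoC (ga + al * INR n)) al 0 b))%C N)))%C).
  { assert (Et : forall n, expansion_term m al a ga x n = (cexp (RtoC ga * RtoC (ln a)) * exp_term (RtoC (- (x * Rpower a al))) n
     - powexp_term (RtoC ga) al x b n
     + (RtoC (gamma_residue n * x ^ n) * ray_integral m (strip_powexp m (RtoC (ga + al * INR n)) al 0 b)
      + Cconj (RtoC (gamma_residue n * x ^ n) * ray_integral m (strip_powexp m (RtoC (ga + al * INR n)) al 0 b))))%C).
    { intro n. unfold expansion_term, zeta_value, powexp_term, ray_pair. fold b. rewrite exp_term_power by exact Ha.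
      rewrite Ec, Cmult_conj, Ec.
      replace (RtoC ga + 1 + RtoC (al * INR n))%C with (RtoC (ga + al * INR n) + 1)%C by (rewrite RtoC_plus; ring).
      replace (cexp (RtoC (ga + al * INR n) * RtoC (ln a))) with (cexp (RtoC ga * RtoC (ln a)) * cexp (RtoC (al * INR n) * RtoC (ln a)))%C; [ring|].
      rewrite <- cexp_plus, RtoC_plus. f_equal. ring. }
    assert (Ep : forall z w : C, Cconj (z + w) = (Cconj z + Cconj w)%C) by (intros; unfold Cconj, Cplus; simpl; f_equal; ring).
    clear Er. induction N as [|N IH]; [now rewrite !csum_0, Et|].
    rewrite !csum_S, IH, Et, Ep. ring. }
  rewrite Es. unfold powexp at 1. rewrite <- (cexp_R (- (x * Rpower a al))). unfold exp_rem.
  set (S1 := csum (exp_term (RtoC (- (x * Rpower a al)))) N). set (S2 := csum (powexp_term (RtoC ga) al x b) N).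
  set (S3 := csum (fun n => RtoC (gamma_residue n * x ^ n) * ray_integral m (strip_powexp m (RtoC (ga + al * INR n)) al 0 b))%C N).
  assert (Em : Cconj (Z0 - S3) = (Cconj Z0 - Cconj S3)%C) by (unfold Cconj, Cminus, Cplus, Copp; simpl; f_equal; ring).
  rewrite Em. ring.
Qed.

Lemma exp_rem_left_half_plane (n : nat) (v : C) : Re v <= 0 -> Cmod (exp_rem n v) <= Cmod v ^ S n / INR (fact (S n)).
Proof.
  intro H. eapply Rle_trans; [apply exp_rem_bound|]. rewrite Rmax_left; [lra|].
  rewrite <- exp_0. now apply exp_le_mono.
Qed.

Lemma ccont_exp_rem (f : R -> C) (n : nat) (r : R) : ccont f r -> ccont (fun r => exp_rem n (f r)) r.
Proof.
  intro H. apply ccont_minus; [now apply ccont_cexp|]. apply (ccont_csum (fun j r => exp_term (f r) j)). intro j.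
  unfold exp_term. apply ccont_mult; [now apply ccont_pow|apply ccont_const].
Qed.

Lemma ccont_ray_remainder (m al ga x b : R) (N : nat) (r : R) : 0 <= m -> 0 < b -> 0 <= r -> ccont (ray_remainder m al ga x b N) r.
Proof.
  intros Hm Hb Hr.
  assert (CL : ccont (fun r => clog (ray m b r)) r) by (eapply (holo_ccont_r m _ _ b r (holo_clog m)); nra).
  apply ccont_mult; [apply ccont_cexp, ccont_mult; [apply ccont_const|exact CL]|].
  apply (ccont_exp_rem (fun r => - (RtoC x * cexp (RtoC al * clog (ray m b r))))%C).
  apply ccont_opp, ccont_mult; [apply ccont_const|]. apply ccont_cexp, ccont_mult; [apply ccont_const|exact CL].
Qed.

Lemma ray_remainder_bound (m c al ga x b : R) (N : nat) (r : R) : 0 <= c -> cone_bound m al c -> 0 < b -> 0 <= x -> 0 <= r ->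
  Cmod (ray_remainder m al ga x b N r) <=
  Cmod (cexp (RtoC ga * clog (ray m b r))) * ((x * Cmod (cexp (RtoC al * clog (ray m b r)))) ^ S N / INR (fact (S N))).
Proof.
  intros Hc HC Hb Hx Hr. unfold ray_remainder. rewrite Cmod_mult. apply Rmult_le_compat_l; [apply Cmod_ge_0|].
  eapply Rle_trans; [apply exp_rem_left_half_plane|].
  - pose proof (cone_bound_nonneg m al c b r Hc HC Hb Hr) as P.
    replace (Re (- (RtoC x * cexp (RtoC al * clog (ray m b r))))) with (- (x * Re (cexp (RtoC al * clog (ray m b r)))))
      by (unfold Re, Copp, Cmult, RtoC; simpl; ring).
    assert (0 <= x * Re (cexp (RtoC al * clog (ray m b r)))) by (now apply Rmult_le_pos). lra.
  - rewrite Cmod_opp, Cmod_mult, Cmod_R, Rabs_pos_eq by exact Hx. apply Rle_refl.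
Qed.

(** In [x] this is a power series with coefficients free of [x], so the general tail estimate
    applies near [0]. *)
Lemma powexp_series_tail (ga al b : R) (N : nat) : 0 < al -> 0 < b -> exists K x0, 0 <= K /\ 0 < x0 /\ forall x, 0 < x <= x0 ->
  Cmod (powexp_series (RtoC ga) al x b - csum (powexp_term (RtoC ga) al x b) N) <= K * x ^ S N.
Proof.
  intros Hal Hb.
  set (e := fun n => (RtoC (gamma_residue n) * power_primitive (RtoC ga + 1 + RtoC (al * INR n)) b)%C).
  assert (Et : forall x n, powexp_term (RtoC ga) al x b n = (RtoC x ^ n * e n)%C).
  { intros x n. unfold powexp_term, e. rewrite RtoC_mult, RtoC_pow. ring. }
  destruct (powexp_term_bound (RtoC ga) al Hal) as [c [Hc Hbd]].
  destruct (pseries_tail e (fun w => CSer (fun n => w ^ n * e n)%C) 1 Rlt_0_1) as [B [R0 [PB [[PR _] HT]]]].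
  { intros w Hw. eapply CSer_lim; [|apply (ex_series_scal_R ((c + Rabs (ln b)) * Rpower b (Re (RtoC ga) + 1))), (ex_series_exp (1 * Rpower b al))].
    intro n. rewrite Cmod_mult, Cmod_pow. specialize (Hbd 1 b n ltac:(lra) Hb). rewrite Et in Hbd.
    replace (RtoC 1 ^ n * e n)%C with (e n) in Hbd by (rewrite Cpow_1_l; ring).
    eapply Rle_trans; [|exact Hbd]. rewrite <- (Rmult_1_l (Cmod (e n))) at 2. apply Rmult_le_compat_r; [apply Cmod_ge_0|].
    rewrite <- (pow1 n). apply pow_incr. split; [apply Cmod_ge_0|lra]. }
  exists (B / R0 ^ S N), (R0 / 2). split; [apply Rdiv_le_0_compat; [exact PB|now apply pow_lt]|]. split; [lra|].
  intros x Hx. specialize (HT N (RtoC x)). rewrite Cmod_R, Rabs_pos_eq in HT by lra. specialize (HT ltac:(lra)).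
  unfold powexp_series. rewrite (CSer_ext _ _ (Et x)), (csum_ext _ _ N (fun k _ => Et x k)).
  eapply Rle_trans; [exact HT|]. right. unfold Rdiv. rewrite Rpow_mult_distr, pow_inv. ring.
Qed.

Lemma expansion_error_O (m c a ga al : R) (N : nat) : 0 <= m -> 0 < c -> cone_bound m al c -> 0 < a -> 0 < al ->
  exists K x0, 0 <= K /\ 0 < x0 /\ forall x, 0 < x <= x0 -> Cmod (expansion_error m al a ga x N) <= K * x ^ S N.
Proof.
  intros Hm Hc HC Ha Hal. set (b := a + / 2). assert (Hb : 0 < b) by (unfold b; lra).
  pose proof two_PI_gt_6 as P6.
  destruct (powexp_series_tail ga al b N Hal Hb) as [K1 [x0 [PK1 [Px0 H1]]]].
  destruct (ray_integral_bound m 1 Hm ltac:(lra)) as [cr [Pcr Hr]].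
  (* The remainder bound turns [u^ga] into a power of exponent [ga + al (N + 1)], still at most a
     multiple of [exp r] on the ray. *)
  destruct (strip_power_bound m b Hm Hb (RtoC (ga + al * INR (S N))) 1 b Rlt_0_1) as [K2 HK2].
  assert (PK2 : 0 <= K2).
  { specialize (HK2 b 0 ltac:(lra) ltac:(lra)). rewrite Rmult_0_r, exp_0 in HK2. 
    pose proof (Cmod_ge_0 (cexp (RtoC (ga + al * INR (S N)) * clog (ray m b 0)))). lra. }
  set (K0 := Cmod (cexp (RtoC ga * RtoC (ln a))) * Rpower a al ^ S N).
  assert (PK0 : 0 <= K0) by (unfold K0; apply Rmult_le_pos; [apply Cmod_ge_0|apply pow_le; left; apply exp_pos]).
  assert (Pc : 0 <= cr * K2) by (apply Rmult_le_pos; lra).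
  exists (K0 + K1 + 2 * (cr * K2)), x0. split; [lra|]. split; [exact Px0|].
  intros x Hx. rewrite (expansion_error_split m c) by (assumption || lra). fold b.
  assert (PX : 0 <= x ^ S N) by (apply pow_le; lra).
  assert (Fi : 0 < / INR (fact (S N)) <= 1).
  { split; [apply Rinv_0_lt_compat, INR_fact_lt_0|]. rewrite <- Rinv_1. apply Rinv_le_contravar; [lra|].
    change 1 with (INR 1). apply le_INR. apply lt_O_fact. }
  assert (B0 : Cmod (cexp (RtoC ga * RtoC (ln a)) * exp_rem N (RtoC (- (x * Rpower a al)))) <= K0 * x ^ S N).
  { rewrite Cmod_mult. unfold K0. rewrite Rmult_assoc. apply Rmult_le_compat_l; [apply Cmod_ge_0|].
    assert (Pp : 0 < Rpower a al) by apply exp_pos.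
    assert (Px : 0 < x * Rpower a al) by (apply Rmult_lt_0_compat; lra).
    eapply Rle_trans; [apply exp_rem_left_half_plane; simpl; lra|].
    rewrite Cmod_R, Rabs_Ropp, Rabs_pos_eq by lra. rewrite Rpow_mult_distr. unfold Rdiv.
    rewrite <- (Rmult_1_r (Rpower a al ^ S N * x ^ S N)). rewrite (Rmult_comm (x ^ S N)).
    apply Rmult_le_compat_l; [apply Rmult_le_pos; [apply pow_le; lra|exact PX]|lra]. }
  assert (B2 : Cmod (ray_integral m (ray_remainder m al ga x b N)) <= cr * (K2 * x ^ S N)).
  { apply Hr; [intros; now apply ccont_ray_remainder|]. intros r Hr0.
    eapply Rle_trans; [apply (ray_remainder_bound m c); lra || assumption|].
    rewrite Rpow_mult_distr. specialize (HK2 b r ltac:(lra) Hr0).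
    set (L := clog (ray m b r)) in *.
    assert (E : Cmod (cexp (RtoC ga * L)) * Cmod (cexp (RtoC al * L)) ^ S N = Cmod (cexp (RtoC (ga + al * INR (S N)) * L))).
    { rewrite <- Cmod_pow, <- Cmod_mult, <- cexp_nat, <- cexp_plus. do 2 f_equal. rewrite RtoC_plus, RtoC_mult. ring. }
    replace (Cmod (cexp (RtoC ga * L)) * (x ^ S N * Cmod (cexp (RtoC al * L)) ^ S N / INR (fact (S N))))
      with ((Cmod (cexp (RtoC ga * L)) * Cmod (cexp (RtoC al * L)) ^ S N) * x ^ S N * / INR (fact (S N))) by (unfold Rdiv; ring).
    rewrite E. apply Rle_trans with (Cmod (cexp (RtoC (ga + al * INR (S N)) * L)) * x ^ S N * 1).
    - apply Rmult_le_compat_l; [|lra]. apply Rmult_le_pos; [apply Cmod_ge_0|exact PX].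
    - rewrite Rmult_1_r. replace (K2 * x ^ S N * exp (1 * r)) with (K2 * exp (1 * r) * x ^ S N) by ring. now apply Rmult_le_compat_r. }
  specialize (H1 x Hx).
  set (z0 := (cexp (RtoC ga * RtoC (ln a)) * exp_rem N (RtoC (- (x * Rpower a al))))%C) in *.
  set (z1 := (powexp_series (RtoC ga) al x b - csum (powexp_term (RtoC ga) al x b) N)%C) in *.
  set (z2 := ray_integral m (ray_remainder m al ga x b N)) in *.
  eapply Rle_trans; [apply Cmod_triangle|].
  assert (T1 : Cmod (z0 - z1) <= Cmod z0 + Cmod z1) by (unfold Cminus; eapply Rle_trans; [apply Cmod_triangle|rewrite Cmod_opp; lra]).
  assert (T2 : Cmod (z2 + Cconj z2) <= 2 * Cmod z2) by (eapply Rle_trans; [apply Cmod_triangle|rewrite Cmod_conj; lra]).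
  lra.
Qed.

(* Some [l > 1] leaves the exponential of [l x |u|^al] dominated by the kernel [e^(-2 pi r)] on the vertical rays. *)
Lemma vertical_growth (al x b : R) : 0 < al -> al <= 1 -> 0 < x -> (al = 1 -> x < 2 * PI) -> 0 < b ->
  exists l d K, 1 < l /\ 0 <= d < 2 * PI /\ forall r, 0 <= r -> l * (x * Cmod (cexp (RtoC al * clog (ray 0 b r)))) <= d * r + K.
Proof.
  intros Hal Hal1 Hx Hx1 Hb. pose proof two_PI_gt_6 as P6.
  assert (Cu : forall r, 0 <= r -> Cmod (cexp (RtoC al * clog (ray 0 b r))) <= exp (al * ln (b + r))).
  { intros r Hr. rewrite Cmod_cexp. apply exp_le_mono.
    replace (Re (RtoC al * clog (ray 0 b r))) with (al * Re (clog (ray 0 b r))) by (unfold Re, Cmult, RtoC; simpl; ring).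
    apply Rmult_le_compat_l; [lra|]. unfold clog, ray, Re, Im; cbn [fst snd].
    assert (H : ln ((b + r * 0) ^ 2 + r ^ 2) <= ln ((b + r) * (b + r))).
    { apply ln_le; [nra|]. assert (0 <= b * r) by (apply Rmult_le_pos; lra). nra. }
    rewrite ln_mult in H by lra. lra. }
  destruct (Rle_lt_or_eq_dec al 1 Hal1) as [L|E].
  - (* Young's inequality [y^al <= (1 - al) M^al + al M^(al - 1) y] with [M] so large that the slope is at most [1 / (2 x)] *)
    set (T := ln (2 * x * al) / (1 - al)).
    exists 2, 1, (2 * x * (exp (al * T) * (1 - al)) + b). split; [lra|]. split; [lra|]. intros r Hr.
    specialize (Cu r Hr).
    pose proof (exp_young (ln (b + r) - T) al ltac:(lra)) as Y.
    assert (E1 : exp (al * ln (b + r)) = exp (al * T) * exp (al * (ln (b + r) - T))) by (rewrite <- exp_plus; f_equal; ring).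
    assert (E2 : exp (al * T) * exp (ln (b + r) - T) = (b + r) / (2 * x * al)).
    { rewrite <- exp_plus. replace (al * T + (ln (b + r) - T)) with (ln (b + r) + - ln (2 * x * al)) by (unfold T; field; lra).
      assert (0 < 2 * x * al) by (apply Rmult_lt_0_compat; lra).
      rewrite exp_plus, exp_Ropp, !exp_ln by lra. reflexivity. }
    pose proof (exp_pos (al * T)) as PT.
    assert (Y2 : exp (al * ln (b + r)) <= exp (al * T) * (1 - al) + (b + r) / (2 * x)).
    { rewrite E1. apply Rle_trans with (exp (al * T) * (1 - al + al * exp (ln (b + r) - T))); [apply Rmult_le_compat_l; lra|].
      rewrite Rmult_plus_distr_l. apply Rplus_le_compat_l.
      replace (exp (al * T) * (al * exp (ln (b + r) - T))) with (al * (exp (al * T) * exp (ln (b + r) - T))) by ring.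
      rewrite E2. right. field. split; lra. }
    apply Rle_trans with (2 * (x * (exp (al * T) * (1 - al) + (b + r) / (2 * x)))).
    + apply Rmult_le_compat_l; [lra|]. apply Rmult_le_compat_l; lra.
    + right. field. lra.
  (* Here [d = l x] is the midpoint of [x] and [2 PI]; [l > 1] and [d < 2 PI] both express
     [x < 2 PI]. *)
  - subst al. specialize (Hx1 eq_refl). exists ((1 + 2 * PI / x) / 2), ((x + 2 * PI) / 2), ((x + 2 * PI) / 2 * b).
    assert (Q : 1 < 2 * PI / x). { apply Rmult_lt_reg_r with x; [exact Hx|]. unfold Rdiv. rewrite Rmult_assoc, Rinv_l by lra. lra. }
    split; [lra|]. split; [lra|]. intros r Hr. specialize (Cu r Hr). rewrite Rmult_1_l, exp_ln in Cu by lra.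
    apply Rle_trans with ((1 + 2 * PI / x) / 2 * (x * (b + r))); [apply Rmult_le_compat_l; [lra|]; apply Rmult_le_compat_l; lra|].
    right. field. lra.
Qed.

(** Comparing [y^(N+1) / (N+1)!] with a term of the series of [exp (l y)] gains the factor
    [l^-(N+1)] at the cost of [exp (l y)], which the kernel still dominates. As [l > 1], the ray
    integrals decay geometrically in [N]. *)
Lemma expansion_error_vanishes (c a ga al x : R) : 0 < c -> cone_bound 0 al c -> 0 < a -> 0 < al -> al <= 1 -> 0 < x ->
  (al = 1 -> x < 2 * PI) -> is_cseq (expansion_error 0 al a ga x) 0.
Proof.
  intros Hc HC Ha Hal Hal1 Hx Hx1. set (b := a + / 2). assert (Hb : 0 < b) by (unfold b; lra).
  pose proof two_PI_gt_6 as P6.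
  destruct (vertical_growth al x b Hal Hal1 Hx Hx1 Hb) as [l [d [K [Hl [Hd HK]]]]].
  (* Half of the room left below [2 PI] absorbs the power [u^ga]. *)
  set (d2 := (2 * PI - d) / 2).
  destruct (strip_power_bound 0 b (Rle_refl 0) Hb (RtoC ga) d2 b ltac:(unfold d2; lra)) as [K2 HK2].
  destruct (ray_integral_bound 0 (d + d2) (Rle_refl 0) ltac:(unfold d2; lra)) as [cr [Pcr Hr]].
  assert (Hl2 : 0 <= / l < 1) by (split; [left; apply Rinv_0_lt_compat; lra|rewrite <- Rinv_1; apply Rinv_lt_contravar; lra]).
  assert (L2 : is_cseq (fun N => ray_integral 0 (ray_remainder 0 al ga x b N)) 0).
  { apply is_cseq_le with (fun N => (/ l) ^ S N * (cr * (K2 * exp K))).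
    - intro N. set (z := ray_integral _ _). replace (z - 0)%C with z by ring. unfold z.
      replace ((/ l) ^ S N * (cr * (K2 * exp K))) with (cr * ((/ l) ^ S N * (K2 * exp K))) by ring.
      apply Hr; [intros; apply ccont_ray_remainder; lra|]. intros r Hr0.
      eapply Rle_trans; [apply (ray_remainder_bound 0 c); lra || assumption|].
      specialize (HK r Hr0). specialize (HK2 b r ltac:(lra) Hr0).
      set (y := x * Cmod (cexp (RtoC al * clog (ray 0 b r)))) in *.
      assert (Py : 0 <= y) by (unfold y; apply Rmult_le_pos; [lra|apply Cmod_ge_0]).
      assert (By : y ^ S N / INR (fact (S N)) <= (/ l) ^ S N * exp (d * r + K)).
      { pose proof (pow_fact_le_exp (l * y) (S N) ltac:(apply Rmult_le_pos; lra)) as E. rewrite Rpow_mult_distr in E.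
        assert (exp (l * y) <= exp (d * r + K)) by (now apply exp_le_mono).
        assert (Pl : 0 < l ^ S N) by (apply pow_lt; lra).
        rewrite pow_inv. apply Rmult_le_reg_l with (l ^ S N); [exact Pl|].
        rewrite <- (Rmult_assoc (l ^ S N) (/ l ^ S N)), Rinv_r, Rmult_1_l by lra.
        apply Rle_trans with (exp (l * y)); [|assumption]. eapply Rle_trans; [|exact E]. right. unfold Rdiv; ring. }
      apply Rle_trans with (K2 * exp (d2 * r) * ((/ l) ^ S N * exp (d * r + K))).
      + apply Rmult_le_compat; try assumption; [apply Cmod_ge_0|]. apply Rdiv_le_0_compat; [now apply pow_le|apply INR_fact_lt_0].
      + rewrite exp_plus. replace ((d + d2) * r) with (d2 * r + d * r) by ring. rewrite (exp_plus (d2 * r)). right; ring.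
    - replace (Finite 0) with (Rbar_mult 0 (cr * (K2 * exp K))) by (simpl; f_equal; ring).
      apply (is_lim_seq_scal_r (fun n => (/ l) ^ S n)).
      apply (is_lim_seq_incr_1 (fun n => (/ l) ^ n)). apply is_lim_seq_geom. rewrite Rabs_pos_eq; lra. }
  set (z0 := cexp (RtoC ga * RtoC (ln a))). set (v := RtoC (- (x * Rpower a al))).
  assert (L0 : is_cseq (fun N => exp_rem N v) 0).
  { apply is_cseq_le with (fun N => (/ 2) ^ S N * exp (3 * Cmod v)); [|apply is_lim_seq_half_pow].
    intro N. replace (exp_rem N v - 0)%C with (exp_rem N v) by ring. apply exp_rem_geom. }
  set (P := powexp_series (RtoC ga) al x b).
  assert (L1 : is_cseq (fun N => P - csum (powexp_term (RtoC ga) al x b) N)%C (P - P)%C).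
  { apply is_cseq_minus; [apply is_cseq_const|]. apply powexp_series_lim; lra. }
  eapply is_cseq_ext; [intro N; symmetry; apply (expansion_error_split 0 c); assumption || lra|]. fold b.
  match goal with |- is_cseq ?f _ => assert (KK : is_cseq f (z0 * 0 - (P - P) + (0 + Cconj 0))%C) end.
  { apply is_cseq_plus; [apply is_cseq_minus; [apply is_cseq_scal, L0|exact L1]|]. apply is_cseq_plus; [exact L2|apply is_cseq_conj, L2]. }
  replace (z0 * 0 - (P - P) + (0 + Cconj 0))%C with (RtoC 0) in KK; [exact KK|].
  replace (Cconj 0) with (RtoC 0) by (unfold Cconj, RtoC; simpl; f_equal; ring). ring.
Qed.

(** * The resonant and the nonresonant case *)

Lemma log_term_nonresonant (ga al x : R) : (forall r : nat, - ((ga + 1) / al) <> INR r) -> log_term ga al x = 0.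
Proof.
  intro H. unfold log_term. rewrite (CSer_ext _ (fun _ => 0)).
  - rewrite (CSer_single _ 0%nat) by reflexivity. ring.
  - intro n. unfold resonant_residue. destruct (excluded_middle_informative _) as [E|_]; [|ring].
    rewrite <- RtoC_plus in E. apply RtoC_inj in E. destruct (H n). lra.
Qed.

Lemma log_term_resonant (ga al x : R) (r : nat) : - ((ga + 1) / al) = INR r ->
  log_term ga al x = RtoC (gamma_residue r * x ^ r * (ln x / al)).
Proof.
  intro H. unfold log_term. replace ((ga + 1) / al) with (- INR r) by lra. rewrite (CSer_single _ r); unfold resonant_residue.
  - destruct (excluded_middle_informative _) as [_|N]; [now rewrite !RtoC_mult|]. destruct N. rewrite RtoC_opp. ring.
  - intros n Hn. destruct (excluded_middle_informative _) as [E|_]; [|ring].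
    rewrite <- RtoC_plus in E. apply RtoC_inj in E. destruct Hn. apply INR_eq. lra.
Qed.

Lemma singular_part_nonresonant (ga al x : R) : 0 < al -> (forall r : nat, - ((ga + 1) / al) <> INR r) ->
  singular_part ga al x = T_nonresonant ga al x.
Proof.
  intros Hal H. unfold singular_part, T_nonresonant. rewrite log_term_nonresonant by exact H.
  rewrite Gamma_eq_real by (intros n E; apply (H n); lra).
  replace (1 / al) with (/ al) by (field; lra). rewrite RtoC_mult. ring.
Qed.

Lemma expansion_term_zeta (m c a ga al x : R) (n : nat) : 0 <= m -> 0 <= c -> cone_bound m al c -> 0 < a -> ga + al * INR n <> -1 ->
  expansion_term m al a ga x n = (zeta_coeff a ga al n * RtoC (x ^ n))%C.
Proof.
  intros Hm Hc HC Ha Hn. unfold expansion_term, zeta_coeff. rewrite (zeta_value_eq m c) by assumption.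
  replace (- (ga + al * INR n)) with (- al * INR n - ga) by ring. fold (gamma_residue n). rewrite RtoC_mult. ring.
Qed.

(** At a resonance the term of index [r] moves into the leading part. It carries the constant term
    [- digamma a] of zeta, while [singular_part] carries [digamma (r + 1) / al] and the logarithm,
    all with the factor [(-1)^r x^r / r!]. *)
Lemma T_resonant_eq (m c a ga al x : R) (r : nat) : 0 <= m -> 0 <= c -> cone_bound m al c -> 0 < a -> 0 < al -> 0 < x ->
  - ((ga + 1) / al) = INR r -> T_resonant a al r x = (singular_part ga al x + expansion_term m al a ga x r)%C.
Proof.
  intros Hm Hc HC Ha Hal Hx Hr. pose proof (pos_INR r) as Pr.
  unfold singular_part. rewrite (log_term_resonant ga al x r Hr). replace ((ga + 1) / al) with (- INR r) by lra.
  rewrite gamma_fn_neg, Ropp_involutive, Rpower_pow by exact Hx.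
  assert (Eq : ga + al * INR r = -1) by (rewrite <- Hr; field; lra).
  unfold expansion_term. rewrite Eq, (zeta_value_pole m c) by assumption.
  unfold T_resonant. rewrite !Gamma_logderiv by lra.
  assert (Eg : Gamma (RtoC (INR r + 1)) = RtoC (INR (fact r))).
  { rewrite Gamma_eq_right by (simpl; lra). destruct (gamma_trunc_lim (INR r + 1) ltac:(lra)) as [_ ->]. now rewrite gamma_re_fact. }
  rewrite Eg, <- RtoC_div by apply INR_fact_neq_0.
  rewrite <- RtoC_opp, <- !RtoC_mult, <- !RtoC_plus, <- !RtoC_minus, <- !RtoC_mult, <- !RtoC_plus. f_equal.
  unfold gamma_residue. field. split; [apply INR_fact_neq_0|lra].
Qed.

Lemma asymp_expansion_of_bound (F T : R -> C) (adm : nat -> bool) (c : nat -> C) :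
  (forall N, exists K x0, 0 <= K /\ 0 < x0 /\ forall x, 0 < x <= x0 -> Cmod (F x - T x - csum (power_term adm c x) N) <= K * x ^ S N) ->
  asymp_expansion F T adm c.
Proof.
  intros H N eps. destruct (H N) as [K [x0 [PK [Px HK]]]].
  pose proof (cond_pos eps) as Pe.
  assert (Pm : 0 < Rmin x0 (eps / (K + 1))) by (apply Rmin_glb_lt; [exact Px|apply Rdiv_lt_0_compat; lra]).
  exists (mkposreal _ Pm). intros x Hx Hx0.
  assert (Hb : Rabs x < Rmin x0 (eps / (K + 1))).
  { unfold ball in Hx; simpl in Hx; unfold AbsRing_ball, abs, minus, plus, opp in Hx; simpl in Hx. rewrite Ropp_0, Rplus_0_r in Hx. exact Hx. }
  rewrite Rabs_pos_eq in Hb by lra.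
  pose proof (Rmin_l x0 (eps / (K + 1))). pose proof (Rmin_r x0 (eps / (K + 1))).
  change (Cmod (F x - T x - csum (power_term adm c x) N) <= eps * Rabs (x ^ N)).
  rewrite Rabs_pos_eq by (apply pow_le; lra).
  eapply Rle_trans; [apply HK; lra|]. change (x ^ S N) with (x * x ^ N). rewrite <- Rmult_assoc.
  apply Rmult_le_compat_r; [apply pow_le; lra|].
  assert (Hx2 : x <= eps / (K + 1)) by lra. apply (Rmult_le_compat_l (K + 1)) in Hx2; [|lra].
  replace ((K + 1) * (eps / (K + 1))) with (pos eps) in Hx2 by (field; lra). lra.
Qed.

Lemma convergent_of_error (F T : R -> C) (adm : nat -> bool) (c : nat -> C) (x : R) :
  is_cseq (fun N => F x - T x - csum (power_term adm c x) N)%C 0 -> convergent_expansion_at F T adm c x.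
Proof.
  intro H. apply is_cseq_is_series.
  assert (L : is_cseq (fun N => (F x - T x) - (F x - T x - csum (power_term adm c x) N))%C ((F x - T x) - 0)%C)
    by (apply is_cseq_minus; [apply is_cseq_const|exact H]).
  replace (F x - T x - 0)%C with (F x - T x)%C in L by ring.
  eapply is_cseq_ext; [|exact L]. intro N. cbv beta. ring.
Qed.

Lemma csum_skip (u : nat -> C) (r N : nat) :
  csum (fun k => if negb (Nat.eqb k r) then u k else 0) N = (csum u N - (if Nat.leb r N then u r else 0))%C.
Proof.
  induction N as [|N IH].
  - rewrite !csum_0. destruct r; simpl; ring.
  - rewrite !csum_S, IH. destruct (Nat.eqb_spec (S N) r) as [E|E].
    + subst r. rewrite Nat.leb_refl. destruct (Nat.leb_spec (S N) N); [lia|]. simpl. ring.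
    + destruct (Nat.leb_spec r N); destruct (Nat.leb_spec r (S N)); try lia; simpl; ring.
Qed.

Theorem theorem1p1 :
  forall a gamma alpha : R, 0 < a -> 0 < alpha ->
    ((forall r : nat, - ((gamma + 1) / alpha) <> INR r) ->
       let F := fun x : R => RtoC (exp_power_sum x a gamma alpha) in
       let T := T_nonresonant gamma alpha in
       let adm := fun _ : nat => true in
       let c := zeta_coeff a gamma alpha in
       asymp_expansion F T adm c /\
       (alpha < 1 -> forall x : R, 0 < x ->
          convergent_expansion_at F T adm c x) /\
       (alpha = 1 -> forall x : R, 0 < x < 2 * PI ->
          convergent_expansion_at F T adm c x))
    /\
    (forall r : nat, - ((gamma + 1) / alpha) = INR r ->
       let F := fun x : R => RtoC (exp_power_sum x a gamma alpha) in
       let T := T_resonant a alpha r in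
       let adm := fun k : nat => negb (Nat.eqb k r) in
       let c := zeta_coeff a gamma alpha in
       asymp_expansion F T adm c /\
       (alpha < 1 -> forall x : R, 0 < x ->
          convergent_expansion_at F T adm c x) /\
       (alpha = 1 -> forall x : R, 0 < x < 2 * PI ->
          convergent_expansion_at F T adm c x)).
Proof.
  intros a ga al Ha Hal.
  destruct (slope_exists al Hal) as [m [c0 [Hm [Hc [Hm0 HC]]]]].
  assert (Hc' : 0 <= c0) by lra.
  assert (Pole : forall n : nat, ga + al * INR n = -1 -> - ((ga + 1) / al) = INR n).
  { intros n E. replace (ga + 1) with (- (al * INR n)) by lra. field. lra. }
  split.
  - intros Hr F T adm c.
    assert (E : forall x N, 0 < x -> (F x - T x - csum (power_term adm c x) N)%C = expansion_error m al a ga x N).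
    { intros x N Hx. unfold expansion_error, F, T. rewrite singular_part_nonresonant by assumption. f_equal.
      apply csum_ext. intros k _. unfold power_term, adm, c. symmetry.
      apply (expansion_term_zeta m c0); try assumption. intro E. apply (Hr k). now apply Pole. }
    assert (Cv : al <= 1 -> forall x, 0 < x -> (al = 1 -> x < 2 * PI) -> convergent_expansion_at F T adm c x).
    { intros H1 x Hx Hx1. apply convergent_of_error. eapply is_cseq_ext; [intro N; symmetry; now apply E|].
      (* For [al <= 1] the chosen slope is [0], so the rays are vertical, as the convergence
         argument requires. *)
      rewrite (Hm0 H1) in *. now apply (expansion_error_vanishes c0). }
    split; [|split].
    + apply asymp_expansion_of_bound. intro N. destruct (expansion_error_O m c0 a ga al N) as [K [x0 [PK [Px HK]]]]; try assumption.
      exists K, x0. split; [exact PK|]. split; [exact Px|]. intros x Hx. rewrite E by lra. now apply HK.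
    + intros H1 x Hx. apply Cv; lra.
    + intros H1 x Hx. apply Cv; lra.
  - intros r Hr F T adm c.
    (* [T] already contains the term of index [r]; for [N < r] that term is not part of the
       truncated expansion and has to be subtracted. *)
    assert (E : forall x N, 0 < x -> (F x - T x - csum (power_term adm c x) N)%C =
       (expansion_error m al a ga x N - (if Nat.leb r N then 0 else expansion_term m al a ga x r))%C).
    { intros x N Hx. unfold expansion_error, F, T. rewrite (T_resonant_eq m c0 a ga al x r) by assumption.
      assert (Es : csum (power_term adm c x) N = csum (fun k => if negb (Nat.eqb k r) then expansion_term m al a ga x k else 0) N).
      { apply csum_ext. intros k _. unfold power_term, adm, c. destruct (Nat.eqb_spec k r) as [Ek|Ek]; [reflexivity|]. cbv beta iota delta [negb].
        symmetry. apply (expansion_term_zeta m c0); try assumption. intro E. apply Ek. apply INR_eq. rewrite <- Hr. symmetry. now apply Pole. }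
      rewrite Es, csum_skip. destruct (Nat.leb r N); ring. }
    assert (Cv : al <= 1 -> forall x, 0 < x -> (al = 1 -> x < 2 * PI) -> convergent_expansion_at F T adm c x).
    { intros H1 x Hx Hx1. apply convergent_of_error.
      assert (L : is_cseq (expansion_error m al a ga x) 0) by (rewrite (Hm0 H1) in *; now apply (expansion_error_vanishes c0)).
      intros eps He. destruct (L eps He) as [N0 HN0]. exists (max N0 r). intros N HN. rewrite E by exact Hx.
      destruct (Nat.leb_spec r N); [|lia].
      replace (expansion_error m al a ga x N - 0 - 0)%C with (expansion_error m al a ga x N - 0)%C by ring. apply HN0. lia. }
    split; [|split].
    + apply asymp_expansion_of_bound. intro N. destruct (expansion_error_O m c0 a ga al N) as [K [x0 [PK [Px HK]]]]; try assumption.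
      set (V := Cmod (RtoC (gamma_residue r) * zeta_value m al a (ga + al * INR r))).
      assert (PV : 0 <= V) by apply Cmod_ge_0.
      (* The term subtracted when [N < r] is at most [V x^r], and [x <= 1] turns this into
         [V x^(N+1)]. *)
      exists (K + V), (Rmin x0 1). split; [lra|]. split; [apply Rmin_glb_lt; lra|]. intros x Hx.
      pose proof (Rmin_l x0 1). pose proof (Rmin_r x0 1). rewrite E by lra.
      specialize (HK x ltac:(lra)). assert (Px2 : 0 <= x ^ S N) by (apply pow_le; lra).
      assert (Bt : Cmod (if Nat.leb r N then 0 else expansion_term m al a ga x r) <= V * x ^ S N).
      { destruct (Nat.leb_spec r N) as [Hl|Hl]; [rewrite Cmod_0; now apply Rmult_le_pos|].
        unfold expansion_term. rewrite RtoC_mult.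
        replace (RtoC (gamma_residue r) * RtoC (x ^ r) * zeta_value m al a (ga + al * INR r))%C with
          (RtoC (gamma_residue r) * zeta_value m al a (ga + al * INR r) * RtoC (x ^ r))%C by ring.
        rewrite Cmod_mult. fold V. rewrite Cmod_R, Rabs_pos_eq by (apply pow_le; lra). apply Rmult_le_compat_l; [exact PV|].
        replace r with (S N + (r - S N))%nat by lia. rewrite pow_add. rewrite <- (Rmult_1_r (x ^ S N)) at 2.
        apply Rmult_le_compat_l; [exact Px2|]. rewrite <- (pow1 (r - S N)). apply pow_incr. lra. }
      unfold Cminus at 1. eapply Rle_trans; [apply Cmod_triangle|]. rewrite Cmod_opp. lra.
    + intros H1 x Hx. apply Cv; lra.
    + intros H1 x Hx. apply Cv; lra.
Qed.
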